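(* Let $D\subset\mathbb R^3$ be a bounded domain, and let $\bm f$ be a $\mathbb C^3$-valued centered GMIG random field of order $-m$ in $D$ with $\bm f\in\mathbb X$, whose covariance operator and relation operator have principal symbols $A^c(x)|\xi|^{-m}$ and $A^r(x)|\xi|^{-m}$, respectively, with $A^c,A^r\in C_0^\infty(D;\mathbb C^{3\times3})$, and $m\in(-1,3]$. Let $$\bm E^\infty(\hat x,\kappa)=\frac{{\rm i}\kappa}{4\pi}\int_{\mathbb R^3}e^{-{\rm i}\kappa\hat x\cdot y}\bm f(y)\,dy .$$ Then for all $\hat x\in\mathbb S^2$ and $\tau\ge0$, it holds almost surely that $$\lim_{Q\to\infty}\frac1Q\int_Q^{2Q}\kappa^{m-2}\,\bm E^\infty(\hat x,\kappa+\tau)\overline{\bm E^\infty(\hat x,\kappa)}^\top d\kappa=\frac1{16\pi^2}\widehat{A^c}(\tau\hat x),$$ $$\lim_{Q\to\infty}\frac1Q\int_Q^{2Q}\kappa^{m-2}\,\bm E^\infty(\hat x,\kappa+\tau)\bm E^\infty(-\hat x,\kappa)^\top d\kappa=-\frac1{16\pi^2}\widehat{A^r}(\tau\hat x).$$ Moreover, for any nonempty open set $\Theta\subset\mathbb R_+\times\mathbb S^2$, the matrices $A^c$ and $A^r$ are uniquely determined by the values of the first and, respectively, the second of these limits for $(\tau,\hat x)\in\Theta$.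
   Context: $\mathbb R_+=(0,\infty)$. Fourier transform: $\hat\varphi(\xi)=\int_{\mathbb R^3}e^{-{\rm i}x\cdot\xi}\varphi(x)\,dx$, applied entrywise to vectors and matrices. $\bm{\mathcal D}(\mathbb R^3)=C_0^\infty(\mathbb R^3;\mathbb C^3)$, $\bm{\mathcal D}'(\mathbb R^3)$ is its dual, and $$\mathbb X=\left\{\bm U\in\bm{\mathcal D}'(\mathbb R^3):\ \int_{\mathbb R^3}\bm U\cdot\nabla(\nabla\cdot\bm\phi)\,dx=0\ \ \forall\,\bm\phi\in\bm{\mathcal D}(\mathbb R^3)\right\}$$ (integral understood as distributional pairing). The function $\bm E^\infty$ is the far-field pattern of the electric field $\bm E(x,\kappa)={\rm i}\kappa\int_{\mathbb R^3}\frac{e^{{\rm i}\kappa|x-y|}}{4\pi|x-y|}\bm f(y)\,dy$ associated with Maxwell's equations $\nabla\times\bm E-{\rm i}\kappa\bm H=0$, $\nabla\times\bm H+{\rm i}\kappa\bm E=\bm f$ in $\mathbb R^3$, with $\bm f$ independent of $\kappa>0$. The integral defining $\bm E^\infty$ is the componentwise pairing of the compactly supported distribution $\bm f$ with the smooth function $y\mapsto e^{-{\rm i}\kappa\hat x\cdot y}$. Random fields (here $d=n=3$). $(\Omega,\mathcal F,\mathbb P)$ is a complete probability space. A $\mathbb C^n$-valued generalized Gaussian random field is a map $\bm f=(f_1,\dots,f_n)^\top:\Omega\to\mathcal D'(\mathbb R^d;\mathbb C^n)$ such that $\langle\bm f,\bm\psi\rangle$ (bilinear pairing) is a $\mathbb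 C$-valued Gaussian random variable for every $\bm\psi\in C_0^\infty(\mathbb R^d;\mathbb C^n)$; it is centered if these have mean zero. For centered $\bm f$, the covariance and relation operators $\mathcal C_{\bm f},\mathcal R_{\bm f}$ are the operators with matrix-valued distributional kernels $K^c_{\bm f}(x,y)=\mathbb E[\bm f(x)\overline{\bm f(y)}^\top]$ and $K^r_{\bm f}(x,y)=\mathbb E[\bm f(x)\bm f(y)^\top]$, i.e. $\langle(K^c_{\bm f})_{jl},\psi\otimes\varphi\rangle=\mathbb E[\langle f_j,\psi\rangle\langle\overline{f_l},\varphi\rangle]$ and $\langle(K^r_{\bm f})_{jl},\psi\otimes\varphi\rangle=\mathbb E[\langle f_j,\psi\rangle\langle f_l,\varphi\rangle]$ for scalar test functions. Symbols: $\mathcal S^{-m}(\mathbb R^d\times\mathbb R^d;\mathbb C^{n\times n})$ is the set of smooth $\Sigma:\mathbb R^d\times\mathbb R^d\to\mathbb C^{n\times n}$ with $|\partial_\xi^{\gamma_1}\partial_x^{\gamma_2}\Sigma(x,\xi)|\le C_{\gamma_1,\gamma_2}(1+|\xi|)^{-m-|\gamma_1|}$ for all multi-indices. GMIG (generalized microlocally isotropic Gaussian) of order $-m$ in $D$: for $\eta\in\{c,r\}$ the operators are pseudo-differential, $\mathcal C_{\bm f}\bm\varphi(x)=(2\pi)^{-d}\int e^{{\rm i}x\cdot\xi}\Sigma^c(x,\xi)\widehat{\bm\varphi}(\xi)\,d\xi$, $\mathcal R_{\bm f}\bm\varphi(x)=(2\pi)^{-d}\int e^{{\rm i}x\cdot\xi}\Sigma^r(x,\xi)\widehat{\bm\varphi}(\xi)\,d\xi$,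 with $\Sigma^\eta\in\mathcal S^{-m}$, $\Sigma^\eta(\cdot,\xi)\in C_0^\infty(D;\mathbb C^{n\times n})$ for every $\xi$, and $\Sigma^\eta(x,\xi)=A^\eta(x)|\xi|^{-m}+B^\eta(x,\xi)$ for $|\xi|\ge1$, where $A^\eta\in C_0^\infty(D;\mathbb C^{n\times n})$, $B^\eta\in\mathcal S^{-m-1}$, $B^\eta(\cdot,\xi)\in C_0^\infty(D;\mathbb C^{n\times n})$. In particular $\bm f$ is almost surely a distribution supported in $\overline D$. *)

(* Defs.v *)
(* MathComp / MathComp-Analysis. *)
From HB Require Import structures.
From mathcomp Require Import all_boot all_order all_algebra.
From mathcomp Require Import complex.
From mathcomp Require Import all_classical all_reals all_analysis.

Set Implicit Arguments.
Unset Strict Implicit.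
Unset Printing Implicit Defensive.

Import Order.TTheory GRing.Theory Num.Theory.
Import numFieldNormedType.Exports.

Local Open Scope classical_set_scope.
Local Open Scope ring_scope.
Local Open Scope complex_scope.

Section Euclidean.
Variable R : realType.

Definition dot (n : nat) (x y : 'rV[R]_n) : R := \sum_(i < n) x 0 i * y 0 i.

(* The library norm on ['rV[R]_n] is the sup norm, hence this definition. *)
Definition enorm (n : nat) (x : 'rV[R]_n) : R := Num.sqrt (dot x x).

Definition sphere2 : set 'rV[R]_3 := [set x | enorm x = 1].

Definition bounded_domain (D : set 'rV[R]_3) : Prop :=
  [/\ D !=set0, open D, connected D & bounded_set D].

Definition expi (t : R) : R[i] := cos t +i* sin t.

End Euclidean.

Section Integrals.
Variable R : realType.

Definition cintegral (d : measure_display) (T : measurableType d)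
    (nu : {measure set T -> \bar R}) (D : set T) (g : T -> R[i]) : R[i] :=
  (\int[nu]_(x in D) complex.Re (g x)) +i* (\int[nu]_(x in D) complex.Im (g x)).

Definition row3 (u : R * R * R) : 'rV[R]_3 :=
  \row_(k < 3) nth 0 [:: u.1.1; u.1.2; u.2] k.

Definition integral3 (g : 'rV[R]_3 -> R[i]) : R[i] :=
  cintegral ((lebesgue_measure \x lebesgue_measure) \x lebesgue_measure)%E
    setT (g \o row3).

Definition fourier (p q : nat) (g : 'rV[R]_3 -> 'M[R[i]]_(p, q))
    (xi : 'rV[R]_3) : 'M[R[i]]_(p, q) :=
  \matrix_(j, l) integral3 (fun x => expi (- dot x xi) * g x j l).

End Integrals.

Section SmoothFunctions.
Variables (R : realType) (n : nat).

Definition cpartial (k : 'I_n) (g : 'rV[R]_n -> R[i]) (x : 'rV[R]_n) : R[i] :=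
  'D_(delta_mx 0 k) (@complex.Re R \o g) x
    +i* 'D_(delta_mx 0 k) (@complex.Im R \o g) x.

(* Multi-indices are encoded as the list [s] of the successive directions of
   differentiation; the order of the multi-index is [size s]. *)
Definition cpartials (s : seq 'I_n) (g : 'rV[R]_n -> R[i]) :
  'rV[R]_n -> R[i] := foldr cpartial g s.

Definition smooth (g : 'rV[R]_n -> R[i]) : Prop :=
  forall s : seq 'I_n,
    [/\ continuous (@complex.Re R \o cpartials s g),
        continuous (@complex.Im R \o cpartials s g),
        forall x k, derivable (@complex.Re R \o cpartials s g) x (delta_mx 0 k) &
        forall x k, derivable (@complex.Im R \o cpartials s g) x (delta_mx 0 k)].

Definition csupport (g : 'rV[R]_n -> R[i]) : set 'rV[R]_n :=
  closure [set x | g x != 0].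

Definition test_fun (D : set 'rV[R]_n) (g : 'rV[R]_n -> R[i]) : Prop :=
  [/\ smooth g, compact (csupport g) & csupport g `<=` D].

Definition test_mx (p q : nat) (D : set 'rV[R]_n)
    (g : 'rV[R]_n -> 'M[R[i]]_(p, q)) : Prop :=
  forall j l, test_fun D (fun x => g x j l).

End SmoothFunctions.

Section Distributions.
Variable R : realType.
Local Notation pt := 'rV[R]_3.
Local Notation C := R[i].

(* Elements of the dual of C_0^oo(R^3; C^3). Only the values on test functions
   are meaningful. Continuity is the usual seminorm estimate on each compact
   set [K], [M] being any common bound of the derivatives up to order [N]. *)
Record vdistribution := VDistribution {
  vpairing :> (pt -> 'cV[C]_3) -> C ;
  _ : forall (a : C) (phi psi : pt -> 'cV[C]_3),
      test_mx setT phi -> test_mx setT psi ->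
      vpairing (fun x => a *: phi x + psi x) = a * vpairing phi + vpairing psi ;
  _ : forall K : set pt, compact K ->
      exists (N : nat) (c : R), forall (phi : pt -> 'cV[C]_3) (M : R),
        test_mx setT phi ->
        (forall j, csupport (fun x => phi x j 0) `<=` K) ->
        (forall (s : seq 'I_3) (j : 'I_3) (x : pt), (size s <= N)%N ->
           Normc.normc (cpartials s (fun y => phi y j 0) x) <= M) ->
        Normc.normc (vpairing phi) <= c * M
}.

Definition component (u : vdistribution) (j : 'I_3) (psi : pt -> C) : C :=
  u (fun x => psi x *: delta_mx j 0).

Definition div (phi : pt -> 'cV[C]_3) (x : pt) : C :=
  \sum_(k < 3) cpartial k (fun y => phi y k 0) x.

Definition grad (g : pt -> C) (x : pt) : 'cV[C]_3 := \col_k cpartial k g x.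

Definition spaceX : set vdistribution :=
  [set u : vdistribution |
    forall phi : pt -> 'cV[C]_3, test_mx setT phi -> u (grad (div phi)) = 0].

Definition dsupport (u : (pt -> C) -> C) : set pt :=
  [set x | forall V : set pt, open V -> V x ->
     ~ (forall psi, test_fun V psi -> u psi = 0)].

(* Pairing of a compactly supported distribution with a smooth function [g],
   i.e. [u (chi g)] for any test function [chi] equal to 1 near the support of
   [u]; the value is 0 when the support of [u] is not compact, since no such
   [chi] exists in that case. *)
Definition smooth_pairing (u : (pt -> C) -> C) (g : pt -> C) : C :=
  xget 0 [set z | exists chi : pt -> C,
    [/\ test_fun setT chi,
        exists V : set pt,
          [/\ open V, dsupport u `<=` V & forall x, V x -> chi x = 1] &
        z = u (fun x => chi x * g x)]].

End Distributions.

Section PseudoDifferential.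
Variable R : realType.
Local Notation pt := 'rV[R]_3.
Local Notation C := R[i].

(* The class S^o; [x] is the left block and [xi] the right block of the
   variable in R^(3+3). *)
Definition symbol_class (o : R) (S : pt -> pt -> 'M[C]_3) : Prop :=
  forall j l : 'I_3,
    let Sjl := fun z : 'rV[R]_(3 + 3) => S (lsubmx z) (rsubmx z) j l in
    smooth Sjl /\
    forall g1 g2 : seq 'I_3, exists c : R, forall x xi : pt,
      Normc.normc (cpartials (map (@rshift 3 3) g1 ++ map (@lshift 3 3) g2)
                     Sjl (row_mx x xi))
        <= c * (1 + enorm xi) `^ (o - (size g1)%:R).

Definition psido (S : pt -> pt -> 'M[C]_3) (phi : pt -> 'cV[C]_3) (x : pt) :
    'cV[C]_3 :=
  (((2 * pi) ^+ 3)^-1)%:C *: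
  \col_j integral3 (fun xi => expi (dot x xi) * (S x xi *m fourier phi xi) j 0).

(* A matrix of kernels in D'(R^3 x R^3) is represented by its values
   [K j l psi phi] on tensor products, which determine it. *)
Definition kernel_operator
    (K : 'I_3 -> 'I_3 -> (pt -> C) -> (pt -> C) -> C)
    (phi : pt -> 'cV[C]_3) (j : 'I_3) (psi : pt -> C) : C :=
  \sum_(l < 3) K j l psi (fun y => phi y l 0).

Definition is_psido (K : 'I_3 -> 'I_3 -> (pt -> C) -> (pt -> C) -> C)
    (S : pt -> pt -> 'M[C]_3) : Prop :=
  forall (phi : pt -> 'cV[C]_3) (j : 'I_3) (psi : pt -> C),
    test_mx setT phi -> test_fun setT psi ->
    kernel_operator K phi j psi =
      integral3 (fun x => psi x * psido S phi x j 0).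

Definition has_isotropic_symbol (D : set pt) (m : R)
    (K : 'I_3 -> 'I_3 -> (pt -> C) -> (pt -> C) -> C)
    (A : pt -> 'M[C]_3) : Prop :=
  test_mx D A /\
  exists S B : pt -> pt -> 'M[C]_3,
    [/\ is_psido K S,
        symbol_class (- m) S,
        forall xi, test_mx D (S^~ xi),
        symbol_class (- m - 1) B /\ (forall xi, test_mx D (B^~ xi)) &
        forall x xi, 1 <= enorm xi ->
          S x xi = (enorm xi `^ (- m))%:C *: A x + B x xi].

End PseudoDifferential.

Section RandomFields.
Variables (R : realType) (d : measure_display) (T : measurableType d).
Variable P : probability T R.
Local Notation pt := 'rV[R]_3.
Local Notation C := R[i].

(* [normal_prob m 0] is not the Dirac mass, so the degenerate case is
   treated separately. *)
Definition gaussian (X : T -> R) : Prop :=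
  measurable_fun setT X /\
  exists m s : R, 0 <= s /\
    forall A : set R, measurable A ->
      P (X @^-1` A) = if s == 0 then \d_m A else normal_prob m s A.

(* Joint Gaussianity of the real and imaginary parts. *)
Definition cgaussian (Z : T -> C) : Prop :=
  forall a b : R, gaussian (fun w => a * complex.Re (Z w) + b * complex.Im (Z w)).

Definition cexpectation (Z : T -> C) : C :=
  fine ('E_P[fun w => complex.Re (Z w)])%E
    +i* fine ('E_P[fun w => complex.Im (Z w)])%E.

Variable f : T -> vdistribution R.

Definition gaussian_field : Prop :=
  forall phi : pt -> 'cV[C]_3, test_mx setT phi -> cgaussian (fun w => f w phi).

Definition centered : Prop :=
  forall phi : pt -> 'cV[C]_3, test_mx setT phi ->
    cexpectation (fun w => f w phi) = 0.

(* [<conj f_l, phi>] is the conjugate of [<f_l, conj phi>]. *)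
Definition covariance_kernel (j l : 'I_3) (psi phi : pt -> C) : C :=
  cexpectation (fun w => component (f w) j psi *
                         (component (f w) l (fun y => (phi y)^*))^*).

Definition relation_kernel (j l : 'I_3) (psi phi : pt -> C) : C :=
  cexpectation (fun w => component (f w) j psi * component (f w) l phi).

(* Centered GMIG field of order [- m] in [D], with principal symbols
   [Ac x * |xi| ^ (- m)] and [Ar x * |xi| ^ (- m)]. *)
Definition centered_GMIG (D : set pt) (m : R) (Ac Ar : pt -> 'M[C]_3) : Prop :=
  [/\ gaussian_field, centered,
      has_isotropic_symbol D m covariance_kernel Ac &
      has_isotropic_symbol D m relation_kernel Ar].

Definition far_field (w : T) (xhat : pt) (kappa : R) : 'cV[C]_3 :=
  \col_j ((0 +i* (kappa / (4 * pi))) *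
          smooth_pairing (component (f w) j)
            (fun y => expi (- (kappa * dot xhat y)))).

Definition frequency_mean (m Q : R) (G : R -> 'M[C]_3) : 'M[C]_3 :=
  (Q^-1)%:C *: \matrix_(j, l) cintegral lebesgue_measure `[Q, 2 * Q]
    (fun kappa => (kappa `^ (m - 2))%:C * G kappa j l).

(* The topology on complex matrices is found through the alias [C^o]. *)
Definition covariance_limit (m : R) (xhat : pt) (tau : R) (L : 'M[C]_3) : Prop :=
  {ae P, forall w,
    (frequency_mean m Q (fun kappa =>
       far_field w xhat (kappa + tau) *m
         (map_mx conjc (far_field w xhat kappa))^T) : 'M[C^o]_3)
    @[Q --> +oo] --> (L : 'M[C^o]_3)}.

Definition relation_limit (m : R) (xhat : pt) (tau : R) (L : 'M[C]_3) : Prop :=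
  {ae P, forall w,
    (frequency_mean m Q (fun kappa =>
       far_field w xhat (kappa + tau) *m
         (far_field w (- xhat) kappa)^T) : 'M[C^o]_3)
    @[Q --> +oo] --> (L : 'M[C^o]_3)}.

End RandomFields.

Definition open_in_freq_sphere (R : realType) (Theta : set (R * 'rV[R]_3)) :
    Prop :=
  exists U : set (R * 'rV[R]_3),
    open U /\ Theta = U `&` [set z | 0 < z.1 /\ sphere2 z.2].

(* Main.v *)
Require Import Defs.
From HB Require Import structures.
From mathcomp Require Import all_boot all_order all_algebra.
From mathcomp Require Import complex.
From mathcomp Require Import all_classical all_reals all_analysis.
From mathcomp Require Import measurable_realfun.
From mathcomp Require Import ring lra.

Set Implicit Arguments.
Unset Strict Implicit.
Unset Printing Implicit Defensive.

Import Order.TTheory GRing.Theory Num.Theory.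
Import numFieldNormedType.Exports.

Local Open Scope classical_set_scope.
Local Open Scope ring_scope.
Local Open Scope complex_scope.

(** Up to the factor i kappa / (4 pi), the far field in direction v is the Fourier transform of [f]
    at the frequency kappa v. If chi is a real cutoff equal to 1 near the closure of D, that value
    is a [mode]: the pairing of [f] with the compactly supported plane wave chi exp(-i x.xi). The
    expected product of two modes is the covariance kernel (with a conjugate) or the relation kernel
    (without) tested on two such waves. By [kernel_amplitude] it equals (2 pi)^-3 times the Fourier
    transform, at the difference xi - zeta of the two frequencies, of chi(x) a(x, zeta), where a(.,
    zeta) is, up to a constant, what the pseudo-differential operator makes of chi exp(i x.zeta)
    once the oscillation is divided out.

    Two facts about this amplitude carry the analysis. First, chi a(., zeta) has a fixed compact
    support and is Lipschitz with a constant of order (1 + |zeta|)^-m, so correlations of modes are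
    bounded by (1 + |zeta|)^-m / (1 + |xi - zeta|) ([amplitude_decay]). Secondly, kappa^m a(x, kappa
    v) tends to (2 pi)^3 A(x) chi(x), by Fourier inversion for chi ([hat_amplitude_limit]). Since
    kappa^(m-2) kappa (kappa + tau) is kappa^m to leading order, the expectation of the weighted
    product of far fields tends to the Fourier transform of A at tau v, times 1 / (16 pi^2), with a
    sign from i times i in the relation case.

    The passage from expectations to almost sure averages is an ergodic argument. The field is
    centred Gaussian, so Wick's formula ([wick]) expresses the covariance of two products of real
    parts as two products of correlations. After weighting, each correlation is of order 1 / (1 +
    |kappa - kappa'|), hence the covariance is of order 1 / (1 + |kappa - kappa'|^2), which is
    integrable; [law_of_large_numbers] then makes the averages of the fluctuations vanish almost
    surely. One power of decay per correlation is enough, which is why Lipschitz control of the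
    amplitude suffices. [complex_average] and [ae_average] assemble the pieces.

    Using one cutoff for all frequencies requires that almost surely [f] be supported in the closure
    of D ([ae_dsupport]). For a single test function vanishing on D the pairing has variance 0. To
    reach all test functions outside one null set, countably many are selected: cutoffs with
    rational centres times exponentials with lattice frequencies. On a small box every test function
    is a limit of trigonometric polynomials together with all its derivatives ([trig_kernel]), so
    vanishing on the countable family propagates by continuity.

    For uniqueness, two almost sure limits are compared at a common outcome, so equal data means
    that the Fourier transform of a difference of matrices vanishes on an open set of frequencies.
    The transform of a compactly supported function continues along lines as an analytic function
    does ([continuation]), so it vanishes everywhere, and [hat_eq0] concludes, again through
    [trig_kernel]. *)

Notation cRe := (@complex.Re _).
Notation cIm := (@complex.Im _).
Notation nc := (@Normc.normc _).

(** * Complex numbers: parts, modulus and phase factors *)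

Section ComplexNumbers.
Variable R : realType.
Implicit Types z w : R[i].

Lemma complex_eqP z w : cRe z = cRe w -> cIm z = cIm w -> z = w.
Proof. by case: z => a b; case: w => c d /= -> ->. Qed.

Lemma cReD z w : cRe (z + w) = cRe z + cRe w. Proof. by case: z; case: w. Qed.
Lemma cImD z w : cIm (z + w) = cIm z + cIm w. Proof. by case: z; case: w. Qed.
Lemma cReN z : cRe (- z) = - cRe z. Proof. by case: z. Qed.
Lemma cImN z : cIm (- z) = - cIm z. Proof. by case: z. Qed.
Lemma cReM z w : cRe (z * w) = cRe z * cRe w - cIm z * cIm w.
Proof. by case: z; case: w. Qed.
Lemma cImM z w : cIm (z * w) = cRe z * cIm w + cIm z * cRe w.
Proof. by case: z; case: w => /= *; ring. Qed.
Lemma cReJ z : cRe (z^*) = cRe z. Proof. by case: z. Qed.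
Lemma cImJ z : cIm (z^*) = - cIm z. Proof. by case: z. Qed.

Definition cE := (cReD, cImD, cReN, cImN, cReM, cImM, cReJ, cImJ).

Lemma nc_def z : nc z = Num.sqrt (cRe z ^+ 2 + cIm z ^+ 2).
Proof. by case: z. Qed.

Lemma nc_ge0 z : 0 <= nc z. Proof. by rewrite nc_def sqrtr_ge0. Qed.
Hint Resolve nc_ge0 : core.

Lemma nc_sqr z : nc z ^+ 2 = cRe z ^+ 2 + cIm z ^+ 2.
Proof. by rewrite nc_def sqr_sqrtr// addr_ge0// sqr_ge0. Qed.

Lemma le_Re_nc z : `|cRe z| <= nc z.
Proof.
rewrite nc_def -sqrtr_sqr ler_sqrt ?lerDl ?sqr_ge0//.
by rewrite addr_ge0// sqr_ge0.
Qed.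

Lemma le_Im_nc z : `|cIm z| <= nc z.
Proof.
rewrite nc_def -sqrtr_sqr ler_sqrt ?lerDr ?sqr_ge0//.
by rewrite addr_ge0// sqr_ge0.
Qed.

Lemma nc_leD z : nc z <= `|cRe z| + `|cIm z|.
Proof.
rewrite -(@ler_pXn2r _ 2)// ?nnegrE ?addr_ge0//.
rewrite nc_sqr -(real_normK (num_real (cRe z))) -(real_normK (num_real (cIm z))).
rewrite sqrrD addrAC lerDl mulrn_wge0// mulr_ge0//.
Qed.

Lemma ncD z w : nc (z + w) <= nc z + nc w. Proof. exact: le_normcD. Qed.
Lemma ncM z w : nc (z * w) = nc z * nc w. Proof. exact: Normc.normcM. Qed.
Lemma ncN z : nc (- z) = nc z. Proof. exact: normcN. Qed.
Lemma ncB z w : nc (z - w) <= nc z + nc w. Proof. by rewrite -(ncN w) ncD. Qed.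
Lemma nc0 : nc (0 : R[i]) = 0. Proof. exact: Normc.normc0. Qed.
Lemma nc1 : nc (1 : R[i]) = 1. Proof. exact: Normc.normc1. Qed.
Lemma ncR (x : R) : nc x%:C = `|x|.
Proof. by rewrite nc_def /= expr0n addr0 sqrtr_sqr. Qed.
Lemma nc_eq0 z : nc z = 0 -> z = 0. Proof. exact: Normc.eq0_normc. Qed.
Lemma nc_subC z w : nc (z - w) = nc (w - z).
Proof. by rewrite -ncN opprB. Qed.

Lemma nc_sum I (r : seq I) (P : pred I) (F : I -> R[i]) :
  nc (\sum_(i <- r | P i) F i) <= \sum_(i <- r | P i) nc (F i).
Proof.
elim/big_rec2: _ => [|i y1 y2 _ h]; first by rewrite nc0.
by apply: le_trans (ncD _ _) _; rewrite lerD2l.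
Qed.

Lemma ncX z n : nc (z ^+ n) = nc z ^+ n.
Proof. by elim: n => [|n IH]; rewrite ?expr0 ?nc1// !exprS ncM IH. Qed.

Lemma expiD (a b : R) : expi (a + b) = expi a * expi b.
Proof. by apply: complex_eqP; rewrite ?cE /= ?cosD ?sinD; ring. Qed.

Lemma expi0 : expi 0 = 1 :> R[i].
Proof. by apply: complex_eqP; rewrite /= ?cos0 ?sin0. Qed.

Lemma expiN (a : R) : expi (- a) = (expi a)^*.
Proof. by apply: complex_eqP; rewrite /= ?cosN ?sinN. Qed.

Lemma nc_expi (a : R) : nc (expi a) = 1.
Proof. by rewrite nc_def /= cos2Dsin2 sqrtr1. Qed.

Lemma expi_pi : expi (pi : R) = - 1.
Proof. by apply: complex_eqP; rewrite /= ?cospi ?sinpi ?oppr0. Qed.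

Lemma le_derive_lipschitz (f df : R -> R) (C : R) :
  (forall x : R, is_derive x 1 f (df x)) -> (forall x, `|df x| <= C) ->
  forall a b, `|f a - f b| <= C * `|a - b|.
Proof.
move=> fd dC.
have H a b : a <= b -> `|f b - f a| <= C * `|b - a|.
  move=> ab; have [|c _ ->] := @MVT_segment R f df a b ab (fun x _ => fd x).
    apply: continuous_subspaceT => x; apply: differentiable_continuous.
    by apply/derivable1_diffP; apply: ex_derive.
  by rewrite normrM ler_wpM2r.
move=> a b; have [|/ltW] := leP a b => ab; last exact: H.
by rewrite distrC (distrC a); exact: H.
Qed.

(** Cosine and sine are each 1-Lipschitz; adding the two parts gives the constant 2, which is not
    sharp but suffices throughout. *)
Lemma expi_lipschitz (a b : R) : nc (expi a - expi b) <= 2 * `|a - b|.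
Proof.
apply: le_trans (nc_leD _) _.
rewrite !cE /= mulr2n mulrDl !mul1r lerD//.
  have := @le_derive_lipschitz cos (fun x => - sin x) 1.
  move=> /(_ (@is_derive_cos R)) h; rewrite -[leRHS]mul1r; apply: h => x.
  by rewrite normrN ler_norml sin_geN1 sin_le1.
have := @le_derive_lipschitz sin (fun x => cos x) 1.
move=> /(_ (@is_derive_sin R)) h; rewrite -[leRHS]mul1r; apply: h => x.
by rewrite ler_norml cos_geN1 cos_le1.
Qed.

Lemma expi_norm (a : R) : nc (expi a - 1) <= 2 * `|a|.
Proof. by rewrite -expi0 -[in leRHS](subr0 a) expi_lipschitz. Qed.

End ComplexNumbers.
#[global] Hint Resolve nc_ge0 : core.

(** * Limits of complex-valued functions *)

Section ComplexLimits.
Variable R : realType.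

(** Convergence is taken part by part, so that the real limit theory applies without fixing a
    topology on [R[i]]; the passage to the topology of the statement is made once, in
    [complex_matrix_cvg]. *)
Definition ccvg (T : Type) (F : set_system T) (g : T -> R[i]) (l : R[i]) :=
  (cRe (g x) @[x --> F] --> cRe l) /\ (cIm (g x) @[x --> F] --> cIm l).

Variables (T : Type) (F : set_system T).
Context {FF : Filter F}.
Implicit Types (g h : T -> R[i]).

Lemma ccvg_cst (c : R[i]) : ccvg F (fun=> c) c.
Proof. by split; exact: cvg_cst. Qed.

Lemma ccvgD g h a b : ccvg F g a -> ccvg F h b -> ccvg F (fun x => g x + h x) (a + b).
Proof.
move=> [g1 g2] [h1 h2]; split; rewrite cE.
  by under eq_fun do rewrite cE; exact: cvgD.
by under eq_fun do rewrite cE; exact: cvgD.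
Qed.

Lemma ccvgM g h a b : ccvg F g a -> ccvg F h b -> ccvg F (fun x => g x * h x) (a * b).
Proof.
move=> [g1 g2] [h1 h2]; split; rewrite cE.
  by under eq_fun do rewrite cE; apply: cvgB; exact: cvgM.
by under eq_fun do rewrite cE; apply: cvgD; exact: cvgM.
Qed.

Lemma ccvgR (u : T -> R) (l : R) : u x @[x --> F] --> l -> ccvg F (fun x => (u x)%:C) l%:C.
Proof. by move=> ul; split => //=; exact: cvg_cst. Qed.

Lemma ccvg_squeeze g l (u : T -> R) :
  (\forall x \near F, nc (g x - l) <= u x) -> u x @[x --> F] --> 0 -> ccvg F g l.
Proof.
move=> gu u0; split; apply/subr_cvg0; apply/norm_cvg0P;
  apply: (@squeeze_cvgr _ _ _ _ (cst 0) u) => //; try exact: cvg_cst;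
  apply: filterS gu => x gu; rewrite normr_ge0/=;
  rewrite -?cReN -?cImN -?cReD -?cImD.
  exact: le_trans (le_Re_nc _) gu.
exact: le_trans (le_Im_nc _) gu.
Qed.

Lemma ccvg_nc g l : ccvg F g l -> nc (g x - l) @[x --> F] --> 0.
Proof.
move=> [g1 g2].
apply: (@squeeze_cvgr _ _ _ _ (cst 0)
  (fun x => `|cRe (g x) - cRe l| + `|cIm (g x) - cIm l|)).
- apply: nearW => x; rewrite nc_ge0/=.
  by rewrite -?cReN -?cImN -?cReD -?cImD nc_leD.
- exact: cvg_cst.
- rewrite -[X in _ --> X](addr0 0); apply: cvgD; apply/norm_cvg0P; apply/subr_cvg0 => //.
Qed.

Lemma near_ccvg g h l : {near F, g =1 h} -> ccvg F g l -> ccvg F h l.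
Proof.
move=> gh [g1 g2]; split; [move: g1|move: g2]; apply: cvg_trans; apply: near_eq_cvg;
  by apply: filterS gh => x ->.
Qed.

End ComplexLimits.

Lemma ccvg_unique (R : realType) (T : Type) (F : set_system T) {FF : ProperFilter F}
  (g : T -> R[i]) a b : ccvg F g a -> ccvg F g b -> a = b.
Proof.
move=> [a1 a2] [b1 b2]; apply: complex_eqP.
  by apply: cvg_unique a1 b1; exact: Rhausdorff.
by apply: cvg_unique a2 b2; exact: Rhausdorff.
Qed.

(** * Complex-valued Lebesgue integrals *)

Section ComplexIntegral.
Context d (T : measurableType d) (R : realType) (mu : {measure set T -> \bar R}).
Variable D : set T.
Hypothesis mD : measurable D.
Implicit Types (g h : T -> R[i]).

Definition cmeas g := measurable_fun D (fun x => cRe (g x)) /\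
                      measurable_fun D (fun x => cIm (g x)).

Definition cintegrable g := mu.-integrable D (fun x => (cRe (g x))%:E) /\
                            mu.-integrable D (fun x => (cIm (g x))%:E).

Lemma cmeasM g h : cmeas g -> cmeas h -> cmeas (fun x => g x * h x).
Proof.
move=> [g1 g2] [h1 h2]; split.
  by under eq_fun do rewrite cE; apply: measurable_funB; exact: measurable_funM.
by under eq_fun do rewrite cE; apply: measurable_funD; exact: measurable_funM.
Qed.

Lemma cmeas_cst (c : R[i]) : cmeas (fun=> c).
Proof. by split; exact: measurable_cst. Qed.

Lemma cintegrable_meas g : cintegrable g -> cmeas g.
Proof.
move=> [/integrableP[g1 _] /integrableP[g2 _]].
by split; apply/measurable_EFinP.
Qed.

Lemma cintegrable_le g (h : T -> R) : cmeas g -> mu.-integrable D (fun x => (h x)%:E) ->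
  (forall x, D x -> nc (g x) <= h x) -> cintegrable g.
Proof.
move=> [g1 g2] ih gh; split; apply: le_integrable ih => //;
  do ?[by apply/measurable_EFinP]; move=> x Dx /=; rewrite lee_fin.
  by apply: le_trans (le_trans (le_Re_nc _) (gh _ Dx)) (ler_norm _).
by apply: le_trans (le_trans (le_Im_nc _) (gh _ Dx)) (ler_norm _).
Qed.

Lemma cintegrableZ (c : R[i]) g : cintegrable g -> cintegrable (fun x => c * g x).
Proof.
move=> [g1 g2]; split.
  under eq_fun do rewrite cE EFinB !EFinM; apply: integrableB => //; exact: integrableZl.
under eq_fun do rewrite cE EFinD !EFinM; apply: integrableD => //; exact: integrableZl.
Qed.

Lemma cintegralD g h : cintegrable g -> cintegrable h ->
  cintegral mu D (fun x => g x + h x) = cintegral mu D g + cintegral mu D h.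
Proof.
move=> [g1 g2] [h1 h2]; apply: complex_eqP; rewrite cE /=.
  by under eq_Rintegral do rewrite cE; rewrite RintegralD.
by under eq_Rintegral do rewrite cE; rewrite RintegralD.
Qed.

Lemma cintegralZ (c : R[i]) g : cintegrable g ->
  cintegral mu D (fun x => c * g x) = c * cintegral mu D g.
Proof.
move=> [g1 g2]; apply: complex_eqP; rewrite cE /=.
  under eq_Rintegral do rewrite cE.
  by rewrite RintegralB ?RintegralZl//; [exact: (integrableZl mD (cRe c) g1)|exact: (integrableZl mD (cIm c) g2)].
under eq_Rintegral do rewrite cE.
by rewrite RintegralD ?RintegralZl//; [exact: (integrableZl mD (cRe c) g2)|exact: (integrableZl mD (cIm c) g1)].
Qed.

Lemma eq_cintegral g h : (forall x, D x -> g x = h x) ->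
  cintegral mu D g = cintegral mu D h.
Proof.
by move=> gh; apply: complex_eqP => /=; apply: eq_Rintegral => x /set_mem Dx; rewrite gh.
Qed.

(** The factor 2 comes from bounding the real and imaginary parts separately. *)
Lemma nc_cintegral g (h : T -> R) : cmeas g -> mu.-integrable D (fun x => (h x)%:E) ->
  (forall x, D x -> nc (g x) <= h x) ->
  nc (cintegral mu D g) <= 2 * \int[mu]_(x in D) h x.
Proof.
move=> mg ih gh; have [g1 g2] := cintegrable_le mg ih gh.
apply: le_trans (nc_leD _) _; rewrite mulr2n mulrDl !mul1r /=.
apply: lerD; apply: le_trans (le_normr_Rintegral _ _) _ => //;
  apply: le_Rintegral => //; try exact: (integrable_abse g1); try exact: (integrable_abse g2).
- by move=> x Dx; apply: le_trans (le_Re_nc _) (gh _ Dx).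
- by move=> x Dx; apply: le_trans (le_Im_nc _) (gh _ Dx).
Qed.

Lemma Rintegral_dominated (f_ : nat -> T -> R) (f h : T -> R) :
  (forall n, measurable_fun D (f_ n)) -> measurable_fun D f ->
  (forall x, D x -> f_ n x @[n --> \oo] --> f x) ->
  mu.-integrable D (fun x => (h x)%:E) ->
  (forall n x, D x -> `|f_ n x| <= h x) ->
  \int[mu]_(x in D) f_ n x @[n --> \oo] --> \int[mu]_(x in D) f x.
Proof.
move=> mf_ mf f_f ih f_h.
have [|||||if_ _ c] := @dominated_convergence _ _ _ mu D mD
   (fun n x => (f_ n x)%:E) (fun x => (f x)%:E) (fun x => (h x)%:E).
- by move=> n; apply/measurable_EFinP.
- exact/measurable_EFinP.
- by apply: aeW => x Dx; apply: cvg_EFin; [exact: nearW|exact: f_f].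
- exact: ih.
- by apply: aeW => x n Dx; rewrite /= lee_fin f_h.
apply: fine_cvg; rewrite fineK; last exact: integrable_fin_num.
exact: c.
Qed.

Lemma cintegral_dominated (g_ : nat -> T -> R[i]) (g : T -> R[i]) (h : T -> R) :
  (forall n, cmeas (g_ n)) -> cmeas g ->
  (forall x, D x -> ccvg \oo (g_ ^~ x) (g x)) ->
  mu.-integrable D (fun x => (h x)%:E) ->
  (forall n x, D x -> nc (g_ n x) <= h x) ->
  ccvg \oo (fun n => cintegral mu D (g_ n)) (cintegral mu D g).
Proof.
move=> mg_ [mg1 mg2] gg ih gh; split => /=.
- apply: (@Rintegral_dominated (fun n x => cRe (g_ n x)) (fun x => cRe (g x)) h) => //.
  + by move=> n; have [] := mg_ n.
  + by move=> x /gg [].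
  + by move=> n x Dx; apply: le_trans (le_Re_nc _) (gh _ _ Dx).
- apply: (@Rintegral_dominated (fun n x => cIm (g_ n x)) (fun x => cIm (g x)) h) => //.
  + by move=> n; have [] := mg_ n.
  + by move=> x /gg [].
  + by move=> n x Dx; apply: le_trans (le_Im_nc _) (gh _ _ Dx).
Qed.

End ComplexIntegral.

(** * Joint measurability and product measures *)

Section RealMeasurability.
Context (R : realType) d (X : measurableType d).

                                                         
(** Rounding the second variable down to a grid of mesh 1 / (n + 1) gives a function that is
    measurable on each of countably many strips; continuity in that variable makes these
    approximants converge pointwise. *)
Lemma measurable_caratheodory (g : X -> R -> R) :
  (forall t, measurable_fun setT (g^~ t)) -> (forall x, continuous (g x)) ->
  measurable_fun setT (fun z : X * measurableTypeR R => g z.1 z.2).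
Proof.
move=> mg cg.
pose q (n : nat) (t : R) : R := (Num.floor (t * n.+1%:R))%:~R / n.+1%:R.
apply: (@measurable_fun_cvg _ _ _ _ (fun n z => g z.1 (q n z.2))).
  move=> n _ Y mY; rewrite setTI.
  have -> : (fun z : X * measurableTypeR R => g z.1 (q n z.2)) @^-1` Y =
    \bigcup_(i in [set: int]) (((g^~ (i%:~R / n.+1%:R)) @^-1` Y) `*`
        ((fun t => Num.floor (t * n.+1%:R)) @^-1` [set i])).
    apply/seteqP; split=> [[x t]/= gY|[x t]/= [i _ [/= gY fi]]]; last by rewrite /q fi.
    by exists (Num.floor (t * n.+1%:R)).
  apply: countable_bigcupT_measurable => // i; apply: measurableX.
    by rewrite -[X in measurable X]setTI; exact: mg.
  rewrite (_ : _ @^-1` _ = `[i%:~R / n.+1%:R, (i + 1)%:~R / n.+1%:R[%classic).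
    exact: measurable_itv.
  apply/seteqP; split=> t /=.
    move=> <-; rewrite in_itv/= ler_pdivrMr ?ltr_pdivlMr ?ltr0n//.
    exact: floor_itv.
  rewrite in_itv/= ler_pdivrMr ?ltr_pdivlMr ?ltr0n// => h.
  exact: floor_def.
have n0 n : (0 : R) < n.+1%:R by rewrite ltr0n.
move=> [x t] _ /=; apply: (@continuous_cvg _ _ _ _ _ (q^~ t) (g x)); first exact: cg.
apply/subr_cvg0; apply/norm_cvg0P.
apply: (@squeeze_cvgr _ _ _ _ (cst 0) (fun n => n.+1%:R^-1)).
- apply: nearW => n; rewrite normr_ge0/= /q.
  have /andP[f1 f2] := floor_itv (t * n.+1%:R).
  have -> : (Num.floor (t * n.+1%:R))%:~R / n.+1%:R - t =
     ((Num.floor (t * n.+1%:R))%:~R - t * n.+1%:R) / n.+1%:R.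
    by rewrite mulrBl mulfK// gt_eqF.
  rewrite normrM normfV (ger0_norm (ltW (n0 n))) ler_piMl// ?invr_ge0//.
  by rewrite ler0_norm ?subr_le0// opprB lerBlDr addrC -intrD1 ltW.
- exact: cvg_cst.
- exact: cvg_harmonic.
Qed.

End RealMeasurability.

Lemma sigma_finite_prod d1 d2 (T1 : measurableType d1) (T2 : measurableType d2)
    (R : realType) (m1 : {sigma_finite_measure set T1 -> \bar R})
    (m2 : {sigma_finite_measure set T2 -> \bar R}) :
  sigma_finite setT (m1 \x m2)%E.
Proof.
have /sigma_finiteP[F [TF ndF Foo]] := sigma_finiteT m1.
have /sigma_finiteP[G [TG ndG Goo]] := sigma_finiteT m2.
exists (fun n => F n `*` G n); last first.
  move=> k; have [mF Fk] := Foo k; have [mG Gk] := Goo k.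
  split; first exact: measurableX.
  by rewrite product_measure1E// lte_mul_pinfty// ge0_fin_numE.
rewrite -setXTT TF TG; apply/seteqP; split=> [[x y] [[n _ Fx] [k _ Gy]]|[x y] [n _ [? ?]]].
  exists (maxn n k) => //; split.
    by move: Fx; apply/subsetPset/ndF/leq_maxl.
  by move: Gy; apply/subsetPset/ndG/leq_maxr.
by split; exists n.
Qed.

(** A named planar Lebesgue measure, so that it can carry the sigma-finite structure needed when a
    third factor is added or Fubini is applied. *)
Definition lebesgue2 (R : realType) : set (measurableTypeR R * measurableTypeR R) -> \bar R :=
  (lebesgue_measure \x lebesgue_measure)%E.

HB.instance Definition _ (R : realType) := Measure.on (@lebesgue2 R).
HB.instance Definition _ (R : realType) :=
  Measure_isSigmaFinite.Build _ _ _ (@lebesgue2 R)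
    (sigma_finite_prod lebesgue_measure lebesgue_measure).

Section ProductIntegral.
Local Open Scope ereal_scope.
Context d1 d2 (T1 : measurableType d1) (T2 : measurableType d2) (R : realType).
Variable m1 : {sigma_finite_measure set T1 -> \bar R}.
Variable m2 : {sigma_finite_measure set T2 -> \bar R}.

Lemma integrable_prod (f : T1 -> R) (g : T2 -> R) :
  m1.-integrable setT (fun x => (f x)%:E) -> m2.-integrable setT (fun x => (g x)%:E) ->
  (m1 \x m2).-integrable setT (fun z => (f z.1 * g z.2)%:E).
Proof.
move=> fi gi; have /integrableP[/measurable_EFinP mf f_fin] := fi.
have /integrableP[/measurable_EFinP mg g_fin] := gi.
apply/integrable12ltyP.
  apply/measurable_EFinP; apply: measurable_funM.
    exact: measurableT_comp mf measurable_fst.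
  exact: measurableT_comp mg measurable_snd.
rewrite /=.
under eq_integral => x _.
  under eq_integral => y _ do rewrite normrM EFinM.
  rewrite (integralZl measurableT) ?normr_ge0//; last exact: (integrable_abse gi).
  rewrite -(fineK (_ : \int[m2]_y `|g y|%:E \is a fin_num)); last first.
    by apply: integrable_fin_num => //; exact: (integrable_abse gi).
  rewrite muleC; over.
rewrite /= (integralZl measurableT); last exact: (integrable_abse fi).
have : \int[m1]_x `|f x|%:E \is a fin_num.
  by apply: integrable_fin_num => //; exact: (integrable_abse fi).
by move=> /fineK <-; rewrite ltry.
Qed.

Lemma Rintegral_prod (f : T1 -> R) (g : T2 -> R) :
  m1.-integrable setT (fun x => (f x)%:E) -> m2.-integrable setT (fun x => (g x)%:E) ->
  (\int[m1 \x m2]_z (f z.1 * g z.2) = \int[m1]_x f x * \int[m2]_x g x)%R.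
Proof.
move=> fi gi; rewrite [in LHS]/Rintegral -(integral12_prod_meas1 (integrable_prod fi gi)).
rewrite /fubini_F /=.
under eq_integral => x _.
  under eq_integral => y _ do rewrite EFinM.
  rewrite (integralZl measurableT)//.
  rewrite -(fineK (_ : \int[m2]_y (g y)%:E \is a fin_num)); last first.
    exact: integrable_fin_num.
  rewrite muleC; over.
rewrite /= (integralZl measurableT)//.
have h : \int[m1]_x (f x)%:E \is a fin_num by exact: integrable_fin_num.
by rewrite fineM// mulrC.
Qed.

Lemma cintegral_prod (f : T1 -> R[i]) (g : T2 -> R[i]) :
  cintegrable m1 setT f -> cintegrable m2 setT g ->
  cintegrable (m1 \x m2) setT (fun z => f z.1 * g z.2)%R /\
  (cintegral (m1 \x m2) setT (fun z => f z.1 * g z.2) =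
   cintegral m1 setT f * cintegral m2 setT g)%R.
Proof.
move=> [f1 f2] [g1 g2].
have h11 := integrable_prod f1 g1; have h12 := integrable_prod f1 g2.
have h21 := integrable_prod f2 g1; have h22 := integrable_prod f2 g2.
split.
  split; under eq_fun do rewrite cE ?EFinB ?EFinD.
    exact: integrableB h11 h22.
  exact: integrableD h12 h21.
apply: complex_eqP; rewrite cE /=; under [LHS]eq_Rintegral do rewrite cE.
  rewrite RintegralB//; first by rewrite (Rintegral_prod f1 g1) (Rintegral_prod f2 g2).
rewrite RintegralD//; by rewrite (Rintegral_prod f1 g2) (Rintegral_prod f2 g1).
Qed.

End ProductIntegral.

(** * Measure-preserving changes of variables *)

Section MeasurePreserving.
Local Open Scope ereal_scope.

Definition measure_preserving d (T : measurableType d) (R : realType)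
    (mu : {measure set T -> \bar R}) (phi : T -> T) :=
  measurable_fun setT phi /\ forall A, measurable A -> mu (phi @^-1` A) = mu A.

Lemma cintegral_preserving d (T : measurableType d) (R : realType)
    (mu : {measure set T -> \bar R}) (phi : T -> T) (g : T -> R[i]) :
  measure_preserving mu phi -> cintegrable mu setT g ->
  cintegrable mu setT (g \o phi) /\ cintegral mu setT (g \o phi) = cintegral mu setT g.
Proof.
move=> [mphi pphi].
have pe (F : T -> \bar R) : \int[pushforward mu phi]_x F x = \int[mu]_x F x.
  by apply: eq_measure_integral => A mA _; exact: pphi.
have H (f : T -> R) : mu.-integrable setT (EFin \o f) ->
   mu.-integrable setT (EFin \o f \o phi) /\
   (\int[mu]_x f (phi x) = \int[mu]_x f x)%R.
  move=> fi; have /integrableP[mf f_fin] := fi.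
  have fphi : mu.-integrable setT (EFin \o f \o phi).
    apply/integrableP; split; first exact: measurableT_comp mf mphi.
    apply: le_lt_trans f_fin; rewrite le_eqVlt; apply/orP; left; apply/eqP.
    rewrite -(pe (fun x => `|(EFin \o f) x|)) ge0_integral_pushforward//=.
    exact: (measurableT_comp (@abse_measurable R setT) mf).
  split=> //; congr fine.
  by rewrite -(pe (EFin \o f)) integral_pushforward.
move=> [g1 g2]; have [h1 e1] := H _ g1; have [h2 e2] := H _ g2.
by split; [split|apply: complex_eqP].
Qed.

(** The image measure agrees with the product measure on rectangles, which determine it. *)
Lemma measure_preserving_prod d1 d2 (T1 : measurableType d1) (T2 : measurableType d2)
    (R : realType) (m1 : {sigma_finite_measure set T1 -> \bar R})
    (m2 : {sigma_finite_measure set T2 -> \bar R}) (p1 : T1 -> T1) (p2 : T2 -> T2) :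
  measure_preserving m1 p1 -> measure_preserving m2 p2 ->
  measure_preserving (m1 \x m2) (fun z => (p1 z.1, p2 z.2)).
Proof.
move=> [mp1 pp1] [mp2 pp2].
have mp : measurable_fun setT (fun z : T1 * T2 => (p1 z.1, p2 z.2)).
  apply: measurable_fun_pair.
    exact: measurableT_comp mp1 measurable_fst.
  exact: measurableT_comp mp2 measurable_snd.
split=> // A mA; apply/esym.
have mA1 (B : set T1) : measurable B -> measurable (p1 @^-1` B).
  by move=> mB; rewrite -[X in measurable X]setTI; exact: mp1.
have mA2 (B : set T2) : measurable B -> measurable (p2 @^-1` B).
  by move=> mB; rewrite -[X in measurable X]setTI; exact: mp2.
apply: (@product_measure_unique _ _ _ _ _ m1 m2 (pushforward (m1 \x m2) (fun z => (p1 z.1, p2 z.2)))) => //.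
move=> A1 A2 mA1' mA2'; rewrite /pushforward.
transitivity ((m1 \x m2) ((p1 @^-1` A1) `*` (p2 @^-1` A2))); first by [].
by rewrite product_measure1E; [rewrite pp1// pp2|exact: mA1|exact: mA2].
Qed.

(** The image measure agrees with Lebesgue measure on half-open intervals, which determine it. *)
Lemma measure_preserving_shift (R : realType) (a : R) :
  measure_preserving (@lebesgue_measure R) (fun x => x + a)%R.
Proof.
have m : measurable_fun setT (fun x : measurableTypeR R => x + a : measurableTypeR R)%R.
  apply: measurable_funD => //; exact: measurable_cst.
split=> // A mA; apply/esym.
apply: (@lebesgue_measure_unique R
  (pushforward lebesgue_measure (fun x : measurableTypeR R => x + a : measurableTypeR R)%R)) => //.
move=> _ [[b c] _ <-] /=.
transitivity (lebesgue_measure (`]b - a, c - a]%classic : set R))%R; last first.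
  congr lebesgue_measure; apply/seteqP; split=> x /=.
    by rewrite !in_itv/= ltrBlDr lerBrDr.
  by rewrite !in_itv/= ltrBlDr lerBrDr.
rewrite !lebesgue_measure_itv/= !lte_fin ltrD2r; case: ifPn => // _.
by rewrite -!EFinB; congr EFin; ring.
Qed.

End MeasurePreserving.

(** * Integration over three-dimensional space *)

Section RealSpace3.
Variable R : realType.
Local Notation mu1 := (@lebesgue_measure R).
Local Notation mu3 := ((mu1 \x mu1) \x mu1)%E.
Local Notation mR := (measurableTypeR R).
Local Notation R3 := (mR * mR * mR)%type.
Local Notation pt := 'rV[R]_3.

Definition ccont (V : topologicalType) (g : V -> R[i]) :=
  continuous (fun x => cRe (g x)) /\ continuous (fun x => cIm (g x)).

Lemma row3K (x : pt) : row3 (x 0 0, x 0 1, x 0 2) = x.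
Proof.
by apply/rowP => -[[|[|[|//]]] i]; rewrite !mxE /=; congr (x _ _); apply/val_inj.
Qed.

Lemma row3E (a b c : R) : [/\ row3 (a, b, c) 0 0 = a, row3 (a, b, c) 0 1 = b &
  row3 (a, b, c) 0 2 = c].
Proof. by rewrite !mxE. Qed.

Lemma row3D (a b c a' b' c' : R) :
  row3 (a + a', b + b', c + c') = row3 (a, b, c) + row3 (a', b', c').
Proof. by apply/rowP => -[[|[|[|//]]] i]; rewrite !mxE. Qed.

Lemma row3_coord (a b c : R) : [/\
  row3 (a, b, c) = row3 (0, b, c) + a *: delta_mx 0 0,
  row3 (a, b, c) = row3 (a, 0, c) + b *: delta_mx 0 1 &
  row3 (a, b, c) = row3 (a, b, 0) + c *: delta_mx 0 2].
Proof.
by split; apply/rowP => -[[|[|[|//]]] i]; rewrite !mxE /= ?mulr0 ?mulr1 ?addr0 ?add0r.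
Qed.

Lemma continuous_line (V : normedModType R) (x v : V) : continuous (fun t : R => x + t *: v).
Proof.
by move=> t; apply: cvgD; [exact: cvg_cst|apply: cvgZr_tmp; exact: cvg_id].
Qed.

(** Continuity on row vectors gives continuity in each coordinate separately; the Carathéodory
    argument then adds one coordinate at a time. *)
Lemma measurable_row3 (g : pt -> R) : continuous g -> measurable_fun (setT : set R3) (g \o @row3 R).
Proof.
move=> cg.
have lc (x v : pt) : continuous (fun t : R => g (x + t *: v)).
  by move=> t; apply: (@continuous_comp _ _ _ (fun t : R => x + t *: v) g t); [exact: continuous_line|exact: cg].
have -> : g \o @row3 R = fun z : R3 => (fun (w : mR * mR) t => g (row3 (w.1, w.2, t))) z.1 z.2.
  by apply/funext => -[[a b] c].
apply: (@measurable_caratheodory R _ (mR * mR)%type (fun w t => g (row3 (w.1, w.2, t)))) => [t|w].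
  apply: (@measurable_caratheodory R _ mR (fun a b => g (row3 (a, b, t)))) => [b|a].
    apply: continuous_measurable_fun.
    rewrite (_ : (fun a => _) = fun a => g (row3 (0, b, t) + a *: delta_mx 0 0)) //.
    by apply/funext => a; have [<-] := row3_coord a b t.
  rewrite (_ : (fun b => _) = fun b => g (row3 (a, 0, t) + b *: delta_mx 0 1)) //.
  by apply/funext => b; have [_ <-] := row3_coord a b t.
rewrite (_ : (fun c => _) = fun c => g (row3 (w.1, w.2, 0) + c *: delta_mx 0 2)) //.
by apply/funext => c; have [_ _ <-] := row3_coord w.1 w.2 c.
Qed.

Lemma cmeas_row3 (g : pt -> R[i]) : ccont g -> cmeas (setT : set R3) (g \o @row3 R).
Proof. by move=> [g1 g2]; split; [exact: (measurable_row3 g1)|exact: (measurable_row3 g2)]. Qed.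

(** The Cauchy density without its normalisation. It and its tensor product [bump3] are the
    universal integrable majorants of the whole development; the inverse of [bump3] is moreover a
    polynomial, the Fourier multiplier of a differential operator. *)
Definition bump1 (t : R) : R := (1 + t ^+ 2)^-1.
Definition bump3 (x : pt) : R := \prod_(k < 3) bump1 (x 0 k).

Lemma bump1_gt0 t : 0 < bump1 t.
Proof. by rewrite invr_gt0 ltr_pwDl// sqr_ge0. Qed.

Lemma bump3_gt0 x : 0 < bump3 x.
Proof. by apply: prodr_gt0 => k _; exact: bump1_gt0. Qed.

Lemma integral_bump1 : (\int[mu1]_x (bump1 x)%:E = pi%:E)%E.
Proof.
rewrite ge0_symfun_integralT.
- rewrite (_ : [set x | 0 <= x] = `[0, +oo[%classic); last first.
    by apply/seteqP; split=> x /=; rewrite in_itv/= andbT.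
  rewrite (_ : (fun x => (bump1 x)%:E) = (fun x => (trigo.oneDsqr x)^-1%:E))//.
  rewrite integral0y_oneDsqr -EFinM; congr EFin.
  by rewrite mulrC divfK.
- by move=> x; rewrite ltW// bump1_gt0.
- exact: continuous_oneDsqrV.
- by move=> x; rewrite /bump1/= sqrrN.
Qed.

Lemma continuous_bump1 : continuous bump1.
Proof. exact: continuous_oneDsqrV. Qed.

Lemma integrable_bump1 : mu1.-integrable setT (fun x => (bump1 x)%:E).
Proof.
apply/integrableP; split.
  by apply/measurable_EFinP; exact: continuous_measurable_fun continuous_bump1.
under eq_integral => x _ do rewrite /= ger0_norm ?ltW ?bump1_gt0//.
by rewrite integral_bump1 ltry.
Qed.

Lemma integrable_bump3 : mu3.-integrable setT (EFin \o (bump3 \o @row3 R)).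
Proof.
have h := @integrable_prod _ _ _ _ R (@lebesgue2 R) mu1 (fun z => bump1 z.1 * bump1 z.2) _
  (integrable_prod integrable_bump1 integrable_bump1) integrable_bump1.
rewrite (_ : EFin \o _ = fun z : R3 => (bump1 z.1.1 * bump1 z.1.2 * bump1 z.2)%:E)//.
apply/funext => -[[a b] c] /=; rewrite /bump3 !big_ord_recl big_ord0 mulr1 mulrA.
by rewrite !mxE.
Qed.

(** The 2 is the one of [nc_cintegral], absorbed here once and for all. *)
Definition mass3 : R := 2 * \int[mu3]_u bump3 (row3 u).

Lemma mass3_ge0 : 0 <= mass3.
Proof. by rewrite mulr_ge0//; apply: Rintegral_ge0 => u _; rewrite ltW// bump3_gt0. Qed.

(** The class in which integrals are manipulated: continuity gives measurability and the majorant
    gives integrability, and both survive the operations used below. *)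
Definition tame (g : pt -> R[i]) := ccont g /\ exists C, forall x, nc (g x) <= C * bump3 x.

Lemma integrable_bump3Z (C : R) : mu3.-integrable setT (fun u => (C * bump3 (row3 u))%:E).
Proof. exact: (integrableZl measurableT C integrable_bump3). Qed.

Lemma tame_cintegrable g : tame g -> cintegrable mu3 setT (g \o @row3 R).
Proof.
move=> [cg [C gC]]; apply: (cintegrable_le measurableT (cmeas_row3 cg) (integrable_bump3Z C)).
by move=> u _; exact: gC.
Qed.

Lemma eq_integral3 (g h : pt -> R[i]) : g =1 h -> integral3 g = integral3 h.
Proof. by move=> gh; congr integral3; apply/funext. Qed.

Lemma integral3D g h : tame g -> tame h ->
  integral3 (fun x => g x + h x) = integral3 g + integral3 h.
Proof.
by move=> /tame_cintegrable ig /tame_cintegrable ih; exact: (cintegralD measurableT ig ih).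
Qed.

Lemma integral3Z c g : tame g -> integral3 (fun x => c * g x) = c * integral3 g.
Proof. by move=> /tame_cintegrable ig; exact: (cintegralZ measurableT c ig). Qed.

Lemma nc_integral3 g C : ccont g -> (forall x, nc (g x) <= C * bump3 x) ->
  nc (integral3 g) <= C * mass3.
Proof.
move=> cg gC.
have := nc_cintegral measurableT (cmeas_row3 cg) (integrable_bump3Z C) (fun u _ => gC (row3 u)).
rewrite RintegralZl//; last exact: integrable_bump3.
by rewrite mulrCA.
Qed.

Lemma integral3_dominated (g_ : nat -> pt -> R[i]) (g : pt -> R[i]) (C : R) :
  (forall n, ccont (g_ n)) -> ccont g -> (forall x, ccvg \oo (g_ ^~ x) (g x)) ->
  (forall n x, nc (g_ n x) <= C * bump3 x) ->
  ccvg \oo (fun n => integral3 (g_ n)) (integral3 g).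
Proof.
move=> cg_ cg gg gC; apply: (cintegral_dominated measurableT _ _ _ (integrable_bump3Z C)).
- by move=> n; exact: cmeas_row3.
- exact: cmeas_row3.
- by move=> u _; exact: gg.
- by move=> n u _; exact: gC.
Qed.

Lemma integral3_shift g (v : pt) : tame g -> integral3 (fun x => g (x + v)) = integral3 g.
Proof.
move=> /tame_cintegrable ig.
pose phi (u : R3) : R3 := (u.1.1 + v 0 0, u.1.2 + v 0 1, u.2 + v 0 2).
have p : measure_preserving mu3 phi.
  have h := @measure_preserving_prod _ _ _ _ R (@lebesgue2 R) mu1 _ _ (measure_preserving_prod
     (measure_preserving_shift (v 0 0)) (measure_preserving_shift (v 0 1)))
     (measure_preserving_shift (v 0 2)).
  exact: h.
have [_ e] := cintegral_preserving p ig; apply: etrans e.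
congr cintegral; apply/funext => -[[a b] c]; rewrite /= /phi /=.
by rewrite row3D row3K.
Qed.

Lemma integral3_prod (g0 g1 g2 : R -> R[i]) :
  cintegrable mu1 setT g0 -> cintegrable mu1 setT g1 -> cintegrable mu1 setT g2 ->
  integral3 (fun x => g0 (x 0 0) * g1 (x 0 1) * g2 (x 0 2)) =
  cintegral mu1 setT g0 * cintegral mu1 setT g1 * cintegral mu1 setT g2.
Proof.
move=> i0 i1 i2; have [j e] := cintegral_prod i0 i1; have [_ e'] := @cintegral_prod _ _ _ _ R (@lebesgue2 R) mu1 _ _ j i2.
rewrite -e -e'; congr cintegral; apply/funext => -[[a b] c] /=.
by rewrite !mxE.
Qed.

End RealSpace3.

(** * Smooth cutoffs on the line *)

Section OneVariable.
Variable R : realType.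
Implicit Types f g : R -> R.

(** Class C^N by an explicit chain of derivatives, which turns the closure properties into plain
    inductions on N. *)
Fixpoint diffn (N : nat) f : Prop :=
  match N with
  | 0 => continuous f
  | N'.+1 => exists g, (forall t : R, is_derive t 1 f (g t)) /\ diffn N' g
  end.

Lemma is_derive_continuous f (x l : R) : is_derive x 1 f l -> {for x, continuous f}.
Proof.
by move=> fl; apply: differentiable_continuous; apply/derivable1_diffP; apply: ex_derive.
Qed.

Lemma diffn_continuous N f : diffn N f -> continuous f.
Proof. by case: N => [//|N] [g [fg _]] t; exact: is_derive_continuous (fg t). Qed.

Lemma diffnW N f : diffn N.+1 f -> diffn N f.
Proof.
elim: N f => [f|N IH f]; first exact: diffn_continuous.
by move=> [g [fg /IH hg]]; exists g.
Qed.

Lemma diffnD N f g : diffn N f -> diffn N g -> diffn N (fun t => f t + g t).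
Proof.
elim: N f g => [f g cf cg|N IH f g [f' [ff hf]] [g' [gg hg]]].
  by move=> x; apply: cvgD; [exact: cf|exact: cg].
exists (fun t => f' t + g' t); split; last exact: IH.
by move=> t; exact: is_deriveD.
Qed.

Lemma diffn_cst N (c : R) : diffn N (fun=> c).
Proof.
elim: N c => [c x|N IH c]; first exact: cvg_cst.
by exists (fun=> 0); split=> // t; exact: is_derive_cst.
Qed.

Lemma diffnM N f g : diffn N f -> diffn N g -> diffn N (fun t => f t * g t).
Proof.
elim: N f g => [f g cf cg|N IH f g hf hg].
  by move=> x; apply: cvgM; [exact: cf|exact: cg].
have [f' [ff hf']] := hf; have [g' [gg hg']] := hg.
exists (fun t => f t * g' t + g t * f' t); split.
  by move=> t; exact: is_deriveM.
by apply: diffnD; apply: IH => //; exact: diffnW.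
Qed.

Lemma diffnZ N (c : R) f : diffn N f -> diffn N (fun t => c * f t).
Proof. by move=> hf; apply: diffnM => //; exact: diffn_cst. Qed.

Lemma is_derive_affine (a b t : R) : is_derive t 1 (fun t : R => a * t + b) a.
Proof.
have h : is_derive t 1 (fun t : R => a * t) a.
  have := @is_deriveZ R R R (id : R -> R) a t 1 1.
  by rewrite /GRing.scale /= mulr1; apply.
have := @is_deriveD R R R (fun t : R => a * t) (fun=> b) t 1 a 0 h (is_derive_cst _ _ _).
by rewrite addr0.
Qed.

Lemma is_derive_comp_affine f (a b l t : R) : is_derive (a * t + b) 1 f l ->
  is_derive t 1 (fun t => f (a * t + b)) (l * a).
Proof. by move=> fl; apply: (@is_derive1_comp R f (fun t => a * t + b) t l a) => //; exact: is_derive_affine. Qed.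

Lemma diffn_affine N f (a b : R) : diffn N f -> diffn N (fun t => f (a * t + b)).
Proof.
elim: N f => [f cf|N IH f [g [fg hg]]].
  move=> t; apply: (@continuous_comp _ _ _ (fun t => a * t + b) f t); last exact: cf.
  exact: is_derive_continuous (is_derive_affine a b t).
exists (fun t => a * g (a * t + b)); split; last by apply: diffnZ; exact: IH.
by move=> t; rewrite mulrC; exact: is_derive_comp_affine.
Qed.

                                                                         
(** The functions t^-i exp(-1/t) on the positive half-line, extended by 0. The derivative of each is
    a linear combination of two others, so the whole family is shown smooth by one induction. *)
Definition flat (i : nat) (t : R) : R := if 0 < t then t^-1 ^+ i * expR (- t^-1) else 0.

(** exp(u) is the i-th power of exp(u/i), and exp(u/i) is at least 1 + u/i, hence at least u/i. *)
Lemma expX_bound (i : nat) (u : R) : 0 < u -> u ^+ i * expR (- u) <= i%:R ^+ i.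
Proof.
move=> u0; rewrite expRN ler_pdivrMr ?expR_gt0//.
case: i => [|i]; first by rewrite !expr0 mul1r -expR0 ler_expR ltW.
have -> : expR u = expR (u / i.+1%:R) ^+ i.+1 by rewrite -expRM_natr divfK.
rewrite -exprMn lerXn2r ?nnegrE ?mulr_ge0 ?expR_ge0//; first exact: ltW.
rewrite mulrC -ler_pdivrMr ?ltr0n//; apply: le_trans (expR_ge1Dx _).
by rewrite ler_wpDl.
Qed.

Lemma flat_bound i t : `|flat i t| <= (i.+2%:R ^+ i.+2) * t ^+ 2.
Proof.
rewrite /flat; case: ifPn => [t0|_]; last first.
  by rewrite normr0; apply: mulr_ge0; [exact: exprn_ge0|exact: sqr_ge0].
rewrite ger0_norm; last by rewrite mulr_ge0// ?expR_ge0// exprn_ge0// invr_ge0 ltW.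
rewrite -ler_pdivrMr ?exprn_gt0//.
have := @expX_bound i.+2 t^-1; rewrite invr_gt0 => /(_ t0); apply: le_trans.
by rewrite mulrAC -exprVn -exprD addn2.
Qed.

(** The only delicate point for [flat] is the origin, where a quadratic bound forces both the value
    and the derivative to be 0. *)
Lemma is_derive_sqr_bound f (C : R) : (forall t, `|f t| <= C * t ^+ 2) -> is_derive (0 : R) 1 f 0.
Proof.
move=> fC.
have f0 : f 0 = 0 by apply/eqP; rewrite -normr_le0 (le_trans (fC 0))// expr0n mulr0.
apply/is_derive1_caratheodory; exists (fun z => f z / z); split.
- move=> z; rewrite f0 !subr0; have [->|z0] := eqVneq z 0; first by rewrite mulr0.
  by rewrite divfK.
- change (f z / z @[z --> (0 : R)] --> f 0 / 0); rewrite f0 mul0r; apply/norm_cvg0P.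
  apply: (@squeeze_cvgr _ _ _ _ (cst 0) (fun z => C * `|z|)).
  + apply: nearW => z; rewrite normr_ge0/= normrM normfV.
    have [->|z0] := eqVneq z 0; first by rewrite !normr0 invr0 !mulr0.
    rewrite ler_pdivrMr ?normr_gt0// -mulrA -expr2 real_normK ?num_real//.
  + exact: cvg_cst.
  + have h := @norm_continuous R R (0 : R); rewrite /continuous_at normr0 in h.
    by rewrite -[X in _ --> X](mulr0 C); apply: cvgMl_tmp.
- by rewrite f0 mul0r.
Qed.

Lemma is_derive_near f g (x l : R) : (\near x, f x = g x) -> is_derive x 1 f l -> is_derive x 1 g l.
Proof.
move=> fg [df dl]; apply: DeriveDef; last by rewrite -(near_eq_derive (1 : R) fg).
exact: (near_eq_derivable fg df).
Qed.

Lemma is_derive_flat i (t : R) : is_derive t 1 (flat i) (- i%:R * flat i.+1 t + flat i.+2 t).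
Proof.
have [t0|t0|->] := ltgtP t 0.
- have -> : - i%:R * flat i.+1 t + flat i.+2 t = 0.
    by rewrite /flat ltNge ltW//= mulr0 addr0.
  apply: (@is_derive_near (fun=> 0) _ _ _ _ (is_derive_cst _ _ _)).
  near=> z; rewrite /flat ifF//; apply/negbTE; rewrite -leNgt ltW//.
  by near: z; first [exact: lt_nbhsl|exact: gt_nbhsr].
- have t0' : t != 0 by rewrite gt_eqF.
  apply: (@is_derive_near (fun t => t^-1 ^+ i * expR (- t^-1))).
    near=> z; rewrite /flat ifT//.
    by near: z; first [exact: lt_nbhsr|exact: gt_nbhsl].
  have h1 : is_derive t 1 (fun z : R => z^-1) (- t ^- 2).
    have := @is_deriveV R (id : R -> R) t 1 1 t0'.
    by rewrite /GRing.scale /= mulr1; apply.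
  have h2 : is_derive t 1 (fun z : R => expR (- z^-1)) (expR (- t^-1) * t ^- 2).
    have h := is_deriveN h1; rewrite opprK in h.
    exact: (is_derive1_comp (is_derive_expR _) h).
  have h3 : is_derive t 1 (fun z : R => z^-1 ^+ i) (i%:R * t^-1 ^+ i.-1 * - t ^- 2).
    have := is_deriveX i h1; rewrite (_ : _ ^+ i = fun z : R => z^-1 ^+ i)//.
    by apply/funext => z; rewrite fctE.
  apply: (is_derive_eq (is_deriveM h3 h2)).
  rewrite /flat t0 /GRing.scale /=.
  case: i {h3} => [|i] /=; rewrite ?expr0 ?mul0r ?mulr0 ?oppr0 ?addr0 ?mul0r ?add0r.
    by rewrite -!exprVn; ring.
  by rewrite -!exprVn !exprS; ring.
- have -> : - i%:R * flat i.+1 0 + flat i.+2 0 = 0.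
    by rewrite /flat ltxx mulr0 addr0.
  exact: is_derive_sqr_bound (flat_bound i).
Unshelve. all: by end_near. Qed.

Lemma diffn_flat N i : diffn N (flat i).
Proof.
elim: N i => [|N IH] i.
  by move=> t; exact: is_derive_continuous (is_derive_flat i t).
exists (fun t => - i%:R * flat i.+1 t + flat i.+2 t); split; first exact: is_derive_flat.
by apply: diffnD => //; apply: diffnZ.
Qed.

Definition hump (t : R) : R := flat 0 t * flat 0 (- 1 * t + 1).

Lemma diffn_hump N : diffn N hump.
Proof. by apply: diffnM; [exact: diffn_flat|apply: diffn_affine; exact: diffn_flat]. Qed.

Lemma flat0_ge0 t : 0 <= flat 0 t.
Proof. by rewrite /flat; case: ifP => // _; rewrite expr0 mul1r expR_ge0. Qed.

Lemma flat0_le1 t : flat 0 t <= 1.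
Proof.
rewrite /flat; case: ifP => // t0; rewrite expr0 mul1r -expR0 ler_expR.
by rewrite oppr_le0 invr_ge0 ltW.
Qed.

Lemma hump_ge0 t : 0 <= hump t. Proof. by rewrite mulr_ge0 ?flat0_ge0. Qed.

Lemma hump_out t : ~~ (0 < t < 1) -> hump t = 0.
Proof.
rewrite /hump /flat negb_and -!leNgt => /orP[t0|t1].
  by rewrite ltNge t0 mul0r.
by rewrite [X in _ * (if X then _ else _)](_ : _ = false) ?mulr0//; apply/negbTE; rewrite -leNgt; lra.
Qed.

Local Notation mu := (@lebesgue_measure R).

Lemma hump_le t : hump t <= 2 * bump1 t.
Proof.
have [/andP[t0 t1]|/hump_out->] := boolP (0 < t < 1); last first.
  by rewrite mulr_ge0// ltW// bump1_gt0.
apply: (@le_trans _ _ 1).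
  by rewrite /hump -[leRHS]mulr1 ler_pM ?flat0_ge0 ?flat0_le1.
rewrite /bump1 ler_pdivlMr; first by nra.
by rewrite ltr_pwDl// sqr_ge0.
Qed.

Lemma integrable_hump : mu.-integrable setT (fun t => (hump t)%:E).
Proof.
have := integrableZl measurableT 2 (@integrable_bump1 R).
apply: le_integrable => //.
  by apply/measurable_EFinP; apply: continuous_measurable_fun; exact: (@diffn_continuous 0 _ (diffn_hump 0)).
move=> t _ /=; rewrite lee_fin ger0_norm ?hump_ge0//.
exact: le_trans (hump_le t) (ler_norm _).
Qed.

Definition hump_mass : R := \int[mu]_t hump t.

(** On [1/4, 3/4] both factors of [hump] are at least [flat 0 (1/4)], since [flat 0] increases. *)
Lemma hump_mass_gt0 : 0 < hump_mass.
Proof.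
have h0 : 0 < flat 0 (4^-1 : R) ^+ 2.
  by rewrite exprn_gt0// /flat ifT ?invr_gt0// expr0 mul1r expR_gt0.
have fle (s t : R) : 0 < s -> s <= t -> flat 0 s <= flat 0 t.
  move=> s0 st; have t0 := lt_le_trans s0 st; rewrite /flat s0 t0 !expr0 !mul1r ler_expR.
  by rewrite lerN2 lef_pV2.
apply: (@lt_le_trans _ _ (\int[mu]_(t in `[4^-1, 3 / 4]) flat 0 (4^-1 : R) ^+ 2)).
  rewrite Rintegral_cst//= lebesgue_measure_itv/= lte_fin ifT; last by lra.
  by rewrite -EFinB/= mulr_gt0//; lra.
rewrite /hump_mass [leRHS](_ : _ = fine (\int[mu]_t (hump t)%:E))//.
apply: (@le_trans _ _ (\int[mu]_(t in `[4^-1, 3 / 4]) hump t)).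
  apply: le_Rintegral => //.
  - apply: continuous_compact_integrable; first exact: segment_compact.
    by apply: continuous_subspaceT => x; exact: cvg_cst.
  - exact: (integrableS measurableT _ _ integrable_hump).
  - move=> t; rewrite /= in_itv/= => /andP[t1 t2].
    by rewrite /hump expr2 ler_pM ?flat0_ge0 ?fle//; rewrite ?invr_gt0//; lra.
apply: fine_le.
- by apply: integrable_fin_num => //; exact: (integrableS measurableT _ _ integrable_hump).
- by apply: integrable_fin_num => //; exact: integrable_hump.
- apply: ge0_subset_integral => //; last by move=> t _; rewrite lee_fin hump_ge0.
  exact: (measurable_int mu integrable_hump).
Qed.

Definition step (t : R) : R := hump_mass^-1 * \int[mu]_(s in `]-oo, t]) hump s.

Lemma diffn_step N : diffn N step.
Proof.
have ch : continuous hump := @diffn_continuous 0 _ (diffn_hump 0).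
have d : diffn N.+1 step.
  exists (fun t => hump_mass^-1 * hump t); split; last by apply: diffnZ; exact: diffn_hump.
  move=> t; have [|||dF F'] := @continuous_FTC1 R hump -oo%O t (t + 1) _ _ _ (ch t).
  - by rewrite ltrDl.
  - exact: (integrableS measurableT _ _ integrable_hump).
  - by rewrite ltNyr.
  have dF' : is_derive t 1 (fun x : R => \int[mu]_(s in `]-oo, x]) hump s) (hump t).
    by apply: DeriveDef; [exact: dF|rewrite -derive1E].
  exact: (is_deriveZ hump_mass^-1 dF').
exact: diffnW.
Qed.

Lemma step_le0 t : t <= 0 -> step t = 0.
Proof.
move=> t0; rewrite /step (@eq_Rintegral _ _ _ _ _ (fun=> 0)); last first.
  move=> s; rewrite inE/= in_itv/= => st; rewrite hump_out//.
  by rewrite negb_and -!leNgt (le_trans st t0).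
by rewrite Rintegral_cst// mul0r mulr0.
Qed.

Lemma step_ge1 t : 1 <= t -> step t = 1.
Proof.
move=> t1; transitivity (hump_mass^-1 * hump_mass); last first.
  by rewrite mulVf// gt_eqF// hump_mass_gt0.
rewrite /step Rintegral_mkcond; congr (_ * _); apply: eq_Rintegral.
move=> s _; rewrite patchE; case: ifPn => //.
rewrite notin_setE/= in_itv/= => /negP; rewrite -ltNge => ts.
by rewrite hump_out// negb_and -!leNgt (le_trans t1 (ltW ts)) orbT.
Qed.

(** A rising and a falling copy of the normalised primitive [step]: the product is 1 on [-1, 1] and
    0 outside [-2, 2]. *)
Definition plateau (t : R) : R := step (1 * t + 2) * step (- 1 * t + 2).

Lemma diffn_plateau N : diffn N plateau.
Proof. by apply: diffnM; apply: diffn_affine; exact: diffn_step. Qed.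

Lemma plateau1 t : `|t| <= 1 -> plateau t = 1.
Proof.
by rewrite ler_norml => /andP[t1 t2]; rewrite /plateau !step_ge1 ?mulr1//; lra.
Qed.

Lemma plateau0 t : 2 <= `|t| -> plateau t = 0.
Proof.
rewrite ler_normr /plateau => /orP[t2|t2].
  by rewrite [X in _ * X]step_le0 ?mulr0//; lra.
by rewrite step_le0 ?mul0r//; lra.
Qed.

End OneVariable.

(** * Partial derivatives, smooth functions and test functions *)

Section PartialDerivatives.
Variables (R : realType) (n : nat).
Local Notation pt := 'rV[R]_n.
Local Notation C := R[i].
Implicit Types (g h : pt -> C) (x : pt) (k : 'I_n).
Local Notation e_ k := (delta_mx 0 k : pt).

Definition is_cpartial k g x (l : C) :=
  is_derive x (e_ k) (fun y => cRe (g y)) (cRe l) /\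
  is_derive x (e_ k) (fun y => cIm (g y)) (cIm l).

Definition cdiff g := forall k x,
  derivable (fun y => cRe (g y)) x (e_ k) /\ derivable (fun y => cIm (g y)) x (e_ k).

Lemma is_cpartialE k g x l : is_cpartial k g x l -> cpartial k g x = l.
Proof.
by move=> [[_ h1] [_ h2]]; apply: complex_eqP; rewrite /cpartial /=; [exact: h1|exact: h2].
Qed.

Lemma cdiff_is_cpartial g : cdiff g -> forall k x, is_cpartial k g x (cpartial k g x).
Proof. by move=> dg k x; have [h1 h2] := dg k x; split; apply: DeriveDef. Qed.

Lemma is_cpartial_cdiff g (dg : 'I_n -> pt -> C) :
  (forall k x, is_cpartial k g x (dg k x)) -> cdiff g /\ forall k, cpartial k g = dg k.
Proof.
move=> H; split; first by move=> k x; have [[h1 _] [h2 _]] := H k x.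
by move=> k; apply/funext => x; exact: is_cpartialE.
Qed.

Lemma is_cpartialD k g h x l l' : is_cpartial k g x l -> is_cpartial k h x l' ->
  is_cpartial k (fun y => g y + h y) x (l + l').
Proof.
move=> [g1 g2] [h1 h2]; split; rewrite cE.
  rewrite (_ : (fun y => _) = (fun y => cRe (g y)) + (fun y => cRe (h y))); first exact: is_deriveD.
  by apply/funext => y; rewrite cE.
rewrite (_ : (fun y => _) = (fun y => cIm (g y)) + (fun y => cIm (h y))); first exact: is_deriveD.
by apply/funext => y; rewrite cE.
Qed.

Lemma is_cpartialM k g h x l l' : is_cpartial k g x l -> is_cpartial k h x l' ->
  is_cpartial k (fun y => g y * h y) x (l * h x + g x * l').
Proof.
move=> [g1 g2] [h1 h2]; split; rewrite !cE.
  rewrite (_ : (fun y => _) = (fun y => cRe (g y)) * (fun y => cRe (h y)) -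
     (fun y => cIm (g y)) * (fun y => cIm (h y))); last by apply/funext => y; rewrite cE.
  apply: (is_derive_eq (is_deriveB (is_deriveM g1 h1) (is_deriveM g2 h2))).
  by rewrite /GRing.scale /=; ring.
rewrite (_ : (fun y => _) = (fun y => cRe (g y)) * (fun y => cIm (h y)) +
     (fun y => cIm (g y)) * (fun y => cRe (h y))); last by apply/funext => y; rewrite cE.
apply: (is_derive_eq (is_deriveD (is_deriveM g1 h2) (is_deriveM g2 h1))).
by rewrite /GRing.scale /=; ring.
Qed.

Lemma is_cpartial_cst k (c : C) x : is_cpartial k (fun=> c) x 0.
Proof. by split; exact: is_derive_cst. Qed.

Lemma is_derive_line (f : pt -> R) x v (l t : R) :
  is_derive (x + t *: v) v f l <-> is_derive t 1 (fun t : R => f (x + t *: v)) l.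
Proof.
have E : (fun h : R => h^-1 *: ((f \o shift (x + t *: v)) (h *: v) - f (x + t *: v))) =
   (fun h : R => h^-1 *: (((fun t : R => f (x + t *: v)) \o shift t) (h *: 1) - f (x + t *: v))).
  by apply/funext => h /=; congr (_ *: (f _ - _)); rewrite [h *: 1]mulr1 scalerDl; rewrite addrCA addrA addrC.
split=> -[d <-]; apply: DeriveDef; rewrite /derivable /derive.
- by rewrite -E; exact: d.
- by rewrite -E.
- by rewrite E; exact: d.
- by rewrite E.
Qed.

Lemma is_derive_line0 (f : pt -> R) x v (l : R) :
  is_derive x v f l <-> is_derive (0 : R) 1 (fun t : R => f (x + t *: v)) l.
Proof. by rewrite -is_derive_line scale0r addr0. Qed.

Fixpoint cdiffn (N : nat) g : Prop :=
  ccont g /\ match N with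
  | 0 => True
  | N'.+1 => exists dg, (forall k x, is_cpartial k g x (dg k x)) /\ forall k, cdiffn N' (dg k)
  end.

Lemma cdiffn_cont N g : cdiffn N g -> ccont g. Proof. by case: N => [|N] []. Qed.

Lemma smooth0 g : smooth g -> ccont g.
Proof. by move=> /(_ [::]) [h1 h2 _ _]; split. Qed.

Lemma smooth_cdiff g : smooth g -> cdiff g.
Proof. by move=> /(_ [::]) [_ _ h1 h2] k x; split; [exact: h1|exact: h2]. Qed.

Lemma cpartials_cons k s g : cpartials (k :: s) g = cpartial k (cpartials s g).
Proof. by []. Qed.

Lemma cpartials_rcons s k g : cpartials (rcons s k) g = cpartials s (cpartial k g).
Proof. by rewrite /cpartials foldr_rcons. Qed.

Lemma smooth_cpartial g k : smooth g -> smooth (cpartial k g).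
Proof. by move=> sg s; rewrite -cpartials_rcons; exact: sg. Qed.

Lemma smooth_cpartials g s : smooth g -> smooth (cpartials s g).
Proof.
by move=> sg; elim: s => [|k s IH]; [exact: sg|exact: (smooth_cpartial k IH)].
Qed.

(** [smooth] speaks of iterated derivatives along lists, [cdiffn] of derivatives that are again
    differentiable. Peeling the list from its last element, the derivative taken first, reconciles
    the two; closure properties are then proved on the [cdiffn] side. *)
Lemma smoothP g : smooth g <-> forall N, cdiffn N g.
Proof.
split=> [sg N|].
  elim: N g sg => [|N IH] g sg; split=> //; try exact: smooth0.
  exists (fun k => cpartial k g); split; last by move=> k; apply: IH; exact: smooth_cpartial.
  exact: cdiff_is_cpartial (smooth_cdiff sg).
move=> dg s; elim/last_ind: s g dg => [|s k IH] g dg.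
  have [[c1 c2] [d [dP _]]] := dg 1; have [cd _] := is_cpartial_cdiff dP.
  by split=> // x k; have [] := cd k x.
rewrite cpartials_rcons; apply: IH => N.
have [_ [d [dP dN]]] := dg N.+1; have [_ ->] := is_cpartial_cdiff dP; exact: dN.
Qed.

Lemma cdiffnW N g : cdiffn N.+1 g -> cdiffn N g.
Proof.
elim: N g => [|N IH] g [cg [dg [dP dN]]]; split=> //.
by exists dg; split=> // k; exact: IH.
Qed.

Lemma ccontD (V : topologicalType) (g h : V -> C) : ccont g -> ccont h -> ccont (fun y => g y + h y).
Proof.
move=> [g1 g2] [h1 h2]; split=> y.
  by under eq_fun do rewrite cE; apply: cvgD; [exact: g1|exact: h1].
by under eq_fun do rewrite cE; apply: cvgD; [exact: g2|exact: h2].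
Qed.

Lemma ccontM (V : topologicalType) (g h : V -> C) : ccont g -> ccont h -> ccont (fun y => g y * h y).
Proof.
move=> [g1 g2] [h1 h2]; split=> y; under eq_fun do rewrite cE.
  by apply: cvgB; apply: cvgM; [exact: g1|exact: h1|exact: g2|exact: h2].
by apply: cvgD; apply: cvgM; [exact: g1|exact: h2|exact: g2|exact: h1].
Qed.

Lemma ccont_cst (V : topologicalType) (c : C) : ccont (fun _ : V => c).
Proof. by split=> x; exact: cvg_cst. Qed.

Lemma ccontJ (V : topologicalType) (g : V -> C) : ccont g -> ccont (fun y => (g y)^*).
Proof.
move=> [g1 g2]; split=> y; under eq_fun do rewrite cE; first exact: g1.
by apply: cvgN; exact: g2.
Qed.

Lemma cdiffnD N g h : cdiffn N g -> cdiffn N h -> cdiffn N (fun x => g x + h x).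
Proof.
elim: N g h => [|N IH] g h [cg dg] [ch dh]; split=> //; try by apply: ccontD.
have [g' [gP gN]] := dg; have [h' [hP hN]] := dh.
exists (fun k x => g' k x + h' k x); split=> [k x|k]; first exact: is_cpartialD.
by apply: IH; [exact: gN|exact: hN].
Qed.

Lemma cdiffnM N g h : cdiffn N g -> cdiffn N h -> cdiffn N (fun x => g x * h x).
Proof.
elim: N g h => [|N IH] g h hg hh.
  by split=> //; apply: ccontM; [case: hg|case: hh].
have [cg [g' [gP gN]]] := hg; have [ch [h' [hP hN]]] := hh.
split; first exact: ccontM.
exists (fun k x => g' k x * h x + g x * h' k x); split=> [k x|k]; first exact: is_cpartialM.
by apply: cdiffnD; apply: IH;
  [exact: gN|exact: cdiffnW hh|exact: cdiffnW hg|exact: hN].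
Qed.

Lemma cdiffn_cst N (c : C) : cdiffn N (fun=> c).
Proof.
elim: N c => [|N IH] c; split=> //; try exact: ccont_cst.
by exists (fun _ _ => 0); split=> [k x|k]; [exact: is_cpartial_cst|exact: IH].
Qed.

Lemma smoothD g h : smooth g -> smooth h -> smooth (fun x => g x + h x).
Proof. by move=> /smoothP sg /smoothP sh; apply/smoothP => N; exact: cdiffnD. Qed.
Lemma smoothM g h : smooth g -> smooth h -> smooth (fun x => g x * h x).
Proof. by move=> /smoothP sg /smoothP sh; apply/smoothP => N; exact: cdiffnM. Qed.
Lemma smooth_cst (c : C) : smooth (fun _ : pt => c).
Proof. by apply/smoothP => N; exact: cdiffn_cst. Qed.
Lemma smoothZ (c : C) g : smooth g -> smooth (fun x => c * g x).
Proof. by move=> sg; apply: smoothM => //; exact: smooth_cst. Qed.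
Lemma smooth_sum (I : Type) (r : seq I) (F : I -> pt -> C) :
  (forall i, smooth (F i)) -> smooth (fun x => \sum_(i <- r) F i x).
Proof.
move=> sF; elim: r => [|i r IH].
  by under eq_fun do rewrite big_nil; exact: smooth_cst.
by under eq_fun do rewrite big_cons; exact: smoothD.
Qed.
Lemma smooth_prod (I : Type) (r : seq I) (F : I -> pt -> C) :
  (forall i, smooth (F i)) -> smooth (fun x => \prod_(i <- r) F i x).
Proof.
move=> sF; elim: r => [|i r IH].
  by under eq_fun do rewrite big_nil; exact: smooth_cst.
by under eq_fun do rewrite big_cons; exact: smoothM.
Qed.

Lemma cpartialD k g h : smooth g -> smooth h ->
  cpartial k (fun x => g x + h x) = fun x => cpartial k g x + cpartial k h x.
Proof.
move=> /smooth_cdiff sg /smooth_cdiff sh; apply/funext => x; apply: is_cpartialE.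
by apply: is_cpartialD; exact: cdiff_is_cpartial.
Qed.

Lemma cpartialM k g h : smooth g -> smooth h ->
  cpartial k (fun x => g x * h x) = fun x => cpartial k g x * h x + g x * cpartial k h x.
Proof.
move=> /smooth_cdiff sg /smooth_cdiff sh; apply/funext => x; apply: is_cpartialE.
by apply: is_cpartialM; exact: cdiff_is_cpartial.
Qed.

Lemma cpartialZ k c g : smooth g -> cpartial k (fun x => c * g x) = fun x => c * cpartial k g x.
Proof.
move=> sg; rewrite cpartialM//; last exact: smooth_cst.
apply/funext => x; rewrite (is_cpartialE (is_cpartial_cst k c x)).
by rewrite mul0r add0r.
Qed.

Lemma cpartial_cst k c : cpartial k (fun _ : pt => c) = fun=> 0.
Proof. by apply/funext => x; exact: is_cpartialE (is_cpartial_cst k c x). Qed.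

Lemma cpartialsZ s c g : smooth g -> cpartials s (fun x => c * g x) = fun x => c * cpartials s g x.
Proof.
move=> sg; elim: s => [|k s IH]; first by [].
by rewrite cpartials_cons IH cpartialZ; last exact: smooth_cpartials.
Qed.

Lemma cpartialsD s g h : smooth g -> smooth h ->
  cpartials s (fun x => g x + h x) = fun x => cpartials s g x + cpartials s h x.
Proof.
move=> sg sh; elim: s => [|k s IH]; first by [].
by rewrite cpartials_cons IH cpartialD; [|exact: smooth_cpartials|exact: smooth_cpartials].
Qed.

Lemma dotDl (x y z : pt) : dot (x + y) z = dot x z + dot y z.
Proof. by rewrite /dot -big_split; apply: eq_bigr => i _; rewrite !mxE mulrDl. Qed.
Lemma dotZl (a : R) (x z : pt) : dot (a *: x) z = a * dot x z.
Proof. by rewrite /dot mulr_sumr; apply: eq_bigr => i _; rewrite !mxE mulrA. Qed.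
Lemma dotC (x z : pt) : dot x z = dot z x.
Proof. by apply: eq_bigr => i _; rewrite mulrC. Qed.
Lemma dotDr (x y z : pt) : dot z (x + y) = dot z x + dot z y.
Proof. by rewrite dotC dotDl !(dotC z). Qed.
Lemma dotZr (a : R) (x z : pt) : dot z (a *: x) = a * dot z x.
Proof. by rewrite dotC dotZl (dotC z). Qed.
Lemma dotNl (x z : pt) : dot (- x) z = - dot x z.
Proof. by rewrite -scaleN1r dotZl mulN1r. Qed.
Lemma dotNr (x z : pt) : dot x (- z) = - dot x z.
Proof. by rewrite dotC dotNl dotC. Qed.
Lemma dot_delta k (z : pt) : dot (e_ k) z = z 0 k.
Proof.
rewrite /dot (bigD1 k)//= mxE !eqxx mul1r big1 ?addr0// => i ik.
by rewrite mxE eqxx (negbTE ik) mul0r.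
Qed.
Lemma dot0r (x : pt) : dot x 0 = 0.
Proof. by rewrite /dot big1// => i _; rewrite mxE mulr0. Qed.

Lemma continuous_sum (V : topologicalType) (I : Type) (r : seq I) (F : I -> V -> R) :
  (forall i, continuous (F i)) -> continuous (fun z => \sum_(i <- r) F i z).
Proof.
move=> cF; elim: r => [|i r IH] z.
  by under eq_fun do rewrite big_nil; exact: cst_continuous.
under eq_fun do rewrite big_cons.
by apply: (@continuousD _ _ _ (F i) (fun z => \sum_(i <- r) F i z)); [exact: cF|exact: IH].
Qed.

Lemma continuous_dot (z : pt) : continuous (fun x : pt => dot x z).
Proof.
apply: continuous_sum => k y.
by apply: (@continuousM _ _ (fun x0 : pt => x0 0 k) (fun=> z 0 k));
  [exact: coord_continuous|exact: cst_continuous].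
Qed.

Lemma is_derive_dot (F : R -> R) (l b : R) k (x z : pt) :
  is_derive (dot x z + b) 1 F l ->
  is_derive x (e_ k) (fun y => F (dot y z + b)) (l * z 0 k).
Proof.
move=> Fl; apply/is_derive_line0.
rewrite (_ : (fun t => _) = fun t => F (z 0 k * t + (dot x z + b))).
  by apply: is_derive_comp_affine; rewrite mulr0 add0r.
by apply/funext => t; rewrite dotDl dotZl dot_delta; congr F; ring.
Qed.

Lemma is_derive_dot0 (F : R -> R) (l : R) k (x z : pt) :
  is_derive (dot x z) 1 F l ->
  is_derive x (e_ k) (fun y => F (dot y z)) (l * z 0 k).
Proof.
rewrite -[dot x z]addr0 => /is_derive_dot.
by rewrite (_ : (fun y => F (dot y z + 0)) = fun y => F (dot y z))//; apply/funext => y; rewrite addr0.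
Qed.

Lemma cdiffn_dot N (F : R -> R) (c : C) (b : R) (z : pt) : diffn N F ->
  cdiffn N (fun x => c * (F (dot x z + b))%:C).
Proof.
elim: N F c => [|N IH] F c dF.
  split=> //; apply: ccontM; first exact: ccont_cst.
  split=> x; last exact: cst_continuous.
  apply: (@continuous_comp _ _ _ (fun x => dot x z + b) F x); last exact: dF.
  by apply: continuousD; [exact: continuous_dot|exact: cst_continuous].
have [G [FG dG]] := dF; split.
  have := IH F c (diffnW dF); exact: cdiffn_cont.
exists (fun k x => c * (z 0 k)%:C * (G (dot x z + b))%:C); split=> [k x|k]; last exact: IH.
have := @is_cpartialM k (fun=> c) (fun x => (F (dot x z + b))%:C) x 0 (G (dot x z + b) * z 0 k)%:C
  (is_cpartial_cst k c x).
rewrite mul0r add0r [(_ * _)%:C]rmorphM /= mulrAC -mulrA mulrCA; apply.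
by split=> /=; [rewrite mulr0 subr0; exact: is_derive_dot|rewrite mulr0 mul0r addr0; exact: is_derive_cst].
Qed.

Lemma smooth_dot (F : R -> R) (b : R) (z : pt) : (forall N, diffn N F) ->
  smooth (fun x => (F (dot x z + b))%:C).
Proof.
move=> dF; apply/smoothP => N; have := @cdiffn_dot N F 1 b z (dF N).
by under [X in cdiffn _ X]eq_fun do rewrite mul1r.
Qed.

Lemma is_cpartial_expi k (z x : pt) :
  is_cpartial k (fun x => expi (dot x z)) x ('i * (z 0 k)%:C * expi (dot x z)).
Proof.
split; rewrite !cE /=.
  by apply: (is_derive_eq (is_derive_dot0 k (is_derive_cos _))); ring.
by apply: (is_derive_eq (is_derive_dot0 k (is_derive_sin _))); ring.
Qed.

Lemma ccont_expi (V : topologicalType) (F : V -> R) : continuous F -> ccont (fun y => expi (F y)).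
Proof.
move=> cF; split=> y.
  by apply: (@continuous_comp _ _ _ F cos y); [exact: cF|exact: continuous_cos].
by apply: (@continuous_comp _ _ _ F sin y); [exact: cF|exact: continuous_sin].
Qed.

Lemma smooth_expi (z : pt) : smooth (fun x => expi (dot x z)).
Proof.
apply/smoothP => N.
suff H (c : C) : cdiffn N (fun x : pt => c * expi (dot x z)).
  by have := H 1; under [X in cdiffn _ X]eq_fun do rewrite mul1r.
elim: N c => [|N IH] c.
  by split=> //; apply: ccontM; [exact: ccont_cst|apply: ccont_expi; exact: continuous_dot].
split.
  by apply: ccontM; [exact: ccont_cst|apply: ccont_expi; exact: continuous_dot].
exists (fun k x => c * ('i * (z 0 k)%:C) * expi (dot x z)); split=> [k x|k]; last exact: IH.
have := is_cpartialM (is_cpartial_cst k c x) (is_cpartial_expi k z x).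
by rewrite mul0r add0r mulrA.
Qed.

Lemma cpartials_expi s (z : pt) : cpartials s (fun x => expi (dot x z)) =
  fun x => (\prod_(k <- s) ('i * (z 0 k)%:C)) * expi (dot x z).
Proof.
elim: s => [|k s IH]; first by apply/funext => x /=; rewrite big_nil mul1r.
rewrite cpartials_cons IH cpartialZ; last exact: smooth_expi.
apply/funext => x; rewrite (is_cpartialE (is_cpartial_expi k z x)) big_cons.
by rewrite mulrCA mulrA.
Qed.

Lemma near_is_cpartial k g h x l : (\near x, g x = h x) -> is_cpartial k g x l -> is_cpartial k h x l.
Proof.
have H (f f' : pt -> R) (a : R) : (\near x, f x = f' x) -> is_derive x (e_ k) f a ->
    is_derive x (e_ k) f' a.
  move=> fg [df dl]; apply: DeriveDef; last by rewrite -(near_eq_derive _ fg).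
  exact: (near_eq_derivable fg df).
by move=> gh [g1 g2]; split; [apply: H g1|apply: H g2]; apply: filterS gh => y ->.
Qed.

Lemma notin_csupport g x : ~ csupport g x -> \near x, 0 = g x.
Proof.
move=> sx; have : nbhs x (~` csupport g).
  by apply: open_nbhs_nbhs; split=> //; apply: closed_openC; exact: closed_closure.
apply: filterS => y /= sy; apply/esym/eqP; apply/negPn/negP => gy; apply: sy.
exact: subset_closure.
Qed.

Lemma csupport0 g x : ~ csupport g x -> g x = 0.
Proof. by move=> /notin_csupport /nbhs_singleton. Qed.

Lemma csupportP g (K : set pt) : closed K -> (forall x, ~ K x -> g x = 0) -> csupport g `<=` K.
Proof.
move=> cK gK x; rewrite /csupport => xs; rewrite ((closure_id K).1 cK).
move: xs; apply: closureS => y /= gy; apply: contrapT => /gK y0.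
by rewrite y0 eqxx in gy.
Qed.

Lemma csupport_cpartial k g : csupport (cpartial k g) `<=` csupport g.
Proof.
apply: csupportP; first exact: closed_closure.
move=> x /notin_csupport near0; apply: is_cpartialE.
exact: near_is_cpartial near0 (is_cpartial_cst k 0 x).
Qed.

Lemma test_funP (D : set pt) g (K : set pt) : smooth g -> compact K -> closed K -> K `<=` D ->
  (forall x, ~ K x -> g x = 0) -> test_fun D g.
Proof.
move=> sg cK clK KD gK; have h := csupportP clK gK; split=> //.
  by apply: subclosed_compact cK h; exact: closed_closure.
exact: subset_trans h KD.
Qed.

Lemma test_funS (D D' : set pt) g : D `<=` D' -> test_fun D g -> test_fun D' g.
Proof. by move=> DD [s c gD]; split=> //; exact: subset_trans DD. Qed.

Lemma test_fun_smooth D g : test_fun D g -> smooth g. Proof. by case. Qed.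

Lemma test_funM D g h : test_fun D g -> smooth h -> test_fun D (fun x => g x * h x).
Proof.
move=> [sg cg gD] sh.
apply: (@test_funP D _ (csupport g) (smoothM sg sh) cg (@closed_closure _ _) gD).
by move=> x /csupport0 ->; rewrite mul0r.
Qed.

Lemma compactU_closed (A B : set pt) : compact A -> compact B -> compact (A `|` B).
Proof. exact: compactU. Qed.

Lemma test_funD D g h : test_fun D g -> test_fun D h -> test_fun D (fun x => g x + h x).
Proof.
move=> [sg cg gD] [sh ch hD]; apply: (@test_funP _ _ (csupport g `|` csupport h)).
- exact: smoothD.
- exact: compactU_closed.
- by apply: closedU; exact: closed_closure.
- by move=> x [/gD|/hD].
- move=> x /not_orP[/csupport0-> /csupport0->]; exact: addr0.
Qed.

Lemma test_fun_cpartial D k g : test_fun D g -> test_fun D (cpartial k g).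
Proof.
move=> [sg cg gD].
apply: (@test_funP D _ (csupport g) (smooth_cpartial k sg) cg (@closed_closure _ _) gD).
by move=> x sx; apply: csupport0 => /csupport_cpartial.
Qed.

Lemma test_funZ D c g : test_fun D g -> test_fun D (fun x => c * g x).
Proof.
move=> tg; have := test_funM tg (smooth_cst c).
by under eq_fun do rewrite mulrC.
Qed.

Lemma test_fun0 D : test_fun D (fun _ : pt => 0).
Proof.
by apply: (@test_funP D _ set0 (smooth_cst 0) compact0 closed0).
Qed.

Lemma cpartial_lipschitz k g (M : R) x (t : R) : smooth g -> (forall y, nc (cpartial k g y) <= M) ->
  nc (g (x + t *: e_ k) - g x) <= 2 * M * `|t|.
Proof.
move=> /smooth_cdiff/cdiff_is_cpartial sg gM.
have H (f : C -> R) (fle : forall z, `|f z| <= nc z)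
   (fd : forall x, is_derive x (e_ k) (fun y => f (g y)) (f (cpartial k g x))) :
   `|f (g (x + t *: e_ k)) - f (g x)| <= M * `|t|.
  have := @le_derive_lipschitz R (fun t : R => f (g (x + t *: e_ k)))
     (fun t => f (cpartial k g (x + t *: e_ k))) M.
  move=> /(_ _ _ t 0); rewrite scale0r addr0 subr0; apply.
    by move=> s; apply/is_derive_line; exact: fd.
  by move=> s; apply: le_trans (fle _) (gM _).
apply: le_trans (nc_leD _) _; rewrite !cE -mulrA mulr2n mulrDl mul1r lerD//.
  by apply: H => [z|y]; [exact: le_Re_nc|have [] := sg k y].
by apply: H => [z|y]; [exact: le_Im_nc|have [] := sg k y].
Qed.

End PartialDerivatives.

(** * Boxes, compactness bounds and uniform smallness of derivatives *)

Section Boxes.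
Variables (R : realType) (n : nat).
Local Notation pt := 'rV[R]_n.
Implicit Types (x y c : pt) (k : 'I_n).

Lemma le_coord_norm x k : `|x 0 k| <= `|x|.
Proof.
rewrite [leRHS]/Num.Def.normr /= mx_normrE; apply/bigmax_geP; right => /=.
by exists (0, k).
Qed.

Lemma le_norm_coord x (r : R) : 0 <= r -> (forall k, `|x 0 k| <= r) -> `|x| <= r.
Proof.
move=> r0 xr; rewrite [leLHS]/Num.Def.normr /= mx_normrE; apply/bigmax_leP; split=> // -[i k] _ /=.
by rewrite ord1.
Qed.

Definition box c (r : R) : set pt := [set x | forall k, `|x 0 k - c 0 k| <= r].

Lemma compact_box c r : compact (box c r).
Proof.
rewrite (_ : box c r = [set v | forall k, `[c 0 k - r, c 0 k + r]%classic (v ord0 k)]).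
  exact: (@rV_compact _ n (fun k => `[c 0 k - r, c 0 k + r]%classic) (fun k => @segment_compact _ _ _)).
by apply/seteqP; split=> x h k; have := h k; rewrite /= in_itv/= ler_distl.
Qed.

Lemma closed_box c r : closed (box c r).
Proof. by apply: compact_closed; [exact: norm_hausdorff|exact: compact_box]. Qed.

Lemma box_nbhs c r : 0 < r -> nbhs c (box c r).
Proof.
move=> r0; apply/nbhs_ballP; exists r => // x /=; rewrite mx_norm_ball /= => xr k.
have := le_coord_norm (c - x) k; rewrite !mxE distrC => /le_trans -> //; exact: ltW.
Qed.

Lemma compact_ubound (K : set pt) (f : pt -> R) : compact K -> continuous f ->
  exists M : R, 0 <= M /\ forall x, K x -> f x <= M.
Proof.
move=> cK cf; have [->|K0] := eqVneq K set0; first by exists 0.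
have [c _ cM] := EVT_max_rV ((set0P _).1 K0) cK (continuous_subspaceT cf).
exists (Num.max 0 (f c)); split; first by rewrite le_max lexx.
by move=> x Kx; rewrite le_max cM ?orbT//; exact: mem_set.
Qed.

Lemma compact_coord_bound (K : set pt) : compact K ->
  exists r : R, 0 <= r /\ forall x, K x -> forall k, `|x 0 k| <= r.
Proof.
move=> cK; have [M [M0 MK]] := compact_ubound cK (@norm_continuous _ _).
by exists M; split=> // x Kx k; apply: le_trans (le_coord_norm _ _) (MK _ Kx).
Qed.

Lemma continuous_nc (V : topologicalType) (g : V -> R[i]) : ccont g -> continuous (fun z => nc (g z)).
Proof.
move=> [g1 g2] z; under eq_fun do rewrite nc_def.
apply: (@continuous_comp _ _ _ (fun z => cRe (g z) ^+ 2 + cIm (g z) ^+ 2) Num.sqrt); last exact: sqrt_continuous.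
have sq (f : V -> R) : continuous f -> continuous (fun z => f z ^+ 2).
  move=> cf y; apply: (@continuous_comp _ _ _ f (fun r => r ^+ 2) y); [exact: cf|exact: exprn_continuous].
by apply: (@continuousD _ _ _ (fun z => cRe (g z) ^+ 2) (fun z => cIm (g z) ^+ 2)); [exact: sq|exact: sq].
Qed.

Lemma test_bounded (D : set pt) (g : pt -> R[i]) : test_fun D g ->
  exists M : R, 0 <= M /\ forall x, nc (g x) <= M.
Proof.
move=> [sg cg _]; have [M [M0 MK]] := compact_ubound cg (continuous_nc (smooth0 sg)).
exists M; split=> // x; have [/MK//|/csupport0->] := pselect (csupport g x).
by rewrite nc0.
Qed.

Definition dist1 x y : R := \sum_k `|x 0 k - y 0 k|.

Lemma dist1_ge0 x y : 0 <= dist1 x y. Proof. by apply: sumr_ge0 => k _. Qed.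

Lemma dist1_cvg y : dist1 x y @[x --> y] --> 0.
Proof.
have -> : 0 = dist1 y y by rewrite /dist1 big1// => k _; rewrite subrr normr0.
apply: continuous_sum => k x.
apply: (@continuous_comp _ _ _ (fun x : pt => x 0 k - y 0 k) (fun r => `|r|)); last exact: norm_continuous.
by apply: continuousB; [exact: coord_continuous|exact: cst_continuous].
Qed.

Lemma ccont_lipschitz (g : pt -> R[i]) (L : R) :
  (forall x y, nc (g x - g y) <= L * dist1 x y) -> ccont g.
Proof.
move=> gL.
suff H y : ccvg (nbhs y) g (g y) by split=> y; have [] := H y.
apply: (@ccvg_squeeze _ _ _ _ _ _ (fun x => L * dist1 x y)); first exact: nearW.
by rewrite -[X in _ --> X](mulr0 L); apply: cvgMl_tmp; exact: dist1_cvg.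
Qed.

Lemma norm_dot_le x (xi : pt) (r : R) : (forall k, `|x 0 k| <= r) ->
  `|dot x xi| <= r * \sum_k `|xi 0 k|.
Proof.
move=> xr; apply: le_trans (ler_norm_sum _ _ _) _; rewrite mulr_sumr; apply: ler_sum => k _.
by rewrite normrM ler_wpM2r.
Qed.

Lemma fin_near (T I : Type) (F : set_system T) {FF : Filter F} (r : seq I) (P : I -> T -> Prop) :
  (forall i, \forall t \near F, P i t) -> \forall t \near F, forall i, List.In i r -> P i t.
Proof.
move=> h; elim: r => [|i r IH]; first exact: nearW.
by near=> t; move=> j /= [<-|]; [near: t; exact: h|move: j; near: t].
Unshelve. all: by end_near. Qed.

Lemma In_mem (I : eqType) (i : I) (r : seq I) : i \in r -> List.In i r.
Proof. by elim: r => //= j r IH; rewrite inE => /orP[/eqP->|/IH]; [left|right]. Qed.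

Lemma fin_near_ord (T : Type) (F : set_system T) {FF : Filter F} (P : 'I_n -> T -> Prop) :
  (forall i, \forall t \near F, P i t) -> \forall t \near F, forall i, P i t.
Proof.
move=> h; apply: filterS (fin_near (enum 'I_n) h) => t H i; apply: H.
by apply: In_mem; rewrite mem_enum.
Qed.

(** There are finitely many lists of length at most N over a finite alphabet, so the statements can
    be intersected. This serves the seminorms of a distribution, which involve all derivatives up to
    a finite order. *)
Lemma fin_near_seq (T : Type) (F : set_system T) {FF : Filter F} (N : nat)
   (P : seq 'I_n -> T -> Prop) :
  (forall s, \forall t \near F, P s t) ->
  \forall t \near F, forall s, (size s <= N)%N -> P s t.
Proof.
elim: N P => [|N IH] P h.
  by apply: filterS (h [::]) => t Pt s; rewrite leqn0 => /nilP ->.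
have h1 := h [::].
have h2 : \forall t \near F, forall s, (size s <= N)%N -> forall k, P (k :: s) t.
  by apply: IH => s; exact: fin_near_ord.
by apply: filterS2 h1 h2 => t p1 p2 [|k s]//= ss; exact: p2.
Qed.

(** Leibniz rule: each derivative falls either on [chi], giving another test function with support
    inside that of [chi], or on [g], giving another family with the same property. Hence both are
    generalised in the induction. *)
Lemma cutoff_cvg0 (T : Type) (F : set_system T) {FF : Filter F} (chi : pt -> R[i]) (g : T -> pt -> R[i]) :
  test_fun setT chi -> (forall t, smooth (g t)) ->
  (forall s (e : R), 0 < e -> \forall t \near F, forall x, csupport chi x -> nc (cpartials s (g t) x) <= e) ->
  forall s (e : R), 0 < e -> \forall t \near F, forall x, nc (cpartials s (fun y => chi y * g t y) x) <= e.
Proof.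
move=> tchi sg gF s; elim/last_ind: s chi g tchi sg gF => [|s k IH] chi g tchi sg gF e e0.
  have [M [M0 chiM]] := test_bounded tchi.
  have M1 : 0 < M + 1 by rewrite ltr_wpDl.
  have := gF [::] (e / (M + 1)) (divr_gt0 e0 M1); apply: filterS => t h x /=.
  have [/h /= gx|/csupport0->] := pselect (csupport chi x); last by rewrite mul0r nc0 ltW.
  rewrite ncM (@le_trans _ _ ((M + 1) * (e / (M + 1))))//.
    apply: ler_pM; [exact: nc_ge0|exact: nc_ge0| |exact: gx].
    by apply: le_trans (chiM x) _; rewrite lerDl.
  by rewrite mulrCA divff ?mulr1// gt_eqF.
have e2 : 0 < e / 2 by rewrite divr_gt0.
have h1 := IH (cpartial k chi) g (test_fun_cpartial k tchi) sg.
have {h1} h1 : \forall t \near F, forall x, nc (cpartials s (fun y => cpartial k chi y * g t y) x) <= e / 2.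
  apply: h1 => // s' e' e'0; apply: filterS (gF s' e' e'0) => t h x /csupport_cpartial; exact: h.
have h2 : \forall t \near F, forall x, nc (cpartials s (fun y => chi y * cpartial k (g t) y) x) <= e / 2.
  apply: IH => // [t|s' e' e'0]; first exact: smooth_cpartial.
  by under eq_near do under eq_forall do rewrite -cpartials_rcons; exact: gF.
apply: filterS2 h1 h2 => t h1 h2 x.
have schi := test_fun_smooth tchi.
rewrite cpartials_rcons (cpartialM k schi (sg t)) cpartialsD.
- by apply: le_trans (ncD _ _) _; rewrite [leRHS]splitr lerD.
- exact: (smoothM (smooth_cpartial k schi) (sg t)).
- exact: (smoothM schi (smooth_cpartial k (sg t))).
Qed.

End Boxes.

(** * Components of a vector distribution and their continuity *)

Section Components.
Variable R : realType.
Local Notation pt := 'rV[R]_3.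
Local Notation C := R[i].
Implicit Types (u : vdistribution R) (psi phi : pt -> C).

Lemma entry_delta (psi : pt -> C) (i j : 'I_3) :
  (fun x => (psi x *: delta_mx j 0 : 'cV[C]_3) i 0) = fun x => (i == j)%:R * psi x.
Proof. by apply/funext => x; rewrite !mxE andbT mulrC. Qed.

Lemma test_mx_delta (D : set pt) psi (j : 'I_3) : test_fun D psi ->
  test_mx D (fun x => psi x *: delta_mx j 0 : 'cV[C]_3).
Proof.
by move=> tpsi i l; rewrite (ord1 l) entry_delta; exact: test_funZ.
Qed.

Lemma componentP u j (a : C) psi phi : test_fun setT psi -> test_fun setT phi ->
  component u j (fun x => a * psi x + phi x) = a * component u j psi + component u j phi.
Proof.
case: u => u /= lin _ tpsi tphi; rewrite /component /= -lin; last 2 first.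
- exact: test_mx_delta.
- exact: test_mx_delta.
by congr u; apply/funext => x; rewrite scalerDl scalerA.
Qed.

Lemma component0 u j : component u j (fun=> 0) = 0.
Proof.
have := @componentP u j 1 (fun=> 0) (fun=> 0) (test_fun0 _) (test_fun0 _).
rewrite !mul1r addr0.
by move=> /eqP; rewrite -subr_eq subrr eq_sym => /eqP.
Qed.

Lemma componentD u j psi phi : test_fun setT psi -> test_fun setT phi ->
  component u j (fun x => psi x + phi x) = component u j psi + component u j phi.
Proof.
move=> tp tq; have := @componentP u j 1 _ _ tp tq.
by rewrite mul1r; under eq_fun do rewrite mul1r.
Qed.

Lemma componentZ u j (a : C) psi : test_fun setT psi ->
  component u j (fun x => a * psi x) = a * component u j psi.
Proof.
move=> tp; have := @componentP u j a _ _ tp (test_fun0 _).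
by rewrite component0 addr0; under eq_fun do rewrite addr0.
Qed.

Lemma component_sum u j (I : Type) (r : seq I) (F : I -> pt -> C) :
  (forall i, test_fun setT (F i)) ->
  component u j (fun x => \sum_(i <- r) F i x) = \sum_(i <- r) component u j (F i).
Proof.
move=> tF; elim: r => [|i r IH].
  by under eq_fun do rewrite big_nil; rewrite big_nil component0.
under eq_fun do rewrite big_cons; rewrite big_cons componentD ?IH//.
elim: r {IH} => [|l r IH]; first by under eq_fun do rewrite big_nil; exact: test_fun0.
by under eq_fun do rewrite big_cons; exact: test_funD.
Qed.

(** Continuity in the form used later: on the compact support of [chi] the seminorm estimate
    involves finitely many derivatives of the product, and each of them becomes uniformly small. The
    filter is arbitrary, so it serves both for sequences and for a continuous frequency. *)
Lemma component_cvg0 u j (T : Type) (F : set_system T) {FF : Filter F} (chi : pt -> C)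
    (g : T -> pt -> C) : test_fun setT chi -> (forall t, smooth (g t)) ->
  (forall s (e : R), 0 < e -> \forall t \near F, forall x, csupport chi x -> nc (cpartials s (g t) x) <= e) ->
  ccvg F (fun t => component u j (fun x => chi x * g t x)) 0.
Proof.
move=> tchi sg gF; have H := @cutoff_cvg0 R 3 T F FF chi g tchi sg gF.
case: u => u /= lin bd; have [_ cchi _] := tchi.
have [N [c bdK]] := bd _ cchi.
have key (e : R) : 0 < e -> \forall t \near F, nc (u (fun x => (chi x * g t x) *: delta_mx j 0)) <= `|c| * e.
  move=> e0.
  have := @fin_near_seq 3 T F FF N (fun s t => forall x, nc (cpartials s (fun y => chi y * g t y) x) <= e) (fun s => H s e e0).
  apply: filterS => t h.
  have tt : test_fun setT (fun x => chi x * g t x) by exact: test_funM.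
  apply: le_trans (bdK _ e _ _ _) _.
  - exact: test_mx_delta.
  - move=> i; rewrite entry_delta.
    apply: csupportP; first exact: closed_closure.
    by move=> x /csupport0 ->; rewrite mul0r mulr0.
  - move=> s i x sN; rewrite entry_delta cpartialsZ; last exact: test_fun_smooth tt.
    rewrite ncM; apply: le_trans (h s sN x); rewrite ler_piMl//.
    by case: (i == j); rewrite ?nc1 ?nc0.
  - by rewrite ler_wpM2r ?ler_norm// ltW.
have c1 : 0 < `|c| + 1 by rewrite ltr_wpDl.
have nc0' : nc (component (VDistribution lin bd) j (fun x => chi x * g t x) - 0) @[t --> F] --> 0.
  apply/cvgr0Pnorm_le => e e0; have := key (e / (`|c| + 1)) (divr_gt0 e0 c1).
  apply: filterS => t; rewrite subr0 (ger0_norm (nc_ge0 _)) => /le_trans; apply.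
  by rewrite mulrCA ger_pMr// ler_pdivrMr// mul1r lerDl.
exact: (ccvg_squeeze (nearW _ (fun=> lexx _)) nc0').
Qed.

End Components.

(** * Tensor-product cutoff functions *)

Section Cutoff.
Variable R : realType.
Local Notation pt := 'rV[R]_3.
Local Notation C := R[i].

Definition cutoff (c : pt) (r : R) (x : pt) : C :=
  \prod_(k < 3) (plateau ((x 0 k - c 0 k) / r))%:C.

Lemma cutoff1 c r x : 0 < r -> box c r x -> cutoff c r x = 1.
Proof.
move=> r0 xb; rewrite /cutoff big1// => k _; rewrite plateau1//.
by rewrite normrM normfV (gtr0_norm r0) ler_pdivrMr// mul1r; exact: xb.
Qed.

Lemma cutoff0 c r x : 0 < r -> ~ box c (2 * r) x -> cutoff c r x = 0.
Proof.
move=> r0 /existsNP[k /negP]; rewrite -ltNge => h.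
rewrite /cutoff (bigD1 k)//= plateau0 ?mul0r//.
by rewrite normrM normfV (gtr0_norm r0) ler_pdivlMr// ltW.
Qed.

Lemma smooth_cutoff c r : smooth (cutoff c r).
Proof.
apply: smooth_prod => k.
have := @smooth_dot R 3 (@plateau R) (- (c 0 k / r)) (r^-1 *: delta_mx 0 k) (fun N => diffn_plateau R N).
by under eq_fun do rewrite dotZr dotC dot_delta mulrC -mulrBl.
Qed.

Lemma test_cutoff c r (D : set pt) : 0 < r -> box c (2 * r) `<=` D -> test_fun D (cutoff c r).
Proof.
move=> r0 bD; apply: (@test_funP _ _ _ _ (box c (2 * r))) => //.
- exact: smooth_cutoff.
- exact: compact_box.
- exact: closed_box.
- by move=> x; exact: cutoff0.
Qed.

Lemma cutoffJ c r x : (cutoff c r x)^* = cutoff c r x.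
Proof. by rewrite /cutoff rmorph_prod; apply: eq_bigr => k _; exact: conjc_real. Qed.

End Cutoff.

(** * Fourier transform of test functions *)

Section FourierTransform.
Variable R : realType.
Local Notation pt := 'rV[R]_3.
Local Notation C := R[i].
Implicit Types (g h : pt -> C) (x xi zeta : pt) (k : 'I_3).

Lemma bump3E x : bump3 x = bump1 (x 0 0) * bump1 (x 0 1) * bump1 (x 0 2).
Proof.
rewrite /bump3 !big_ord_recl big_ord0 mulr1 mulrA.
by congr (_ * _ * _); congr (bump1 (x 0 _)); apply/val_inj.
Qed.

Lemma bump3_box x (r : R) : (forall k, `|x 0 k| <= r) -> 1 <= (1 + r ^+ 2) ^+ 3 * bump3 x.
Proof.
move=> xr; have -> : (1 + r ^+ 2) ^+ 3 = \prod_(k < 3) (1 + r ^+ 2).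
  by rewrite prodr_const card_ord.
rewrite /bump3 -big_split /=.
have e1 : \prod_(k < 3) (1 : R) = 1 by rewrite prodr_const expr1n.
rewrite -[leLHS]e1; apply: ler_prod => k _; rewrite ler01/= /bump1 ler_pdivlMr ?mul1r; last first.
  by rewrite ltr_pwDl// sqr_ge0.
by rewrite lerD2l -(real_normK (num_real (x 0 k))) lerXn2r ?nnegrE// (le_trans _ (xr k)).
Qed.

Lemma bump3_le1 x : bump3 x <= 1.
Proof.
rewrite /bump3; apply: (@le_trans _ _ (\prod_(k < 3) 1)); last by rewrite prodr_const expr1n.
apply: ler_prod => k _; rewrite ltW ?bump1_gt0//= invf_le1 ?lerDl ?sqr_ge0//.
by rewrite ltr_pwDl// sqr_ge0.
Qed.

Lemma bump3_support g (M r : R) : 0 <= M -> (forall x, nc (g x) <= M) ->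
  (forall x, g x != 0 -> forall k, `|x 0 k| <= r) ->
  forall x, nc (g x) <= M * (1 + r ^+ 2) ^+ 3 * bump3 x.
Proof.
move=> M0 gM gr x; have [->|gx] := eqVneq (g x) 0.
  by rewrite nc0 mulr_ge0 ?(ltW (bump3_gt0 _))// mulr_ge0// exprn_ge0// addr_ge0// sqr_ge0.
by apply: le_trans (gM x) _; rewrite -mulrA ler_peMr// bump3_box//; exact: gr.
Qed.

Lemma test_support (D : set pt) g : test_fun D g ->
  exists r : R, 0 <= r /\ forall x, g x != 0 -> forall k, `|x 0 k| <= r.
Proof.
move=> [_ cg _]; have [r [r0 h]] := compact_coord_bound cg.
exists r; split=> // x gx; apply: h; exact: subset_closure.
Qed.

Lemma test_tame (D : set pt) g : test_fun D g -> tame g.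
Proof.
move=> tg; have [M [M0 gM]] := test_bounded tg; have [r [_ gr]] := test_support tg.
split; first exact: smooth0 (test_fun_smooth tg).
exists (M * (1 + r ^+ 2) ^+ 3); exact: bump3_support.
Qed.

Lemma tameM g h (M : R) : ccont h -> (forall x, nc (h x) <= M) -> tame g -> tame (fun x => h x * g x).
Proof.
move=> ch hM [cg [c gc]]; split; first exact: ccontM.
exists (M * c) => x; rewrite ncM -mulrA ler_pM//; exact: gc.
Qed.

Lemma tameZ c g : tame g -> tame (fun x => c * g x).
Proof. by apply: (@tameM _ _ (nc c)); [exact: ccont_cst|]. Qed.

Lemma tameD g h : tame g -> tame h -> tame (fun x => g x + h x).
Proof.
move=> [cg [a ga]] [ch [b hb]]; split; first exact: ccontD.
by exists (a + b) => x; apply: le_trans (ncD _ _) _; rewrite mulrDl lerD.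
Qed.

(** The derivative is sampled along 1 / (n + 1), because dominated convergence is available for
    sequences. *)
Lemma is_derive_seq (f : pt -> R) x (v : pt) (l : R) : is_derive x v f l ->
  (n.+1%:R * (f (x + n.+1%:R^-1 *: v) - f x)) @[n --> \oo] --> l.
Proof.
move=> [df <-].
have := (cvgr_dnbhsP (fun h : R => h^-1 *: ((f \o shift x) (h *: v) - f x)) 0 ('D_v f x)).1 df.
move=> /(_ (fun n => n.+1%:R^-1)) H.
have : (n.+1%:R^-1)^-1 *: ((f \o shift x) (n.+1%:R^-1 *: v) - f x) @[n --> \oo] --> 'D_v f x.
  by apply: H; split; [move=> n; rewrite invr_eq0 pnatr_eq0|exact: cvg_harmonic].
by apply: cvg_trans; apply: near_eq_cvg; apply: nearW => n /=; rewrite invrK [X in f X]addrC.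
Qed.

Lemma is_cpartial_seq k g x (l : C) : is_cpartial k g x l ->
  ccvg \oo (fun n => n.+1%:R%:C * (g (x + n.+1%:R^-1 *: delta_mx 0 k) - g x)) l.
Proof.
move=> [/is_derive_seq g1 /is_derive_seq g2]; split.
  by under eq_fun do rewrite !cE /= mul0r subr0.
by under eq_fun do rewrite !cE /= mul0r addr0.
Qed.

Lemma ccont_shift g x : ccont g -> ccont (fun y : pt => g (y + x)).
Proof.
move=> [g1 g2].
have sh : continuous (fun y : pt => y + x).
  by move=> y; apply: (@continuousD _ _ _ id (fun=> x)); [exact: id|exact: cst_continuous].
by split=> y; [apply: (@continuous_comp _ _ _ (fun y : pt => y + x) (fun y : pt => cRe (g y)) y); [exact: sh|exact: g1]
  |apply: (@continuous_comp _ _ _ (fun y : pt => y + x) (fun y : pt => cIm (g y)) y); [exact: sh|exact: g2]].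
Qed.

(** Difference quotients integrate to 0 by translation invariance, and dominated convergence passes
    to the derivative. This replaces integration by parts. *)
Lemma integral3_cpartial (D : set pt) k g : test_fun D g -> integral3 (cpartial k g) = 0.
Proof.
move=> tg; have sg := test_fun_smooth tg.
have [M [M0 gM]] := test_bounded (test_fun_cpartial k tg).
have [r [r0 gr]] := test_support tg.
pose v : pt := delta_mx 0 k.
pose F (n : nat) x := n.+1%:R%:C * (g (x + n.+1%:R^-1 *: v) - g x).
have n0 n : (0 : R) < n.+1%:R by rewrite ltr0n.
(* The shifts have length at most 1, so all translates are supported in the box of half-width r + 1,
   uniformly in n. *)
have xv n x i : `|(x + n.+1%:R^-1 *: v) 0 i| <= r -> `|x 0 i| <= r + 1.
  move=> xr; have -> : x 0 i = (x + n.+1%:R^-1 *: v) 0 i - n.+1%:R^-1 * v 0 i by rewrite !mxE addrK.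
  apply: le_trans (ler_normB _ _) _; rewrite lerD// normrM normfV (ger0_norm (ltW (n0 n))).
  rewrite mxE eqxx/=; case: (i == k) => /=; rewrite ?normr1 ?normr0 ?mulr1 ?mulr0//.
  by rewrite invf_le1// ler1n.
have tshift n : tame (fun x => g (x + n.+1%:R^-1 *: v)).
  split; first by apply: ccont_shift; exact: smooth0.
  have [M' [M'0 gM']] := test_bounded tg.
  exists (M' * (1 + (r + 1) ^+ 2) ^+ 3); apply: bump3_support => // x /gr xr i.
  exact: (xv n).
have tN : tame (fun x => - 1 * g x) by apply: tameZ; exact: test_tame tg.
have FE n x : F n x = n.+1%:R%:C * (g (x + n.+1%:R^-1 *: v) + - 1 * g x) by rewrite mulN1r.
have F0 n : integral3 (F n) = 0.
  rewrite (eq_integral3 (FE n)) integral3Z; last exact: tameD (tshift n) tN.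
  rewrite integral3D// integral3Z ?(integral3_shift _ (test_tame tg)); last exact: test_tame tg.
  by rewrite mulN1r subrr mulr0.
have FM n x : nc (F n x) <= 2 * M.
  rewrite /F ncM ncR (ger0_norm (ltW (n0 n))) mulrC -ler_pdivlMr//.
  by apply: le_trans (cpartial_lipschitz _ _ sg gM) _; rewrite normfV (ger0_norm (ltW (n0 n))).
have h : ccvg \oo (fun n => integral3 (F n)) (integral3 (cpartial k g)).
  apply: (@integral3_dominated _ _ _ (2 * M * (1 + (r + 1) ^+ 2) ^+ 3)).
  - move=> n; rewrite (_ : F n = fun x => n.+1%:R%:C * (g (x + n.+1%:R^-1 *: v) + - 1 * g x)).
      by apply: ccontM; [exact: ccont_cst|exact: (tameD (tshift n) tN).1].
    by apply/funext => x; exact: FE.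
  - exact: smooth0 (smooth_cpartial k sg).
  - by move=> x; apply: is_cpartial_seq; exact: cdiff_is_cpartial (smooth_cdiff sg) _ _.
  - move=> n; apply: bump3_support => //; first by rewrite mulr_ge0.
    move=> x Fx i; have [gx|/gr/(_ i)/xv//] := eqVneq (g (x + n.+1%:R^-1 *: v)) 0.
    have [gx'|/gr/(_ i)/le_trans->//] := eqVneq (g x) 0; last by rewrite lerDl.
    by move: Fx; rewrite /F gx gx' subrr mulr0 eqxx.
move: h; under eq_fun do rewrite F0; move=> h.
exact: (ccvg_unique h (@ccvg_cst R nat \oo _ 0)).
Qed.

Definition hat g xi : C := integral3 (fun x => expi (- dot x xi) * g x).

Lemma fourierE (p q : nat) (g : pt -> 'M[C]_(p, q)) xi j l :
  fourier g xi j l = hat (fun x => g x j l) xi.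
Proof. by rewrite mxE. Qed.

Lemma ccont_expiN xi : ccont (fun x : pt => expi (- dot x xi)).
Proof. by under eq_fun do rewrite -dotNr; apply: ccont_expi; exact: continuous_dot. Qed.

Lemma tame_hat g xi : tame g -> tame (fun x => expi (- dot x xi) * g x).
Proof. by apply: (@tameM _ _ 1); [exact: ccont_expiN|move=> x; rewrite nc_expi]. Qed.

Lemma hatD g h xi : tame g -> tame h -> hat (fun x => g x + h x) xi = hat g xi + hat h xi.
Proof.
move=> tg th; rewrite /hat -integral3D; [|exact: tame_hat|exact: tame_hat].
by apply: eq_integral3 => x; rewrite mulrDr.
Qed.

Lemma hatZ c g xi : tame g -> hat (fun x => c * g x) xi = c * hat g xi.
Proof.
move=> tg; rewrite /hat -integral3Z; last exact: tame_hat.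
by apply: eq_integral3 => x; rewrite mulrCA.
Qed.

Lemma hat_cpartial (D : set pt) k g xi : test_fun D g ->
  hat (cpartial k g) xi = 'i * (xi 0 k)%:C * hat g xi.
Proof.
move=> tg; have se := smooth_expi (- xi).
have te : test_fun D (fun x => expi (dot x (- xi)) * g x).
  by have := test_funM tg se; under eq_fun do rewrite mulrC.
have := integral3_cpartial k te; rewrite (cpartialM k se (test_fun_smooth tg)).
have e1 x : expi (dot x (- xi)) = expi (- dot x xi) by rewrite dotNr.
rewrite (@eq_integral3 _ _ (fun x => (- ('i * (xi 0 k)%:C)) * (expi (- dot x xi) * g x) +
   expi (- dot x xi) * cpartial k g x)); last first.
  move=> x; rewrite (is_cpartialE (is_cpartial_expi k (- xi) x)) e1 mxE rmorphN /=.
  by ring.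
rewrite integral3D ?integral3Z.
- by move=> /eqP; rewrite mulNr addrC subr_eq0 => /eqP.
- exact: tame_hat (test_tame tg).
- apply: (@tameM _ _ (nc (- ('i * (xi 0 k)%:C)))); [exact: ccont_cst|by []|].
  exact: tame_hat (test_tame tg).
- exact: tame_hat (test_tame (test_fun_cpartial k tg)).
Qed.

Lemma hat_bounded g : tame g -> exists M : R, 0 <= M /\ forall xi, nc (hat g xi) <= M.
Proof.
move=> [cg [c gc]]; exists (`|c| * mass3 R); split.
  by rewrite mulr_ge0// mass3_ge0.
move=> xi; apply: (@le_trans _ _ (c * mass3 R)); last by rewrite ler_wpM2r ?mass3_ge0 ?ler_norm.
apply: nc_integral3; first by apply: ccontM => //; exact: ccont_expiN.
by move=> x; rewrite ncM nc_expi mul1r.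
Qed.

(** The multiplier 1 + xi_k^2 is that of the operator which subtracts the second derivative in
    direction k from the identity. *)
Lemma hat_mulop1 (D : set pt) k g : test_fun D g -> exists2 h, test_fun D h &
  forall xi, hat h xi = (1 + xi 0 k ^+ 2)%:C * hat g xi.
Proof.
move=> tg; pose g2 := cpartial k (cpartial k g).
have t2 : test_fun D g2 by do 2 apply: test_fun_cpartial.
have t2' := test_funZ (-1) t2.
exists (fun x => g x + -1 * g2 x); first exact: test_funD.
move=> xi; rewrite hatD; [|exact: test_tame tg|exact: test_tame t2'].
rewrite hatZ; last exact: test_tame t2.
rewrite (hat_cpartial k xi (test_fun_cpartial k tg)) (hat_cpartial k xi tg).
rewrite !mulrA -[X in _ + X * _](_ : (xi 0 k ^+ 2)%:C = _); last first.
  by apply: complex_eqP; rewrite !cE /=; ring.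
by rewrite rmorphD /= mulrDl mul1r.
Qed.

Lemma hat_mulop (D : set pt) g : test_fun D g -> exists2 h, test_fun D h &
  forall xi, hat h xi = ((bump3 xi)^-1)%:C * hat g xi.
Proof.
move=> tg; have [g0 t0 h0] := hat_mulop1 0 tg; have [g1 t1 h1] := hat_mulop1 1 t0.
have [g2 t2 h2] := hat_mulop1 2 t1; exists g2 => // xi.
rewrite h2 h1 h0 !mulrA -!rmorphM /=; congr (_%:C * _).
by rewrite bump3E !invfM !invrK; ring.
Qed.

(** Each application of the operator of [hat_mulop] yields another test function, with bounded
    transform, and gains one factor [bump3]. *)
Lemma hat_decay (D : set pt) g N : test_fun D g ->
  exists M : R, 0 <= M /\ forall xi, nc (hat g xi) <= M * bump3 xi ^+ N.
Proof.
elim: N g => [|N IH] g tg.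
  have [M [M0 h]] := hat_bounded (test_tame tg); exists M; split=> // xi.
  by rewrite expr0 mulr1.
have [h th hg] := hat_mulop tg; have [M [M0 hM]] := IH h th; exists M; split=> // xi.
have := hM xi; rewrite hg ncM ncR gtr0_norm ?invr_gt0 ?bump3_gt0//.
by rewrite mulrC ler_pdivrMr ?bump3_gt0// exprSr mulrA.
Qed.

(** The exponential is Lipschitz in the frequency with a constant governed by the size of the
    support. *)
Lemma ccont_hat (D : set pt) g : test_fun D g -> ccont (hat g).
Proof.
move=> tg; have [M [M0 gM]] := test_bounded tg; have [r [r0 gr]] := test_support tg.
have tt := test_tame tg.
apply: (@ccont_lipschitz _ _ _ (2 * r * M * (1 + r ^+ 2) ^+ 3 * mass3 R)) => xi zeta.
have tN : tame (fun x => - 1 * (expi (- dot x zeta) * g x)).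
  by apply: (@tameM _ _ (nc (-1))); [exact: ccont_cst|by []|exact: tame_hat].
have -> : hat g xi - hat g zeta =
    integral3 (fun x => expi (- dot x xi) * g x + - 1 * (expi (- dot x zeta) * g x)).
  by rewrite integral3D ?integral3Z ?mulN1r//; exact: tame_hat.
rewrite mulrAC; apply: nc_integral3; first by apply: ccontD; [exact: (tame_hat xi tt).1|exact: tN.1].
move=> x; rewrite mulN1r -mulrBl ncM.
have d0 := dist1_ge0 xi zeta.
apply: (@le_trans _ _ (2 * r * dist1 xi zeta * nc (g x))).
  have [->|gx] := eqVneq (g x) 0; first by rewrite nc0 !mulr0.
  apply: ler_wpM2r; first exact: nc_ge0.
  apply: le_trans (expi_lipschitz _ _) _.
  rewrite -mulrA ler_wpM2l// opprK addrC -dotNr -dotDr.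
  apply: le_trans (norm_dot_le _ (gr x gx)) _; rewrite ler_wpM2l// /dist1.
  by apply: ler_sum => k _; rewrite !mxE distrC.
apply: (@le_trans _ _ (2 * r * dist1 xi zeta * (M * (1 + r ^+ 2) ^+ 3 * bump3 x))).
  by rewrite ler_wpM2l ?mulr_ge0// bump3_support.
by rewrite le_eqVlt; apply/orP; left; apply/eqP; ring.
Qed.

Lemma hat_shift g zeta xi : hat (fun x => expi (dot x zeta) * g x) xi = hat g (xi - zeta).
Proof.
apply: eq_integral3 => x; rewrite mulrA -expiD; congr (expi _ * _).
by rewrite dotDr dotNr opprB addrC.
Qed.

End FourierTransform.

(** * Fubini's theorem for complex integrands *)

Section ComplexFubini.
Context d1 d2 (T1 : measurableType d1) (T2 : measurableType d2) (R : realType).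
Variable m1 : {sigma_finite_measure set T1 -> \bar R}.
Variable m2 : {sigma_finite_measure set T2 -> \bar R}.

Lemma Rintegral_fubini (g : T1 * T2 -> R) :
  (m1 \x m2)%E.-integrable setT (fun z => (g z)%:E) ->
  (forall x, m2.-integrable setT (fun y => (g (x, y))%:E)) ->
  (forall y, m1.-integrable setT (fun x => (g (x, y))%:E)) ->
  m1.-integrable setT (fun x => (\int[m2]_y g (x, y))%:E) /\
  \int[m1]_x (\int[m2]_y g (x, y)) = \int[m2]_y (\int[m1]_x g (x, y)).
Proof.
move=> ig i2 i1.
have e2 x : (\int[m2]_y g (x, y))%:E = (\int[m2]_y (g (x, y))%:E)%E.
  by rewrite /Rintegral fineK//; exact: integrable_fin_num.
have e1 y : (\int[m1]_x g (x, y))%:E = (\int[m1]_x (g (x, y))%:E)%E.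
  by rewrite /Rintegral fineK//; exact: integrable_fin_num.
split; first by under eq_fun do rewrite e2; exact: (integrable_fubini_F ig).
rewrite /Rintegral; congr fine.
under eq_integral do rewrite e2; under [RHS]eq_integral do rewrite e1.
exact: (Fubini ig).
Qed.

Lemma cintegral_fubini (g : T1 * T2 -> R[i]) :
  cintegrable (m1 \x m2)%E setT g ->
  (forall x, cintegrable m2 setT (fun y => g (x, y))) ->
  (forall y, cintegrable m1 setT (fun x => g (x, y))) ->
  cintegrable m1 setT (fun x => cintegral m2 setT (fun y => g (x, y))) /\
  cintegral m1 setT (fun x => cintegral m2 setT (fun y => g (x, y))) =
  cintegral m2 setT (fun y => cintegral m1 setT (fun x => g (x, y))).
Proof.
move=> [ig1 ig2] i2 i1.
have [h1 e1] := Rintegral_fubini ig1 (fun x => (i2 x).1) (fun x => (i1 x).1).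
have [h2 e2] := Rintegral_fubini ig2 (fun x => (i2 x).2) (fun x => (i1 x).2).
by split; [split|apply: complex_eqP].
Qed.

End ComplexFubini.

(** * The Poisson kernel as an approximate identity *)

Section PoissonKernel.
Variable R : realType.
Local Notation mu := (@lebesgue_measure R).
Implicit Types (eps s x t eta : R).

Lemma cintegral_real (h : R -> R) :
  cintegral mu setT (fun t => (h t)%:C) = (\int[mu]_t h t)%:C.
Proof. by apply: complex_eqP => //=; rewrite Rintegral_cst// mul0r. Qed.

(** Improper integrals by a primitive on the half-line. Nonnegativity gives integrability and value
    at once; integrands that change sign are brought to this form below by adding a known positive
    term. *)
Lemma even_integral_halfline (f : R -> R) (F : R -> R) (l : R) :
  (forall x, 0 <= f x) -> continuous f -> (forall x, f (- x) = f x) ->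
  (forall x, 0 <= x -> is_derive x 1 F (f x)) -> F x @[x --> +oo] --> l ->
  mu.-integrable setT (fun x => (f x)%:E) /\ \int[mu]_x f x = 2 * (l - F 0).
Proof.
move=> f0 cf fN dF Fl.
have e : (\int[mu]_x (f x)%:E = (2 * (l - F 0))%:E)%E.
  rewrite ge0_symfun_integralT//; last by move=> x /=; rewrite fN.
  rewrite (_ : [set x | 0 <= x] = `[0, +oo[%classic); last first.
    by apply/seteqP; split=> x /=; rewrite in_itv/= andbT.
  rewrite (ge0_continuous_FTC2y _ _ Fl) ?EFinM ?EFinB//.
  - exact: continuous_subspaceT.
  - by move=> x x0; have := dF x (ltW x0); move=> h; apply: ex_derive.
  - by apply: cvg_at_right_filter; have := is_derive_continuous (dF 0 (lexx _)).
  - move=> x; rewrite in_itv/= andbT => x0; rewrite derive1E.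
    by have [_ ->] := dF x (ltW x0).
split; last by rewrite /Rintegral e.
apply/integrableP; split; first by apply/measurable_EFinP; exact: continuous_measurable_fun.
under eq_integral => x _ do rewrite /= ger0_norm//.
by rewrite e ltry.
Qed.

Definition damp eps eta : R := expR (- eps * `|eta|).

Lemma damp_gt0 eps eta : 0 < damp eps eta. Proof. exact: expR_gt0. Qed.

Lemma damp_le1 eps eta : 0 < eps -> damp eps eta <= 1.
Proof. by move=> e0; rewrite -expR0 ler_expR mulNr oppr_le0 mulr_ge0// ltW. Qed.

Lemma continuous_damp eps : continuous (damp eps).
Proof.
move=> eta; apply: (@continuous_comp _ _ _ (fun eta => - eps * `|eta|) expR); last exact: continuous_expR.
by apply: (@continuousM _ _ (fun=> - eps) (fun eta => `|eta|)); [exact: cst_continuous|exact: norm_continuous].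
Qed.

Definition poisson eps s : R := 2 * eps / (eps ^+ 2 + s ^+ 2).

Lemma poisson_den eps s : 0 < eps -> 0 < eps ^+ 2 + s ^+ 2.
Proof. by move=> e0; rewrite ltr_wpDr ?sqr_ge0// exprn_gt0. Qed.

Lemma poisson_ge0 eps s : 0 < eps -> 0 <= poisson eps s.
Proof. by move=> e0; rewrite divr_ge0 ?(ltW (poisson_den s e0))// mulr_ge0// ltW. Qed.

(** The 1 added to the cosine makes the integrand nonnegative. The damped cosine itself is recovered
    in [cintegral_damp] with the help of the case s = 0, where the integrand is twice the
    damping. *)
Lemma damp_cos eps s : 0 < eps ->
  mu.-integrable setT (fun eta => (damp eps eta * (1 + cos (s * eta)))%:E) /\
  \int[mu]_eta (damp eps eta * (1 + cos (s * eta))) = 2 * eps^-1 + poisson eps s.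
Proof.
move=> e0; have d0 := poisson_den s e0.
have en0 : eps != 0 by rewrite gt_eqF.
have dn0 : eps ^+ 2 + s ^+ 2 != 0 by rewrite gt_eqF.
(* exp(-eps t) (s sin(s t) - eps cos(s t)) / (eps^2 + s^2) is a primitive of exp(-eps t) cos(s t).
   The terms [+ 0] give the affine shape expected by [is_derive_comp_affine]. *)
pose F (t : R) := - eps^-1 * expR (- eps * t + 0) +
   (eps ^+ 2 + s ^+ 2)^-1 * (expR (- eps * t + 0) * (s * sin (s * t + 0) - eps * cos (s * t + 0))).
have [] := @even_integral_halfline (fun eta => damp eps eta * (1 + cos (s * eta))) F 0.
- by move=> x; rewrite mulr_ge0 ?expR_ge0//; have := cos_geN1 (s * x); lra.
- move=> x; apply: (@continuousM _ _ (damp eps) (fun eta => 1 + cos (s * eta))); first exact: continuous_damp.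
  apply: (@continuousD _ _ _ (fun _ : R => 1 : R) (fun eta => cos (s * eta))); first exact: cst_continuous.
  apply: (@continuous_comp _ _ _ (fun eta => s * eta) cos); last exact: continuous_cos.
  by apply: (@continuousM _ _ (fun=> s) id); [exact: cst_continuous|exact: id].
- by move=> x; rewrite /damp normrN mulrN cosN.
- move=> x x0; rewrite /damp ger0_norm//.
  have hE := is_derive_comp_affine (is_derive_expR (- eps * x + 0)).
  have hs := is_derive_comp_affine (is_derive_sin (s * x + 0)).
  have hc := is_derive_comp_affine (is_derive_cos (s * x + 0)).
  have h1 := is_deriveZ (- eps^-1) hE.
  have h2 : is_derive x 1 (fun t : R => s * sin (s * t + 0) - eps * cos (s * t + 0))
    (s * (cos (s * x + 0) * s) - eps * (- sin (s * x + 0) * s)).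
    exact: is_deriveB (is_deriveZ s hs) (is_deriveZ eps hc).
  have h3 := is_deriveZ (eps ^+ 2 + s ^+ 2)^-1 (is_deriveM hE h2).
  apply: (is_derive_eq (is_deriveD h1 h3)).
  by rewrite /GRing.scale /= !addr0; field; rewrite en0 dn0.
- pose c := eps^-1 + (eps ^+ 2 + s ^+ 2)^-1 * (`|s| + eps).
  apply/norm_cvg0P; apply: (@squeeze_cvgr _ _ _ _ (cst 0) (fun t => expR (- (eps * t)) * c)).
  + apply: nearW => t; rewrite normr_ge0/= /F addr0 mulNr.
    have E0 := expR_ge0 (- (eps * t)).
    apply: le_trans (ler_normD _ _) _; rewrite /c [leRHS]mulrDr lerD//.
      by rewrite normrN normrM normfV (gtr0_norm e0) mulNr (ger0_norm E0) mulrC.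
    rewrite mulNr !normrM normfV (gtr0_norm d0) (ger0_norm E0) mulrCA ler_wpM2l//.
    rewrite ler_wpM2l ?invr_ge0 ?(ltW d0)//.
    apply: le_trans (ler_normB _ _) _; rewrite !normrM (gtr0_norm e0).
    apply: lerD; first by rewrite ler_piMr// ler_norml sin_geN1 sin_le1.
    by rewrite ler_piMr ?(ltW e0)// ler_norml cos_geN1 cos_le1.
  + exact: cvg_cst.
  + rewrite -[X in _ --> X](mul0r c); apply: cvgMr_tmp.
    apply: (@cvg_comp _ _ _ (fun t : R => eps * t) (fun t => expR (- t)) _ +oo); last exact: cvgr_expR.
    rewrite (_ : (fun t : R => eps * t) = (fun t => t * eps)); last by apply/funext => t; rewrite mulrC.
    exact: gt0_cvgMly.
- move=> hi ->; split=> //.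
  rewrite /F /poisson !mulr0 addr0 expR0 sin0 cos0 mulr0 sub0r; field.
  by rewrite dn0 en0.
Qed.

Lemma integrable_damp eps : 0 < eps -> mu.-integrable setT (fun eta => (damp eps eta)%:E).
Proof.
move=> e0; have [h _] := damp_cos 0 e0; apply: le_integrable h => //.
  by apply/measurable_EFinP; apply: continuous_measurable_fun; exact: continuous_damp.
move=> x _ /=; rewrite lee_fin mul0r cos0 normrM ler_peMr//.
by rewrite ger0_norm; lra.
Qed.

Lemma measurable_affine_cos s : measurable_fun setT (fun eta : R => cos (s * eta)).
Proof.
apply: continuous_measurable_fun => x.
apply: (@continuous_comp _ _ _ (fun eta => s * eta) cos); last exact: continuous_cos.
by apply: (@continuousM _ _ (fun=> s) id); [exact: cst_continuous|exact: id].
Qed.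

Lemma measurable_affine_sin s : measurable_fun setT (fun eta : R => sin (s * eta)).
Proof.
apply: continuous_measurable_fun => x.
apply: (@continuous_comp _ _ _ (fun eta => s * eta) sin); last exact: continuous_sin.
by apply: (@continuousM _ _ (fun=> s) id); [exact: cst_continuous|exact: id].
Qed.

Lemma measurable_damp eps : measurable_fun setT (damp eps).
Proof. by apply: continuous_measurable_fun; exact: continuous_damp. Qed.

Lemma cintegrable_damp eps s : 0 < eps ->
  cintegrable mu setT (fun eta => (damp eps eta)%:C * expi (s * eta)).
Proof.
move=> e0; apply: (cintegrable_le measurableT _ (integrable_damp e0)).
  apply: cmeasM; split => /=; [exact: measurable_damp|exact: measurable_cst| |].
    exact: measurable_affine_cos.
  exact: measurable_affine_sin.
by move=> x _; rewrite ncM nc_expi mulr1 ncR ger0_norm// ltW// damp_gt0.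
Qed.

Lemma cintegral_damp eps s : 0 < eps ->
  cintegral mu setT (fun eta => (damp eps eta)%:C * expi (s * eta)) = (poisson eps s)%:C.
Proof.
move=> e0; have [i1 i2] := cintegrable_damp s e0.
have iD := integrable_damp e0.
apply: complex_eqP => /=.
- transitivity (\int[mu]_eta (damp eps eta * (1 + cos (s * eta)) - damp eps eta)).
    by apply: eq_Rintegral => x _; ring.
  have [h1 e1] := damp_cos s e0; have [h2 e2] := damp_cos 0 e0.
  rewrite RintegralB// e1.
  have : \int[mu]_eta (damp eps eta * (1 + cos (0 * eta))) = 2 * \int[mu]_eta damp eps eta.
    rewrite -RintegralZl//; apply: eq_Rintegral => x _; rewrite mul0r cos0; ring.
  rewrite e2 /poisson expr0n addr0 => h.
  have -> : \int[mu]_eta damp eps eta = 2 * eps^-1.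
    apply: (@mulfI _ 2); first by [].
    rewrite -h; field; exact: lt0r_neq0.
  by rewrite addrAC subrr add0r.
- pose f x := damp eps x * sin (s * x).
  have fE x : cIm ((damp eps x)%:C * expi (s * x)) = f x by rewrite !cE /= mul0r addr0.
  transitivity (\int[mu]_x f x); first by apply: eq_Rintegral => x _; rewrite mul0r addr0.
  have p : measure_preserving mu (-%R : R -> R).
    split; first exact: oppr_measurable.
    by move=> A mA; exact: (lebesgue_measureN mA).
  have ci : cintegrable mu setT (fun x => (f x)%:C).
    split; first by move: i2; under eq_fun do rewrite fE.
    exact: integrable0.
  have [_ e] := cintegral_preserving p ci.
  have /(congr1 (@complex.Re R)) /= := e.
  have -> : \int[mu]_x f (- x) = \int[mu]_x (-1 * f x).
    by apply: eq_Rintegral => x _; rewrite /f /damp normrN mulrN sinN; ring.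
  rewrite RintegralZl//; last by move: i2; under eq_fun do rewrite fE.
  lra.
Qed.

Lemma poisson_integral eps : 0 < eps ->
  mu.-integrable setT (fun s => (poisson eps s)%:E) /\ \int[mu]_s poisson eps s = 2 * pi.
Proof.
move=> e0.
have en0 : eps != 0 by rewrite gt_eqF.
have [] := @even_integral_halfline (poisson eps) (fun s => 2 * atan (eps^-1 * s + 0)) pi.
- by move=> x; exact: poisson_ge0.
- move=> x; apply: (@continuousM _ _ (fun=> 2 * eps) (fun s => (eps ^+ 2 + s ^+ 2)^-1)); first exact: cst_continuous.
  apply: continuousV; first by rewrite gt_eqF// poisson_den.
  apply: (@continuousD _ _ _ (fun=> eps ^+ 2) (fun s => s ^+ 2)); first exact: cst_continuous.
  exact: exprn_continuous.
- by move=> x; rewrite /poisson sqrrN.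
- move=> x x0; apply: (is_derive_eq (is_deriveZ 2 (is_derive_comp_affine (is_derive1_atan _)))).
  have := poisson_den x e0; rewrite /GRing.scale /= addr0 /poisson => d0.
  have d1 : 0 < 1 + (eps^-1 * x) ^+ 2 by rewrite ltr_wpDr ?sqr_ge0.
  have e1 : 1 + (eps^-1 * x) ^+ 2 = (eps ^+ 2 + x ^+ 2) / eps ^+ 2 by field.
  have dn0 : eps ^+ 2 + x ^+ 2 != 0 by rewrite gt_eqF.
  by rewrite e1; field; rewrite ?en0 ?dn0.
- have -> : pi = 2 * (pi / 2) :> R by rewrite mulrC divfK.
  apply: cvgMl_tmp; under eq_fun do rewrite addr0 mulrC.
  apply: (@cvg_comp _ _ _ (fun t : R => t * eps^-1) (@atan R) _ +oo); last exact: cvgy_atan.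
  by apply: gt0_cvgMly => //; rewrite invr_gt0.
- by move=> hi ->; split=> //; rewrite mulr0 addr0 atan0 mulr0 subr0.
Qed.

Lemma cvg_invS : (n.+1%:R^-1 : R) @[n --> \oo] --> 0. Proof. exact: cvg_harmonic. Qed.

(** After subtracting f(x), whose share is exact because the kernel has mass 2 pi, the remaining
    integrand tends to 0 pointwise under an integrable majorant independent of the parameter. *)
Lemma poisson_cvg (f : R -> R) (L M x : R) : continuous f ->
  (forall s t, `|f s - f t| <= L * `|s - t|) -> (forall t, `|f t| <= M) ->
  \int[mu]_s (f (x + s) * poisson n.+1%:R^-1 s) @[n --> \oo] --> 2 * pi * f x.
Proof.
move=> cf fL fM.
have L0 : 0 <= L by have := fL 0 1; rewrite sub0r normrN normr1 mulr1; apply: le_trans.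
have M0 : 0 <= M by apply: le_trans (fM 0).
have e0 n : (0 : R) < n.+1%:R^-1 by rewrite invr_gt0.
have mp n : measurable_fun setT (poisson n.+1%:R^-1).
  by have [/(measurable_int mu)/measurable_EFinP] := poisson_integral (e0 n).
have mf : measurable_fun setT (fun s => f (x + s) - f x).
  apply: measurable_funB; last exact: measurable_cst.
  apply: continuous_measurable_fun => s; apply: (@continuous_comp _ _ _ (fun s => x + s) f); last exact: cf.
  by apply: (@continuousD _ _ _ (fun=> x) id); [exact: cst_continuous|exact: id].
have fM2 s : `|f (x + s) - f x| <= 2 * M.
  by apply: le_trans (ler_normB _ _) _; rewrite mulr2n mulrDl !mul1r lerD.
have fL1 s : `|f (x + s) - f x| <= L * `|s|.
  by apply: le_trans (fL _ _) _; rewrite addrAC subrr add0r.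
pose h n s := (f (x + s) - f x) * poisson n.+1%:R^-1 s.
(* For |s| at most 1 the Lipschitz bound is used with 2 e |s| <= e^2 + s^2; for |s| larger than 1
   the uniform bound is used with e (1 + s^2) <= 2 s^2. *)
have hb n s : `|h n s| <= (2 * L + 8 * M) * bump1 s.
  rewrite /h normrM (ger0_norm (poisson_ge0 s (e0 n))) /poisson /bump1.
  set e := n.+1%:R^-1; have d := poisson_den s (e0 n : 0 < e).
  have e1 : e <= 1 by rewrite /e invf_le1// ler1n.
  have s1 : 0 < 1 + s ^+ 2 by rewrite ltr_pwDl// sqr_ge0.
  rewrite mulrA ler_pdivlMr// mulrAC ler_pdivrMr//.
  have [sle|sgt] := leP `|s| 1.
  - apply: (@le_trans _ _ (L * `|s| * (2 * e) * (1 + s ^+ 2))).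
      by rewrite !ler_wpM2r ?(ltW s1)// mulr_ge0// ltW// e0.
    rewrite -(real_normK (num_real s)).
    have e0' : 0 < e := e0 n; have := normr_ge0 s; move: (`|s|) sle => u u1 u0.
    have A : u * (2 * e) <= e ^+ 2 + u ^+ 2 by have := sqr_ge0 (e - u); nra.
    have B : u * (2 * e) * (1 + u ^+ 2) <= (e ^+ 2 + u ^+ 2) * 2.
      by apply: ler_pM => //; rewrite ?mulr_ge0 ?addr_ge0 ?sqr_ge0 ?(ltW e0')//; nra.
    have := ler_wpM2l L0 B; have : 0 <= M * (e ^+ 2 + u ^+ 2) by rewrite mulr_ge0// addr_ge0 ?sqr_ge0.
    by lra.
  - apply: (@le_trans _ _ (2 * M * (2 * e) * (1 + s ^+ 2))).
      by rewrite !ler_wpM2r ?(ltW s1)// mulr_ge0// ltW// e0.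
    rewrite -(real_normK (num_real s)).
    have e0' : 0 < e := e0 n; move: (`|s|) sgt => u u1.
    have A : e * (1 + u ^+ 2) <= 2 * u ^+ 2 by nra.
    have := ler_wpM2l M0 A; have : 0 <= M * e ^+ 2 by rewrite mulr_ge0// sqr_ge0.
    have : 0 <= L * (e ^+ 2 + u ^+ 2) by rewrite mulr_ge0// addr_ge0 ?sqr_ge0.
    by lra.
have hi n : mu.-integrable setT (fun s => (h n s)%:E).
  apply: le_integrable (integrableZl measurableT (2 * L + 8 * M) (@integrable_bump1 R)) => //.
    by apply/measurable_EFinP; exact: (measurable_funM mf (mp n)).
  by move=> s _ /=; rewrite lee_fin; apply: le_trans (hb n s) (ler_norm _).
have e n : \int[mu]_s (f (x + s) * poisson n.+1%:R^-1 s) =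
    \int[mu]_s h n s + 2 * pi * f x.
  have [pi1 <-] := poisson_integral (e0 n).
  rewrite -RintegralZr// -RintegralD//; [|exact: hi|exact: (integrableZr measurableT (f x) pi1)].
  by apply: eq_Rintegral => s _; rewrite /h; ring.
have -> : (fun n => \int[mu]_s (f (x + s) * poisson n.+1%:R^-1 s)) =
    (fun n => \int[mu]_s h n s + 2 * pi * f x) by apply/funext => n; exact: e.
rewrite -[X in _ --> X]add0r; apply: cvgD; last exact: cvg_cst.
have -> : 0 = \int[mu]_s (0 : R) by rewrite Rintegral_cst// mul0r.
apply: (@Rintegral_dominated _ _ _ mu _ measurableT h (fun=> 0) (fun s => (2 * L + 8 * M) * bump1 s)) => //.
- by move=> n; exact: (measurable_funM mf (mp n)).
- move=> s _; have [->|s0] := eqVneq s 0.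
    by rewrite /h addr0 subrr; under eq_fun do rewrite mul0r; exact: cvg_cst.
  rewrite /h -[X in _ --> X](mulr0 (f (x + s) - f x)); apply: cvgMl_tmp.
  apply: (@squeeze_cvgr _ _ _ _ (cst 0) (fun n => n.+1%:R^-1 * (2 * s ^- 2))).
  + apply: nearW => n; rewrite poisson_ge0//= /poisson mulrC mulrA [X in _ <= X]mulrC.
    rewrite [X in X <= _](_ : _ = 2 * n.+1%:R^-1 * (n.+1%:R^-1 ^+ 2 + s ^+ 2)^-1); last by rewrite mulrC.
    rewrite [X in _ <= X](_ : _ = 2 * n.+1%:R^-1 * s ^- 2); last by ring.
    have s2 : 0 < s ^+ 2 by rewrite exprn_even_gt0.
    rewrite ler_wpM2l ?mulr_ge0 ?(ltW (e0 n))// lef_pV2 ?posrE ?poisson_den//.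
    by rewrite lerDr sqr_ge0.
  + exact: cvg_cst.
  + by rewrite -[X in _ --> X](mul0r (2 * s ^- 2)); apply: cvgMr_tmp; exact: cvg_invS.
- exact: (integrableZl measurableT _ (@integrable_bump1 R)).
Qed.

End PoissonKernel.

(** * Fourier inversion for the cutoffs *)

Section CutoffInversion.
Variable R : realType.
Local Notation mu := (@lebesgue_measure R).
Local Notation pt := 'rV[R]_3.

Definition hat1 (f : R -> R) (eta : R) : R[i] :=
  cintegral mu setT (fun t => expi (- (t * eta)) * (f t)%:C).

                                                                                     
                                         
(** The damping makes the double integral absolutely convergent; exchanging the order, the inner
    integral over frequencies is the Poisson kernel. *)
Lemma damped_inversion (f : R -> R) (eps x : R) : 0 < eps -> continuous f ->
  mu.-integrable setT (fun t => (f t)%:E) ->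
  cintegrable mu setT (fun eta => (damp eps eta)%:C * (expi (x * eta) * hat1 f eta)) /\
  cintegral mu setT (fun eta => (damp eps eta)%:C * (expi (x * eta) * hat1 f eta)) =
  (\int[mu]_s (f (x + s) * poisson eps s))%:C.
Proof.
move=> e0 cf fi; have iD := integrable_damp e0.
pose g (z : measurableTypeR R * measurableTypeR R) : R[i] :=
  (damp eps z.1)%:C * expi ((x - z.2) * z.1) * (f z.2)%:C.
have mf : measurable_fun setT f by exact: continuous_measurable_fun.
have m1 : measurable_fun setT (fst : measurableTypeR R * measurableTypeR R -> measurableTypeR R).
  exact: measurable_fst.
have m2 : measurable_fun setT (snd : measurableTypeR R * measurableTypeR R -> measurableTypeR R).
  exact: measurable_snd.
have mphase : measurable_fun setT (fun z : measurableTypeR R * measurableTypeR R => (x - z.2) * z.1 : R).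
  by apply: measurable_funM => //; apply: measurable_funB => //; exact: measurable_cst.
have mcos : measurable_fun setT (@cos R) by apply: continuous_measurable_fun; exact: continuous_cos.
have msin : measurable_fun setT (@sin R) by apply: continuous_measurable_fun; exact: continuous_sin.
have mg : cmeas setT g.
  apply: cmeasM.
    apply: cmeasM; split; [|exact: measurable_cst| |].
    - exact: (measurableT_comp (@measurable_damp R eps) m1).
    - exact: (measurableT_comp mcos mphase).
    - exact: (measurableT_comp msin mphase).
  by split; [exact: (measurableT_comp mf m2)|exact: measurable_cst].
have nf : mu.-integrable setT (fun t => (`|f t|)%:E) by exact: (integrable_abse fi).
have ig : cintegrable (mu \x mu)%E setT g.
  apply: (cintegrable_le measurableT mg (integrable_prod iD nf)) => z _.
  by rewrite /g !ncM nc_expi mulr1 !ncR (ger0_norm (ltW (damp_gt0 _ _))).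
have fc : cintegrable mu setT (fun t => (f t)%:C).
  by split=> //=; exact: integrable0.
have i2 eta : cintegrable mu setT (fun t => g (eta, t)).
  apply: (cintegrable_le measurableT _ (integrableZl measurableT (damp eps eta) nf)) => [|t _].
    apply: cmeasM; last exact: cintegrable_meas fc.
    apply: cmeasM; first exact: (cmeas_cst _ (damp eps eta)%:C).
    have m : measurable_fun setT (fun t : R => (x - t) * eta).
      by apply: measurable_funM => //; [apply: measurable_funB => //; exact: measurable_cst].
    by split; [exact: (measurableT_comp mcos m)|exact: (measurableT_comp msin m)].
  by rewrite /g !ncM nc_expi mulr1 !ncR (ger0_norm (ltW (damp_gt0 _ _))).
have i1 t : cintegrable mu setT (fun eta => g (eta, t)).
  rewrite /g /=; under eq_fun do rewrite mulrC.
  exact: (cintegrableZ measurableT _ (cintegrable_damp (x - t) e0)).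
have [j e] := cintegral_fubini ig i2 i1.
have inner eta : cintegral mu setT (fun t => g (eta, t)) =
    (damp eps eta)%:C * (expi (x * eta) * hat1 f eta).
  have If : cintegrable mu setT (fun t => expi (- (t * eta)) * (f t)%:C).
    apply: (cintegrable_le measurableT _ nf) => [|t _].
      apply: cmeasM; last exact: cintegrable_meas fc.
      have m : measurable_fun setT (fun t : R => - (t * eta)).
        by apply: measurable_funN; apply: measurable_funM.
      by split; [exact: (measurableT_comp mcos m)|exact: (measurableT_comp msin m)].
    by rewrite ncM nc_expi mul1r ncR.
  rewrite mulrA /hat1 -(cintegralZ measurableT _ If).
  by apply: eq_cintegral => t _; rewrite /g mulrA mulrBl expiD !mulrA.
split; first by move: j; under eq_fun do rewrite inner.
move: e; under [in LHS]eq_cintegral do [rewrite inner].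
move=> ->; transitivity (cintegral mu setT (fun t => (f t * poisson eps (x - t))%:C)).
  apply: eq_cintegral => t _; rewrite /g /=.
  transitivity (cintegral mu setT (fun eta => (f t)%:C * ((damp eps eta)%:C * expi ((x - t) * eta)))).
    by apply: eq_cintegral => eta _; rewrite mulrC.
  rewrite cintegralZ//; last exact: cintegrable_damp.
  by rewrite cintegral_damp// -rmorphM.
rewrite cintegral_real; congr (_%:C).
have [p1 _] := poisson_integral e0.
pose h t := f t * poisson eps (x - t).
have hc : cintegrable mu setT (fun t => (h t)%:C).
  have mh : measurable_fun setT h.
    apply: measurable_funM => //.
    have mp : measurable_fun setT (poisson eps) by have /(measurable_int mu)/measurable_EFinP := p1.
    by apply: (measurableT_comp mp); apply: measurable_funB => //; exact: measurable_cst.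
  apply: (@cintegrable_le _ _ _ mu setT measurableT _ (fun t => (2 * eps / eps ^+ 2) * `|f t|)).
  - by split => //=; exact: measurable_cst.
  - exact: (integrableZl measurableT _ nf).
  - move=> t _; rewrite ncR /h normrM mulrC ler_wpM2r// ger0_norm ?poisson_ge0//.
    rewrite /poisson ler_wpM2l ?mulr_ge0 ?(ltW e0)// lef_pV2 ?posrE ?poisson_den ?exprn_gt0//.
    by rewrite lerDl sqr_ge0.
have [_ e2] := cintegral_preserving (measure_preserving_shift x) hc.
have := congr1 (@complex.Re R) e2; rewrite /= => <-.
apply: eq_Rintegral => s _; rewrite /h addrC; congr (f _ * _).
by rewrite /poisson; congr (_ / (_ + _)); ring.
Qed.

Definition plateau_at (c r t : R) : R := plateau ((t - c) / r).

Lemma continuous_plateau_at c r : continuous (plateau_at c r).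
Proof.
have := @diffn_affine R 0 (@plateau R) r^-1 (- (c / r)) (diffn_plateau R 0).
by rewrite /=; under eq_fun do rewrite mulrC -mulrBl.
Qed.

(** [plateau] is the restriction of the three-dimensional cutoff to a coordinate axis, and a partial
    derivative of a test function is bounded. *)
Lemma plateau_lipschitz : exists L : R, forall s t, `|plateau s - plateau t| <= L * `|s - t| :> R.
Proof.
have tc := @test_cutoff R 0 1 setT ltr01 (@subsetT _ _).
have [M [_ gM]] := test_bounded (test_fun_cpartial 0 tc).
have E (t : R) : cutoff 0 1 (0 + t *: delta_mx 0 0 : pt) = (plateau t)%:C.
  rewrite add0r /cutoff (bigD1 0)//= big1 ?mulr1.
    by rewrite !mxE /= mulr1 subr0 divr1.
  move=> k k0; rewrite !mxE (negbTE k0) andbF mulr0 subr0 mul0r plateau1// normr0.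
  exact: ler01.
exists (2 * M) => s t.
have := @cpartial_lipschitz R 3 0 (cutoff 0 1) M (0 + t *: delta_mx 0 0) (s - t) (smooth_cutoff _ _) gM.
rewrite -addrA -scalerDl [t + _]addrC subrK !E -rmorphB ncR.
exact.
Qed.

Lemma plateau_bounded : exists M : R, forall t, `|plateau t| <= M :> R.
Proof.
have [L PL] := plateau_lipschitz; exists (L * 4 + `|L| * 4) => t.
have L0 : 0 <= L by have := PL 0 1; rewrite sub0r normrN normr1 mulr1; apply: le_trans.
have [t2|t2] := leP 2 `|t|; first by rewrite plateau0// normr0 addr_ge0// mulr_ge0.
have := PL t 2; rewrite [plateau 2]plateau0 ?subr0; last by rewrite ger0_norm.
move=> /le_trans; apply.
rewrite (ger0_norm L0) -[leLHS]addr0 lerD ?mulr_ge0// ler_wpM2l//.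
by apply: le_trans (ler_normB _ _) _; rewrite (@ger0_norm _ 2)//; lra.
Qed.

Lemma integrable_plateau_at c r : 0 < r -> mu.-integrable setT (fun t => (plateau_at c r t)%:E).
Proof.
move=> r0; have [M PM] := plateau_bounded.
have M0 : 0 <= M := le_trans (normr_ge0 _) (PM 0).
pose a := `|c| + 2 * r.
have a0 : 0 <= a by rewrite addr_ge0// mulr_ge0// ltW.
apply: le_integrable (integrableZl measurableT (M * (1 + a ^+ 2)) (@integrable_bump1 R)) => //.
  by apply/measurable_EFinP; apply: continuous_measurable_fun; exact: continuous_plateau_at.
move=> t _; rewrite /= lee_fin; apply: le_trans (ler_norm _).
have [ta|ta] := leP `|t| a.
  apply: le_trans (PM _) _; rewrite -mulrA ler_peMr// /bump1 ler_pdivlMr ?mul1r; last first.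
    by rewrite ltr_pwDl// sqr_ge0.
  by rewrite lerD2l -(real_normK (num_real t)) lerXn2r ?nnegrE.
rewrite /plateau_at plateau0 ?normr0 ?mulr_ge0 ?addr_ge0 ?sqr_ge0 ?(ltW (bump1_gt0 _))//.
rewrite normrM normfV (gtr0_norm r0) ler_pdivlMr//.
have := lerB_dist t c; move: ta; rewrite /a; lra.
Qed.

Lemma cutoffE c r (x : pt) : cutoff c r x =
  (plateau_at (c 0 0) r (x 0 0))%:C * (plateau_at (c 0 1) r (x 0 1))%:C *
  (plateau_at (c 0 2) r (x 0 2))%:C.
Proof.
rewrite /cutoff !big_ord_recl big_ord0 mulr1 mulrA.
have e1 : lift ord0 ord0 = 1 :> 'I_3 by apply/val_inj.
have e2 : lift ord0 (lift ord0 ord0) = 2 :> 'I_3 by apply/val_inj.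
by rewrite e1 e2.
Qed.

Lemma dot3 (x y : pt) : dot x y = x 0 0 * y 0 0 + x 0 1 * y 0 1 + x 0 2 * y 0 2.
Proof.
rewrite /dot !big_ord_recl big_ord0 addr0 addrA.
by congr (_ + _ + _); congr (x 0 _ * y 0 _); apply/val_inj.
Qed.

Lemma hat_cutoff c r (xi : pt) : 0 < r -> hat (cutoff c r) xi =
  hat1 (plateau_at (c 0 0) r) (xi 0 0) * hat1 (plateau_at (c 0 1) r) (xi 0 1) *
  hat1 (plateau_at (c 0 2) r) (xi 0 2).
Proof.
move=> r0.
have H (a b : R) : cintegrable mu setT (fun t => expi (- (t * b)) * (plateau_at a r t)%:C).
  have ip := integrable_plateau_at a r0.
  apply: (cintegrable_le measurableT _ (integrable_abse ip)) => [|t _]; last first.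
    by rewrite ncM nc_expi mul1r ncR.
  apply: cmeasM.
    have m : measurable_fun setT (fun t : R => - (t * b)).
      by apply: measurable_funN; apply: measurable_funM.
    have mcos : measurable_fun setT (@cos R) by apply: continuous_measurable_fun; exact: continuous_cos.
    have msin : measurable_fun setT (@sin R) by apply: continuous_measurable_fun; exact: continuous_sin.
    by split; [exact: (measurableT_comp mcos m)|exact: (measurableT_comp msin m)].
  split; last exact: measurable_cst.
  by apply: continuous_measurable_fun; exact: continuous_plateau_at.
rewrite /hat1 -integral3_prod//; apply: eq_integral3 => x.
rewrite cutoffE dot3 !opprD !expiD; ring.
Qed.

Lemma mulr_tensor (K : comRingType) (a1 a2 a3 b1 b2 b3 c1 c2 c3 : K) :
  a1 * (b1 * c1) * (a2 * (b2 * c2)) * (a3 * (b3 * c3)) =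
  a1 * a2 * a3 * (b1 * b2 * b3 * (c1 * c2 * c3)).
Proof. ring. Qed.

(** The damped inversion integral is evaluated in two ways as the damping disappears: by dominated
    convergence, since the transform of the cutoff is integrable, and as a product of three
    one-dimensional Poisson limits, since cutoff and damping are tensor products. *)
Lemma cutoff_inversion c r (x : pt) : 0 < r ->
  integral3 (fun xi => expi (dot x xi) * hat (cutoff c r) xi) =
  ((2 * pi) ^+ 3)%:C * cutoff c r x.
Proof.
move=> r0; have tc := @test_cutoff R c r setT r0 (@subsetT _ _).
have [M [M0 hM]] := hat_decay 1 tc.
have ch := ccont_hat tc.
have e0 n : (0 : R) < n.+1%:R^-1 by rewrite invr_gt0.
pose D n (xi : pt) : R := damp n.+1%:R^-1 (xi 0 0) * damp n.+1%:R^-1 (xi 0 1) * damp n.+1%:R^-1 (xi 0 2).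
pose G (xi : pt) : R[i] := expi (dot x xi) * hat (cutoff c r) xi.
have cG : ccont G.
  apply: ccontM => //; under eq_fun do rewrite dotC.
  by apply: ccont_expi; exact: continuous_dot.
have cdamp n (k : 'I_3) : continuous (fun xi : pt => damp n.+1%:R^-1 (xi 0 k)).
  move=> xi; apply: (@continuous_comp _ _ _ (fun xi : pt => xi 0 k) (damp n.+1%:R^-1) xi).
    exact: coord_continuous.
  exact: continuous_damp.
have D0 n xi : 0 <= D n xi by rewrite !mulr_ge0// ltW// damp_gt0.
have D1 n xi : D n xi <= 1.
  by rewrite /D !mulr_ile1// ?mulr_ge0 ?damp_le1// ltW// damp_gt0.
have lim1 : ccvg \oo (fun n => integral3 (fun xi => (D n xi)%:C * G xi)) (integral3 G).
  apply: (@integral3_dominated _ _ _ M) => //.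
  - move=> n; apply: ccontM => //; split; last by move=> ?; exact: cst_continuous.
    move=> xi; apply: (@continuousM _ _
      (fun xi : pt => damp n.+1%:R^-1 (xi 0 0) * damp n.+1%:R^-1 (xi 0 1))
      (fun xi : pt => damp n.+1%:R^-1 (xi 0 2))); last exact: cdamp.
    by apply: (@continuousM _ _ (fun xi : pt => damp n.+1%:R^-1 (xi 0 0)) (fun xi : pt => damp n.+1%:R^-1 (xi 0 1))); exact: cdamp.
  - move=> xi; rewrite -[X in ccvg _ _ X]mul1r; apply: ccvgM; last exact: ccvg_cst.
    have h (a : R) : damp n.+1%:R^-1 a @[n --> \oo] --> (1 : R).
      rewrite -[X in _ --> X](@expR0 R); apply: continuous_cvg; first exact: continuous_expR.
      rewrite -[X in _ --> X](mul0r `|a|); apply: cvgMr_tmp.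
      by rewrite -[X in _ --> X]oppr0; apply: cvgN; exact: cvg_invS.
    suff /ccvgR : D n xi @[n --> \oo] --> (1 : R) by [].
    rewrite (_ : (1 : R) = 1 * 1 * 1); last by rewrite !mulr1.
    by apply: cvgM => //; exact: cvgM.
  - move=> n xi; rewrite ncM ncR (ger0_norm (D0 n xi)) -[leRHS]mul1r ler_pM//.
    by rewrite /G ncM nc_expi mul1r; apply: le_trans (hM xi) _; rewrite expr1.
have lim2 : ccvg \oo (fun n => integral3 (fun xi => (D n xi)%:C * G xi))
   (((2 * pi) ^+ 3)%:C * cutoff c r x).
  have [L PL] := plateau_lipschitz; have [M' PM] := plateau_bounded.
  have key (k : 'I_3) : ccvg \oo (fun n => cintegral mu setT (fun eta => (damp n.+1%:R^-1 eta)%:C *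
       (expi (x 0 k * eta) * hat1 (plateau_at (c 0 k) r) eta)))
       (2 * pi * plateau_at (c 0 k) r (x 0 k))%:C.
    under [X in ccvg _ X]eq_fun do rewrite (damped_inversion _ (e0 _) (@continuous_plateau_at _ _) (integrable_plateau_at _ r0)).2.
    apply: ccvgR; apply: (@poisson_cvg _ _ (`|L| / r) M').
    - exact: continuous_plateau_at.
    - move=> s t; apply: le_trans (PL _ _) _; rewrite -mulrBl.
      rewrite (_ : s - c 0 k - (t - c 0 k) = s - t); last by ring.
      rewrite normrM normfV (gtr0_norm r0) mulrA mulrAC ler_wpM2r//.
      by rewrite ler_wpM2r ?invr_ge0 ?(ltW r0)// ler_norm.
    - by move=> t; exact: PM.
  have H := ccvgM (ccvgM (key 0) (key 1)) (key 2).
  have -> : ((2 * pi) ^+ 3)%:C * cutoff c r x = (2 * pi * plateau_at (c 0 0) r (x 0 0))%:C *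
    (2 * pi * plateau_at (c 0 1) r (x 0 1))%:C * (2 * pi * plateau_at (c 0 2) r (x 0 2))%:C.
    rewrite cutoffE -!rmorphM /=; congr (_%:C); ring.
  move: {H}(H (eventually_filter) (eventually_filter)); apply: near_ccvg; apply: nearW => n; rewrite -integral3_prod; last 3 first.
  - exact: (damped_inversion _ (e0 _) (@continuous_plateau_at _ _) (integrable_plateau_at _ r0)).1.
  - exact: (damped_inversion _ (e0 _) (@continuous_plateau_at _ _) (integrable_plateau_at _ r0)).1.
  - exact: (damped_inversion _ (e0 _) (@continuous_plateau_at _ _) (integrable_plateau_at _ r0)).1.
  apply: eq_integral3 => xi; rewrite /D /G hat_cutoff// dot3 !expiD !rmorphM.
  by rewrite mulr_tensor.
exact: (ccvg_unique lim1 lim2).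
Qed.

End CutoffInversion.

(** * Euclidean norm and Peetre's inequality *)

Section EuclideanNorm.
Variable R : realType.
Local Notation pt := 'rV[R]_3.
Implicit Types (x y : pt).

Lemma dot_ge0 x : 0 <= dot x x.
Proof. by apply: sumr_ge0 => i _; rewrite -expr2 sqr_ge0. Qed.

Lemma enorm_ge0 x : 0 <= enorm x. Proof. exact: sqrtr_ge0. Qed.

Lemma enorm_sqr x : enorm x ^+ 2 = dot x x. Proof. by rewrite sqr_sqrtr// dot_ge0. Qed.

Lemma enormN x : enorm (- x) = enorm x.
Proof. by rewrite /enorm dotNl dotNr opprK. Qed.

Lemma enormZ (a : R) x : enorm (a *: x) = `|a| * enorm x.
Proof. by rewrite /enorm dotZl dotZr mulrA -expr2 sqrtrM ?sqr_ge0// sqrtr_sqr. Qed.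

                                                 
(** Cauchy-Schwarz through Lagrange's identity: the deficit is the sum of the squares of the three
    minors. *)
Lemma dot_le_enorm x y : dot x y <= enorm x * enorm y.
Proof.
rewrite -sqrtrM ?dot_ge0//; apply: le_trans (ler_norm _) _; rewrite -sqrtr_sqr.
rewrite ler_sqrt ?mulr_ge0 ?dot_ge0// !dot3; set a := x 0 0; set b := x 0 1; set c := x 0 2.
set a' := y 0 0; set b' := y 0 1; set c' := y 0 2.
have := sqr_ge0 (a * b' - b * a'); have := sqr_ge0 (a * c' - c * a').
have := sqr_ge0 (b * c' - c * b'); lra.
Qed.

Lemma enormD x y : enorm (x + y) <= enorm x + enorm y.
Proof.
rewrite -(@ler_pXn2r _ 2)// ?nnegrE ?addr_ge0 ?enorm_ge0//.
rewrite enorm_sqr dotDl !dotDr sqrrD !enorm_sqr (dotC y x) mulr2n.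
have := dot_le_enorm x y; lra.
Qed.

Lemma enorm_coord x k : `|x 0 k| <= enorm x.
Proof.
rewrite -sqrtr_sqr ler_sqrt ?dot_ge0// /dot (bigD1 k)//= -expr2 lerDl.
by apply: sumr_ge0 => i _; rewrite -expr2 sqr_ge0.
Qed.

(** (1 + |x|)^2 <= 2 (1 + |x|^2), and expanding the product of the 1 + x_k^2 gives at least 1 +
    |x|^2. *)
Lemma bracket_bump3 x : (1 + enorm x) ^+ 4 <= 4 * (bump3 x)^-1 ^+ 2.
Proof.
have E : (1 + enorm x) ^+ 2 <= 2 * (bump3 x)^-1.
  rewrite bump3E !invfM /bump1 !invrK; have := enorm_sqr x; rewrite dot3.
  have := enorm_ge0 x; move: (enorm x) => e e0.
  set a := x 0 0; set b := x 0 1; set c := x 0 2 => h.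
  have := sqr_ge0 (e - 1); have := mulr_ge0 (sqr_ge0 a) (sqr_ge0 b).
  have := mulr_ge0 (sqr_ge0 a) (sqr_ge0 c); have := mulr_ge0 (sqr_ge0 b) (sqr_ge0 c).
  have := mulr_ge0 (mulr_ge0 (sqr_ge0 a) (sqr_ge0 b)) (sqr_ge0 c); lra.
have -> : 4 * (bump3 x)^-1 ^+ 2 = (2 * (bump3 x)^-1) ^+ 2 by ring.
rewrite (exprM _ 2 2) lerXn2r// nnegrE.
  by rewrite exprn_ge0// addr_ge0// enorm_ge0.
by rewrite mulr_ge0// invr_ge0 ltW// bump3_gt0.
Qed.

(** If a and b are comparable up to the factor c in both directions, so are their powers; the sign
    of the exponent decides which direction is used. [bracket_peetre] is the classical case a = 1 +
    |x + y|, b = 1 + |x|, c = 1 + |y|. *)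
Lemma powR_peetre (a b c o : R) N : 0 < a -> 0 < b -> 1 <= c -> a <= b * c -> b <= a * c ->
  `|o| <= N%:R -> a `^ o <= b `^ o * c ^+ N.
Proof.
move=> a0 b0 c1 abc bac; rewrite ler_norml => /andP[oN1 oN2].
have c0 : 0 < c by exact: lt_le_trans c1.
have H p : 0 <= p -> p <= N%:R -> c `^ p <= c ^+ N.
  by move=> p0 pN; rewrite -powR_mulrn ?(ltW c0)// ler_powR.
have [po|no] := leP 0 o.
- apply: (@le_trans _ _ ((b * c) `^ o)).
    by apply: ge0_ler_powR => //; rewrite nnegrE ?mulr_ge0// ltW.
  rewrite powRM ?(ltW b0) ?(ltW c0)//; apply: ler_wpM2l; [exact: powR_ge0|exact: H].
- have p0 : 0 <= - o by rewrite oppr_ge0 ltW.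
  have pN : - o <= N%:R by rewrite lerNl.
  have h : b `^ (- o) <= a `^ (- o) * c ^+ N.
    apply: (@le_trans _ _ ((a * c) `^ (- o))).
      by apply: ge0_ler_powR => //; rewrite nnegrE ?mulr_ge0// ltW.
    by rewrite powRM ?(ltW a0) ?(ltW c0)//; apply: ler_wpM2l; [exact: powR_ge0|exact: H].
  move: h; rewrite !powRN ler_pdivlMl ?powR_gt0// ler_pdivrMr ?powR_gt0//.
  by rewrite mulrC.
Qed.

Lemma bracket_peetre (o : R) N x y : `|o| <= N%:R ->
  (1 + enorm (x + y)) `^ o <= (1 + enorm x) `^ o * (1 + enorm y) ^+ N.
Proof.
move=> oN; have e0 := enorm_ge0.
apply: powR_peetre => //; rewrite ?ltr_pwDl ?lerDl//.
  have := enormD x y; have := mulr_ge0 (e0 x) (e0 y); lra.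
have := enormD (x + y) (- y); rewrite addrK enormN; have := mulr_ge0 (e0 (x + y)) (e0 y); lra.
Qed.

End EuclideanNorm.

(** * Fourier decay of compactly supported Lipschitz functions *)

Section LipschitzTransform.
Variable R : realType.
Local Notation pt := 'rV[R]_3.
Local Notation e_ k := (delta_mx 0 k : pt).

Lemma ord3P (k : 'I_3) : [\/ k = 0, k = 1 | k = 2].
Proof.
by case: k => -[|[|[|//]]] kP; [apply: Or31|apply: Or32|apply: Or33]; apply/val_inj.
Qed.

Lemma sum3 (V : nmodType) (F : 'I_3 -> V) : \sum_k F k = F 0 + F 1 + F 2.
Proof.
rewrite !big_ord_recl big_ord0 addr0 addrA.
by congr (_ + _ + _); congr (F _); apply/val_inj.
Qed.

Lemma row3_dist1 (g : pt -> R[i]) (L : R) :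
  (forall x k t, nc (g (x + t *: e_ k) - g x) <= L * `|t|) ->
  forall x y, nc (g x - g y) <= L * dist1 x y.
Proof.
move=> gL x y.
pose a (k : 'I_3) : R := x 0 k - y 0 k.
pose y1 : pt := y + a 0 *: e_ 0; pose y2 : pt := y1 + a 1 *: e_ 1.
have xE : x = y2 + a 2 *: e_ 2.
  by apply/rowP => k; case: (ord3P k) => ->; rewrite !mxE -?val_eqE /= /a; ring.
have -> : g x - g y = (g x - g y2) + (g y2 - g y1) + (g y1 - g y) by ring.
have -> : dist1 x y = `|a 2| + `|a 1| + `|a 0|.
  by rewrite /dist1 sum3 /a; ring.
apply: le_trans (ncD _ _) _; rewrite !mulrDr lerD ?gL//.
apply: le_trans (ncD _ _) _; rewrite lerD ?gL//.
by rewrite {1}xE gL.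
Qed.

Lemma ccontB (V : topologicalType) (g h : V -> R[i]) : ccont g -> ccont h ->
  ccont (fun y => g y - h y).
Proof.
move=> cg ch; rewrite (_ : (fun y => _) = fun y => g y + (- 1) * h y).
  by apply: ccontD => //; apply: ccontM => //; exact: ccont_cst.
by apply/funext => y; rewrite mulN1r.
Qed.

Lemma integral3B (g h : pt -> R[i]) : tame g -> tame h ->
  integral3 (fun x => g x - h x) = integral3 g - integral3 h.
Proof.
move=> tg th; rewrite -mulN1r -integral3Z// -integral3D//; last exact: tameZ.
by apply: eq_integral3 => x; rewrite mulN1r.
Qed.

                                                                             
                                                    
(** Translating by t e_k with t xi_k = pi flips the sign of the exponential, so twice the transform
    is the transform of g(x) - g(x + t e_k), which is of size L |t|. One power of decay is thus
    obtained from Lipschitz regularity alone. *)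
Lemma hat_lipschitz (g : pt -> R[i]) (r L : R) (xi : pt) (k : 'I_3) :
  0 <= r -> ccont g -> (forall x, g x != 0 -> forall j, `|x 0 j| <= r) ->
  (forall x, nc (g x) <= L) -> (forall x t, nc (g (x + t *: e_ k) - g x) <= L * `|t|) ->
  nc (hat g xi) * (1 + `|xi 0 k|) <= L * (8 * (1 + (r + 1) ^+ 2) ^+ 3 * mass3 R).
Proof.
move=> r0 cg gr gL gl.
have L0 : 0 <= L by exact: le_trans (nc_ge0 _) (gL 0).
have r1 : 0 <= r + 1 by lra.
have tg : tame g.
  by split=> //; exists (L * (1 + r ^+ 2) ^+ 3) => x; exact: bump3_support.
set B := (1 + (r + 1) ^+ 2) ^+ 3.
have rB : (1 + r ^+ 2) ^+ 3 <= B.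
  by rewrite lerXn2r// ?nnegrE ?addr_ge0 ?sqr_ge0// lerD2l lerXn2r// ?nnegrE// lerDl.
have B0 : 0 <= B by rewrite exprn_ge0// addr_ge0// sqr_ge0.
have m0 := mass3_ge0 R.
have h1 : nc (hat g xi) <= L * B * mass3 R.
  apply: nc_integral3; first by apply: ccontM => //; exact: ccont_expiN.
  move=> x; rewrite ncM nc_expi mul1r.
  apply: le_trans (bump3_support L0 gL gr x) _.
  by rewrite ler_wpM2r ?(ltW (bump3_gt0 x))// ler_wpM2l.
have LBm : 0 <= L * B * mass3 R by exact: mulr_ge0 (mulr_ge0 L0 B0) m0.
(* The threshold 4 exceeds pi, so above it the shift has length at most 1 and the support grows to r
   + 1 at most; below it the trivial bound suffices. *)
have [x4|x4] := leP `|xi 0 k| 4.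
  apply: (@le_trans _ _ (L * B * mass3 R * (1 + 4))).
    by rewrite ler_pM ?nc_ge0 ?addr_ge0// lerD2l.
  by rewrite (_ : _ * (8 * _ * _) = L * B * mass3 R * 8); [rewrite ler_wpM2l//; lra|ring].
have xk0 : xi 0 k != 0 by rewrite -normr_gt0; apply: lt_trans x4.
pose t := pi / xi 0 k.
have tn : `|t| = pi / `|xi 0 k| by rewrite normrM normfV (gtr0_norm (pi_gt0 R)).
have t1 : `|t| <= 1.
  rewrite tn ler_pdivrMr ?normr_gt0// mul1r; apply: le_trans (ltW x4).
  by have := @pihalf_02 R; lra.
have gv x j : g (x + t *: e_ k) != 0 -> `|x 0 j| <= r + 1.
  move=> /gr/(_ j); rewrite !mxE => h; have : `|t * (j == k)%:R| <= 1.
    by rewrite normrM; case: (j == k); rewrite /= ?normr0 ?mulr0// normr1 mulr1.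
  have := lerB_normD (x 0 j) (t * (j == k)%:R); move: h; rewrite /=; lra.
have tgv : tame (fun x => g (x + t *: e_ k)).
  split; first exact: ccont_shift.
  exists (L * B) => x.
  by apply: (@bump3_support R (fun x => g (x + t *: e_ k)) L (r + 1)) => // y yn j; exact: gv.
have e : hat g xi = - integral3 (fun x => expi (- dot x xi) * g (x + t *: e_ k)).
  rewrite {1}/hat -(integral3_shift (t *: e_ k)); last exact: tame_hat.
  rewrite -mulN1r -integral3Z//; last exact: tame_hat.
  apply: eq_integral3 => x.
  by rewrite dotDl dotZl dot_delta /t divfK// opprD expiD [expi (- pi)]expiN expi_pi rmorphN rmorph1 mulrN1 mulNr mulN1r.
have e2 : 2 * hat g xi = integral3 (fun x => expi (- dot x xi) * (g x - g (x + t *: e_ k))).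
  rewrite mulr2n mulrDl mul1r {2}e -integral3B; [|exact: tame_hat..].
  by apply: eq_integral3 => x; rewrite mulrBr.
have h2 : 2 * nc (hat g xi) <= L * `|t| * B * mass3 R.
  have <- : nc (2 * hat g xi) = 2 * nc (hat g xi).
    by rewrite ncM (_ : 2 = (2 : R)%:C) ?ncR ?ger0_norm// rmorph_nat.
  rewrite e2; apply: nc_integral3.
    apply: ccontM; first exact: ccont_expiN.
    by apply: ccontB => //; exact: tgv.1.
  apply: bump3_support => //; first by rewrite mulr_ge0.
    by move=> x; rewrite ncM nc_expi mul1r nc_subC.
  move=> x xn j; apply: contraNT xn; rewrite -ltNge => rx.
  have z1 : g x = 0.
    by apply/eqP; apply: contraTT rx => /gr/(_ j); rewrite -leNgt => /le_trans; apply; rewrite lerDl.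
  have z2 : g (x + t *: e_ k) = 0.
    by apply/eqP; apply: contraTT rx => /gv; rewrite -leNgt.
  by rewrite z1 z2 subr0 mulr0.
have h3 : `|t| * (1 + `|xi 0 k|) <= 16.
  have p4 : (pi : R) < 4 by have := @pihalf_02 R; lra.
  rewrite tn -mulrA mulrDr mulr1 mulVf ?normr_eq0// mulrDr mulr1.
  have : pi / `|xi 0 k| <= 4 by rewrite -tn (le_trans t1)// ler1n.
  lra.
have := ler_wpM2r (_ : 0 <= 1 + `|xi 0 k|) h2; rewrite addr_ge0// => /(_ isT).
have := ler_wpM2l LBm h3; lra.
Qed.

End LipschitzTransform.

(** * Symbol estimates in the form used below *)

Section SymbolSlices.
Variable R : realType.
Local Notation pt := 'rV[R]_3.
Local Notation e_ k := (delta_mx 0 k : pt).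

Lemma row_mx_line (x xi : pt) k (t : R) :
  row_mx (x + t *: e_ k) xi = row_mx x xi + t *: delta_mx 0 (lshift 3 k).
Proof.
apply/rowP => i; rewrite !mxE; case: split_ordP => i' ->; rewrite ?mxE /=.
  by rewrite eq_lshift.
by rewrite eq_rlshift mulr0 addr0.
Qed.

Lemma continuous_comb3 (T : topologicalType) (V : normedModType R) (w v0 v1 v2 : V)
    (f0 f1 f2 : T -> R) : continuous f0 -> continuous f1 -> continuous f2 ->
  continuous (fun z => w + f0 z *: v0 + f1 z *: v1 + f2 z *: v2).
Proof.
move=> c0 c1 c2 z; apply: cvgD; last by apply: cvgZr_tmp; exact: c2.
apply: cvgD; last by apply: cvgZr_tmp; exact: c1.
by apply: cvgD; [exact: cvg_cst|apply: cvgZr_tmp; exact: c0].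
Qed.

Lemma continuous_row_mx (x : pt) : continuous (fun xi : pt => row_mx x xi : 'rV[R]_(3 + 3)).
Proof.
rewrite (_ : (fun xi : pt => _) = fun xi => row_mx x 0 + xi 0 0 *: delta_mx 0 (rshift 3 0) +
  xi 0 1 *: delta_mx 0 (rshift 3 1) + xi 0 2 *: delta_mx 0 (rshift 3 2)); last first.
  apply/funext => xi; apply/rowP => i; rewrite !mxE; case: split_ordP => i' ->; rewrite ?mxE /=.
    by rewrite !eq_lrshift !mulr0 !addr0.
  by rewrite !eq_rshift; case: (ord3P i') => ->; rewrite -!val_eqE /= ?mulr0 ?mulr1 ?addr0 ?add0r.
by apply: continuous_comb3; exact: coord_continuous.
Qed.

(** What is retained of a symbol entry of order o: its size, its Lipschitz constant in x, both of
    order (1 + |xi|)^o, and continuity in xi. *)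
Definition slice_bounds (o c : R) (s : pt -> pt -> R[i]) :=
  [/\ forall x xi, nc (s x xi) <= c * (1 + enorm xi) `^ o,
      forall x xi k t, nc (s (x + t *: e_ k) xi - s x xi) <= c * `|t| * (1 + enorm xi) `^ o &
      forall x, ccont (s x)].

Lemma symbol_slice (o : R) (S : pt -> pt -> 'M[R[i]]_3) j l : symbol_class o S ->
  exists c, 0 <= c /\ slice_bounds o c (fun x xi => S x xi j l).
Proof.
move=> /(_ j l); set s := fun z : 'rV_(3 + 3) => _ => -[sm bd].
have sE x xi : S x xi j l = s (row_mx x xi) by rewrite /s row_mxKl row_mxKr.
have [c0 h0] := bd [::] [::].
have hk k : exists c, forall x xi, nc (cpartial (lshift 3 k) s (row_mx x xi)) <= c * (1 + enorm xi) `^ o.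
  by have [c h] := bd [::] [:: k]; exists c => x xi; have := h x xi; rewrite /= subr0.
have p0 (xi : pt) : 0 <= (1 + enorm xi) `^ o := powR_ge0 _ _.
have [c1 h1] := hk 0; have [c2 h2] := hk 1; have [c3 h3] := hk 2.
exists (`|c0| + 2 * (`|c1| + `|c2| + `|c3|)); split; first by rewrite addr_ge0// mulr_ge0// !addr_ge0.
have hC k x xi : nc (cpartial (lshift 3 k) s (row_mx x xi)) <= (`|c1| + `|c2| + `|c3|) * (1 + enorm xi) `^ o.
  have := ler_norm c1; have := ler_norm c2; have := ler_norm c3.
  have := normr_ge0 c1; have := normr_ge0 c2; have := normr_ge0 c3 => n3 n2 n1 a3 a2 a1.
  case: (ord3P k) => ->; [move: (h1 x xi)|move: (h2 x xi)|move: (h3 x xi)];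
    by move=> /le_trans; apply; rewrite ler_wpM2r//; lra.
split.
- move=> x xi; rewrite sE; have := h0 x xi; rewrite /= subr0 => /le_trans; apply.
  rewrite ler_wpM2r//; apply: le_trans (ler_norm _) _; rewrite lerDl mulr_ge0// !addr_ge0//.
- move=> x xi k t; rewrite !sE row_mx_line.
  set z := row_mx x xi; set v := delta_mx 0 _.
  set C := (`|c1| + `|c2| + `|c3|) * (1 + enorm xi) `^ o.
  have dz u := cdiff_is_cpartial (smooth_cdiff sm) (lshift 3 k) (z + u *: v).
  have bz u : nc (cpartial (lshift 3 k) s (z + u *: v)) <= C by rewrite /z /v -row_mx_line; exact: hC.
  have L1 := @le_derive_lipschitz R (fun u => cRe (s (z + u *: v))) (fun u => cRe (cpartial (lshift 3 k) s (z + u *: v))) C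
    (fun u => (is_derive_line _ _ _ _ _).1 (dz u).1) (fun u => le_trans (le_Re_nc _) (bz u)) t 0.
  have L2 := @le_derive_lipschitz R (fun u => cIm (s (z + u *: v))) (fun u => cIm (cpartial (lshift 3 k) s (z + u *: v))) C
    (fun u => (is_derive_line _ _ _ _ _).1 (dz u).2) (fun u => le_trans (le_Im_nc _) (bz u)) t 0.
  move: L1 L2; rewrite scale0r addr0 subr0 => L1 L2.
  apply: le_trans (nc_leD _) _; rewrite !cE.
  apply: le_trans (lerD L1 L2) _; rewrite /C.
  have : 0 <= `|c0| * (`|t| * (1 + enorm xi) `^ o) by rewrite !mulr_ge0.
  lra.
- move=> x; have [a b] := smooth0 sm; rewrite /ccont; under eq_fun do rewrite sE; under [X in _ /\ continuous X]eq_fun do rewrite sE.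
  have cr := @continuous_row_mx x.
  split=> xi.
    exact: (@continuous_comp _ _ _ (fun xi : pt => row_mx x xi) (fun z => cRe (s z)) xi (cr xi) (a _)).
  exact: (@continuous_comp _ _ _ (fun xi : pt => row_mx x xi) (fun z => cIm (s z)) xi (cr xi) (b _)).
Qed.

End SymbolSlices.

(** * The amplitude of a pseudo-differential operator on localised plane waves *)

Section Amplitude.
Variable R : realType.
Local Notation pt := 'rV[R]_3.
Local Notation C := R[i].
Local Notation e_ k := (delta_mx 0 k : pt).
Implicit Types (s : pt -> pt -> C) (chi : pt -> C) (x zeta : pt).

(** Four powers are reserved: three pay for Peetre's inequality, as orders are at most 3 in modulus,
    and one for the factor |eta| produced by varying x in exp(i x.eta). *)
Lemma hat_weight chi : test_fun setT chi ->
  exists W, 0 <= W /\ forall eta : pt, (1 + enorm eta) ^+ 4 * nc (hat chi eta) <= W * bump3 eta.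
Proof.
move=> tc; have [M [M0 hM]] := hat_decay 3 tc.
exists (4 * M); split; first by rewrite mulr_ge0.
move=> eta; apply: le_trans (ler_pM _ (nc_ge0 _) (bracket_bump3 eta) (hM eta)) _.
  by rewrite exprn_ge0// addr_ge0// enorm_ge0.
have b0 := bump3_gt0 eta.
rewrite (_ : _ * (M * _) = 4 * M * bump3 eta)//; field; exact: lt0r_neq0.
Qed.

                                                                         
                 
(** Up to the factor (2 pi)^3 this is exp(-i x.zeta) Op(s)(chi exp(i x.zeta))(x), after the change
    of frequency xi = zeta + eta. *)
Definition amplitude chi s x zeta : C :=
  integral3 (fun eta => expi (dot x eta) * (s x (zeta + eta) * hat chi eta)).

Section Fixed.
Variables (chi : pt -> C) (s : pt -> pt -> C) (o c W : R).
Hypothesis tchi : test_fun setT chi.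
Hypothesis (c0 : 0 <= c) (W0 : 0 <= W).
Hypothesis hW : forall eta : pt, (1 + enorm eta) ^+ 4 * nc (hat chi eta) <= W * bump3 eta.
Hypothesis hs : slice_bounds o c s.
Hypothesis o3 : `|o| <= 3.

Lemma slice_decay x zeta (eta : pt) :
  nc (s x (zeta + eta) * hat chi eta) * (1 + enorm eta) <= c * W * (1 + enorm zeta) `^ o * bump3 eta.
Proof.
have [h1 _ _] := hs; have e0 := enorm_ge0 eta.
rewrite ncM -!mulrA; apply: (@le_trans _ _ (c * ((1 + enorm zeta) `^ o * (1 + enorm eta) ^+ 3) * (nc (hat chi eta) * (1 + enorm eta)))).
  rewrite ler_wpM2r//; first by rewrite mulr_ge0 ?nc_ge0// addr_ge0.
  by apply: le_trans (h1 _ _) _; rewrite ler_wpM2l//; exact: bracket_peetre.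
rewrite -!mulrA ler_wpM2l// [leRHS]mulrCA ler_wpM2l ?powR_ge0//.
by apply: le_trans (hW eta); rewrite exprS; lra.
Qed.

Lemma le_bracket (a : R) (eta : pt) : 0 <= a -> a <= a * (1 + enorm eta).
Proof. by move=> a0; rewrite ler_peMr// lerDl enorm_ge0. Qed.

Lemma ccont_amplitude_integrand x zeta :
  ccont (fun eta => expi (dot x eta) * (s x (zeta + eta) * hat chi eta)).
Proof.
have [_ _ h3] := hs.
apply: ccontM; first by under eq_fun do rewrite dotC; apply: ccont_expi; exact: continuous_dot.
apply: ccontM; last exact: ccont_hat tchi.
by under eq_fun do rewrite addrC; apply: ccont_shift.
Qed.

Lemma amplitude_integrand_le x zeta (eta : pt) :
  nc (expi (dot x eta) * (s x (zeta + eta) * hat chi eta)) <= c * W * (1 + enorm zeta) `^ o * bump3 eta.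
Proof.
rewrite ncM nc_expi mul1r; apply: le_trans (slice_decay x zeta eta).
exact: le_bracket (nc_ge0 _).
Qed.

Lemma tame_amplitude x zeta :
  tame (fun eta => expi (dot x eta) * (s x (zeta + eta) * hat chi eta)).
Proof.
split; first exact: ccont_amplitude_integrand.
by eexists => eta; exact: amplitude_integrand_le.
Qed.

Lemma amplitude_le x zeta :
  nc (amplitude chi s x zeta) <= c * W * (1 + enorm zeta) `^ o * mass3 R.
Proof. by apply: nc_integral3 (amplitude_integrand_le x zeta); exact: ccont_amplitude_integrand. Qed.

(** The increment splits into that of the phase, which costs 2 |t| and one power of |eta|, and that
    of the symbol, which costs |t|; together 3 |t|. *)
Lemma amplitude_lipschitz x zeta k (t : R) :
  nc (amplitude chi s (x + t *: e_ k) zeta - amplitude chi s x zeta) <=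
  3 * `|t| * (c * W * (1 + enorm zeta) `^ o) * mass3 R.
Proof.
have [h1 h2 h3] := hs.
rewrite -integral3B; [|exact: tame_amplitude..].
apply: nc_integral3; first by apply: ccontB; exact: ccont_amplitude_integrand.
move=> eta; set y := x + t *: e_ k.
have -> : expi (dot y eta) * (s y (zeta + eta) * hat chi eta) -
   expi (dot x eta) * (s x (zeta + eta) * hat chi eta) =
   (expi (dot y eta) - expi (dot x eta)) * (s y (zeta + eta) * hat chi eta) +
   expi (dot x eta) * ((s y (zeta + eta) - s x (zeta + eta)) * hat chi eta) by ring.
have e0 := enorm_ge0 eta.
have A : nc ((expi (dot y eta) - expi (dot x eta)) * (s y (zeta + eta) * hat chi eta)) <=
    2 * `|t| * (c * W * (1 + enorm zeta) `^ o * bump3 eta).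
  rewrite ncM; apply: le_trans (ler_wpM2l _ (slice_decay y zeta eta)); last by rewrite mulr_ge0.
  rewrite [leRHS]mulrA mulrAC ler_wpM2r ?nc_ge0//.
  apply: le_trans (expi_lipschitz _ _) _; rewrite -mulrA ler_wpM2l//.
  rewrite /y dotDl dotZl dot_delta addrC addKr normrM ler_wpM2l//.
  by apply: le_trans (enorm_coord eta k) _; rewrite lerDr.
have B : nc (expi (dot x eta) * ((s y (zeta + eta) - s x (zeta + eta)) * hat chi eta)) <=
    `|t| * (c * W * (1 + enorm zeta) `^ o * bump3 eta).
  rewrite ncM nc_expi mul1r ncM.
  apply: le_trans (ler_wpM2r (nc_ge0 _) (h2 _ _ _ _)) _.
  have := ler_wpM2l (_ : 0 <= c * `|t|) (ler_wpM2r (nc_ge0 (hat chi eta)) (bracket_peetre zeta eta o3)).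
  rewrite mulr_ge0// => /(_ isT); rewrite [in leLHS]mulrA => /le_trans; apply.
  have := ler_wpM2l (_ : 0 <= c * `|t| * (1 + enorm zeta) `^ o) (hW eta).
  rewrite !mulr_ge0 ?powR_ge0// => /(_ isT) h.
  have n0 := nc_ge0 (hat chi eta).
  have := ler_wpM2l (_ : 0 <= c * `|t| * (1 + enorm zeta) `^ o * (1 + enorm eta) ^+ 3 * nc (hat chi eta)) (_ : 1 <= 1 + enorm eta).
  rewrite !mulr_ge0 ?powR_ge0 ?exprn_ge0 ?addr_ge0// lerDl e0 => /(_ isT isT) h'.
  move: h; rewrite exprS; lra.
apply: le_trans (ncD _ _) _; apply: le_trans (lerD A B) _; lra.
Qed.

End Fixed.

Lemma test_lipschitz chi : test_fun setT chi -> exists M : R, [/\ 0 <= M, forall x, nc (chi x) <= M &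
  forall x k t, nc (chi (x + t *: e_ k) - chi x) <= 2 * M * `|t|].
Proof.
move=> tc; have [M [M0 hM]] := test_bounded tc.
have [M1 [M10 hM1]] := test_bounded (test_fun_cpartial 0 tc).
have [M2 [M20 hM2]] := test_bounded (test_fun_cpartial 1 tc).
have [M3 [M30 hM3]] := test_bounded (test_fun_cpartial 2 tc).
exists (M + M1 + M2 + M3); split; first by rewrite !addr_ge0.
  by move=> x; apply: le_trans (hM x) _; lra.
move=> x k t; apply: cpartial_lipschitz; first exact: test_fun_smooth tc.
by move=> y; case: (ord3P k) => ->; [move: (hM1 y)|move: (hM2 y)|move: (hM3 y)]; lra.
Qed.

(** The product with [chi] is supported in a fixed box and Lipschitz with constant of order (1 +
    |zeta|)^o, so [hat_lipschitz] applies with uniform constants. The number 5 is 2 from the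
    increment of [chi] plus 3 from that of the amplitude. *)
Lemma amplitude_decay chi s (o c : R) : test_fun setT chi -> 0 <= c -> slice_bounds o c s -> `|o| <= 3 ->
  (forall zeta, tame (fun x => chi x * amplitude chi s x zeta)) /\
  exists B : R, 0 <= B /\ forall zeta theta k,
    nc (hat (fun x => chi x * amplitude chi s x zeta) theta) * (1 + `|theta 0 k|) <=
    B * (1 + enorm zeta) `^ o.
Proof.
move=> tc c0 hs o3; have [W [W0 hW]] := hat_weight tc.
have [M [M0 hM hL]] := test_lipschitz tc.
have [r [r0 hr]] := test_support tc.
have m0 := mass3_ge0 R.
pose g zeta x := chi x * amplitude chi s x zeta.
pose L zeta := 5 * M * (c * W * mass3 R) * (1 + enorm zeta) `^ o.
have q0 : 0 <= c * W * mass3 R by exact: mulr_ge0 (mulr_ge0 c0 W0) m0.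
have aL := amplitude_le tc c0 hW hs o3.
have aLip := amplitude_lipschitz tc c0 hW hs o3.
have gL zeta x : nc (g zeta x) <= L zeta.
  rewrite /g ncM; apply: le_trans (ler_pM (nc_ge0 _) (nc_ge0 _) (hM x) (aL x zeta)) _.
  have : 0 <= M * (c * W * mass3 R * (1 + enorm zeta) `^ o) by exact: mulr_ge0 M0 (mulr_ge0 q0 (powR_ge0 _ _)).
  rewrite /L; lra.
have gl zeta x k t : nc (g zeta (x + t *: e_ k) - g zeta x) <= L zeta * `|t|.
  rewrite /g; set y := x + t *: e_ k.
  have -> : chi y * amplitude chi s y zeta - chi x * amplitude chi s x zeta =
    (chi y - chi x) * amplitude chi s y zeta + chi x * (amplitude chi s y zeta - amplitude chi s x zeta) by ring.
  apply: le_trans (ncD _ _) _; rewrite !ncM.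
  apply: le_trans (lerD (ler_pM (nc_ge0 _) (nc_ge0 _) (hL x k t) (aL y zeta))
    (ler_pM (nc_ge0 _) (nc_ge0 _) (hM x) (aLip x zeta k t))) _.
  rewrite /L; lra.
have cg zeta : ccont (g zeta) by apply: (@ccont_lipschitz _ _ _ (L zeta)); exact: row3_dist1 (gl zeta).
have gr zeta x : g zeta x != 0 -> forall j, `|x 0 j| <= r.
  by move=> gx; apply: hr; apply: contra_neq gx => z; rewrite /g z mul0r.
split=> [zeta|].
  split; first exact: cg.
  exists (L zeta * (1 + r ^+ 2) ^+ 3) => x; apply: (@bump3_support _ (g zeta)).
  - by apply: le_trans (gL zeta 0); exact: nc_ge0.
  - exact: gL.
  - exact: gr.
exists (5 * M * (c * W * mass3 R) * (8 * (1 + (r + 1) ^+ 2) ^+ 3 * mass3 R)); split.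
  have B0 : 0 <= (1 + (r + 1) ^+ 2) ^+ 3 by rewrite exprn_ge0// addr_ge0// sqr_ge0.
  exact: mulr_ge0 (mulr_ge0 (mulr_ge0 (ler0n _ 5) M0) q0) (mulr_ge0 (mulr_ge0 (ler0n _ 8) B0) m0).
move=> zeta theta k.
have := hat_lipschitz theta r0 (cg zeta) (gr zeta) (gL zeta) (fun x t => gl zeta x k t).
by rewrite /L [X in _ <= X -> _]mulrAC.
Qed.

End Amplitude.

(** * High-frequency limit of the amplitude along a ray, and kernels on plane waves *)

Section AmplitudeLimit.
Variable R : realType.
Local Notation pt := 'rV[R]_3.
Local Notation C := R[i].

Lemma powR_shift1 (m kap : R) : `|m| <= 3 -> 1 <= kap -> kap `^ m * (1 + kap) `^ (- m) <= 8.
Proof.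
move=> m3 k1; have k0 : 0 < kap by exact: lt_le_trans k1.
have /(ler_wpM2l (powR_ge0 kap m)) h : (1 + kap) `^ (- m) <= kap `^ (- m) * 2 ^+ 3.
  by apply: powR_peetre; rewrite ?normrN//; lra.
apply: le_trans h _; rewrite mulrA -powRD ?subrr ?eqxx//; last by rewrite gt_eqF.
by rewrite powRr0 mul1r; lra.
Qed.

Lemma powR_ratio (m kap z : R) : 0 < kap -> 0 <= z -> kap `^ m * z `^ (- m) = (z / kap) `^ (- m).
Proof.
move=> k0 z0; rewrite powRM ?invr_ge0 ?(ltW k0)// mulrC; congr (_ * _).
by rewrite -(powR_inv1 (ltW k0)) -powRrM mulN1r opprK.
Qed.

Lemma cvg_powR1 (u : nat -> R) (p : R) : u n @[n --> \oo] --> (1 : R) ->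
  u n `^ p @[n --> \oo] --> (1 : R).
Proof.
move=> u1; have -> : (1 : R) = 1 `^ p by rewrite powR1.
apply: (@continuous_cvg _ _ _ _ _ u (fun t : R => t `^ p) 1); last exact: u1.
exact: is_derive_continuous (is_derive1_powR p (@ltr01 R)).
Qed.

Lemma cvg_inv_pinfty (kap : nat -> R) : kap n @[n --> \oo] --> +oo -> (kap n)^-1 @[n --> \oo] --> 0.
Proof.
move=> kapy; apply/gtr0_cvgV0; last exact: kapy.
by move/cvgryPgt: kapy; apply.
Qed.

Section Limit.
Variables (chi : pt -> C) (s b : pt -> pt -> C) (a : pt -> C) (m c c' : R) (v : pt) (kap : nat -> R).
Hypothesis tchi : test_fun setT chi.
Hypothesis chi_inversion : forall x,
  integral3 (fun xi => expi (dot x xi) * hat chi xi) = ((2 * pi) ^+ 3)%:C * chi x.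
Hypotheses (c0 : 0 <= c) (hs : slice_bounds (- m) c s) (m3 : `|m| <= 3).
Hypothesis hb : forall x xi, nc (b x xi) <= c' * (1 + enorm xi) `^ (- m - 1).
Hypothesis sE : forall x xi, 1 <= enorm xi -> s x xi = (enorm xi `^ (- m))%:C * a x + b x xi.
Hypotheses (v1 : enorm v = 1) (kap1 : forall n, 1 <= kap n) (kapy : kap n @[n --> \oo] --> +oo).

Let kap0 n : 0 < kap n := lt_le_trans ltr01 (kap1 n).

Let ekv n : enorm (kap n *: v) = kap n.
Proof. by rewrite enormZ v1 mulr1 ger0_norm// ltW. Qed.

(** A bounded shift eta does not matter at high frequency: |kappa v + eta| / kappa tends to 1, so
    the principal part tends to a(x), while the remainder, of order one lower, contributes O(1 /
    kappa). The 16 = 2^4 trades 1 + kappa for kappa in the remainder. *)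
Lemma slice_limit x (eta : pt) :
  ccvg \oo (fun n => (kap n `^ m)%:C * s x (kap n *: v + eta)) (a x).
Proof.
have e0 := enorm_ge0 eta.
pose z n := enorm (kap n *: v + eta).
have zle n : z n <= kap n + enorm eta by have := enormD (kap n *: v) eta; rewrite ekv.
have zge n : kap n - enorm eta <= z n.
  by have := enormD (kap n *: v + eta) (- eta); rewrite addrK enormN ekv -/(z n); lra.
have z1 : z n / kap n @[n --> \oo] --> (1 : R).
  apply/cvgrPdist_le => /= e ep.
  have ie : enorm eta * (kap n)^-1 @[n --> \oo] --> 0.
    by rewrite -[X in _ --> X](mulr0 (enorm eta)); apply: cvgMl_tmp; exact: cvg_inv_pinfty.
  move/cvgrPdist_le : ie => /(_ e ep); apply: filterS => n.
  rewrite sub0r normrN ger0_norm ?mulr_ge0 ?invr_ge0 ?(ltW (kap0 n))// => h.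
  apply: le_trans h; rewrite distrC -[X in _ - X](divff (lt0r_neq0 (kap0 n))) -mulrBl normrM.
  rewrite [X in _ * X]ger0_norm ?invr_ge0 ?(ltW (kap0 n))// ler_wpM2r ?invr_ge0 ?(ltW (kap0 n))//.
  by rewrite ler_norml; have := zle n; have := zge n; lra.
have p1 := cvg_powR1 (- m) z1.
apply: (@ccvg_squeeze _ _ _ _ _ _
   (fun n => `|(z n / kap n) `^ (- m) - 1| * nc (a x) + `|c'| * 16 * (1 + enorm eta) ^+ 4 * (kap n)^-1)).
- have : \forall n \near \oo, 1 + enorm eta <= kap n by move/cvgryPge : kapy; apply.
  apply: filterS => n kn.
  have zn1 : 1 <= z n by have := zge n; lra.
  rewrite sE// mulrDr mulrA -rmorphM powR_ratio ?enorm_ge0// -/(z n).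
  have -> : forall p q w : C, p * a x + q * w - a x = (p - 1) * a x + q * w by move=> *; ring.
  apply: le_trans (ncD _ _) _; rewrite !ncM; apply: lerD.
    by rewrite (_ : 1 = (1 : R)%:C)// -rmorphB ncR.
  rewrite ncR ger0_norm ?powR_ge0//.
  have h1 : (1 + z n) `^ (- m - 1) <= (1 + kap n) `^ (- m - 1) * (1 + enorm eta) ^+ 4.
    have := @bracket_peetre R (- m - 1) 4 (kap n *: v) eta; rewrite ekv; apply.
    by apply: le_trans (ler_normB _ _) _; rewrite normrN normr1; move: m3; lra.
  have h2 : (1 + kap n) `^ (- m - 1) <= kap n `^ (- m - 1) * 2 ^+ 4.
    apply: powR_peetre; rewrite ?addr_gt0//; have k1 := kap1 n; try lra.
    by apply: le_trans (ler_normB _ _) _; rewrite normrN normr1; move: m3; lra.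
  have h3 : kap n `^ m * kap n `^ (- m - 1) = (kap n)^-1.
    rewrite -powRD; last by rewrite (gt_eqF (kap0 n)) implybT.
    by rewrite addrA subrr add0r powR_inv1// ltW.
  have b1 : nc (b x (kap n *: v + eta)) <= `|c'| * (1 + z n) `^ (- m - 1).
    by apply: le_trans (hb _ _) _; rewrite ler_wpM2r ?powR_ge0// ler_norm.
  have E4 : 0 <= (1 + enorm eta) ^+ 4 by rewrite exprn_ge0// addr_ge0.
  have := ler_wpM2l (powR_ge0 (kap n) m) (le_trans b1 (ler_wpM2l (normr_ge0 c')
     (le_trans h1 (ler_wpM2r E4 h2)))).
  move=> /le_trans; apply.
  rewrite [leLHS](_ : _ = `|c'| * (kap n `^ m * kap n `^ (- m - 1)) * 2 ^+ 4 * (1 + enorm eta) ^+ 4); last by ring.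
  by rewrite h3; lra.
- have -> : (0 : R) = 0 * nc (a x) + `|c'| * 16 * (1 + enorm eta) ^+ 4 * 0 by rewrite mul0r mulr0 addr0.
  apply: cvgD; last by apply: cvgMl_tmp; exact: cvg_inv_pinfty.
  apply: cvgMr_tmp; rewrite -[X in _ --> X](@normr0 _ R) -[X in `|X|](subrr (1 : R)).
  by apply: cvg_norm; apply: cvgB => //; exact: cvg_cst.
Qed.

(** Dominated convergence in eta replaces the symbol by a(x); what is left is the inversion integral
    of [chi]. *)
Lemma amplitude_limit x :
  ccvg \oo (fun n => (kap n `^ m)%:C * amplitude chi s x (kap n *: v))
    (((2 * pi) ^+ 3)%:C * (a x * chi x)).
Proof.
have [W [W0 hW]] := hat_weight tchi.
have o3 : `|- m| <= 3 by rewrite normrN.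
have -> : ((2 * pi) ^+ 3)%:C * (a x * chi x) = a x * (((2 * pi) ^+ 3)%:C * chi x) by ring.
rewrite -chi_inversion -integral3Z; last first.
  (* The inversion integrand is the amplitude integrand of the constant symbol 1, of order 0, hence
     tame. *)
  have <- : (fun eta => expi (dot x eta) * (1 * hat chi eta)) =
      (fun eta => expi (dot x eta) * hat chi eta) by apply/funext => eta; rewrite mul1r.
  apply: (@tame_amplitude R chi (fun _ _ => 1) 0 1 W tchi ler01 hW _ _ x 0); last by rewrite normr0.
  split=> [y xi|y xi k t|y]; last exact: ccont_cst.
    by rewrite nc1 powRr0 mulr1.
  by rewrite subrr nc0 !mulr_ge0// powR_ge0.
have ta n := tame_amplitude tchi c0 hW hs o3 x (kap n *: v).
under [X in ccvg _ X]eq_fun do rewrite -integral3Z//.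
apply: (@integral3_dominated _ _ _ (8 * (c * W))).
- by move=> n; apply: ccontM; [exact: ccont_cst|exact: (ta n).1].
- apply: ccontM; first exact: ccont_cst.
  apply: ccontM; last exact: ccont_hat tchi.
  by under eq_fun do rewrite dotC; apply: ccont_expi; exact: continuous_dot.
- move=> eta.
  apply: (@near_ccvg _ _ _ _ (fun n => (kap n `^ m)%:C * s x (kap n *: v + eta) * (expi (dot x eta) * hat chi eta))).
    by apply: nearW => n; rewrite -mulrA [s _ _ * _]mulrCA.
  by apply: ccvgM; [exact: slice_limit|exact: ccvg_cst].
- move=> n eta; rewrite ncM ncR ger0_norm ?powR_ge0//.
  apply: le_trans (ler_wpM2l (powR_ge0 _ _) (amplitude_integrand_le c0 hW hs o3 x (kap n *: v) eta)) _.
  rewrite ekv; have := powR_shift1 m3 (kap1 n).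
  move=> /(ler_wpM2r (_ : 0 <= c * W * bump3 eta)); rewrite !mulr_ge0 ?(ltW (bump3_gt0 _))//.
  move=> /(_ isT); lra.
Qed.

(** Dominated convergence in x. The limit carries two factors [chi], which disappear because [chi]
    is 1 wherever a is nonzero. *)
Lemma hat_amplitude_limit (theta : pt) : ccont a -> (forall x, a x != 0 -> chi x = 1) ->
  ccvg \oo (fun n => (kap n `^ m)%:C * hat (fun x => chi x * amplitude chi s x (kap n *: v)) theta)
    (((2 * pi) ^+ 3)%:C * hat a theta).
Proof.
move=> ca a1; have [W [W0 hW]] := hat_weight tchi.
have o3 : `|- m| <= 3 by rewrite normrN.
have [M [M0 hM _]] := test_lipschitz tchi.
have [r [r0 hr]] := test_support tchi.
have [tg _] := amplitude_decay tchi c0 hs o3.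
have aE x : a x = chi x * (a x * chi x).
  by have [->|/a1 ->] := eqVneq (a x) 0; rewrite ?mul0r ?mulr0 ?mul1r ?mulr1.
have ta : tame a.
  suff : tame (fun x => (a x * chi x) * chi x).
    by under eq_fun do rewrite mulrC -aE.
  split; first by apply: ccontM; [apply: ccontM|] => //; exact: smooth0 (test_fun_smooth tchi).
  have [K [K0 hK]] : exists K : R, 0 <= K /\ forall x, nc (a x * chi x * chi x) <= K.
    have cc := @compact_box R 3 0 r.
    have [K [K0 hK]] := compact_ubound cc (continuous_nc ca).
    exists (K * M * M); split; first by rewrite !mulr_ge0.
    move=> x; have [z|z] := eqVneq (chi x) 0; first by rewrite z mulr0 nc0 !mulr_ge0.
    rewrite !ncM !ler_pM ?mulr_ge0 ?nc_ge0//; apply: hK => k.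
    by rewrite mxE subr0; exact: hr.
  exists (K * (1 + r ^+ 2) ^+ 3) => x.
  apply: (@bump3_support _ (fun x => a x * chi x * chi x)) => // y; rewrite mulf_eq0 negb_or => /andP[_].
  exact: hr.
rewrite -hatZ//; under [X in ccvg _ X]eq_fun do rewrite -hatZ//.
apply: (@integral3_dominated _ _ _ (M * (8 * (c * W) * mass3 R) * (1 + r ^+ 2) ^+ 3)).
- move=> n; apply: ccontM; first exact: ccont_expiN.
  by apply: ccontM; [exact: ccont_cst|exact: (tg _).1].
- apply: ccontM; first exact: ccont_expiN.
  by apply: ccontM; [exact: ccont_cst|].
- move=> x; apply: ccvgM; first exact: ccvg_cst.
  rewrite [X in ccvg _ _ (_ * X)]aE.
  rewrite mulrCA.
  apply: (@near_ccvg _ _ _ _ (fun n => chi x * ((kap n `^ m)%:C * amplitude chi s x (kap n *: v)))).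
    by apply: nearW => n; rewrite mulrCA.
  by apply: ccvgM; [exact: ccvg_cst|exact: amplitude_limit].
- move=> n x; rewrite ncM nc_expi mul1r.
  apply: (@bump3_support _ (fun x => _ * (chi x * amplitude chi s x (kap n *: v)))) => //.
  + exact: mulr_ge0 M0 (mulr_ge0 (mulr_ge0 (ler0n _ 8) (mulr_ge0 c0 W0)) (mass3_ge0 R)).
  + move=> y; rewrite ncM ncR ger0_norm ?powR_ge0// ncM mulrCA ler_pM ?mulr_ge0 ?nc_ge0 ?powR_ge0//.
    apply: le_trans (ler_wpM2l (powR_ge0 _ _) (amplitude_le tchi c0 hW hs o3 y (kap n *: v))) _.
    rewrite ekv; have := powR_shift1 m3 (kap1 n).
    move=> /(ler_wpM2r (mulr_ge0 (mulr_ge0 c0 W0) (mass3_ge0 R))); lra.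
  + by move=> y; rewrite !mulf_eq0 !negb_or => /andP[_ /andP[yn _]]; exact: hr.
Qed.

End Limit.

(** The transform of chi exp(i y.zeta) is that of [chi] translated by zeta; translating the
    frequency back extracts exp(i x.zeta), which combines with exp(-i x.xi) into the kernel of the
    transform at xi - zeta. The hypothesis on the zero function removes the vanishing components in
    [kernel_operator]. *)
Lemma kernel_amplitude (K : 'I_3 -> 'I_3 -> (pt -> C) -> (pt -> C) -> C)
    (S : pt -> pt -> 'M[C]_3) (o : R) (chi : pt -> C) j l (xi zeta : pt) :
  is_psido K S -> symbol_class o S -> `|o| <= 3 -> test_fun setT chi ->
  (forall j l psi, K j l psi (fun=> 0) = 0) ->
  K j l (fun x => chi x * expi (- dot x xi)) (fun x => chi x * expi (dot x zeta)) =
  (((2 * pi) ^+ 3)^-1)%:C *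
    hat (fun x => chi x * amplitude chi (fun x xi => S x xi j l) x zeta) (xi - zeta).
Proof.
move=> KS hS o3 tc K0.
have [c [c0 hs]] := symbol_slice j l hS.
have [W [W0 hW]] := hat_weight tc.
set s := fun x xi => S x xi j l.
have tame_s := tame_amplitude tc c0 hW hs o3.
have [tg _] := amplitude_decay tc c0 hs o3.
pose g x := chi x * expi (dot x zeta).
have tg1 : test_fun setT g by apply: test_funM => //; exact: smooth_expi.
have tgt := test_tame tg1.
have tpsi : test_fun setT (fun x => chi x * expi (- dot x xi)).
  by apply: test_funM => //; under eq_fun do rewrite -dotNr; exact: smooth_expi.
have gE k : (fun x => (g x *: delta_mx l 0 : 'cV[C]_3) k 0) = fun x => (k == l)%:R * g x.
  exact: entry_delta.
have := KS (fun x => g x *: delta_mx l 0) j _ (test_mx_delta l tg1) tpsi.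
rewrite /kernel_operator (bigD1 l)//= big1 => [|k kl]; last first.
  by rewrite gE (negbTE kl); under [X in K _ _ _ X]eq_fun do rewrite mul0r.
rewrite addr0 gE eqxx; under [X in K _ _ _ X = _]eq_fun do rewrite mul1r.
move=> ->; rewrite -integral3Z; last exact: tame_hat.
apply: eq_integral3 => x.
rewrite /psido !mxE.
have -> : integral3 (fun xi => expi (dot x xi) * (S x xi *m fourier (fun x => g x *: delta_mx l 0 : 'cV[C]_3) xi) j 0) =
   expi (dot x zeta) * amplitude chi s x zeta.
  rewrite -integral3Z; last exact: tame_s.
  have tF := tameZ (expi (dot x zeta)) (tame_s x zeta).
  rewrite -(integral3_shift (- zeta) tF).
  apply: eq_integral3 => eta.
  rewrite mxE (bigD1 l)//= big1 => [|k kl]; last first.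
    by rewrite fourierE gE hatZ// (negbTE kl) mul0r mulr0.
  rewrite addr0 fourierE gE hatZ// eqxx mul1r.
  have -> : hat g eta = hat chi (eta - zeta).
    by rewrite -hat_shift; apply: eq_integral3 => y; rewrite /g [chi y * _]mulrC.
  rewrite [zeta + _]addrC subrK [RHS]mulrA -expiD; congr (expi _ * _).
  by rewrite dotDr dotNr addrC subrK.
rewrite dotDr dotNr opprB addrC expiD.
ring.
Qed.

End AmplitudeLimit.

(** * A concentrating trigonometric kernel in one variable *)

Section TrigKernel1.
Variable R : realType.
Local Notation mu := (@lebesgue_measure R).
Variable T : R.
Hypothesis T0 : 0 < T.

                                                                                     
                                                                            
                                                                            
(** The kernel is a power of (1 + cos(t / 2T)) / 2, which is a trigonometric polynomial, in the
    manner of de la Vallée Poussin. The window equals 1 for |t| <= T, where only the polynomial is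
    seen, and vanishes beyond 2T, well within the range where the cosine is monotone, so the power
    concentrates the weight at 0. *)
Definition window (t : R) : R := plateau_at 0 T t ^+ 2.
Definition cosine_bump (t : R) : R := (1 + cos (t / (2 * T))) / 2.
Definition trig_weight n (t : R) : R := window t * cosine_bump t ^+ n.

Lemma window_ge0 t : 0 <= window t. Proof. exact: sqr_ge0. Qed.

Lemma window1 t : `|t| <= T -> window t = 1.
Proof.
move=> tT; rewrite /window /plateau_at plateau1 ?expr1n// subr0 normrM normfV (gtr0_norm T0).
by rewrite ler_pdivrMr// mul1r.
Qed.

Lemma window0 t : 2 * T <= `|t| -> window t = 0.
Proof.
move=> tT; rewrite /window /plateau_at plateau0 ?expr0n// subr0 normrM normfV (gtr0_norm T0).
by rewrite ler_pdivlMr.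
Qed.

Lemma cosine_bump_ge0 t : 0 <= cosine_bump t.
Proof. by rewrite divr_ge0//; have := cos_geN1 (t / (2 * T)); lra. Qed.

Lemma cosine_bump_le1 t : cosine_bump t <= 1.
Proof. by rewrite /cosine_bump; have := cos_le1 (t / (2 * T)); lra. Qed.

Lemma ler_cos (x y : R) : 0 <= x -> x <= y -> y <= pi -> cos y <= cos x.
Proof.
move=> x0 xy ypi; rewrite leNgt; apply/negP; rewrite ltr_cos ?in_itv/=; try lra.
Qed.

Lemma cosine_bump_anti (s t : R) : `|s| <= `|t| -> `|t| <= 2 * T -> cosine_bump t <= cosine_bump s.
Proof.
move=> st tT; have T2 : 0 < 2 * T by rewrite mulr_gt0.
have E u : cosine_bump u = (1 + cos (`|u| / (2 * T))) / 2.
  rewrite /cosine_bump; congr ((1 + _) / 2).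
  by have [u0|u0] := leP 0 u; [rewrite ger0_norm|rewrite ltr0_norm// mulNr cosN].
rewrite !E ler_pM2r ?invr_gt0// lerD2l ler_cos ?divr_ge0 ?ler_pM2r ?invr_gt0 ?(ltW T2)//.
have : `|t| / (2 * T) <= 1 by rewrite ler_pdivrMr// mul1r.
by have := @pihalf_02 R; have := @pi_ge2 R; lra.
Qed.

Lemma continuous_window : continuous window.
Proof.
move=> t; apply: (@continuous_comp _ _ _ (plateau_at 0 T) (fun t => t ^+ 2)); last exact: exprn_continuous.
exact: continuous_plateau_at.
Qed.

Lemma continuous_cosine_bump : continuous cosine_bump.
Proof.
move=> t; apply: (@continuousM _ _ (fun t : R => 1 + cos (t / (2 * T)) : R) (fun _ : R => 2^-1 : R)); last exact: cst_continuous.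
apply: (@continuousD _ _ _ (fun _ : R => 1 : R) (fun t => cos (t / (2 * T)))); first exact: cst_continuous.
apply: (@continuous_comp _ _ _ (fun t : R => t / (2 * T)) cos); last exact: continuous_cos.
by apply: (@continuousM _ _ id (fun _ : R => (2 * T)^-1 : R)); [exact: id|exact: cst_continuous].
Qed.

Lemma continuous_trig_weight n : continuous (trig_weight n).
Proof.
move=> t; apply: (@continuousM _ _ window (fun t => cosine_bump t ^+ n)); first exact: continuous_window.
apply: (@continuous_comp _ _ _ cosine_bump (fun t => t ^+ n)); last exact: exprn_continuous.
exact: continuous_cosine_bump.
Qed.

Lemma trig_weight_ge0 n t : 0 <= trig_weight n t.
Proof. by rewrite mulr_ge0 ?window_ge0// exprn_ge0// cosine_bump_ge0. Qed.

Lemma trig_weight_le n t : trig_weight n t <= window t.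
Proof.
by rewrite ler_piMr ?window_ge0// exprn_ile1 ?cosine_bump_ge0 ?cosine_bump_le1.
Qed.

Lemma integrable_window : mu.-integrable setT (fun t => (window t)%:E).
Proof.
have [M PM] := @plateau_bounded R.
have M0 : 0 <= M := le_trans (normr_ge0 _) (PM 0).
have h := integrableZl measurableT M (integrable_abse (integrable_plateau_at 0 T0)).
apply: le_integrable h => //.
  by apply/measurable_EFinP; apply: continuous_measurable_fun; exact: continuous_window.
move=> t _; rewrite /= lee_fin ger0_norm ?window_ge0// ger0_norm ?mulr_ge0//.
by rewrite -[leLHS](ger0_norm (window_ge0 t)) normrX expr2 ler_wpM2r//; exact: PM.
Qed.

Lemma integrable_trig_weight n : mu.-integrable setT (fun t => (trig_weight n t)%:E).
Proof.
apply: le_integrable integrable_window => //.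
  by apply/measurable_EFinP; apply: continuous_measurable_fun; exact: continuous_trig_weight.
by move=> t _; rewrite /= lee_fin !ger0_norm ?window_ge0 ?trig_weight_ge0 ?trig_weight_le.
Qed.

Lemma integrable_trig_weight_norm n : mu.-integrable setT (fun t => (`|t| * trig_weight n t)%:E).
Proof.
have h := integrableZl measurableT (2 * T) (integrable_trig_weight n).
apply: le_integrable h => //.
  apply/measurable_EFinP; apply: measurable_funM; first by apply: continuous_measurable_fun; exact: norm_continuous.
  by apply: continuous_measurable_fun; exact: continuous_trig_weight.
move=> t _; have w0 := trig_weight_ge0 n t.
rewrite /= lee_fin (ger0_norm (mulr_ge0 (normr_ge0 t) w0)).
rewrite (ger0_norm (mulr_ge0 (mulr_ge0 (ler0n _ 2) (ltW T0)) w0)).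
have [tT|tT] := leP `|t| (2 * T); first by rewrite ler_wpM2r ?trig_weight_ge0.
by rewrite /trig_weight window0 ?mul0r ?mulr0// ltW.
Qed.

Lemma trig_weight_ratio (e : R) : 0 < e -> exists n,
  0 < \int[mu]_t trig_weight n t /\
  \int[mu]_t (`|t| * trig_weight n t) <= e * \int[mu]_t trig_weight n t.
Proof.
move=> e0; pose d := Num.min (e / 2) T.
have d0 : 0 < d by rewrite lt_min T0 andbT divr_gt0.
have dT : d <= T by rewrite ge_min lexx orbT.
have de : d <= e / 2 by rewrite ge_min lexx.
pose b := cosine_bump d; pose c := cosine_bump (d / 2).
have dn : `|d| = d by rewrite gtr0_norm. have d2n : `|d / 2| = d / 2 by rewrite gtr0_norm// divr_gt0.
have T2 : 0 < 2 * T by rewrite mulr_gt0.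
have bc : b < c.
  rewrite /b /c /cosine_bump ltr_pM2r ?invr_gt0// ltrD2l ltr_cos ?in_itv/=.
  - by rewrite ltr_pM2r ?invr_gt0//; lra.
  - rewrite !divr_ge0 ?(ltW T2) ?(ltW d0)//=.
    have : d / 2 / (2 * T) <= 1 by rewrite ler_pdivrMr// mul1r; lra.
    by have := @pi_ge2 R; lra.
  - rewrite divr_ge0 ?(ltW T2) ?(ltW d0)//=.
    have : d / (2 * T) <= 1 by rewrite ler_pdivrMr// mul1r; lra.
    by have := @pi_ge2 R; lra.
have b0 : 0 <= b := cosine_bump_ge0 d.
have c0 : 0 < c := le_lt_trans b0 bc.
set P := \int[mu]_t window t.
have P0 : 0 <= P by apply: Rintegral_ge0 => t _; exact: window_ge0.
have up n : \int[mu]_t (`|t| * trig_weight n t) <= d * \int[mu]_t trig_weight n t + 2 * T * b ^+ n * P.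
  rewrite -!RintegralZl; [|by []|exact: integrable_window|by []|exact: integrable_trig_weight].
  rewrite -RintegralD; [|by []|exact: (integrableZl measurableT d (integrable_trig_weight n))
                             |exact: (integrableZl measurableT _ integrable_window)].
  apply: le_Rintegral => //; first exact: integrable_trig_weight_norm.
    exact: (integrableD measurableT (integrableZl measurableT d (integrable_trig_weight n))
      (integrableZl measurableT _ integrable_window)).
  move=> t _; have w0 := window_ge0 t; have tw0 := trig_weight_ge0 n t.
  have bn : 0 <= b ^+ n by rewrite exprn_ge0.
  have [td|td] := leP `|t| d.
    have := ler_wpM2r tw0 td; have := mulr_ge0 (mulr_ge0 (ltW T2) bn) w0; lra.
  have [tT|tT] := leP (2 * T) `|t|; first by rewrite /trig_weight window0// !(mul0r, mulr0) addr0.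
  have h : trig_weight n t <= window t * b ^+ n.
    rewrite ler_wpM2l// lerXn2r ?nnegrE ?cosine_bump_ge0//.
    by apply: cosine_bump_anti; [rewrite dn ltW|exact: ltW].
  apply: (@le_trans _ _ (2 * T * (window t * b ^+ n))).
    by apply: ler_pM => //; exact: ltW.
  have := mulr_ge0 (ltW d0) tw0; lra.
have low n : d * c ^+ n <= \int[mu]_t trig_weight n t.
  pose I := `[(- (d / 2)), (d / 2)]%classic : set R.
  have mI : measurable I by exact: measurable_itv.
  have muI : mu I = d%:E.
    by rewrite lebesgue_measure_itv/= lte_fin ifT; [rewrite -EFinB; congr EFin|]; lra.
  have iI : mu.-integrable setT (fun t => (\1_I t)%:E).
    exact: integrable_indic_itv.
  have <- : \int[mu]_t (c ^+ n * \1_I t) = d * c ^+ n.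
    rewrite RintegralZl// mulrC; congr (_ * _).
    have e1 : (\int[mu]_x (\1_I x)%:E = mu I)%E by rewrite integral_indic// setIT.
    by rewrite /Rintegral e1 muI.
  apply: le_Rintegral => //; first exact: (integrableZl measurableT (c ^+ n) iI).
    exact: integrable_trig_weight.
  move=> t _; rewrite indicE; have [|] := boolP (t \in I); last by rewrite mulr0 trig_weight_ge0.
  rewrite inE /I /= in_itv /= -ler_norml => tI; rewrite mulr1 /trig_weight window1 ?mul1r; last by lra.
  rewrite lerXn2r ?nnegrE ?cosine_bump_ge0 ?(ltW c0)//.
  by apply: cosine_bump_anti; rewrite d2n//; lra.
have [n hn] : exists n, (2 * T * P) * (b / c) ^+ n <= (e / 2) * d.
  have bc1 : `|b / c| < 1.
    by rewrite ger0_norm ?divr_ge0 ?(ltW c0)// ltr_pdivrMr// mul1r.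
  have : (2 * T * P) * (b / c) ^+ n @[n --> \oo] --> (0 : R).
    by rewrite -[X in _ --> X](mulr0 (2 * T * P)); apply: cvgMl_tmp; exact: cvg_expr.
  move/cvgrPdist_le => /(_ ((e / 2) * d)); rewrite mulr_gt0 ?divr_gt0// => /(_ isT) [n _ /(_ n)].
  rewrite /= sub0r normrN => h; exists n; apply: le_trans (ler_norm _) (h _).
  exact: leqnn.
exists n; have an := low n; split; first by apply: lt_le_trans an; rewrite mulr_gt0// exprn_gt0.
apply: le_trans (up n) _.
have cn : 0 < c ^+ n by rewrite exprn_gt0.
have h : 2 * T * b ^+ n * P <= (e / 2) * (d * c ^+ n).
  have -> : 2 * T * b ^+ n * P = (2 * T * P) * (b / c) ^+ n * c ^+ n.
    have <- : (b / c) ^+ n * c ^+ n = b ^+ n by rewrite -exprMn divfK ?lt0r_neq0.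
    ring.
  by rewrite [leRHS]mulrA ler_wpM2r// ltW.
have a0 : 0 <= \int[mu]_t trig_weight n t by apply: Rintegral_ge0 => t _; exact: trig_weight_ge0.
have := ler_wpM2r a0 de; have := ler_wpM2l (_ : 0 <= e / 2) an; rewrite divr_ge0 ?(ltW e0)// => /(_ isT).
move: h; set A := \int[mu]_t _; set u := 2 * T * _ * P; set v := d * _; clear; lra.
Qed.

End TrigKernel1.

(** * Local approximation by trigonometric polynomials in three variables *)

Section TrigKernel3.
Variable R : realType.
Local Notation mu := (@lebesgue_measure R).
Local Notation pt := 'rV[R]_3.
Local Notation C := R[i].
Local Notation e_ k := (delta_mx 0 k : pt).
Variable T : R.
Hypothesis T0 : 0 < T.

Definition lattice (k : 'rV[int]_3) : pt := (2 * T)^-1 *: map_mx intr k.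

Definition trig_sum (s : seq (C * 'rV[int]_3)) (z : pt) : C :=
  \sum_(i <- s) i.1 * expi (- dot z (lattice i.2)).

Definition trig (G : pt -> C) := exists s, forall z, G z = trig_sum s z.

Lemma latticeD k l : lattice (k + l) = lattice k + lattice l.
Proof. by rewrite /lattice -scalerDr; congr (_ *: _); apply/rowP => i; rewrite !mxE intrD. Qed.

Lemma lattice0 : lattice 0 = 0.
Proof. by rewrite /lattice (_ : map_mx _ _ = 0) ?scaler0//; apply/rowP => i; rewrite !mxE. Qed.

Lemma trig_cst c : trig (fun=> c).
Proof. by exists [:: (c, 0)] => z; rewrite /trig_sum big_seq1 /= lattice0 dot0r oppr0 expi0 mulr1. Qed.

Lemma trigM G H : trig G -> trig H -> trig (fun z => G z * H z).
Proof.
move=> [s sE] [t tE]; exists [seq (i.1 * j.1, i.2 + j.2) | i <- s, j <- t] => z.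
rewrite /trig_sum big_allpairs_dep sE tE /trig_sum big_distrlr /=.
apply: eq_bigr => i _; apply: eq_bigr => j _.
by rewrite latticeD dotDr opprD expiD mulrACA.
Qed.

Lemma trigX G n : trig G -> trig (fun z => G z ^+ n).
Proof.
move=> tG; elim: n => [|n IH]; first exact: trig_cst.
by under eq_fun do rewrite exprS; exact: trigM.
Qed.

Lemma trig_cos k : trig (fun z => (cosine_bump T (z 0 k))%:C).
Proof.
exists [:: (2^-1, 0); (4^-1, delta_mx 0 k); (4^-1, - delta_mx 0 k)] => z.
rewrite /trig_sum !big_cons big_nil addr0 /= lattice0 dot0r oppr0 expi0 mulr1.
have lE (a : int) : dot z (lattice (a *: delta_mx 0 k)) = a%:~R * (z 0 k / (2 * T)).
  rewrite /lattice dotZr (_ : map_mx _ _ = a%:~R *: e_ k).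
    by rewrite dotZr dotC dot_delta mulrCA mulrC [_^-1 * _]mulrC; ring.
  by apply/rowP => i; rewrite !mxE intrM; case: (_ && _).
have := lE 1; rewrite scale1r mul1r => ->.
have := lE (-1); rewrite scaleN1r mulN1r => ->.
rewrite opprK /expi cosN sinN /cosine_bump; set t := z 0 k / (2 * T).
have h2 : (2^-1 : C) = (2^-1 : R)%:C by rewrite fmorphV rmorph_nat.
have h4 : (4^-1 : C) = (4^-1 : R)%:C by rewrite fmorphV rmorph_nat.
by rewrite h2 h4; apply: complex_eqP; rewrite !cE /=; field.
Qed.

Lemma prod3 (F : 'I_3 -> C) : \prod_k F k = F 0 * F 1 * F 2.
Proof.
rewrite !big_ord_recl big_ord0 mulr1 mulrA.
by congr (_ * _ * _); congr (F _); apply/val_inj.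
Qed.

Lemma integral3_real (f : pt -> R) : continuous f ->
  integral3 (fun z => (f z)%:C) = (\int[((mu \x mu) \x mu)%E]_u f (row3 u))%:C.
Proof.
by move=> cf; apply: complex_eqP => //=; rewrite /Rintegral integral0.
Qed.

Lemma Rintegral3_prod (f0 f1 f2 : R -> R) :
  mu.-integrable setT (fun t => (f0 t)%:E) -> mu.-integrable setT (fun t => (f1 t)%:E) ->
  mu.-integrable setT (fun t => (f2 t)%:E) ->
  ((mu \x mu) \x mu)%E.-integrable setT (fun u => (f0 (row3 u 0 0) * f1 (row3 u 0 1) * f2 (row3 u 0 2))%:E) /\
  \int[((mu \x mu) \x mu)%E]_u (f0 (row3 u 0 0) * f1 (row3 u 0 1) * f2 (row3 u 0 2)) =
  \int[mu]_t f0 t * \int[mu]_t f1 t * \int[mu]_t f2 t.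
Proof.
move=> i0 i1 i2.
have E (u : R * R * R) : f0 (row3 u 0 0) * f1 (row3 u 0 1) * f2 (row3 u 0 2) =
    f0 u.1.1 * f1 u.1.2 * f2 u.2.
  by case: u => -[a b] c; have [-> -> ->] := row3E a b c.
have i01 := @integrable_prod _ _ _ _ _ mu mu _ _ i0 i1.
split.
  by under eq_fun do rewrite E; exact: (@integrable_prod _ _ _ _ _ (@lebesgue2 R) mu _ _ i01 i2).
under eq_Rintegral do rewrite E.
rewrite (@Rintegral_prod _ _ _ _ _ (@lebesgue2 R) mu _ _ i01 i2).
by rewrite (@Rintegral_prod _ _ _ _ _ mu mu _ _ i0 i1).
Qed.

                                                                        
(** Convolution of phi with a trigonometric polynomial, written out so that phi enters only through
    its Fourier transform at lattice points. *)
Definition synthesis (s : seq (C * 'rV[int]_3)) (phi : pt -> C) (x : pt) : C :=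
  \sum_(i <- s) i.1 * hat phi (lattice i.2) * expi (dot x (lattice i.2)).

Lemma tame_trig_sum (phi : pt -> C) x t : tame phi -> tame (fun y => trig_sum t (y - x) * phi y).
Proof.
move=> tphi; rewrite /trig_sum.
elim: t => [|i t IHt].
  by under eq_fun do rewrite big_nil; apply: tameZ.
under eq_fun do rewrite big_cons mulrDl; apply: tameD => //.
apply: (@tameM _ _ _ (nc i.1)) => // [|y]; last by rewrite ncM nc_expi mulr1.
apply: ccontM; first exact: ccont_cst.
under eq_fun do rewrite -dotNr dotDl.
apply: ccont_expi => y; apply: (@continuousD _ _ _ (fun y => dot y (- lattice i.2)) (fun=> dot (- x) (- lattice i.2))).
  exact: continuous_dot.
exact: cst_continuous.
Qed.

Lemma tame_bounded (phi : pt -> C) : tame phi -> exists M : R, 0 <= M /\ forall x, nc (phi x) <= M.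
Proof.
move=> [_ [M hM]]; exists `|M|; split=> // x; apply: le_trans (hM x) _.
apply: le_trans (ler_wpM2r (ltW (bump3_gt0 x)) (ler_norm M)) _.
by rewrite ler_piMr// bump3_le1.
Qed.

Lemma synthesis_integral s (phi : pt -> C) x : tame phi ->
  synthesis s phi x = integral3 (fun y => trig_sum s (y - x) * phi y).
Proof.
move=> tphi; rewrite /synthesis /trig_sum.
elim: s => [|[c k] s IH].
  rewrite big_nil -[LHS](mul0r (integral3 phi)) -integral3Z//.
  by apply: eq_integral3 => y; rewrite big_nil.
have ts t := tame_trig_sum x t tphi.
rewrite big_cons IH /=.
under [in RHS]eq_integral3 => y do rewrite big_cons mulrDl.
rewrite integral3D; [|by have := ts [:: (c, k)]; rewrite /trig_sum; under eq_fun do rewrite big_seq1|exact: ts].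
congr (_ + _); rewrite mulrAC -integral3Z; last exact: tame_hat.
apply: eq_integral3 => y /=.
by rewrite dotDl dotNl opprB expiD !mulrA.
Qed.

(** One list of coefficients serves every phi and x, so it applies simultaneously to a function and
    its derivatives. The support condition keeps all relevant differences in the region where the
    window is 1; the error is then the Lipschitz constant times the first absolute moment of the
    kernel. *)
Lemma trig_kernel (e : R) : 0 < e -> exists s, forall (phi : pt -> C) (L : R) (x : pt),
  tame phi -> (forall y y', nc (phi y - phi y') <= L * dist1 y y') ->
  (forall y, phi y != 0 -> forall k, `|y 0 k - x 0 k| <= T) ->
  nc (synthesis s phi x - phi x) <= L * e.
Proof.
(* The 6 is 2, from bounding a complex integral, times 3, one first moment per coordinate. *)
move=> e0; have [n [a0 aN]] := @trig_weight_ratio R T T0 (e / 6) (divr_gt0 e0 (ltr0n _ 6)).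
set a := \int[mu]_t trig_weight T n t in a0 aN.
pose w := trig_weight T n; pose W (z : pt) := w (z 0 0) * w (z 0 1) * w (z 0 2).
have iw := integrable_trig_weight T0 n; have iwn := integrable_trig_weight_norm T0 n.
have tq : trig (fun z => (a ^- 3)%:C * \prod_k (cosine_bump T (z 0 k))%:C ^+ n).
  apply: trigM; first exact: trig_cst.
  under eq_fun do rewrite !big_ord_recl big_ord0 mulr1.
  by do 2! (apply: trigM; first by apply: trigX; exact: trig_cos); apply: trigX; exact: trig_cos.
have [s sE] := tq; exists s => phi L x tphi phiL xT.
have L0 : 0 <= L.
  have := phiL 0 (e_ 0); have := nc_ge0 (phi 0 - phi (e_ 0)).
  move=> h /(le_trans h); rewrite pmulr_lge0//; apply: lt_le_trans (ltr01) _.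
  rewrite /dist1 (bigD1 0)//= !mxE /= sub0r normrN normr1 lerDl; exact: sumr_ge0.
have cW : continuous W.
  have cw (k : 'I_3) : continuous (fun z : pt => w (z 0 k)).
    move=> z; apply: (@continuous_comp _ _ _ (fun z : pt => z 0 k) w); first exact: coord_continuous.
    exact: continuous_trig_weight.
  move=> z; apply: (@continuousM _ _ (fun z : pt => w (z 0 0) * w (z 0 1)) (fun z => w (z 0 2))); last exact: cw.
  by apply: (@continuousM _ _ (fun z : pt => w (z 0 0)) (fun z => w (z 0 1))); exact: cw.
have w0 t : 0 <= w t := trig_weight_ge0 T n t.
have W0 z : 0 <= W z := mulr_ge0 (mulr_ge0 (w0 _) (w0 _)) (w0 _).
have [iW eW] := Rintegral3_prod iw iw iw.
have tW : tame (fun z => (W z)%:C).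
  split; first by split => //; exact: cst_continuous.
  have [M PM] := @plateau_bounded R; have M0 : 0 <= M := le_trans (normr_ge0 _) (PM 0).
  have wb t : w t <= M ^+ 2.
    apply: le_trans (trig_weight_le T n t) _; rewrite /window -(ger0_norm (sqr_ge0 _)) normrX.
    by rewrite lerXn2r ?nnegrE//; exact: PM.
  exists (M ^+ 6 * (1 + (2 * T) ^+ 2) ^+ 3) => z.
  apply: (@bump3_support _ (fun z => (W z)%:C)) => [|y|y]; first by rewrite exprn_ge0.
    rewrite ncR ger0_norm// (_ : M ^+ 6 = M ^+ 2 * M ^+ 2 * M ^+ 2); last by ring.
    by apply: ler_pM => //; [exact: mulr_ge0|exact: ler_pM].
  move=> yW k; rewrite leNgt; apply: contraNN yW => yk.
  have wk0 : w (y 0 k) = 0 by rewrite /w /trig_weight window0 ?mul0r// ltW.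
  by rewrite /W; case: (ord3P k) wk0 => -> ->; rewrite !(mul0r, mulr0).
have cphi := tphi.1; have [M [M0 hM]] := tame_bounded tphi.
have tpW : tame (fun z => phi (z + x) * (W z)%:C).
  by apply: (@tameM _ _ _ M) => //; exact: ccont_shift.
(* Where phi(z + x) is nonzero the window is 1, so the polynomial may be replaced by the windowed
   weight, which is integrable and of known mass. *)
have A : synthesis s phi x = (a ^- 3)%:C * integral3 (fun z => phi (z + x) * (W z)%:C).
  rewrite synthesis_integral// -(integral3_shift x (tame_trig_sum x s tphi)) -integral3Z//.
  apply: eq_integral3 => z; rewrite addrK -sE.
  have [->|/xT zT] := eqVneq (phi (z + x)) 0; first by rewrite mulr0 mul0r mulr0.
  have wE k : w (z 0 k) = cosine_bump T (z 0 k) ^+ n.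
    rewrite /w /trig_weight window1 ?mul1r//.
    by have := zT k; rewrite !mxE addrK.
  rewrite -mulrA [phi _ * _]mulrC; congr (_ * (_ * _)).
  by rewrite prod3 -!rmorphXn -!rmorphM /W !wE.
have an0 : a != 0 := lt0r_neq0 a0.
have B : phi x = (a ^- 3)%:C * integral3 (fun z => phi x * (W z)%:C).
  rewrite integral3Z// integral3_real//.
  have -> : \int[((mu \x mu) \x mu)%E]_u W (row3 u) = a ^+ 3 by rewrite eW -!expr2 -exprSr.
  by rewrite mulrCA -rmorphM mulVf ?expf_neq0// mulr1.
rewrite A [X in _ - X]B -mulrBr -integral3B//; last exact: tameZ.
rewrite ncM ncR ger0_norm ?invr_ge0 ?exprn_ge0 ?(ltW a0)// ler_pdivrMl ?exprn_gt0//.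
pose N := \int[mu]_t (`|t| * w t).
have [i0 e0'] := Rintegral3_prod iwn iw iw.
have [i1 e1'] := Rintegral3_prod iw iwn iw.
have [i2 e2'] := Rintegral3_prod iw iw iwn.
pose h0 u := `|row3 u 0 0| * w (row3 u 0 0) * w (row3 u 0 1) * w (row3 u 0 2).
pose h1 u := w (row3 u 0 0) * (`|row3 u 0 1| * w (row3 u 0 1)) * w (row3 u 0 2).
pose h2 u := w (row3 u 0 0) * w (row3 u 0 1) * (`|row3 u 0 2| * w (row3 u 0 2)).
have i01 := integrableD measurableT i0 i1.
have i012 := integrableD measurableT i01 i2.
have iL := integrableZl measurableT L i012.
have hE : \int[((mu \x mu) \x mu)%E]_u (L * (h0 u + h1 u + h2 u)) = L * (3 * N * a ^+ 2).
  rewrite RintegralZl//; congr (L * _).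
  rewrite RintegralD// RintegralD// e0' e1' e2' -/a -/w -/N; ring.
apply: (@le_trans _ _ (2 * (L * (3 * N * a ^+ 2)))).
  rewrite -hE; apply: nc_cintegral => //.
    apply: (@cmeas_row3 R (fun z => phi (z + x) * (W z)%:C - phi x * (W z)%:C)); apply: ccontB; first exact: tpW.1.
    exact: (tameZ (phi x) tW).1.
  move=> u _ /=; set z := row3 u; rewrite -mulrBl ncM ncR ger0_norm//.
  apply: le_trans (ler_wpM2r (W0 z) (phiL _ _)) _.
  have c k : (z + x) 0 k - x 0 k = z 0 k by rewrite [(z + x) 0 k]mxE addrK.
  rewrite /dist1 sum3 !c /h0 /h1 /h2 -/z /W le_eqVlt; apply/orP; left; apply/eqP.
  clear; ring.
have := ler_wpM2l (mulr_ge0 L0 (sqr_ge0 a)) aN; rewrite -/w -/N.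
have -> : L * a ^+ 2 * (e / 6 * a) = a ^+ 3 * (L * e) / 6 by field.
clear; lra.
Qed.

End TrigKernel3.

(** * Support of a distribution and independence of the cutoff *)

Section Support.
Variable R : realType.
Local Notation pt := 'rV[R]_3.
Local Notation C := R[i].

Lemma test_fun_cpartials (D : set pt) s (g : pt -> C) : test_fun D g -> test_fun D (cpartials s g).
Proof. by move=> tg; elim: s => //= k s IH; exact: test_fun_cpartial. Qed.

Lemma csupport_cpartials s (g : pt -> C) : csupport (cpartials s g) `<=` csupport g.
Proof. by elim: s => [|k s IH] //= x /csupport_cpartial /IH. Qed.

Lemma smooth_synthesis T s (phi : pt -> C) : smooth (synthesis T s phi).
Proof. by apply: smooth_sum => i; apply: smoothZ; exact: smooth_expi. Qed.

Lemma cpartial_synthesis T s (phi : pt -> C) k : test_fun setT phi ->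
  cpartial k (synthesis T s phi) = synthesis T s (cpartial k phi).
Proof.
move=> tphi; rewrite /synthesis; elim: s => [|i s IH].
  rewrite (_ : (fun x => _) = fun=> 0); last by apply/funext => x; rewrite big_nil.
  by rewrite cpartial_cst; apply/funext => x; rewrite big_nil.
rewrite (_ : (fun x => _) = fun x => i.1 * hat phi (lattice T i.2) * expi (dot x (lattice T i.2)) +
   \sum_(j <- s) j.1 * hat phi (lattice T j.2) * expi (dot x (lattice T j.2))); last first.
  by apply/funext => x; rewrite big_cons.
rewrite cpartialD; [|by apply: smoothZ; exact: smooth_expi|exact: (smooth_synthesis T s phi)].
rewrite IH cpartialZ; last exact: smooth_expi.
apply/funext => x; rewrite big_cons; congr (_ + _).
have := cpartials_expi [:: k] (lattice T i.2); rewrite /= => ->.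
by rewrite big_seq1 (hat_cpartial _ _ tphi) !mulrA; congr (_ * _); rewrite -!mulrA; congr (_ * _); rewrite mulrC -mulrA.
Qed.

Lemma cpartials_synthesis T s (phi : pt -> C) t : test_fun setT phi ->
  cpartials t (synthesis T s phi) = synthesis T s (cpartials t phi).
Proof.
move=> tphi; elim: t => //= k t ->; rewrite cpartial_synthesis//.
exact: test_fun_cpartials.
Qed.

(** The distribution kills [chi] times any synthesis. Synthesis commutes with derivatives, so by
    [trig_kernel] the syntheses of psi converge to psi with all derivatives, uniformly on the
    support of [chi], and continuity concludes. *)
Lemma component_synthesis_vanish u j (chi psi : pt -> C) (T : R) : 0 < T ->
  test_fun setT chi -> test_fun setT psi ->
  (forall x y, csupport chi x -> csupport psi y -> forall k, `|y 0 k - x 0 k| <= T) ->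
  (forall k : 'rV[int]_3, component u j (fun x => chi x * expi (dot x (lattice T k))) = 0) ->
  component u j (fun x => chi x * psi x) = 0.
Proof.
move=> T0 tchi tpsi close u0.
have e0 n : (0 : R) < n.+1%:R^-1 by rewrite invr_gt0.
have [s sP] := choice (fun n => trig_kernel T0 (e0 n)).
have ss n := smooth_synthesis T (s n) psi.
have spsi := test_fun_smooth tpsi.
pose g n x := psi x + (- 1) * synthesis T (s n) psi x.
have sg n : smooth (g n) by apply: smoothD; [exact: spsi|apply: smoothZ; exact: ss].
have : ccvg \oo (fun n => component u j (fun x => chi x * g n x)) 0.
  apply: component_cvg0 => // t e ep.
  have [M [M0 _ ML]] := test_lipschitz (test_fun_cpartials t tpsi).
  have h : 2 * M * n.+1%:R^-1 @[n --> \oo] --> (0 : R).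
    by rewrite -[X in _ --> X](mulr0 (2 * M)); apply: cvgMl_tmp; exact: cvg_invS.
  move/cvgrPdist_le : h => /(_ e ep); apply: filterS => n.
  rewrite sub0r normrN => /(le_trans (ler_norm _)) h x chix.
  apply: le_trans h.
  rewrite cpartialsD; [|exact: spsi|by apply: smoothZ].
  rewrite cpartialsZ// cpartials_synthesis// mulN1r nc_subC.
  apply: sP; first exact: test_tame (test_fun_cpartials t tpsi).
    exact: row3_dist1 ML.
  move=> y yn; apply: close => //; apply: (@csupport_cpartials t psi).
  by apply: subset_closure.
have zero n : component u j (fun x => chi x * g n x) = component u j (fun x => chi x * psi x).
  have tce k : test_fun setT (fun x => chi x * expi (dot x (lattice T k))).
    by apply: test_funM => //; exact: smooth_expi.
  have -> : component u j (fun x => chi x * g n x) =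
     (- 1) * component u j (fun x => chi x * synthesis T (s n) psi x) + component u j (fun x => chi x * psi x).
    rewrite -componentP; [|exact: test_funM..].
    congr (component u j _); apply/funext => x; rewrite /g; ring.
  have -> : component u j (fun x => chi x * synthesis T (s n) psi x) = 0.
    rewrite (_ : (fun x => _) = fun x => \sum_(i <- s n) i.1 * hat psi (lattice T i.2) * (chi x * expi (dot x (lattice T i.2)))).
      rewrite component_sum => [|i]; last exact: test_funZ.
      by rewrite big1// => i _; rewrite componentZ// u0 mulr0.
    apply/funext => x; rewrite /synthesis mulr_sumr; apply: eq_bigr => i _.
    by rewrite mulrCA.
  by rewrite mulr0 add0r.
rewrite (_ : (fun n => _) = fun=> component u j (fun x => chi x * psi x)); last exact/funext.
move=> h; apply: (ccvg_unique _ h); exact: ccvg_cst.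
Qed.

(** A partition of unity built one box at a time: psi is split by the cutoff of the first box, whose
    share is killed, and the rest vanishes on that box. *)
Lemma component_cover u j (cov : seq (pt * R)) (psi : pt -> C) : test_fun setT psi ->
  (forall i, i \in cov -> 0 < i.2 /\
     forall phi, test_fun (box i.1 (2 * i.2)) phi -> component u j phi = 0) ->
  (forall x, psi x != 0 -> exists2 i, i \in cov & box i.1 i.2 x) ->
  component u j psi = 0.
Proof.
elim: cov psi => [|[c r] cov IH] psi tpsi hcov cover.
  rewrite (_ : psi = fun=> 0) ?component0//; apply/funext => x.
  by apply/eqP/contraT => /cover[].
have [r0 hr] := hcov (c, r) (mem_head _ _).
have tcut := test_cutoff r0 (@subset_refl _ (box c (2 * r))).
have sc := smooth_cutoff c r; have sp := test_fun_smooth tpsi.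
have t1 := test_funM tcut sp.
have t2 : test_fun setT (fun x => psi x * (1 + (- 1) * cutoff c r x)).
  by apply: test_funM; [exact: tpsi|apply: smoothD; [exact: smooth_cst|apply: smoothZ; exact: sc]].
rewrite (_ : psi = fun x => cutoff c r x * psi x + psi x * (1 + (- 1) * cutoff c r x)); last first.
  by apply/funext => x; ring.
rewrite componentD; [|exact: test_funS t1|exact: t2].
rewrite (hr _ t1) add0r; apply: IH => //.
  by move=> i ic; apply: hcov; rewrite inE ic orbT.
move=> x; rewrite mulf_eq0 negb_or => /andP[xn ce].
have [i0] := cover x xn; rewrite inE => /orP[/eqP ie|ic] xi; last by exists i0.
by move: ce; rewrite ie in xi; rewrite cutoff1//= mulN1r subrr eqxx.
Qed.

Lemma nbhs_box (x : pt) (V : set pt) : nbhs x V -> exists r : R, 0 < r /\ box x r `<=` V.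
Proof.
move=> /nbhs_ballP[e /= e0 eV]; exists (e / 2); split; first by rewrite divr_gt0.
move=> y yx; apply: eV; rewrite -ball_normE /=; apply: (@le_lt_trans _ _ (e / 2)); last by lra.
apply: le_norm_coord; first by rewrite divr_ge0// ltW.
by move=> k; rewrite !mxE distrC.
Qed.

(** Every point of the support of psi lies off the support of the distribution, hence has a box on
    which the distribution vanishes; compactness extracts a finite cover for [component_cover]. *)
Lemma component_dsupport u j (psi : pt -> C) (V : set pt) : test_fun setT psi -> open V ->
  dsupport (component u j) `<=` V -> (forall x, V x -> psi x = 0) -> component u j psi = 0.
Proof.
move=> tpsi oV suppV psi0.
have [_ cK _] := tpsi.
have loc x : exists r : R, csupport psi x -> 0 < r /\
    forall phi, test_fun (box x (2 * r)) phi -> component u j phi = 0.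
  have [Kx|] := pselect (csupport psi x); last by exists 0.
  have nVx : ~ V x.
    move=> Vx; have [y [/= yn Vy]] := Kx V (open_nbhs_nbhs (conj oV Vx)).
    by move: yn; rewrite psi0// eqxx.
  have : ~ dsupport (component u j) x by move=> /suppV.
  rewrite /dsupport /= => /existsNP[U] /not_implyP[oU] /not_implyP[Ux] /contrapT hU.
  have [r [r0 rU]] := nbhs_box (open_nbhs_nbhs (conj oU Ux)).
  exists (r / 2) => _; split; first by rewrite divr_gt0.
  move=> phi tphi; apply: hU; apply: test_funS tphi.
  by apply: subset_trans rU; rewrite mulrC divfK.
have [r rP] := choice loc.
move: cK; rewrite compact_cover => /(_ pt (csupport psi) (fun x => (box x (r x))°)).
case.
- by move=> x _; exact: open_interior.
- move=> x Kx; exists x => //; have [r0 _] := rP x Kx.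
  by apply: box_nbhs.
move=> F FK cov.
apply: (@component_cover u j [seq (x, r x) | x <- finmap.enum_fset F]) => //.
- by move=> i /mapP[x xF ->]; have := rP x (set_mem (FK x xF)).
- move=> x xn; have Kx : csupport psi x by apply: subset_closure.
  have [y yF xy] := cov x Kx; exists (y, r y); last exact: interior_subset xy.
  by apply/mapP; exists y.
Qed.

(** The pairing is defined by choice of an admissible cutoff. Two such cutoffs agree near the
    support, so the difference of the two values is 0 by [component_dsupport]. *)
Lemma smooth_pairingE u j (g chi : pt -> C) (V : set pt) : test_fun setT chi -> open V ->
  dsupport (component u j) `<=` V -> (forall x, V x -> chi x = 1) -> smooth g ->
  smooth_pairing (component u j) g = component u j (fun x => chi x * g x).
Proof.
move=> tchi oV suppV chi1 sg; apply: xget_unique.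
  by exists chi; split=> //; exists V.
move=> z [chi' [tchi' [V' [oV' suppV' chi'1]] ->]].
have tM (c : pt -> C) : test_fun setT c -> test_fun setT (fun x => c x * g x).
  by move=> tc; exact: test_funM.
have z0 : component u j (fun x => (- 1) * (chi x * g x) + chi' x * g x) = 0.
  apply: (@component_dsupport u j _ (V `&` V')).
  - apply: test_funD; [apply: test_funZ|]; exact: tM.
  - exact: openI.
  - by move=> x dx; split; [exact: suppV|exact: suppV'].
  - by move=> x [Vx V'x]; rewrite chi1// chi'1//; ring.
move: z0; rewrite (componentP u j (- 1) (tM _ tchi) (tM _ tchi')) mulN1r addrC => /eqP.
by rewrite subr_eq0 => /eqP.
Qed.

Definition qbox_center (q : 'rV[rat]_3) : pt := map_mx ratr q.

(** Vanishing on countably many test functions bounds the support: near a point off the closure of D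
    lies a small box with rational centre and radius 1 / (N + 1), and lattice exponentials on that
    box suffice by [component_synthesis_vanish]. *)
Lemma dsupport_closure u j (D : set pt) :
  (forall (q : 'rV[rat]_3) (N : nat) (k : 'rV[int]_3),
     (forall x, box (qbox_center q) (2 * N.+1%:R^-1) x -> ~ D x) ->
     component u j (fun x => cutoff (qbox_center q) N.+1%:R^-1 x *
       expi (dot x (lattice (3 * N.+1%:R^-1) k))) = 0) ->
  dsupport (component u j) `<=` closure D.
Proof.
move=> hu x dx; apply: contrapT => nDx.
have [e [e0 eD]] : exists e : R, 0 < e /\ box x e `<=` ~` D.
  apply: nbhs_box; move: nDx; rewrite /closure /= => /existsNP[U] /not_implyP[Ux UD].
  by apply: filterS Ux => y Uy Dy; apply: UD; exists y.
have [N hN] : exists N : nat, 3 * N.+1%:R^-1 <= e.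
  have h : 3 * n.+1%:R^-1 @[n --> \oo] --> (0 : R).
    by rewrite -[X in _ --> X](mulr0 3); apply: cvgMl_tmp; exact: cvg_invS.
  move/cvgrPdist_le : h => /(_ e e0) [n _ /(_ n)] /=; rewrite sub0r normrN => h; exists n.
  by apply: le_trans (ler_norm _) (h _); exact: leqnn.
set r := N.+1%:R^-1 in hN; have r0 : 0 < r by rewrite invr_gt0.
have [q qx] : exists q : 'rV[rat]_3, forall k, `|x 0 k - qbox_center q 0 k| <= r / 2.
  have hq k : exists q : rat, `|x 0 k - ratr q| <= r / 2.
    have /rat_in_itvoo[q] : x 0 k - r / 2 < x 0 k + r / 2 by lra.
    by rewrite in_itv /= => /andP[q1 q2]; exists q; rewrite ler_distlC; lra.
  have [f hf] := choice hq; exists (\row_k f k) => k; rewrite !mxE; exact: hf.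
set c := qbox_center q in qx.
have cD y : box c (2 * r) y -> ~ D y.
  move=> yc; apply: eD => k; have := yc k; have := qx k.
  have := ler_normD (y 0 k - c 0 k) (c 0 k - x 0 k); rewrite addrA subrK [`|c 0 k - _|]distrC; lra.
have xc : (box c r)° x.
  have : nbhs x (box x (r / 2)) by apply: box_nbhs; rewrite divr_gt0.
  apply: filterS => y yx k; have := yx k; have := qx k.
  have := ler_normD (y 0 k - x 0 k) (x 0 k - c 0 k); rewrite addrA subrK; lra.
apply: (dx _ (@open_interior _ _) xc) => psi tpsi.
have [spsi _ suppsi] := tpsi.
have bpsi : csupport psi `<=` box c r by apply: subset_trans suppsi _; exact: interior_subset.
have E : psi = fun x => cutoff c r x * psi x.
  apply/funext => y; have [->|yn] := eqVneq (psi y) 0; first by rewrite mulr0.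
  by rewrite cutoff1 ?mul1r//; apply: bpsi; exact: subset_closure.
(* The cutoff lives in the box of half-width 2r and psi in that of half-width r, so coordinates
   differ by at most 3r; this fixes the lattice parameter. *)
rewrite E; apply: (@component_synthesis_vanish _ _ _ _ (3 * r)).
- by rewrite mulr_gt0.
- exact: test_cutoff.
- exact: test_funS tpsi.
- move=> y z yc /bpsi zc k; have cy : box c (2 * r) y.
    apply: csupportP yc; first exact: closed_box.
    by move=> w; exact: cutoff0.
  have := cy k; have := zc k.
  have := ler_normB (z 0 k - c 0 k) (y 0 k - c 0 k).
  rewrite (_ : z 0 k - c 0 k - (y 0 k - c 0 k) = z 0 k - y 0 k); [lra|ring].
- by move=> k; exact: hu.
Qed.

End Support.

(** * Integration against a measure with density *)

Section Density.
Local Open Scope ereal_scope.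
Context d (T : measurableType d) (R : realType).
Variables (mu nu : {measure set T -> \bar R}) (p : T -> R).
Hypothesis mp : measurable_fun setT p.
Hypothesis p0 : forall x, (0 <= p x)%R.
Hypothesis nuE : forall A, measurable A -> nu A = \int[mu]_(x in A) (p x)%:E.

Import HBNNSimple.

Let density_nnsfun (f : {nnsfun T >-> R}) :
  \int[nu]_x (f x)%:E = \int[mu]_x ((f x)%:E * (p x)%:E).
Proof.
under [LHS]eq_integral do rewrite fimfunE -fsumEFin//.
rewrite [LHS]ge0_integral_fsum//; last 2 first.
  - by move=> r; exact/measurable_EFinP/measurableT_comp.
  - by move=> n x _; rewrite EFinM nnfun_muleindic_ge0.
under [RHS]eq_integral.
  move=> x _; rewrite fimfunE -fsumEFin// ge0_mule_fsuml; last first.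
    by move=> r; rewrite EFinM nnfun_muleindic_ge0.
  over.
rewrite [RHS]ge0_integral_fsum//; last 2 first.
  - move=> r; apply: emeasurable_funM; last exact/measurable_EFinP.
    exact/measurable_EFinP/measurableT_comp.
  - by move=> n x _; apply: mule_ge0; [rewrite EFinM nnfun_muleindic_ge0|rewrite lee_fin].
apply: eq_fsbigr => r _.
have mA : measurable (f @^-1` [set r]) by exact: measurable_sfunP.
rewrite integralZl_indic_nnsfun//= integral_indic// setIT nuE//.
under [RHS]eq_integral do rewrite EFinM -muleA.
have [r0|r0] := leP 0%R r; last first.
  have -> : f @^-1` [set r] = set0.
    by apply/seteqP; split=> // x /= xr; move: r0; rewrite -xr ltNge fun_ge0.
  rewrite integral_set0 mule0 integral0_eq// => x _.
  by rewrite indic0 mul0e mule0.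
rewrite ge0_integralZl//; last 2 first.
  - apply: emeasurable_funM; exact/measurable_EFinP.
  - by move=> x _; rewrite mule_ge0 ?lee_fin.
congr (_ * _); rewrite integral_mkcond; apply: eq_integral => x _.
by rewrite patchE indicE; case: ifPn; rewrite ?mul1e ?mul0e.
Qed.

Lemma ge0_integral_density (f : T -> \bar R) : measurable_fun setT f ->
  (forall x, 0 <= f x) -> \int[nu]_x f x = \int[mu]_x (f x * (p x)%:E).
Proof.
move=> mf f0; pose g := nnsfun_approx measurableT mf.
have gf x : (g n x)%:E @[n --> \oo] --> f x by exact: cvg_nnsfun_approx.
have L := @cvg_monotone_convergence _ _ _ nu setT measurableT (fun n x => (g n x)%:E)
  (fun n => (measurable_EFinP _ _).2 (measurable_funTS (measurable_funP (g n)))).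
transitivity (limn (fun n => \int[nu]_x (g n x)%:E)).
  rewrite -monotone_convergence//=.
  - by apply: eq_integral => x _; apply/esym/cvg_lim.
  - by move=> n; exact/measurable_EFinP/measurable_funTS.
  - by move=> n x _; rewrite lee_fin.
  - by move=> x _ m n mn; rewrite lee_fin; exact/lefP/nd_nnsfun_approx.
under eq_fun do rewrite density_nnsfun.
rewrite -monotone_convergence//=.
- apply: eq_integral => x _; apply: cvg_lim => //.
  by apply: cvgeZr; [|exact: gf].
- move=> n; apply: emeasurable_funM; exact/measurable_EFinP.
- by move=> n x _; rewrite mule_ge0 ?lee_fin.
- move=> x _ m n mn; apply: lee_wpmul2r; first by rewrite lee_fin.
  by rewrite lee_fin; exact/lefP/nd_nnsfun_approx.
Qed.

End Density.

(** * Moments of the normal density *)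

Section GaussianMoments.
Variable R : realType.
Local Notation mu := (@lebesgue_measure R).
Implicit Types (s m c x : R).

Variable s : R.
Hypothesis s0 : s != 0.
Let phi := normal_pdf 0 s.

Let phiE x : phi x = normal_peak s * expR (- (x ^+ 2 / (s ^+ 2 *+ 2))).
Proof. by rewrite /phi normal_pdfE// /normal_fun subr0 mulNr. Qed.

Let ss : 0 < s ^+ 2. Proof. by rewrite exprn_even_gt0. Qed.

(** With y = x^2, (1 + y^2)(1 + y) is at most (1 + y)^3, and exp(y/q) is the cube of exp(y/3q),
    which is at least 1 + y/3q. *)
Lemma normal_pdf_decay : exists K : R, 0 <= K /\
  forall x, (1 + x ^+ 4) * normal_pdf 0 s x <= K * bump1 x.
Proof.
pose q := s ^+ 2 *+ 2; have q0 : 0 < q by rewrite mulrn_wgt0.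
exists (normal_peak s * (1 + 3 * q) ^+ 3); split.
  by rewrite mulr_ge0 ?normal_peak_ge0// exprn_ge0// addr_ge0// mulr_ge0// ltW.
move=> x; rewrite -/phi phiE -/q -(mulrA (normal_peak s)) mulrCA ler_wpM2l ?normal_peak_ge0//.
set y := x ^+ 2; have y0 : 0 <= y by exact: sqr_ge0.
have -> : x ^+ 4 = y ^+ 2 by rewrite /y -exprM.
rewrite expRN ler_pdivrMr ?expR_gt0// /bump1 -/y mulrAC ler_pdivlMr; last by lra.
have E : (1 + y) ^+ 3 <= (1 + 3 * q) ^+ 3 * expR (y / q).
  have -> : expR (y / q) = expR (y / (3 * q)) ^+ 3.
    by rewrite -expRM_natl; congr expR; field; rewrite gt_eqF.
  have q3 : 0 <= 1 + 3 * q by rewrite addr_ge0// mulr_ge0// ltW.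
  have A : 1 + y <= (1 + 3 * q) * expR (y / (3 * q)).
    apply: le_trans (ler_wpM2l q3 (expR_ge1Dx (y / (3 * q)))).
    have -> : (1 + 3 * q) * (1 + y / (3 * q)) = 1 + y + (3 * q + y / (3 * q)).
      by field; rewrite gt_eqF.
    by rewrite lerDl addr_ge0// ?divr_ge0// mulr_ge0// ltW.
  by rewrite -exprMn lerXn2r// nnegrE ?addr_ge0// mulr_ge0// expR_ge0.
apply: le_trans E; have := mulr_ge0 y0 y0; nra.
Qed.

Lemma is_derive_normal_pdf x : is_derive x 1 (normal_pdf 0 s) (- (x / s ^+ 2) * normal_pdf 0 s x).
Proof.
have -> : normal_pdf 0 s = fun x => normal_peak s * expR (- (s ^+ 2 *+ 2)^-1 * (x * x)).
  by apply/funext => y; rewrite -/phi phiE expr2 mulrC [in RHS]mulrC mulNr [X in - X]mulrC.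
have h1 : is_derive x 1 (fun x : R => - (s ^+ 2 *+ 2)^-1 * (x * x)) (- (s ^+ 2 *+ 2)^-1 * (x + x)).
  have h := is_deriveZ (- (s ^+ 2 *+ 2)^-1) (is_deriveM (is_derive_id x (1 : R)) (is_derive_id x (1 : R))).
  by apply: (is_derive_eq h); rewrite /GRing.scale /= !mulr1.
have h2 := is_deriveZ (normal_peak s) (is_derive1_comp (is_derive_expR _) h1).
by apply: (is_derive_eq h2); rewrite /GRing.scale /=; field; exact: s0.
Qed.

Lemma integrable_normal_moment n : (n <= 4)%N ->
  mu.-integrable setT (fun x => (x ^+ n * normal_pdf 0 s x)%:E).
Proof.
move=> n4; have [K [K0 hK]] := normal_pdf_decay.
have h := integrableZl measurableT K (@integrable_bump1 R).
apply: le_integrable h => //.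
  apply/measurable_EFinP; apply: measurable_funM; last exact: measurable_normal_pdf.
  exact: measurable_funX.
move=> x _; rewrite /= lee_fin normrM normrX.
apply: le_trans (ler_norm _); apply: le_trans (hK x).
rewrite (ger0_norm (normal_pdf_ge0 _ _ _)) ler_wpM2r ?normal_pdf_ge0//.
have -> : x ^+ 4 = `|x| ^+ 4 by rewrite -normrX ger0_norm// exprn_even_ge0.
have [x1|x1] := leP `|x| 1; first by rewrite ler_wpDr ?exprn_ge0// exprn_ile1.
by rewrite ler_wpDl// ler_weXn2l// ltW.
Qed.

Lemma normal_pdfN x : normal_pdf 0 s (- x) = normal_pdf 0 s x.
Proof. by rewrite -/phi !phiE sqrrN. Qed.

Lemma normal_moment1 : \int[mu]_x (x * normal_pdf 0 s x) = 0.
Proof.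
pose f x := x * normal_pdf 0 s x.
have fi : mu.-integrable setT (fun x => (f x)%:E).
  by have := @integrable_normal_moment 1 isT; under eq_fun do rewrite expr1.
have p : measure_preserving mu (-%R : R -> R).
  split; first exact: oppr_measurable.
  by move=> A mA; exact: (lebesgue_measureN mA).
have ci : cintegrable mu setT (fun x => (f x)%:C) by split=> //=; exact: integrable0.
have [_ e] := cintegral_preserving p ci.
have /(congr1 (@complex.Re R)) /= := e.
have -> : \int[mu]_x f (- x) = \int[mu]_x (-1 * f x).
  by apply: eq_Rintegral => x _; rewrite /f normal_pdfN; ring.
rewrite RintegralZl// mulN1r; set I := \int[mu]_x f x; lra.
Qed.

(** Integration by parts with the primitive -s^2 x^(n+1) phi(x). To have a nonnegative even
    integrand, a multiple of [bump1] is added, whose primitive is an arctangent, and its integral is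
    removed at the end. *)
Lemma normal_moment_step n : (n = 0 \/ n = 2)%N ->
  \int[mu]_x (x ^+ n.+2 * normal_pdf 0 s x) = n.+1%:R * s ^+ 2 * \int[mu]_x (x ^+ n * normal_pdf 0 s x).
Proof.
move=> n02; have [K [K0 hK]] := normal_pdf_decay.
have n2 : (n <= 2)%N by case: n02 => ->.
have n3 : (n <= 3)%N by apply: leq_trans n2 _.
have n4 : (n <= 4)%N by apply: leq_trans n2 _.
have odd_n k : (k <= 3)%N -> forall x : R, `|x ^+ k| <= 1 + x ^+ 4.
  move=> k3 x; have -> : x ^+ 4 = `|x| ^+ 4 by rewrite -normrX ger0_norm// exprn_even_ge0.
  rewrite normrX; have [x1|x1] := leP `|x| 1; first by rewrite ler_wpDr ?exprn_ge0// exprn_ile1.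
  by rewrite ler_wpDl// ler_weXn2l ?(leq_trans k3)// ltW.
have dec k : (k <= 3)%N -> forall x, `|x ^+ k * phi x| <= K * bump1 x.
  move=> k3 x; rewrite normrM (ger0_norm (normal_pdf_ge0 _ _ _)); apply: le_trans (hK x).
  by rewrite ler_wpM2r ?normal_pdf_ge0// odd_n.
have evn k (x : R) : (k = 0 \/ k = 2)%N -> (- x) ^+ k = x ^+ k /\ (- x) ^+ k.+2 = x ^+ k.+2 /\ 0 <= x ^+ k.+2.
  by case=> ->; rewrite ?expr0 ?sqrrN; do ?split; rewrite ?sqr_ge0// ?(exprM _ 2 2) ?sqrrN// sqr_ge0.
pose c := n.+1%:R * s ^+ 2; have c0 : 0 <= c by rewrite mulr_ge0// ltW.
pose f x := x ^+ n.+2 * phi x - c * (x ^+ n * phi x) + c * K * bump1 x.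
pose F x := - s ^+ 2 * (x ^+ n.+1 * phi x) + c * K * atan x.
have cphi : continuous phi by exact: continuous_normal_pdf.
have cX k : continuous (fun x : R => x ^+ k * phi x).
  by move=> x; apply: (@continuousM _ _ (fun x : R => x ^+ k) phi); [exact: exprn_continuous|exact: cphi].
have cf : continuous f.
  move=> x; apply: (@continuousD _ _ _ (fun x => x ^+ n.+2 * phi x - c * (x ^+ n * phi x)) (fun x => c * K * bump1 x)).
    apply: (@continuousB _ _ _ (fun x => x ^+ n.+2 * phi x) (fun x => c * (x ^+ n * phi x))); first exact: cX.
    by apply: (@continuousM _ _ (fun _ : R => c) (fun x => x ^+ n * phi x)); [exact: cst_continuous|exact: cX].
  by apply: (@continuousM _ _ (fun _ : R => c * K) (@bump1 R)); [exact: cst_continuous|exact: continuous_bump1].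
have [] := @even_integral_halfline R f F (c * K * (pi / 2)).
- move=> x; have [_ [_ e2]] := evn n x n02.
  have := dec n n3 x => /(le_trans (ler_norm _)) h.
  have := ler_wpM2l c0 h; have := mulr_ge0 e2 (normal_pdf_ge0 0 s x); rewrite /f -/phi; lra.
- exact: cf.
- move=> x; have [e1 [e2 _]] := evn n x n02.
  by rewrite /f /phi normal_pdfN e1 e2 /bump1 sqrrN.
- move=> x _.
  have hX : is_derive x 1 (fun x : R => x ^+ n.+1) (n.+1%:R * x ^+ n).
    rewrite (_ : (fun x : R => x ^+ n.+1) = id ^+ n.+1); last by apply/funext => y; rewrite fctE.
    have h := is_deriveX n.+1 (is_derive_id x (1 : R)).
    by apply: (is_derive_eq h); rewrite /GRing.scale /= mulr1.
  have h1 := is_deriveZ (- s ^+ 2) (is_deriveM hX (is_derive_normal_pdf x)).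
  have h2 := is_deriveZ (c * K) (is_derive1_atan x).
  apply: (is_derive_eq (is_deriveD h1 h2)).
  rewrite /GRing.scale /= /f /bump1 /c -/phi !exprS.
  have x2 : 1 + x ^+ 2 != 0 by rewrite gt_eqF// ltr_pwDl// sqr_ge0.
  by field; rewrite x2 s0.
- rewrite /F -[X in _ --> X]add0r; apply: cvgD; last by apply: cvgMl_tmp; exact: cvgy_atan.
  rewrite -[X in _ --> X](mulr0 (- s ^+ 2)); apply: cvgMl_tmp.
  apply/norm_cvg0P; apply: (@squeeze_cvgr _ _ _ _ (cst 0) (fun x => K * bump1 x)).
  + by apply: nearW => x; rewrite normr_ge0 /= dec.
  + exact: cvg_cst.
  + rewrite -[X in _ --> X](mulr0 K); apply: cvgMl_tmp.
    apply: (@squeeze_cvgr _ _ _ _ (cst 0) (fun x : R => x^-1)).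
    * near=> x; rewrite ltW ?bump1_gt0//= /bump1.
      have x1 : 1 <= x by near: x; exact: nbhs_pinfty_ge.
      rewrite lef_pV2 ?posrE; [nra|nra|lra].
    * exact: cvg_cst.
    * apply/gtr0_cvgV0; [exact: nbhs_pinfty_gt|exact: cvg_id].
- move=> fi.
  have iX k : (k <= 4)%N -> mu.-integrable setT (fun x => (x ^+ k * phi x)%:E) by exact: integrable_normal_moment.
  have i1 := iX n.+2 (n2 : (n.+2 <= 4)%N).
  have i2 := integrableZl measurableT c (iX n n4).
  have i3 := integrableZl measurableT (c * K) (@integrable_bump1 R).
  have i12 := integrableB measurableT i1 i2.
  rewrite /f (RintegralD measurableT i12 i3) (RintegralB measurableT i1 i2).
  rewrite (RintegralZl _ measurableT (iX n n4)) (RintegralZl _ measurableT (@integrable_bump1 R)).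
  have -> : \int[mu]_x bump1 x = pi by rewrite /Rintegral integral_bump1.
  rewrite /F expr0n /= mul0r mulr0 atan0 mulr0 addr0 subr0 -/phi -/c.
  move=> h; have : c * K * pi = 2 * (c * K * (pi / 2)) by field.
  move: h; clear; lra.
Unshelve. all: by end_near. Qed.

End GaussianMoments.

(** * Fourth moment of a centred Gaussian variable *)

Section GaussianVariables.
Context d (T : measurableType d) (R : realType) (P : probability T R).
Local Notation mu := (@lebesgue_measure R).
Implicit Types X : T -> R.

Lemma normal_pdf_shift (m s x : R) : s != 0 -> normal_pdf m s (x + m) = normal_pdf 0 s x.
Proof. by move=> s0; rewrite !normal_pdfE// /normal_fun addrK subr0. Qed.

Section Law.
Variables (X : T -> measurableTypeR R) (mX : measurable_fun setT X).
Let X_mixin := isMeasurableFun.Build _ _ _ _ X mX.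
Let X_mfun : {mfun T >-> measurableTypeR R} := HB.pack X X_mixin.

Lemma ge0_integral_law (nu : {measure set (measurableTypeR R) -> \bar R}) (g : R -> R) :
  (forall A, measurable A -> P (X @^-1` A) = nu A) -> measurable_fun setT g -> (forall x, 0 <= g x) ->
  (\int[P]_w (g (X w))%:E = \int[nu]_x (g x)%:E)%E.
Proof.
move=> lawX mg g0; transitivity (\int[pushforward P X_mfun]_x (g x)%:E)%E.
  rewrite ge0_integral_pushforward//; first exact/measurable_EFinP.
  by move=> x _; rewrite lee_fin.
by apply: eq_measure_integral => A mA _; exact: lawX.
Qed.

End Law.

Lemma gaussian_density X (m s : R) (g : R -> R) : s != 0 -> measurable_fun setT X ->
  (forall A, measurable A -> P (X @^-1` A) = normal_prob m s A) ->
  continuous g -> (forall x, 0 <= g x) ->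
  mu.-integrable setT (fun x => (g (x + m) * normal_pdf 0 s x)%:E) ->
  P.-integrable setT (fun w => (g (X w))%:E) /\
  \int[P]_w g (X w) = \int[mu]_x (g (x + m) * normal_pdf 0 s x).
Proof.
move=> s0 mX lawX cg g0 ig.
have mg : measurable_fun setT g by exact: continuous_measurable_fun.
have nE : (\int[P]_w (g (X w))%:E = \int[normal_prob m s]_x (g x)%:E)%E.
  exact: (ge0_integral_law mX).
have E : (\int[P]_w (g (X w))%:E = \int[mu]_x (g x * normal_pdf m s x)%:E)%E.
  rewrite nE (@ge0_integral_density _ _ _ mu (normal_prob m s) (normal_pdf m s))//.
  - exact: measurable_normal_pdf.
  - by move=> x; exact: normal_pdf_ge0.
  - exact/measurable_EFinP.
clear nE lawX; pose h x := g (x + m) * normal_pdf 0 s x.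
have ci : cintegrable mu setT (fun x => (h x)%:C) by split=> //=; exact: integrable0.
have [[j1 _] e1] := cintegral_preserving (measure_preserving_shift (- m)) ci.
have hE x : h (x - m) = g x * normal_pdf m s x.
  by rewrite /h subrK -(normal_pdf_shift m)// subrK.
have i1 : mu.-integrable setT (fun x => (g x * normal_pdf m s x)%:E).
  by move: j1; rewrite /=; under eq_fun do rewrite hE.
have e2 : \int[mu]_x (g x * normal_pdf m s x) = \int[mu]_x h x.
  by have := congr1 (@complex.Re R) e1; rewrite /= => <-; apply: eq_Rintegral => x _; rewrite hE.
have R1 : \int[P]_w g (X w) = \int[mu]_x (g x * normal_pdf m s x) by rewrite /Rintegral E.
split; last exact: (etrans R1 e2).
clear R1 e2 e1 j1 ci.
apply/integrableP; split; first by apply/measurable_EFinP; exact: measurableT_comp.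
under eq_integral do rewrite /= ger0_norm//.
rewrite E; have := integrable_fin_num measurableT i1; rewrite ge0_fin_numE//.
by apply: integral_ge0 => x _; rewrite lee_fin mulr_ge0// normal_pdf_ge0.
Qed.

(** The degenerate law is an almost surely constant variable; otherwise moments are computed with
    the density. Centring is known only through [fine] of an expectation, so integrability of X must
    be established before the mean can be identified as 0. *)
Lemma gaussian_moments X : gaussian P X -> fine ('E_P[X])%E = 0 ->
  P.-integrable setT (fun w => (X w ^+ 4)%:E) /\
  \int[P]_w X w ^+ 4 = 3 * (\int[P]_w X w ^+ 2) ^+ 2.
Proof.
move=> [mX [m [s [s_ge0 lawX]]]] EX.
have [s0|s0] := eqVneq s 0.
  rewrite s0 eqxx in lawX.
  have mXm : measurable (X @^-1` [set m]) by rewrite -[_ @^-1` _]setTI; exact: mX.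
  have aeX : ae_eq P setT (EFin \o X) (cst m%:E).
    exists (~` (X @^-1` [set m])); split.
    - exact: measurableC.
    - have h := probability_setC P mXm; rewrite lawX// diracE mem_set//= subee// in h.
    - by move=> w /= h Xw; apply: h => _; rewrite Xw.
  have m0 : m = 0.
    move: EX; rewrite unlock (ae_eq_integral (cst m%:E))//; last exact/measurable_EFinP.
    by have := expectation_cst P m; rewrite unlock => ->.
  have aeXk k : ae_eq P setT (fun w => (X w ^+ k.+1)%:E) (cst 0%E).
    by apply: filterS aeX => w /= Xw _; have [->] := Xw I; rewrite m0 expr0n.
  have mXk k : measurable_fun setT (fun w => (X w ^+ k)%:E).
    by apply/measurable_EFinP; exact: measurable_funX.
  have zero k : \int[P]_w X w ^+ k.+1 = 0.
    rewrite /Rintegral (ae_eq_integral (cst 0%E))// integral0//.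
  split; last by rewrite !zero expr0n mulr0.
  apply/integrableP; split; first exact: mXk.
  by rewrite (ae_eq_integral_abs _ _ _).2.
rewrite (negbTE s0) in lawX.
have iX k : (k <= 4)%N -> mu.-integrable setT (fun x => (x ^+ k * normal_pdf 0 s x)%:E).
  by move=> ?; exact: integrable_normal_moment.
have I0 : \int[mu]_x (x ^+ 0 * normal_pdf 0 s x) = 1.
  transitivity (\int[mu]_x normal_pdf 0 s x); first by apply: eq_Rintegral => x _; rewrite mul1r.
  by rewrite /Rintegral integral_normal_pdf.
have I1 := normal_moment1 s0.
have I2 := normal_moment_step s0 (or_introl erefl : (0 = 0 \/ 0 = 2)%N).
have I4 := normal_moment_step s0 (or_intror erefl : (2 = 0 \/ 2 = 2)%N).
rewrite I0 mulr1 mul1r in I2.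
rewrite I2 in I4.
have quad c : mu.-integrable setT (fun x => ((x + m + c) ^+ 2 * normal_pdf 0 s x)%:E) /\
    \int[mu]_x ((x + m + c) ^+ 2 * normal_pdf 0 s x) = s ^+ 2 + (m + c) ^+ 2.
  have e x : (x + m + c) ^+ 2 * normal_pdf 0 s x = x ^+ 2 * normal_pdf 0 s x +
     (2 * (m + c)) * (x ^+ 1 * normal_pdf 0 s x) + (m + c) ^+ 2 * (x ^+ 0 * normal_pdf 0 s x) by ring.
  have j1 := integrableZl measurableT (2 * (m + c)) (iX 1 isT).
  have j0 := integrableZl measurableT ((m + c) ^+ 2) (iX 0 isT).
  have j21 := integrableD measurableT (iX 2 isT) j1.
  split; first by under eq_fun do rewrite e; exact: (integrableD measurableT j21 j0).
  under eq_Rintegral do rewrite e.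
  rewrite RintegralD// RintegralD//; last exact: (iX 2 isT).
  rewrite RintegralZl//; last exact: (iX 1 isT).
  rewrite RintegralZl//; last exact: (iX 0 isT).
  rewrite I0 I2 (_ : \int[mu]_x (x ^+ 1 * _) = 0) ?mulr0 ?addr0 ?mulr1//.
have qd c : P.-integrable setT (fun w => ((X w + c) ^+ 2)%:E) /\ \int[P]_w (X w + c) ^+ 2 = s ^+ 2 + (m + c) ^+ 2.
  have [i1 e1] := quad c.
  rewrite -e1; apply: (@gaussian_density X m s (fun x => (x + c) ^+ 2)) => //.
  - move=> x; apply: (@continuous_comp _ _ _ (fun x => x + c) (fun x => x ^+ 2)); last exact: exprn_continuous.
    by apply: (@continuousD _ _ _ id (fun _ : R => c)); [exact: id|exact: cst_continuous].
  - by move=> x; exact: sqr_ge0.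
have [q1 e1] := qd 1; have [q0 e0] := qd 0.
have jc : P.-integrable setT (fun _ : T => (1 : R)%:E) by exact: finite_measure_integrable_cst.
have iX1 : P.-integrable setT (fun w => (X w)%:E).
  (* X = ((X + 1)^2 - X^2 - 1) / 2, and both squares are nonnegative functions of X, covered by
     [gaussian_density]. *)
  have h : P.-integrable setT (fun w => (2^-1 * ((X w + 1) ^+ 2 - (X w + 0) ^+ 2 - 1))%:E).
    exact: (integrableZl measurableT (2^-1) (integrableB measurableT (integrableB measurableT q1 q0)
      jc)).
  move: h; rewrite (_ : (fun w => _) = fun w => (X w)%:E)//.
  by apply/funext => w; congr EFin; field.
have EX0 : \int[P]_w X w = 0 by move: EX; rewrite unlock.
have m0 : m = 0.
  have : \int[P]_w (X w + 1) ^+ 2 = \int[P]_w (X w + 0) ^+ 2 + 2 * \int[P]_w X w + 1.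
    transitivity (\int[P]_w ((X w + 0) ^+ 2 + 2 * X w + 1)).
      by apply: eq_Rintegral => w _; ring.
    have j1 := integrableZl measurableT 2 iX1.
    rewrite (RintegralD measurableT (integrableD measurableT q0 j1) jc) (RintegralD measurableT q0 j1).
    by rewrite RintegralZl// Rintegral_cst//= probability_setT /= mulr1.
  rewrite e1 e0 EX0; lra.
have [q4 e4] : P.-integrable setT (fun w => (X w ^+ 4)%:E) /\ \int[P]_w X w ^+ 4 = 3 * (s ^+ 2) ^+ 2.
  have -> : 3 * (s ^+ 2) ^+ 2 = \int[mu]_x ((x + m) ^+ 4 * normal_pdf 0 s x).
    rewrite m0; transitivity (\int[mu]_x (x ^+ 4 * normal_pdf 0 s x)).
      by rewrite I4; ring.
    by apply: eq_Rintegral => x _; rewrite addr0.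
  apply: (@gaussian_density X m s (fun x => x ^+ 4)) => //.
  - exact: exprn_continuous.
  - by move=> x; rewrite exprn_even_ge0.
  - by rewrite m0; under eq_fun do rewrite addr0; exact: iX.
split=> //; rewrite e4; congr (3 * _ ^+ 2).
move: e0; rewrite m0 addr0 expr0n addr0 => <-.
by apply: eq_Rintegral => w _; rewrite addr0.
Qed.

End GaussianVariables.

(** * Wick's formula *)

Section Wick.
Context d (T : measurableType d) (R : realType) (P : probability T R).
Implicit Types x y z a b c : T -> R.

Definition fourth_moment x := measurable_fun setT x /\ P.-integrable setT (fun w => (x w ^+ 4)%:E).

Definition pairing x y := \int[P]_w (x w * y w).

Lemma integrable_prod4 a b c e : fourth_moment a -> fourth_moment b -> fourth_moment c -> fourth_moment e ->
  P.-integrable setT (fun w => (a w * b w * c w * e w)%:E).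
Proof.
move=> [ma ia] [mb ib] [mc ic] [me ie].
have i4 := integrableD measurableT (integrableD measurableT (integrableD measurableT ia ib) ic) ie.
apply: le_integrable i4 => //.
  apply/measurable_EFinP; do 3! [apply: measurable_funM => //].
move=> w _ /=; rewrite lee_fin; apply: le_trans (ler_norm _); rewrite ler_norml.
have := sqr_ge0 (a w * b w - c w * e w); have := sqr_ge0 (a w * b w + c w * e w).
have := sqr_ge0 (a w ^+ 2 - b w ^+ 2); have := sqr_ge0 (c w ^+ 2 - e w ^+ 2).
have := sqr_ge0 (a w ^+ 2); have := sqr_ge0 (b w ^+ 2); have := sqr_ge0 (c w ^+ 2); have := sqr_ge0 (e w ^+ 2).
lra.
Qed.

Lemma fourth_moment_cst k : fourth_moment (fun=> k).
Proof.
split; first exact: measurable_cst.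
exact: (@finite_measure_integrable_cst _ _ _ P setT (k ^+ 4)).
Qed.

Lemma integrable_prod2 a b : fourth_moment a -> fourth_moment b ->
  P.-integrable setT (fun w => (a w * b w)%:E).
Proof.
move=> ha hb; have := integrable_prod4 ha hb (fourth_moment_cst 1) (fourth_moment_cst 1).
by under eq_fun do rewrite !mulr1.
Qed.

Lemma fourth_moment_lin x y k : fourth_moment x -> fourth_moment y ->
  fourth_moment (fun w => x w + k * y w).
Proof.
move=> [mx ix] [my iy].
have m : measurable_fun setT (fun w => x w + k * y w).
  by apply: measurable_funD => //; apply: measurable_funM => //; exact: measurable_cst.
split=> //; have i4 := integrableZl measurableT 8 (integrableD measurableT ix (integrableZl measurableT (k ^+ 4) iy)).
apply: le_integrable i4 => //.
  by apply/measurable_EFinP; exact: measurable_funX.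
move=> w _ /=; rewrite lee_fin; apply: le_trans (ler_norm _); rewrite ger0_norm ?exprn_even_ge0//.
rewrite -exprMn; move: (x w) (k * y w) => u v.
have := sqr_ge0 (u ^+ 2 - v ^+ 2); have := sqr_ge0 ((u - v) ^+ 2).
have := mulr_ge0 (sqr_ge0 (u - v)) (addr_ge0 (sqr_ge0 u) (sqr_ge0 v)).
have := mulr_ge0 (sqr_ge0 (u - v)) (sqr_ge0 (u + v)); lra.
Qed.

Lemma pairingC x y : pairing x y = pairing y x.
Proof. by apply: eq_Rintegral => w _; rewrite mulrC. Qed.

Lemma pairing_linl x y z k : fourth_moment x -> fourth_moment y -> fourth_moment z ->
  pairing (fun w => x w + k * y w) z = pairing x z + k * pairing y z.
Proof.
move=> hx hy hz; have ixz := integrable_prod2 hx hz; have iyz := integrable_prod2 hy hz.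
rewrite /pairing -(RintegralZl _ measurableT iyz) -(RintegralD measurableT ixz (integrableZl measurableT k iyz)).
by apply: eq_Rintegral => w _; ring.
Qed.

Lemma Rintegral_finsum (I : finType) (F : I -> T -> R) :
  (forall i, P.-integrable setT (fun w => (F i w)%:E)) ->
  P.-integrable setT (fun w => (\sum_i F i w)%:E) /\
  \int[P]_w (\sum_i F i w) = \sum_i \int[P]_w F i w.
Proof.
move=> iF; elim: (index_enum I) => [|i s [IH1 IH2]].
  split; first by under eq_fun do rewrite big_nil; exact: integrable0.
  by under eq_Rintegral do rewrite big_nil; rewrite Rintegral_cst// mul0r big_nil.
split; first by under eq_fun do rewrite big_cons; exact: (integrableD measurableT (iF i) IH1).
under eq_Rintegral do rewrite big_cons.
by rewrite (RintegralD measurableT (iF i) IH1) IH2 big_cons.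
Qed.

                                                         
(** Polarisation: summing the fourth powers of a ± b ± c ± e with the product of the three signs
    leaves 4! times 8 = 192 times the product abce. The same sum over three times the squared second
    moments gives the three pairings. *)
Lemma wick a b c e : fourth_moment a -> fourth_moment b -> fourth_moment c -> fourth_moment e ->
  (forall s t u : R, let x w := a w + s * b w + t * c w + u * e w in
     \int[P]_w x w ^+ 4 = 3 * (\int[P]_w x w ^+ 2) ^+ 2) ->
  \int[P]_w (a w * b w * c w * e w) =
  pairing a b * pairing c e + pairing a c * pairing b e + pairing a e * pairing b c.
Proof.
move=> ha hb hc he H.
pose sg (i : bool) : R := if i then -1 else 1.
pose x s t u w := a w + s * b w + t * c w + u * e w.
have hab s := fourth_moment_lin s ha hb.
have habc s t := fourth_moment_lin t (hab s) hc.
have hx s t u : fourth_moment (x s t u) := fourth_moment_lin u (habc s t) he.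
have E2 s t u : \int[P]_w x s t u w ^+ 2 =
    pairing a a + s ^+ 2 * pairing b b + t ^+ 2 * pairing c c + u ^+ 2 * pairing e e +
    2 * (s * pairing a b + t * pairing a c + u * pairing a e + s * t * pairing b c +
         s * u * pairing b e + t * u * pairing c e).
  have -> : \int[P]_w x s t u w ^+ 2 = pairing (x s t u) (x s t u).
    by apply: eq_Rintegral => w _; rewrite expr2.
  have lin z : fourth_moment z -> pairing (x s t u) z =
      pairing a z + s * pairing b z + t * pairing c z + u * pairing e z.
    by move=> hz; rewrite /x (pairing_linl u (habc s t) he hz) (pairing_linl t (hab s) hc hz) (pairing_linl s ha hb hz).
  rewrite lin; last exact: hx.
  rewrite ![pairing _ (x s t u)]pairingC !lin//.
  rewrite (pairingC b a) (pairingC c a) (pairingC e a) (pairingC c b) (pairingC e b) (pairingC e c).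
  ring.
pose F i j k w := 192^-1 * (sg i * sg j * sg k * x (sg i) (sg j) (sg k) w ^+ 4).
have iF i j k : P.-integrable setT (fun w => (F i j k w)%:E).
  exact: (integrableZl measurableT 192^-1 (integrableZl measurableT (sg i * sg j * sg k) (hx _ _ _).2)).
have h3 i j := Rintegral_finsum (iF i j).
have h2 i := Rintegral_finsum (fun j => (h3 i j).1).
have h1 := Rintegral_finsum (fun i => (h2 i).1).
transitivity (\int[P]_w (\sum_i \sum_j \sum_k F i j k w)).
  apply: eq_Rintegral => w _; rewrite !big_bool /F /sg /x.
  by rewrite /=; clear; field.
rewrite h1.2; under eq_bigr do [rewrite (h2 _).2; under eq_bigr do rewrite (h3 _ _).2].
have EF i j k : \int[P]_w F i j k w = 192^-1 * (sg i * sg j * sg k * (3 * (\int[P]_w x (sg i) (sg j) (sg k) w ^+ 2) ^+ 2)).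
  rewrite (RintegralZl _ measurableT (integrableZl measurableT (sg i * sg j * sg k) (hx _ _ _).2)).
  by rewrite (RintegralZl _ measurableT (hx _ _ _).2) H.
rewrite !big_bool !EF !E2 /sg.
by rewrite /=; clear; field.
Qed.

End Wick.

(** * A law of large numbers for weakly correlated processes *)

Section SecondMoment.
Context d (T : measurableType d) (R : realType) (P : probability T R).
Local Notation mu := (@lebesgue_measure R).
Local Notation mR := (measurableTypeR R).

(** The bounds telescope to at most K, so the sum of the X n is integrable, hence almost surely
    finite, and its terms tend to 0. *)
Lemma ae_cvg0_sum (X : nat -> T -> R) (K : R) :
  (forall n, P.-integrable setT (fun w => (X n w)%:E)) -> (forall n w, 0 <= X n w) ->
  (forall n, \int[P]_w X n w <= K * (n.+1%:R^-1 - n.+2%:R^-1)) ->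
  {ae P, forall w, X n w @[n --> \oo] --> 0}.
Proof.
move=> iX X0 EX.
have mX n : measurable_fun setT (fun w => (X n w)%:E) := measurable_int _ (iX n).
have X0' n w : setT w -> (0 <= (X n w)%:E)%E by rewrite lee_fin.
have sE : (\int[P]_w (\sum_(n <oo) (X n w)%:E) < +oo)%E.
  rewrite integral_nneseries//; apply: (@le_lt_trans _ _ K%:E); last exact: ltry.
  apply: lime_le; first by apply: is_cvg_nneseries => n _ _; apply: integral_ge0 => w _; rewrite lee_fin.
  apply: nearW => n.
  have EE k : (\int[P]_w (X k w)%:E)%E = (\int[P]_w X k w)%:E.
    by rewrite /Rintegral fineK//; exact: integrable_fin_num.
  under eq_bigr do rewrite EE.
  rewrite sumEFin lee_fin; apply: (@le_trans _ _ (K * (1 - n.+1%:R^-1))).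
    elim: n => [|n IH]; first by rewrite big_geq// invr1 subrr mulr0.
    rewrite big_nat_recr//=; apply: le_trans (lerD IH (EX n)) _.
    by rewrite -mulrDr addrA subrK.
  have K0 : 0 <= K.
    have h : 0 <= \int[P]_w X 0%N w by apply: Rintegral_ge0.
    have := le_trans h (EX 0%N); rewrite pmulr_lge0// subr_gt0 ltf_pV2 ?posrE//.
    by rewrite ltr_nat.
  have : 0 <= n.+1%:R^-1 :> R by [].
  by move=> h; rewrite -[leRHS]mulr1 ler_wpM2l//; lra.
have mS : measurable_fun setT (fun w => (\sum_(n <oo) (X n w)%:E)%E).
  by apply: ge0_emeasurable_sum => // n w _ _; rewrite lee_fin.
have S0 w : (0 <= \sum_(n <oo) (X n w)%:E)%E by apply: nneseries_ge0 => n _ _; rewrite lee_fin.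
have iS : P.-integrable setT (fun w => (\sum_(n <oo) (X n w)%:E)%E).
  apply/integrableP; split => //; under eq_integral do rewrite gee0_abs//.
  exact: sE.
apply: filterS (integrable_ae measurableT iS) => w /(_ Logic.I) fS.
have tail := @nneseries_tail_cvg R (fun n => (X n w)%:E) xpredT.
have {}tail : (\sum_(n <= k <oo) (X k w)%:E)%E @[n --> \oo] --> 0%E.
  by apply: tail => [|n _]; [rewrite ltey_eq fS|rewrite lee_fin].
have : (X n w)%:E @[n --> \oo] --> (0 : R)%:E.
  apply: (@squeeze_cvge _ _ _ _ (fun=> 0%E) _ _ _ _ _ tail); last exact: cvg_cst.
  apply: nearW => n; rewrite lee_fin X0/=.
  apply: le_trans (@nneseries_lim_ge _ (fun n => (X n w)%:E) xpredT n n.+1 _); last by move=> *; rewrite lee_fin.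
  by rewrite big_nat1.
by move/fine_cvgP => [_].
Qed.

Lemma Rintegral_indic_itv (a b : R) : a <= b -> \int[mu]_x (\1_`[a, b] x : R) = b - a.
Proof.
move=> ab; rewrite /Rintegral (integral_indic mu measurableT); last exact: measurable_itv.
rewrite setIT; have mE : mu [set` `[a, b]] = (b - a)%:E.
  have -> := lebesgue_measure_itv `[a, b]; rewrite /= lte_fin.
  by move: ab; rewrite le_eqVlt => /orP[/eqP ->|->]; rewrite ?ltxx ?subrr.
by rewrite [X in fine X]mE.
Qed.

Section Windowed.
Variables (V : T -> R -> R) (a b C : R).
Hypothesis ab : a <= b.
Hypothesis mV : measurable_fun setT (fun z : T * mR => V z.1 z.2).
Hypothesis V0 : forall w x, ~ (a <= x <= b) -> V w x = 0.
Hypothesis Vb : forall w, exists M, forall x, `|V w x| <= M.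
Hypothesis iV : forall x, P.-integrable setT (fun w => (V w x ^+ 2)%:E).
Hypothesis EV : forall x, \int[P]_w V w x ^+ 2 <= C.

Let ind (x : R) : R := \1_`[a, b] x.

Let ind01 x : 0 <= ind x <= 1.
Proof. by rewrite /ind indicE; case: (_ \in _); rewrite ?lexx ler01. Qed.

Let indV w x : V w x = ind x * V w x.
Proof.
rewrite /ind indicE; case: (boolP (_ \in _)) => [_|]; first by rewrite mul1r.
by rewrite notin_setE /= in_itv/= => /V0 ->; rewrite mulr0.
Qed.

Let iind : mu.-integrable setT (fun x => (ind x)%:E).
Proof. exact: integrable_indic_itv. Qed.

Let Eind : \int[mu]_x ind x = b - a := Rintegral_indic_itv ab.

Let mVx x : measurable_fun setT (V^~ x).
Proof. by apply: (measurableT_comp mV (@pair2_measurable _ _ _ _ _)). Qed.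

Let mVw w : measurable_fun (setT : set mR) (V w).
Proof. by apply: (measurableT_comp mV (@pair1_measurable _ _ _ _ _)). Qed.

Lemma window_path_integrable w : mu.-integrable setT (fun x => (V w x)%:E).
Proof.
have [M VM] := Vb w; apply: le_integrable (integrableZl measurableT M iind) => //.
  by apply/measurable_EFinP.
move=> x _ /=; rewrite lee_fin indV !normrM mulrC ler_wpM2r//.
by apply: le_trans (VM x) (ler_norm _).
Qed.

Let iVV x y : P.-integrable setT (fun w => (V w x * V w y)%:E).
Proof.
have i2 := integrableD measurableT (iV x) (iV y).
apply: le_integrable i2 => //; first by apply/measurable_EFinP; apply: measurable_funM.
move=> w _ /=; rewrite lee_fin; apply: le_trans (ler_norm _).
by rewrite ler_norml; have := sqr_ge0 (V w x - V w y); have := sqr_ge0 (V w x + V w y);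
  have := sqr_ge0 (V w x); have := sqr_ge0 (V w y); move: (V w x) (V w y) => u v; lra.
Qed.

(** Fubini turns the second moment of the integral into a double integral of E V(x) V(y). Absolute
    integrability comes from the uniform bound C on the square window, and the value from the row
    bound J. *)
Lemma window_second_moment (k : R -> R -> R) (J : R) :
  (forall x y, \int[P]_w (V w x * V w y) <= k x y) ->
  (forall x, mu.-integrable setT (fun y => (ind y * k x y)%:E)) ->
  (forall x, \int[mu]_y (ind y * k x y) <= J) ->
  P.-integrable setT (fun w => ((\int[mu]_x V w x) ^+ 2)%:E) /\
  \int[P]_w (\int[mu]_x V w x) ^+ 2 <= J * (b - a).
Proof.
move=> Ek ik Jk.
pose g (z : T * (mR * mR)) : R := V z.1 z.2.1 * V z.1 z.2.2.
have m1 : measurable_fun setT (fun z : T * (mR * mR) => V z.1 z.2.1).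
  have h : measurable_fun setT (fun z : T * (mR * mR) => (z.1, z.2.1)).
    apply/measurable_fun_pairP; split; first exact: measurable_fst.
    have h1 : measurable_fun setT (@fst mR mR) by exact: measurable_fst.
    exact: (measurableT_comp h1 measurable_snd).
  exact: (measurableT_comp mV h).
have m2 : measurable_fun setT (fun z : T * (mR * mR) => V z.1 z.2.2).
  have h : measurable_fun setT (fun z : T * (mR * mR) => (z.1, z.2.2)).
    apply/measurable_fun_pairP; split; first exact: measurable_fst.
    have h1 : measurable_fun setT (@snd mR mR) by exact: measurable_snd.
    exact: (measurableT_comp h1 measurable_snd).
  exact: (measurableT_comp mV h).
have mg : measurable_fun setT g by exact: measurable_funM.
have i12 : (@lebesgue2 R).-integrable setT (fun z => (ind z.1 * ind z.2)%:E).
  exact: (integrable_prod iind iind).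
have gb x y : \int[P]_w `|V w x * V w y| <= C * (ind x * ind y).
  have E w : `|V w x * V w y| = ind x * ind y * `|V w x * V w y|.
    have [x0 _] := andP (ind01 x); have [y0 _] := andP (ind01 y).
    rewrite {1}(indV w x) {1}(indV w y) !normrM (ger0_norm x0) (ger0_norm y0); ring.
  have iVVn : P.-integrable setT (fun w => (`|V w x * V w y|)%:E) := integrable_norm (iVV x y).
  under eq_Rintegral do rewrite E.
  rewrite (RintegralZl _ measurableT iVVn) mulrC ler_wpM2r//.
    by have [x0 _] := andP (ind01 x); have [y0 _] := andP (ind01 y); exact: mulr_ge0 x0 y0.
  apply: (@le_trans _ _ (\int[P]_w (2^-1 * (V w x ^+ 2 + V w y ^+ 2)))).
    apply: le_Rintegral => //.
      exact: (integrableZl measurableT 2^-1 (integrableD measurableT (iV x) (iV y))).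
    move=> w _; rewrite ler_norml; have := sqr_ge0 (V w x - V w y); have := sqr_ge0 (V w x + V w y).
    by move: (V w x) (V w y) => u v; lra.
  rewrite (RintegralZl _ measurableT (integrableD measurableT (iV x) (iV y))).
  rewrite (RintegralD measurableT (iV x) (iV y)).
  by have := EV x; have := EV y; move: (\int[P]_w _ : R) (\int[P]_w _ : R) => u v; lra.
have ig : (P \x @lebesgue2 R)%E.-integrable setT (fun z => (g z)%:E).
  apply/integrable21ltyP; first exact/measurable_EFinP.
  apply: (@le_lt_trans _ _ (\int[@lebesgue2 R]_z (C%:E * (ind z.1 * ind z.2)%:E))%E).
    apply: ge0_le_integral => //.
    - by move=> z _; apply: integral_ge0.
    - have mag : measurable_fun setT (fun z => `|(g z)%:E|%E).
        by apply: measurableT_comp => //; exact/measurable_EFinP.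
      exact: (@measurable_fun_fubini_tonelli_G _ _ _ _ R P _ mag (fun=> abse_ge0 _)).
    - by have := measurable_int _ (integrableZl measurableT C i12).
    - move=> [x y] _ /=; rewrite -[leLHS]fineK; last first.
        by apply: integrable_fin_num => //; exact: (integrable_norm (iVV x y)).
      by rewrite -EFinM lee_fin; exact: gb.
  by have := integral_fune_lt_pinfty measurableT (integrableZl measurableT C i12).
have sq w : (\int[mu]_x V w x) ^+ 2 = \int[@lebesgue2 R]_z g (w, z).
  rewrite expr2; have i1 := window_path_integrable w.
  by rewrite -(Rintegral_prod i1 i1).
have [i1 e1] := Rintegral_fubini ig
  (fun w => integrable_prod (window_path_integrable w) (window_path_integrable w))
  (fun z => iVV z.1 z.2).
under eq_fun do rewrite sq.
split=> //.
have -> : \int[P]_w (\int[mu]_x V w x) ^+ 2 = \int[P]_w \int[@lebesgue2 R]_z g (w, z).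
  by apply: eq_Rintegral => w _; exact: sq.
rewrite e1 => {i1 e1 sq}.
pose G (z : mR * mR) : R := \int[P]_w (V w z.1 * V w z.2).
have EG z : (G z)%:E = (\int[P]_w (g (w, z))%:E)%E.
  rewrite /G /Rintegral fineK//; apply: integrable_fin_num => //.
have Gind x y : G (x, y) = ind x * (ind y * G (x, y)).
  rewrite mulrA /G -(RintegralZl _ measurableT (iVV x y)).
  by apply: eq_Rintegral => w _ /=; rewrite {1}(indV w x) {1}(indV w y); ring.
have Gb x y : `|G (x, y)| <= C * (ind x * ind y).
  apply: le_trans (gb x y); apply: le_normr_Rintegral => //; exact: iVV.
have iG : (@lebesgue2 R).-integrable setT (fun z => (G z)%:E).
  apply: le_integrable (integrableZl measurableT C i12) => //.
    by under eq_fun do rewrite EG; exact: (measurable_fubini_G ig).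
  by move=> [x y] _ /=; rewrite lee_fin; apply: le_trans (ler_norm _); exact: Gb.
have iGx x : mu.-integrable setT (fun y => (G (x, y))%:E).
  apply: le_integrable (integrableZl measurableT (C * ind x) iind) => //.
    have /measurable_EFinP mG := measurable_int _ iG.
    by apply/measurable_EFinP; exact: (measurableT_comp mG (@pair1_measurable _ _ _ _ x)).
  move=> y _ /=; rewrite lee_fin; apply: le_trans (ler_norm _).
  by rewrite -mulrA; exact: Gb.
have iGy y : mu.-integrable setT (fun x => (G (x, y))%:E).
  apply: le_integrable (integrableZl measurableT (C * ind y) iind) => //.
    have /measurable_EFinP mG := measurable_int _ iG.
    by apply/measurable_EFinP; exact: (measurableT_comp mG (@pair2_measurable _ _ _ _ y)).
  move=> x _ /=; rewrite lee_fin; apply: le_trans (ler_norm _).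
  by rewrite -mulrA (mulrC (ind y)); exact: Gb.
have [iI _] := Rintegral_fubini iG iGx iGy.
have -> : \int[@lebesgue2 R]_z \int[P]_w g (w, z) = \int[mu]_x \int[mu]_y G (x, y).
  rewrite [LHS]/Rintegral [RHS]/Rintegral; congr fine.
  rewrite -(integral12_prod_meas1 iG); apply: eq_integral => x _.
  rewrite /fubini_F /Rintegral fineK//; exact: integrable_fin_num (iGx x).
have -> : J * (b - a) = \int[mu]_x (J * ind x) by rewrite (RintegralZl _ measurableT iind) Eind.
apply: le_Rintegral => //; first exact: (integrableZl measurableT J iind).
move=> x _; have [x0 x1] := andP (ind01 x).
have E : \int[mu]_y G (x, y) = ind x * \int[mu]_y (ind y * G (x, y)).
  rewrite -(RintegralZl _ measurableT); last first.
    apply: le_integrable (iGx x) => //.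
      have /measurable_EFinP mG := measurable_int _ (iGx x).
      have /measurable_EFinP mi := measurable_int _ iind.
      by apply/measurable_EFinP; exact: measurable_funM.
    move=> y _ /=; have [y0 y1] := andP (ind01 y).
    by rewrite lee_fin normrM (ger0_norm y0) ler_piMl.
  by apply: eq_Rintegral => y _; exact: Gind.
rewrite E mulrC ler_wpM2r//; apply: le_trans (Jk x).
apply: le_Rintegral => //.
  apply: le_integrable (iGx x) => //.
    have /measurable_EFinP mG := measurable_int _ (iGx x).
    have /measurable_EFinP mi := measurable_int _ iind.
    by apply/measurable_EFinP; exact: measurable_funM.
  move=> y _ /=; have [y0 y1] := andP (ind01 y).
  by rewrite lee_fin normrM (ger0_norm y0) ler_piMl.
  exact: ik.
by move=> y _; have [y0 y1] := andP (ind01 y); exact: (ler_wpM2l y0 (Ek x y)).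
Qed.

End Windowed.

Section LawOfLargeNumbers.
Variables (W : T -> R -> R) (C : R).
Hypothesis mW : measurable_fun setT (fun z : T * mR => W z.1 z.2).
Hypothesis Wb : forall w b, exists M, forall x, x <= b -> `|W w x| <= M.
Hypothesis iW : forall x, P.-integrable setT (fun w => (W w x ^+ 2)%:E).
Hypothesis EW : forall x y, \int[P]_w (W w x * W w y) <= C * bump1 (x - y).

Let ind (a b x : R) : R := \1_`[a, b] x.

Let ind01 a b x : ind a b x = (a <= x <= b)%R%:R.
Proof. by rewrite /ind indicE mem_setE /= in_itv. Qed.

Lemma bump1_shift x : mu.-integrable setT (fun y => (bump1 (x - y))%:E) /\ \int[mu]_y bump1 (x - y) = pi.
Proof.
have i0 : cintegrable mu setT (fun y => (bump1 y : R)%:C).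
  by split => /=; [exact: integrable_bump1|exact: integrable0].
have [[i1 _] /(congr1 cRe) /= e1] := cintegral_preserving (measure_preserving_shift (- x)) i0.
have E y : bump1 (x - y) = bump1 (y - x) :> R by rewrite /bump1 -opprB sqrrN.
split; first by under eq_fun do rewrite E; exact: i1.
under eq_Rintegral do rewrite E.
by rewrite e1 /Rintegral integral_bump1.
Qed.

Let C0 : 0 <= C.
Proof.
have := EW 0 0; rewrite subrr /bump1 expr0n addr0 invr1 mulr1; apply: le_trans.
by apply: Rintegral_ge0 => w _; rewrite -expr2 sqr_ge0.
Qed.

Let EW2 x : \int[P]_w W w x ^+ 2 <= C.
Proof.
have := EW x x; rewrite subrr /bump1 expr0n addr0 invr1 mulr1.
by under eq_Rintegral do rewrite -expr2.
Qed.

Let iWW x y : P.-integrable setT (fun w => (W w x * W w y)%:E).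
Proof.
have i2 := integrableD measurableT (iW x) (iW y).
apply: le_integrable i2 => //.
  by apply/measurable_EFinP; apply: measurable_funM; apply: (measurableT_comp mW (@pair2_measurable _ _ _ _ _)).
move=> w _ /=; rewrite lee_fin; apply: le_trans (ler_norm _).
by rewrite ler_norml; have := sqr_ge0 (W w x - W w y); have := sqr_ge0 (W w x + W w y);
  have := sqr_ge0 (W w x); have := sqr_ge0 (W w y); move: (W w x) (W w y) => u v; lra.
Qed.

Section Window.
Variables (a b : R).
Hypothesis ab : a <= b.

Let S w := \int[mu]_x (ind a b x * W w x).
Let U w := \int[mu]_x (ind a b x * `|W w x|).

Let mind : measurable_fun setT (fun z : T * mR => ind a b z.2).
Proof. by apply: (measurableT_comp _ measurable_snd); exact: measurable_indic. Qed.

Let V1 : [/\ measurable_fun setT (fun z : T * mR => ind a b z.2 * W z.1 z.2),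
  forall w x, ~ (a <= x <= b) -> ind a b x * W w x = 0,
  forall w, exists M, forall x, `|ind a b x * W w x| <= M,
  forall x, P.-integrable setT (fun w => ((ind a b x * W w x) ^+ 2)%:E) &
  forall x, \int[P]_w (ind a b x * W w x) ^+ 2 <= C].
Proof.
have sq x : (ind a b x) ^+ 2 <= 1 by rewrite ind01; case: (_ <= _ <= _); rewrite ?expr1n ?expr0n.
split.
- exact: measurable_funM.
- by move=> w x /negP /negbTE h; rewrite ind01 h mul0r.
- move=> w; have [M WM] := Wb w b; exists (Num.max M 0) => x; rewrite ind01 le_max.
  case: (boolP (a <= x <= b)) => [/andP[_ xb]|_]; first by rewrite mul1r WM.
  by rewrite mul0r normr0 lexx orbT.
- by move=> x; under eq_fun do rewrite exprMn; exact: (integrableZl measurableT (ind a b x ^+ 2) (iW x)).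
- move=> x; under eq_Rintegral do rewrite exprMn.
  rewrite (RintegralZl _ measurableT (iW x)); apply: le_trans (EW2 x).
  by apply: ler_piMl => //; apply: Rintegral_ge0 => w _; exact: sqr_ge0.
Qed.

Lemma window_integrable w : mu.-integrable setT (fun x => (ind a b x * W w x)%:E).
Proof. by have [h1 h2 h3 h4 h5] := V1; exact: (window_path_integrable h1 h2 h3). Qed.

(** Each row of the covariance integrates to at most C pi, so the second moment grows only linearly
    with the length of the window. *)
Lemma window_mean_square :
  P.-integrable setT (fun w => (S w ^+ 2)%:E) /\ \int[P]_w S w ^+ 2 <= C * pi * (b - a).
Proof.
have [h1 h2 h3 h4 h5] := V1.
have ib x : mu.-integrable setT (fun y => (C * bump1 (x - y))%:E).
  exact: (integrableZl measurableT C (bump1_shift x).1).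
have mib x : measurable_fun setT (fun y => ind a b y * (C * bump1 (x - y))).
  have /measurable_EFinP mi := measurable_int _ (ib x).
  by apply: measurable_funM => //; exact: measurable_indic.
apply: (@window_second_moment (fun w x => ind a b x * W w x) a b C ab h1 h2 h3 h4 h5 (fun x y => C * bump1 (x - y)) (C * pi)).
- move=> x y; rewrite (_ : \int[P]_w _ = ind a b x * ind a b y * \int[P]_w (W w x * W w y)); last first.
    rewrite -(RintegralZl _ measurableT); last exact: iWW.
    by apply: eq_Rintegral => w _; ring.
  rewrite !ind01; case: (_ <= x <= _); case: (_ <= y <= _); rewrite ?mul1r ?mulr1 ?mul0r ?mulr0//.
  - exact: mulr_ge0 C0 (ltW (bump1_gt0 _)).
  - exact: mulr_ge0 C0 (ltW (bump1_gt0 _)).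
  - exact: mulr_ge0 C0 (ltW (bump1_gt0 _)).
- move=> x; apply: le_integrable (ib x) => //; first by apply/measurable_EFinP; exact: mib.
  move=> y _; rewrite lee_fin normrM; apply: ler_piMl => //.
  by rewrite -[\1__ y]/(ind a b y) ind01; case: (_ <= _ <= _); rewrite ?normr1 ?normr0.
- move=> x; have <- : \int[mu]_y (C * bump1 (x - y)) = C * pi.
    by rewrite (RintegralZl _ measurableT (bump1_shift x).1) (bump1_shift x).2.
  apply: le_Rintegral => //.
    apply: le_integrable (ib x) => //; first by apply/measurable_EFinP; exact: mib.
    move=> y _; rewrite lee_fin normrM; apply: ler_piMl => //.
    by rewrite -[\1__ y]/(ind a b y) ind01; case: (_ <= _ <= _); rewrite ?normr1 ?normr0.
    exact: ib.
  move=> y _; apply: ler_piMl; first exact: mulr_ge0 C0 (ltW (bump1_gt0 _)).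
  by rewrite -[\1__ y]/(ind a b y) ind01; case: (_ <= _ <= _).
Qed.

(** Without decay one gets the square of the length; this is good enough on the gaps between
    consecutive squares. *)
Lemma window_abs_mean_square :
  P.-integrable setT (fun w => (U w ^+ 2)%:E) /\ \int[P]_w U w ^+ 2 <= C * (b - a) * (b - a).
Proof.
have [h1 h2 h3 h4 h5] := V1.
have E w x : ind a b x * `|W w x| = `|ind a b x * W w x| by rewrite ind01 normrM normr_nat.
have -> : U = fun w => \int[mu]_x `|ind a b x * W w x|.
  by apply/funext => w; apply: eq_Rintegral => x _; exact: E.
apply: (@window_second_moment (fun w x => `|ind a b x * W w x|) a b C ab _ _ _ _ _ (fun x y => C) (C * (b - a))).
- by apply: measurableT_comp.
- by move=> w x /h2 ->; rewrite normr0.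
- by move=> w; have [M h] := h3 w; exists M => x; rewrite normr_id.
- by move=> x; under eq_fun do rewrite real_normK ?num_real//; exact: h4.
- by move=> x; under eq_Rintegral do rewrite real_normK ?num_real//; exact: h5.
- move=> x y; apply: (@le_trans _ _ (\int[P]_w (2^-1 * ((ind a b x * W w x) ^+ 2 + (ind a b y * W w y) ^+ 2)))).
    apply: le_Rintegral => //.
    + apply: le_integrable (integrableD measurableT (h4 x) (h4 y)) => //.
        apply/measurable_EFinP; apply: measurable_funM; apply: measurableT_comp => //;
        by apply: (measurableT_comp h1 (@pair2_measurable _ _ _ _ _)).
      move=> w _; rewrite lee_fin normrM !normr_id; apply: le_trans (ler_norm _).
      rewrite -[in leRHS]real_normK ?num_real// -[in X in _ + X]real_normK ?num_real//.
      move: `|_| `|_| => u v.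
      by have := sqr_ge0 (u - v); have := sqr_ge0 u; have := sqr_ge0 v; lra.
    + exact: (integrableZl measurableT 2^-1 (integrableD measurableT (h4 x) (h4 y))).
    move=> w _; rewrite -[in leRHS]real_normK ?num_real// -[in X in _ + X]real_normK ?num_real//.
    by move: `|_| `|_| => u v; have := sqr_ge0 (u - v); lra.
  rewrite (RintegralZl _ measurableT (integrableD measurableT (h4 x) (h4 y))).
  rewrite (RintegralD measurableT (h4 x) (h4 y)).
  by have := h5 x; have := h5 y; move: (\int[P]_w _ : R) (\int[P]_w _ : R) => u v; lra.
- by move=> x; under eq_fun do rewrite mulrC; exact: (integrableZl measurableT C (integrable_indic_itv _ _ _ _)).
- move=> x; under eq_Rintegral do rewrite mulrC.
  have i0 : mu.-integrable setT (fun y => (ind a b y)%:E) by exact: integrable_indic_itv.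
  by rewrite (RintegralZl _ measurableT i0) (Rintegral_indic_itv ab).
Qed.

End Window.

(** Along Q = (n + 1)^2 the averages have second moments of order (n + 1)^-2, which is summable, so
    they tend to 0 almost surely. The gap to the next square has length at most 3 (n + 1), and the
    integral of |W| over it, divided by (n + 1)^2, also has second moment of order (n + 1)^-2; this
    covers all real Q in between. *)
Lemma law_of_large_numbers :
  {ae P, forall w, Q^-1 * \int[mu]_(x in `[0, Q]) W w x @[Q --> +oo] --> (0 : R)}.
Proof.
have q2 n : n.+1%:R ^- 2 <= 2 * (n.+1%:R^-1 - n.+2%:R^-1) :> R.
  have n0 : 0 < n.+1%:R :> R by rewrite ltr0n.
  have -> : n.+1%:R ^- 2 = n.+1%:R^-1 * n.+1%:R^-1 :> R by rewrite expr2 invfM.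
  have -> : n.+1%:R^-1 - n.+2%:R^-1 = n.+1%:R^-1 * n.+2%:R^-1 :> R.
    by rewrite -(natr1 n.+1); field; lra.
  by rewrite mulrCA ler_pM2l ?invr_gt0// ler_pdivlMr// mulrC ler_pdivrMr// -natrM ler_nat mul2n -addnn addSn addnS !ltnS leq_addr.
pose X n w := (n.+1%:R ^- 2 * \int[mu]_x (ind 0 (n.+1%:R ^+ 2) x * W w x)) ^+ 2.
pose Y n w := (n.+1%:R ^- 2 * \int[mu]_x (ind (n.+1%:R ^+ 2) (n.+2%:R ^+ 2) x * `|W w x|)) ^+ 2.
have aX : {ae P, forall w, X n w @[n --> \oo] --> 0}.
  have h n := window_mean_square (sqr_ge0 (n.+1%:R : R)).
  apply: (ae_cvg0_sum (K := 2 * C * pi)) => [k|k w|k]; last 2 first.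
  - exact: sqr_ge0.
  - under eq_Rintegral do rewrite /X /Y exprMn.
    rewrite (RintegralZl _ measurableT (h k).1).
    have n0 : k.+1%:R != 0 :> R by rewrite pnatr_eq0.
    have CP : 0 <= C * pi by exact: mulr_ge0 C0 (pi_ge0 _).
    apply: le_trans (ler_wpM2l (sqr_ge0 _) (h k).2) _.
    rewrite subr0 (_ : _ * (C * pi * _) = C * pi * k.+1%:R ^- 2); last by field.
    apply: le_trans (ler_wpM2l CP (q2 k)) _.
    by rewrite (mulrC 2 C) -!mulrA (mulrCA pi 2).
  - by under eq_fun do rewrite /X exprMn; exact: (integrableZl measurableT _ (h k).1).
have aY : {ae P, forall w, Y n w @[n --> \oo] --> 0}.
  have nn n : n.+1%:R ^+ 2 <= n.+2%:R ^+ 2 :> R by rewrite ler_pXn2r ?nnegrE// ler_nat.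
  have h n := window_abs_mean_square (nn n).
  apply: (ae_cvg0_sum (K := 18 * C)) => [k|k w|k]; last 2 first.
  - exact: sqr_ge0.
  - under eq_Rintegral do rewrite /X /Y exprMn.
    rewrite (RintegralZl _ measurableT (h k).1).
    have n0 : k.+1%:R != 0 :> R by rewrite pnatr_eq0.
    have n1 : 0 < k.+1%:R :> R by rewrite ltr0n.
    have dn : k.+2%:R ^+ 2 - k.+1%:R ^+ 2 <= 3 * k.+1%:R :> R.
      by rewrite -(natr1 k.+1) -(natr1 k); have : 0 <= k%:R :> R by []; move: (k%:R : R) => t t0; lra.
    have dn0 : 0 <= k.+2%:R ^+ 2 - k.+1%:R ^+ 2 :> R by rewrite subr_ge0.
    apply: le_trans (ler_wpM2l (sqr_ge0 _) (h k).2) _.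
    have CC : C * (k.+2%:R ^+ 2 - k.+1%:R ^+ 2) * (k.+2%:R ^+ 2 - k.+1%:R ^+ 2) <= C * (3 * k.+1%:R) * (3 * k.+1%:R).
      apply: ler_pM => //; first exact: mulr_ge0 C0 dn0.
      exact: (ler_wpM2l C0 dn).
    apply: le_trans (ler_wpM2l (sqr_ge0 _) CC) _.
    rewrite (_ : _ * (C * _ * _) = 9 * C * k.+1%:R ^- 2); last by field.
    have C9 : 0 <= 9 * C by exact: mulr_ge0 _ C0.
    apply: le_trans (ler_wpM2l C9 (q2 k)) _.
    by rewrite mulrA; have -> : 9 * C * 2 = 18 * C by ring.
  - by under eq_fun do rewrite /Y exprMn; exact: (integrableZl measurableT _ (h k).1).
apply: filterS2 aX aY => w hX hY.
have EQ Q : \int[mu]_(x in `[0, Q]) W w x = \int[mu]_x (ind 0 Q x * W w x).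
  rewrite Rintegral_mkcond; apply: eq_Rintegral => x _.
  by rewrite /patch /ind indicE; case: (_ \in _); rewrite ?mul1r ?mul0r.
apply/cvgrPdist_lt => e e0.
have e20 : 0 < (e / 2) ^+ 2 by rewrite exprn_gt0// divr_gt0.
move/cvgrPdist_lt : hX => /(_ _ e20) hX; move/cvgrPdist_lt : hY => /(_ _ e20) hY.
have [N _ hN] := filterI hX hY.
exists ((N.+2%:R) ^+ 2); split; first exact: num_real.
move=> Q NQ; rewrite sub0r normrN EQ.
have Q0 : 0 < Q by apply: le_lt_trans NQ; exact: sqr_ge0.
(* n + 1 is the integer part of the square root of Q. *)
have [n [nN nQ Qn]] : exists n, [/\ (N <= n)%N, n.+1%:R ^+ 2 <= Q & Q <= n.+2%:R ^+ 2].
  have sQ0 := sqrtr_ge0 Q; have sQ := sqr_sqrtr (ltW Q0).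
  have /andP[k1 k2] := truncn_itv sQ0.
  have kN : N.+2%:R < Num.sqrt Q by rewrite -(ltr_pXn2r (n := 2)) ?nnegrE// sQ.
  have {}kN : (N.+2 <= Num.truncn (Num.sqrt Q))%N.
    by have := lt_trans kN k2; rewrite ltr_nat ltnS.
  case: (Num.truncn _) kN k1 k2 => // k kN k1 k2; exists k; split; first by move: kN; rewrite ltnS => /ltnW.
    by rewrite -sQ ler_pXn2r ?nnegrE.
  by rewrite -sQ ler_pXn2r ?nnegrE// ltW.
have [Xn Yn] := hN n nN.
have {}Xn : `|n.+1%:R ^- 2 * \int[mu]_x (ind 0 (n.+1%:R ^+ 2) x * W w x)| < e / 2.
  rewrite -(ltr_pXn2r (n := 2)) ?nnegrE ?divr_ge0 ?(ltW e0)//.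
  by move: Xn; rewrite /= sub0r normrN /X normrX.
have {}Yn : n.+1%:R ^- 2 * \int[mu]_x (ind (n.+1%:R ^+ 2) (n.+2%:R ^+ 2) x * `|W w x|) < e / 2.
  apply: le_lt_trans (ler_norm _) _.
  rewrite -(ltr_pXn2r (n := 2)) ?nnegrE ?divr_ge0 ?(ltW e0)//.
  by move: Yn; rewrite /= sub0r normrN /Y normrX.
set S1 := \int[mu]_x (ind 0 (n.+1%:R ^+ 2) x * W w x) in Xn.
set S2 := \int[mu]_x (ind (n.+1%:R ^+ 2) (n.+2%:R ^+ 2) x * `|W w x|) in Yn.
set S := \int[mu]_x _.
have nn : n.+1%:R ^+ 2 <= n.+2%:R ^+ 2 :> R by rewrite ler_pXn2r ?nnegrE// ler_nat.
have iQ := window_integrable 0 Q w.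
have in1 := window_integrable 0 (n.+1%:R ^+ 2) w.
have in2 : mu.-integrable setT (fun x => (ind (n.+1%:R ^+ 2) (n.+2%:R ^+ 2) x * `|W w x|)%:E).
  have E x : ind (n.+1%:R ^+ 2) (n.+2%:R ^+ 2) x * `|W w x| =
      `|ind (n.+1%:R ^+ 2) (n.+2%:R ^+ 2) x * W w x| by rewrite ind01 normrM normr_nat.
  under eq_fun do rewrite E.
  exact: integrable_norm (window_integrable (n.+1%:R ^+ 2) (n.+2%:R ^+ 2) w).
have SS : `|S - S1| <= S2.
  rewrite /S /S1 -(RintegralB measurableT iQ in1).
  apply: le_trans (le_normr_Rintegral measurableT (integrableB measurableT iQ in1)) _.
  apply: le_Rintegral => //; first exact: (integrable_norm (integrableB measurableT iQ in1)).
  move=> x _; rewrite -mulrBl normrM ler_wpM2r// !ind01.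
  case: (boolP (n.+1%:R ^+ 2 <= x <= n.+2%:R ^+ 2)) => [_|/negP h].
    by case: (0 <= x <= Q); case: (0 <= x <= _); rewrite ?subr0 ?sub0r ?subrr ?normrN ?normr1 ?normr0.
  have -> : (0 <= x <= Q) = (0 <= x <= n.+1%:R ^+ 2); last by rewrite subrr normr0.
  apply/idP/idP => /andP[x0 xQ]; apply/andP; split => //; last exact: le_trans nQ.
  rewrite leNgt; apply/negP => nx; apply: h; rewrite (ltW nx)/=; exact: le_trans Qn.
have n0 : 0 < n.+1%:R ^- 2 :> R by rewrite invr_gt0 exprn_gt0.
have Qi : 0 < Q^-1 <= n.+1%:R ^- 2.
  by rewrite invr_gt0 Q0 lef_pV2 ?posrE// exprn_gt0.
have S20 : 0 <= S2 := le_trans (normr_ge0 _) SS.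
have Sb : `|S| <= `|S1| + S2.
  by rewrite -[S](subrK S1); apply: le_trans (ler_normD _ _) _; rewrite addrC lerD2l.
rewrite normrM (ger0_norm (ltW _)); last by case/andP: Qi.
apply: (@le_lt_trans _ _ (n.+1%:R ^- 2 * (`|S1| + S2))).
  by case/andP: Qi => q0 q1; apply: ler_pM => //; exact: ltW.
move: Xn; rewrite normrM (gtr0_norm n0) mulrDr => Xn.
by rewrite [e]splitr ltrD.
Qed.

End LawOfLargeNumbers.

End SecondMoment.

(** * Averages over [Q, 2Q] *)

Section Averages.
Variable R : realType.
Local Notation mu := (@lebesgue_measure R).

Lemma bounded_integrable_itv (h : R -> R) a b M : measurable_fun setT h ->
  (forall x, `[a, b]%classic x -> `|h x| <= M) -> mu.-integrable `[a, b] (fun x => (h x)%:E).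
Proof.
move=> mh hM.
apply: le_integrable (integrableS measurableT _ _ (integrableZl measurableT M (integrable_indic_itv a b true false))) => //.
  by apply/measurable_EFinP; exact: measurable_funTS.
move=> x xI; rewrite lee_fin /= indicE mem_set// mulr1.
exact: le_trans (hM x xI) (ler_norm _).
Qed.

Definition average (h : R -> R) (Q : R) : R := Q^-1 * \int[mu]_(x in `[Q, 2 * Q]) h x.

Lemma integrable_itvD (u v : R -> R) a b : mu.-integrable `[a, b] (fun x => (u x)%:E) ->
  mu.-integrable `[a, b] (fun x => (v x)%:E) -> mu.-integrable `[a, b] (fun x => (u x + v x)%:E).
Proof. by move=> iu iv; exact: (integrableD _ iu iv). Qed.

Lemma integrable_itvB (u v : R -> R) a b : mu.-integrable `[a, b] (fun x => (u x)%:E) ->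
  mu.-integrable `[a, b] (fun x => (v x)%:E) -> mu.-integrable `[a, b] (fun x => (u x - v x)%:E).
Proof. by move=> iu iv; exact: (integrableB _ iu iv). Qed.

Lemma averageD (u v : R -> R) Q : mu.-integrable `[Q, 2 * Q] (fun x => (u x)%:E) ->
  mu.-integrable `[Q, 2 * Q] (fun x => (v x)%:E) ->
  average (fun x => u x + v x) Q = average u Q + average v Q.
Proof. by move=> iu iv; rewrite /average RintegralD// mulrDr. Qed.

Lemma averageB (u v : R -> R) Q : mu.-integrable `[Q, 2 * Q] (fun x => (u x)%:E) ->
  mu.-integrable `[Q, 2 * Q] (fun x => (v x)%:E) ->
  average (fun x => u x - v x) Q = average u Q - average v Q.
Proof. by move=> iu iv; rewrite /average RintegralB// mulrBr. Qed.

(** The average over [Q, 2Q] is twice the mean over [0, 2Q] minus the mean over [0, Q]. *)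
Lemma average_cvg0 (h : R -> R) : (forall b, mu.-integrable `[0, b] (fun x => (h x)%:E)) ->
  Q^-1 * \int[mu]_(x in `[0, Q]) h x @[Q --> +oo] --> (0 : R) -> average h Q @[Q --> +oo] --> (0 : R).
Proof.
move=> ih h0.
have h2 : (2 * Q)^-1 * \int[mu]_(x in `[0, 2 * Q]) h x @[Q --> +oo] --> (0 : R).
  have d2 : 2 * Q @[Q --> pinfty_nbhs R] --> pinfty_nbhs R.
    by apply/cvgryPge => A; near=> Q; rewrite -ler_pdivrMl//; near: Q; exact: nbhs_pinfty_ge.
  exact: (cvg_comp _ _ d2 h0).
have c2 : (fun _ : R => 2 : R) x @[x --> +oo] --> (2 : R) by exact: cvg_cst.
have hs : 2 * ((2 * Q)^-1 * \int[mu]_(x in `[0, 2 * Q]) h x) - Q^-1 * \int[mu]_(x in `[0, Q]) h x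
    @[Q --> +oo] --> (2 * 0 - 0 : R) by apply: cvgB h0; exact: cvgM c2 h2.
rewrite mulr0 subr0 in hs; apply: cvg_trans hs; apply: near_eq_cvg; near=> Q.
have Q0 : 0 < Q by near: Q; exact: nbhs_pinfty_gt.
have Q2 : Q <= 2 * Q by lra.
rewrite /average invfM !mulrA mulfV ?pnatr_eq0// mul1r -mulrBr.
congr (_ * _); rewrite Rintegral_itvB; [|exact: ih|by rewrite bnd_simp ltW|by rewrite bnd_simp].
rewrite Rintegral_itv_obnd_cbnd//; apply: integrableS (ih (2 * Q)) => //.
by apply: subset_itvr; rewrite bnd_simp ltW.
Unshelve. all: by end_near. Qed.

Lemma average_cvg (h : R -> R) (l : R) : (forall Q, 1 <= Q -> mu.-integrable `[Q, 2 * Q] (fun x => (h x)%:E)) ->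
  h x @[x --> +oo] --> l -> average h Q @[Q --> +oo] --> l.
Proof.
move=> ih hl; apply/cvgrPdist_le => e e0.
move/cvgrPdist_le : hl => /(_ e e0) [A [_ hA]].
near=> Q.
have Q1 : 1 <= Q by near: Q; apply: nbhs_pinfty_ge.
have Q0 : 0 < Q by lra.
have AQ : A < Q by near: Q; apply: nbhs_pinfty_gt; exact: num_real.
have Q2 : Q <= 2 * Q by lra.
have ic (c : R) : mu.-integrable `[Q, 2 * Q] (fun=> c%:E).
  exact: (@bounded_integrable_itv (fun=> c) Q (2 * Q) `|c|).
have Ec (c : R) : \int[mu]_(x in `[Q, 2 * Q]) c = c * Q.
  rewrite (Rintegral_cst _ _) //; congr (_ * _).
  have mE : mu [set` `[Q, 2 * Q]] = Q%:E.
    have -> := lebesgue_measure_itv `[Q, 2 * Q]; rewrite /= lte_fin.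
    by have -> : Q < 2 * Q; [lra|rewrite -EFinB; congr (_%:E); lra].
  by rewrite [X in fine X]mE.
have -> : l - average h Q = Q^-1 * \int[mu]_(x in `[Q, 2 * Q]) (l - h x).
  by rewrite RintegralB//; [|exact: ic|exact: ih]; rewrite Ec mulrBr (mulrC l) mulrA mulVf ?gt_eqF// mul1r.
have il : mu.-integrable `[Q, 2 * Q] (fun x => (l - h x)%:E).
  exact: (integrableB _ (ic l) (ih _ Q1)).
rewrite normrM gtr0_norm ?invr_gt0// ler_pdivrMl//.
apply: le_trans (le_normr_Rintegral _ il) _ => //.
apply: (@le_trans _ _ (\int[mu]_(x in `[Q, 2 * Q]) e)); last by rewrite Ec mulrC.
apply: le_Rintegral => //; first exact: (integrable_norm il).
  exact: ic.
move=> x /=; rewrite in_itv/= => /andP[Qx _]; apply: hA; exact: lt_le_trans Qx.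
Unshelve. all: by end_near. Qed.

End Averages.

(** * Averages of products of two real Gaussian processes *)

Section ProductAverage.
Context d (T : measurableType d) (R : realType) (P : probability T R).
Local Notation mu := (@lebesgue_measure R).
Local Notation mR := (measurableTypeR R).
Local Notation pair := (pairing P).
Variables (G1 G2 : R -> T -> R) (m C K : R) (om : R -> R).
Hypotheses (fm1 : forall x, fourth_moment P (G1 x)) (fm2 : forall x, fourth_moment P (G2 x)).
Hypotheses (cG1 : forall w, continuous (fun x => G1 x w)) (cG2 : forall w, continuous (fun x => G2 x w)).
Hypothesis wk : forall x y, \int[P]_w (G1 x w * G2 x w * G1 y w * G2 y w) =
  pair (G1 x) (G2 x) * pair (G1 y) (G2 y) + pair (G1 x) (G1 y) * pair (G2 x) (G2 y) +
  pair (G1 x) (G2 y) * pair (G2 x) (G1 y).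
Let decays (F H : R -> T -> R) := forall x y, 1 <= x -> 1 <= y ->
  `|pair (F x) (H y)| * (1 + `|x - y|) <= C * (1 + y) `^ (- m).
Hypotheses (d11 : decays G1 G1) (d22 : decays G2 G2) (d12 : decays G1 G2).
Hypotheses (mom : measurable_fun setT om) (om0 : forall x, x < 1 -> om x = 0).
Hypothesis omK : forall x, 1 <= x -> `|om x| * (1 + x) `^ (- m) <= K.
Hypothesis omb : forall b, exists M, forall x, x <= b -> `|om x| <= M.

Let mG1 : measurable_fun setT (fun z : T * mR => G1 z.2 z.1).
Proof. by apply: (measurable_caratheodory (g := fun w x => G1 x w)) => // x; case: (fm1 x). Qed.

Let mG2 : measurable_fun setT (fun z : T * mR => G2 z.2 z.1).
Proof. by apply: (measurable_caratheodory (g := fun w x => G2 x w)) => // x; case: (fm2 x). Qed.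

Let e x := pair (G1 x) (G2 x).

(** Polarisation writes the mean as a difference of integrals of squares, whose measurability in x
    is part of Tonelli's theorem. *)
Let me : measurable_fun (setT : set mR) e.
Proof.
have msq (a : R) : measurable_fun (setT : set mR) (fun x => \int[P]_w (G1 x w + a * G2 x w) ^+ 2).
  have mg : measurable_fun setT (fun z : T * mR => ((G1 z.2 z.1 + a * G2 z.2 z.1) ^+ 2)%:E).
    apply/measurable_EFinP; apply: measurable_funX; apply: measurable_funD => //.
    by apply: measurable_funM => //; exact: measurable_cst.
  have g0 z : (0 <= ((G1 z.2 z.1 + a * G2 z.2 z.1) ^+ 2)%:E)%E by rewrite lee_fin sqr_ge0.
  have := @measurable_fun_fubini_tonelli_G _ _ _ _ R P _ mg g0.
  by move=> h; apply: (measurableT_comp _ h).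
have -> : e = fun x => 4^-1 * (\int[P]_w (G1 x w + 1 * G2 x w) ^+ 2 - \int[P]_w (G1 x w + (-1) * G2 x w) ^+ 2).
  apply/funext => x.
  have sq (a : R) : \int[P]_w (G1 x w + a * G2 x w) ^+ 2 =
      pair (G1 x) (G1 x) + 2 * a * pair (G1 x) (G2 x) + a ^+ 2 * pair (G2 x) (G2 x).
    have fl := fourth_moment_lin a (fm1 x) (fm2 x).
    have -> : \int[P]_w (G1 x w + a * G2 x w) ^+ 2 =
        pair (fun w => G1 x w + a * G2 x w) (fun w => G1 x w + a * G2 x w).
      by apply: eq_Rintegral => w _; rewrite expr2.
    have e0 := pairing_linl a (fm1 x) (fm2 x) fl.
    have e1 := pairing_linl a (fm1 x) (fm2 x) (fm1 x).
    have e2 := pairing_linl a (fm1 x) (fm2 x) (fm2 x).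
    set X := (fun w => _) in e0 e1 e2 *.
    rewrite e0 (pairingC P (G1 x) X) (pairingC P (G2 x) X) e1 e2.
    by rewrite (pairingC P (G2 x) (G1 x)); ring.
  by rewrite !sq /e; field.
by apply: measurable_funM; [exact: measurable_cst|exact: measurable_funB].
Qed.

Let W (w : T) (x : R) : R := om x * (G1 x w * G2 x w - e x).

Let C0 : 0 <= C.
Proof.
have := d11 (lexx 1) (lexx 1); rewrite subrr normr0 addr0 mulr1 => h.
have h1 : 0 < (1 + 1 : R) `^ (- m) by rewrite powR_gt0.
by have := le_trans (normr_ge0 _) h; rewrite pmulr_lge0.
Qed.

Let ome x : 1 <= x -> `|om x * e x| <= C * K.
Proof.
move=> x1; have := d12 x1 x1; rewrite subrr normr0 addr0 mulr1 => h.
rewrite normrM; apply: le_trans (ler_wpM2l (normr_ge0 _) h) _.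
by rewrite mulrCA; apply: ler_wpM2l => //; exact: omK.
Qed.

Let mW : measurable_fun setT (fun z : T * mR => W z.1 z.2).
Proof.
have mo : measurable_fun setT (fun z : T * mR => om z.2) by exact: (measurableT_comp mom).
have m2 : measurable_fun setT (fun z : T * mR => e z.2) by exact: (measurableT_comp me).
by apply: measurable_funM => //; apply: measurable_funB => //; exact: measurable_funM.
Qed.

(** On [1, b] the paths are continuous and the weight is bounded; below 1 the weight is 0. *)
Let Wb w b : exists M, forall x, x <= b -> `|W w x| <= M.
Proof.
have [b1|b1] := ltP b 1.
  by exists 0 => x xb; rewrite /W om0 ?mul0r ?normr0//; exact: le_lt_trans b1.
have cGG : continuous (fun x => `|G1 x w * G2 x w|).
  by move=> x; apply: cvg_norm; apply: cvgM; [exact: cG1|exact: cG2].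
have [c _ hc] := EVT_max b1 (continuous_subspaceT cGG).
have [M hM] := omb b.
exists (M * `|G1 c w * G2 c w| + C * K) => x xb.
have [x1|x1] := ltP x 1.
  rewrite /W om0// mul0r normr0.
  have M0 := le_trans (normr_ge0 _) (hM _ (lexx b)).
  have CK := le_trans (normr_ge0 _) (ome b1).
  by apply: addr_ge0 => //; exact: mulr_ge0.
rewrite /W mulrBr; apply: le_trans (ler_normB _ _) _; apply: lerD; last exact: ome.
by rewrite normrM; apply: ler_pM => //; [exact: hM|apply: hc; rewrite in_itv/= x1].
Qed.

Let i4 x y : P.-integrable setT (fun w => (G1 x w * G2 x w * G1 y w * G2 y w)%:E).
Proof. exact: integrable_prod4. Qed.

Let i2 x : P.-integrable setT (fun w => (G1 x w * G2 x w)%:E).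
Proof. exact: integrable_prod2. Qed.

Let icst (c : R) : P.-integrable setT (fun=> c%:E).
Proof. exact: finite_measure_integrable_cst. Qed.

(** Centring cancels exactly the first of the three pairings of Wick's formula; the two that remain
    couple x with y. *)
Let cov x y : P.-integrable setT (fun w => (W w x * W w y)%:E) /\
  \int[P]_w (W w x * W w y) = om x * om y *
    (pair (G1 x) (G1 y) * pair (G2 x) (G2 y) + pair (G1 x) (G2 y) * pair (G2 x) (G1 y)).
Proof.
have E w : W w x * W w y = om x * om y *
    (G1 x w * G2 x w * G1 y w * G2 y w + (- e y) * (G1 x w * G2 x w) + (- e x) * (G1 y w * G2 y w) + e x * e y).
  by rewrite /W; ring.
have a1 := integrableZl measurableT (- e y) (i2 x).
have a2 := integrableZl measurableT (- e x) (i2 y).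
have s1 := integrableD measurableT (i4 x y) a1.
have s2 := integrableD measurableT s1 a2.
have s3 := integrableD measurableT s2 (icst (e x * e y)).
split; first by under eq_fun do rewrite E; exact: (integrableZl measurableT _ s3).
under eq_Rintegral do rewrite E.
rewrite (RintegralZl _ measurableT s3) (RintegralD measurableT s2 (icst _)).
rewrite (RintegralD measurableT s1 a2) (RintegralD measurableT (i4 x y) a1).
rewrite (RintegralZl _ measurableT (i2 x)) (RintegralZl _ measurableT (i2 y)).
have -> : \int[P]_w (e x * e y) = e x * e y.
  by rewrite (Rintegral_cst P measurableT) [X in fine X]probability_setT mulr1.
rewrite wk -/(e x) -/(e y); congr (_ * _).
rewrite -[\int[P]_w (G1 x w * _)]/(e x) -[\int[P]_w (G1 y w * _)]/(e y); ring.
Qed.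

Lemma fluctuation_integrable w a b :
  mu.-integrable `[a, b] (fun x => (om x * (G1 x w * G2 x w - pair (G1 x) (G2 x)))%:E).
Proof.
have [M hM] := Wb w b.
have mWw : measurable_fun setT (W w : mR -> R) := measurableT_comp mW (@pair1_measurable _ _ _ _ w).
apply: (bounded_integrable_itv (M := M)) => // x xb; apply: hM.
by move: xb; rewrite /= in_itv/= => /andP[].
Qed.

Lemma mean_integrable a b : 1 <= a -> mu.-integrable `[a, b] (fun x => (om x * pair (G1 x) (G2 x))%:E).
Proof.
move=> a1; apply: (bounded_integrable_itv (M := C * K)); first exact: measurable_funM.
by move=> x /=; rewrite in_itv/= => /andP[ax _]; apply: ome; exact: le_trans ax.
Qed.

(** Each of the two remaining terms is a product of two correlations, each decaying like 1 / (1 + |x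
    - y|) after weighting. Their product is at most a multiple of [bump1 (x - y)], as the law of
    large numbers requires. *)
Lemma product_average : {ae P, forall w,
  average (fun x => om x * (G1 x w * G2 x w - pair (G1 x) (G2 x))) Q @[Q --> +oo] --> (0 : R)}.
Proof.
have iW x : P.-integrable setT (fun w => (W w x ^+ 2)%:E) by have [] := cov x x; under eq_fun do rewrite -expr2.
have EW x y : \int[P]_w (W w x * W w y) <= 2 * (C * K) ^+ 2 * bump1 (x - y).
  rewrite (cov x y).2.
  have r0 : 0 <= 2 * (C * K) ^+ 2 * bump1 (x - y).
    by rewrite mulr_ge0 ?(ltW (bump1_gt0 _))// mulr_ge0 ?sqr_ge0.
  have [x1|x1] := ltP x 1; first by rewrite om0// !mul0r.
  have [y1|y1] := ltP y 1; first by rewrite (om0 y1) mulr0 mul0r.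
  have t0 : 0 < 1 + `|x - y| by apply: ltr_pwDl.
  have xy : `|y - x| = `|x - y| by rewrite distrC.
  (* The decay hypothesis carries the weight of its second argument. One factor is used as it stands
     and the other with x and y exchanged, so that [om y] absorbs one power and [om x] the other. *)
  have key p q : `|p| * (1 + `|x - y|) <= C * (1 + y) `^ (- m) ->
     `|q| * (1 + `|x - y|) <= C * (1 + x) `^ (- m) ->
     om x * om y * (p * q) <= (C * K) ^+ 2 * bump1 (x - y).
    move=> hp hq; apply: le_trans (ler_norm _) _; rewrite !normrM.
    have bt : (1 + `|x - y|) ^- 2 <= bump1 (x - y).
      rewrite /bump1 lef_pV2 ?posrE; [|rewrite exprn_gt0//|by rewrite ltr_pwDl// sqr_ge0].
      by rewrite -[(x - y) ^+ 2]real_normK ?num_real//; have := normr_ge0 (x - y); move: `|x - y| => u u0; nra.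
    apply: le_trans (ler_wpM2l (sqr_ge0 _) bt).
    rewrite ler_pdivlMr ?exprn_gt0//.
    have -> : `|om x| * `|om y| * (`|p| * `|q|) * (1 + `|x - y|) ^+ 2 =
      `|om x| * (`|q| * (1 + `|x - y|)) * (`|om y| * (`|p| * (1 + `|x - y|))) by ring.
    rewrite expr2; apply: ler_pM.
    - by rewrite !mulr_ge0// ltW.
    - by rewrite !mulr_ge0// ltW.
    - apply: le_trans (ler_wpM2l (normr_ge0 _) hq) _; rewrite mulrCA.
      by apply: ler_wpM2l => //; exact: omK.
    - apply: le_trans (ler_wpM2l (normr_ge0 _) hp) _; rewrite mulrCA.
      by apply: ler_wpM2l => //; exact: omK.
  have k1 := key _ (pair (G2 x) (G2 y)) (d11 x1 y1).
  have k2 := key _ (pair (G2 x) (G1 y)) (d12 x1 y1).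
  rewrite mulrDr (_ : 2 * _ * _ = (C * K) ^+ 2 * bump1 (x - y) + (C * K) ^+ 2 * bump1 (x - y)); last by ring.
  apply: lerD.
    by apply: k1; rewrite pairingC -xy; exact: d22.
  by apply: k2; rewrite pairingC -xy; exact: d12.
have := law_of_large_numbers mW Wb iW EW.
apply: filterS => w; apply: average_cvg0 => b.
exact: fluctuation_integrable.
Qed.

End ProductAverage.

(** * From real parts to complex products *)

Section ComplexAverage.
Context d (T : measurableType d) (R : realType) (P : probability T R).
Local Notation mu := (@lebesgue_measure R).
Local Notation C := R[i].

(** The boolean index treats the four products of real and imaginary parts uniformly. *)
Definition part (p : bool) (z : C) : R := if p then cIm z else cRe z.

Lemma pairing_part (X Y : T -> C) : (forall p, fourth_moment P (fun w => part p (X w))) ->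
  (forall p, fourth_moment P (fun w => part p (Y w))) ->
  let pr p q := pairing P (fun w => part p (X w)) (fun w => part q (Y w)) in
  cintegral P setT (fun w => X w * Y w) = (pr false false - pr true true) +i* (pr false true + pr true false) /\
  cintegral P setT (fun w => X w * (Y w)^*) = (pr false false + pr true true) +i* (pr true false - pr false true).
Proof.
move=> hX hY /=; have i2 p q := integrable_prod2 (hX p) (hY q).
split; apply: complex_eqP => /=.
- under eq_Rintegral do rewrite cReM.
  by rewrite RintegralB//; [exact: (i2 false false)|exact: (i2 true true)].
- under eq_Rintegral do rewrite cImM.
  by rewrite RintegralD//; [exact: (i2 false true)|exact: (i2 true false)].
- under eq_Rintegral do rewrite cReM cReJ cImJ mulrN opprK.
  by rewrite RintegralD//; [exact: (i2 false false)|exact: (i2 true true)].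
- under eq_Rintegral do rewrite cImM cReJ cImJ mulrN addrC.
  by rewrite RintegralB//; [exact: (i2 true false)|exact: (i2 false true)].
Qed.

(** Relation and covariance give the sums and differences of the four real correlations, from which
    each one is recovered by halving. This is why both operators enter the decay estimate for either
    limit. *)
Lemma pairing_part_le (X Y : T -> C) p q : (forall p, fourth_moment P (fun w => part p (X w))) ->
  (forall p, fourth_moment P (fun w => part p (Y w))) ->
  `|pairing P (fun w => part p (X w)) (fun w => part q (Y w))| <=
  nc (cintegral P setT (fun w => X w * Y w)) + nc (cintegral P setT (fun w => X w * (Y w)^*)).
Proof.
move=> hX hY; have [] := pairing_part hX hY.
set z1 := cintegral _ _ _; set z2 := cintegral _ _ _ => e1 e2.
pose pr p q := pairing P (fun w => part p (X w)) (fun w => part q (Y w)).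
have r1 : cRe z1 = pr false false - pr true true := congr1 cRe e1.
have i1 : cIm z1 = pr false true + pr true false := congr1 cIm e1.
have r2 : cRe z2 = pr false false + pr true true := congr1 cRe e2.
have i2 : cIm z2 = pr true false - pr false true := congr1 cIm e2.
have h : [\/ pr p q = pr false false, pr p q = pr true true, pr p q = pr false true | pr p q = pr true false].
  by case: p; case: q; [constructor 2|constructor 4|constructor 3|constructor 1].
have := le_Re_nc z1; have := le_Im_nc z1; have := le_Re_nc z2; have := le_Im_nc z2.
rewrite -/(pr p q) r1 i1 r2 i2; move: (nc z1) (nc z2) h => n1 n2.
move: (pr p q) (pr false false) (pr true true) (pr false true) (pr true false) => z a b c e.
move=> h; rewrite !ler_norml => /andP[? ?] /andP[? ?] /andP[? ?] /andP[? ?].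
by case: h => ->; apply/andP; split; lra.
Qed.

Variables (X Y : R -> T -> C) (m B K : R) (om : R -> R) (l : C).
Hypotheses (fX : forall p x, fourth_moment P (fun w => part p (X x w)))
  (fY : forall p x, fourth_moment P (fun w => part p (Y x w))).
Hypotheses (cX : forall w, ccont (fun x => X x w)) (cY : forall w, ccont (fun x => Y x w)).
Let decays (F H : R -> T -> C) := forall p q x y, 1 <= x -> 1 <= y ->
  `|pairing P (fun w => part p (F x w)) (fun w => part q (H y w))| * (1 + `|x - y|) <= B * (1 + y) `^ (- m).
Hypotheses (dXX : decays X X) (dYY : decays Y Y) (dXY : decays X Y).
Hypothesis wk : forall p q x y,
  \int[P]_w (part p (X x w) * part q (Y x w) * part p (X y w) * part q (Y y w)) =
  pairing P (fun w => part p (X x w)) (fun w => part q (Y x w)) *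
    pairing P (fun w => part p (X y w)) (fun w => part q (Y y w)) +
  pairing P (fun w => part p (X x w)) (fun w => part p (X y w)) *
    pairing P (fun w => part q (Y x w)) (fun w => part q (Y y w)) +
  pairing P (fun w => part p (X x w)) (fun w => part q (Y y w)) *
    pairing P (fun w => part q (Y x w)) (fun w => part p (X y w)).
Hypotheses (mom : measurable_fun setT om) (om0 : forall x, x < 1 -> om x = 0).
Hypothesis omK : forall x, 1 <= x -> `|om x| * (1 + x) `^ (- m) <= K.
Hypothesis omb : forall b, exists M, forall x, x <= b -> `|om x| <= M.
Hypothesis hl : ccvg (pinfty_nbhs R) (fun x => (om x)%:C * cintegral P setT (fun w => X x w * Y x w)) l.

(** The fluctuations of the four real products average to 0, and their means recombine into the
    complex expectation, whose weighted limit is given. *)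
Lemma complex_average : {ae P, forall w, ccvg (pinfty_nbhs R)
  (fun Q => (Q^-1)%:C * cintegral mu `[Q, 2 * Q] (fun x => (om x)%:C * (X x w * Y x w))) l}.
Proof.
pose G p x w := part p (X x w); pose H q x w := part q (Y x w).
have cG p w : continuous (fun x => G p x w) by case: p; [exact: (cX w).2|exact: (cX w).1].
have cH p w : continuous (fun x => H p x w) by case: p; [exact: (cY w).2|exact: (cY w).1].
have pa p q := product_average (fX p) (fY q) (cG p) (cH q) (wk p q) (dXX p p) (dYY q q) (dXY p q) mom om0 omK omb.
have fi p q := fluctuation_integrable (fX p) (fY q) (cG p) (cH q) (dXX p p) (dXY p q) mom om0 omK omb.
have mi p q := mean_integrable (fX p) (fY q) (cG p) (cH q) (dXX p p) (dXY p q) mom omK.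
apply: filterS2 (filterI (pa false false) (pa true true)) (filterI (pa false true) (pa true false)).
move=> w [a00 a11] [a01 a10].
pose U p q x := om x * (G p x w * H q x w - pairing P (G p x) (H q x)).
pose M p q x := om x * pairing P (G p x) (H q x).
have iU p q Q : mu.-integrable `[Q, 2 * Q] (fun x => (U p q x)%:E) := fi p q w Q (2 * Q).
have iM p q Q : 1 <= Q -> mu.-integrable `[Q, 2 * Q] (fun x => (M p q x)%:E) := mi p q Q (2 * Q).
have Ec x : cintegral P setT (fun w => X x w * Y x w) =
    (pairing P (G false x) (H false x) - pairing P (G true x) (H true x)) +i*
    (pairing P (G false x) (H true x) + pairing P (G true x) (H false x)).
  by have [E _] := pairing_part (fX^~ x) (fY^~ x); rewrite E.
split.
- have lM : M false false x - M true true x @[x --> +oo] --> cRe l.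
    have := hl.1; apply: cvg_trans; apply: near_eq_cvg; apply: nearW => x.
    by rewrite Ec cReM /= mul0r subr0 mulrBr.
  have iMB Q : 1 <= Q -> mu.-integrable `[Q, 2 * Q] (fun x => (M false false x - M true true x)%:E).
    by move=> Q1; exact: (integrable_itvB (iM false false Q Q1) (iM true true Q Q1)).
  have hs : average (U false false) Q - average (U true true) Q +
      average (fun x => M false false x - M true true x) Q @[Q --> +oo] --> 0 - 0 + cRe l.
    by apply: cvgD; [apply: cvgB; [exact: a00|exact: a11]|exact: average_cvg iMB lM].
  rewrite subrr add0r in hs; move: hs; apply: cvg_trans; apply: near_eq_cvg; near=> Q.
  have Q1 : 1 <= Q by near: Q; apply: nbhs_pinfty_ge.
  rewrite -(averageB (iU false false Q) (iU true true Q)) -averageD; [|exact: (integrable_itvB (iU _ _ Q) (iU _ _ Q))|exact: iMB].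
  rewrite -[RHS]/(cRe ((Q^-1)%:C * _)) cReM /= mul0r subr0; congr (_ * _).
  by apply: eq_Rintegral => x _; rewrite /U /M !cE /G /H /=; ring.
- have lM : M false true x + M true false x @[x --> +oo] --> cIm l.
    have := hl.2; apply: cvg_trans; apply: near_eq_cvg; apply: nearW => x.
    by rewrite Ec cImM /= mul0r addr0 mulrDr.
  have iMB Q : 1 <= Q -> mu.-integrable `[Q, 2 * Q] (fun x => (M false true x + M true false x)%:E).
    by move=> Q1; exact: (integrable_itvD (iM false true Q Q1) (iM true false Q Q1)).
  have hs : average (U false true) Q + average (U true false) Q +
      average (fun x => M false true x + M true false x) Q @[Q --> +oo] --> 0 + 0 + cIm l.
    by apply: cvgD; [apply: cvgD; [exact: a01|exact: a10]|exact: average_cvg iMB lM].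
  rewrite !add0r in hs; move: hs; apply: cvg_trans; apply: near_eq_cvg; near=> Q.
  have Q1 : 1 <= Q by near: Q; apply: nbhs_pinfty_ge.
  rewrite -(averageD (iU false true Q) (iU true false Q)) -averageD; [|exact: (integrable_itvD (iU _ _ Q) (iU _ _ Q))|exact: iMB].
  rewrite -[RHS]/(cIm ((Q^-1)%:C * _)) cImM /= mul0r addr0; congr (_ * _).
  by apply: eq_Rintegral => x _; rewrite /U /M !cE /G /H /=; ring.
Unshelve. all: by end_near.
Qed.

End ComplexAverage.

(** * Gaussian moments of the random field *)

Section FieldMoments.
Context d (T : measurableType d) (R : realType) (P : probability T R).
Local Notation pt := 'rV[R]_3.
Local Notation C := R[i].
Variable f : T -> vdistribution R.
Hypotheses (gf : gaussian_field P f) (cf : centered P f).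

Lemma vpairingP (u : vdistribution R) (a : C) (phi psi : pt -> 'cV[C]_3) :
  test_mx setT phi -> test_mx setT psi ->
  u (fun x => a *: phi x + psi x) = a * u phi + u psi.
Proof. by case: u => u lin h; exact: lin. Qed.

Lemma test_mx_lin (a : C) (phi psi : pt -> 'cV[C]_3) :
  test_mx setT phi -> test_mx setT psi -> test_mx setT (fun x => a *: phi x + psi x).
Proof.
move=> tp tq j l; under eq_fun do rewrite !mxE.
by apply: test_funD (tq j l); apply: test_funZ; exact: tp.
Qed.

(** Real parts of pairings are stable under real linear combinations, which is what polarisation in
    Wick's formula needs, and they include imaginary parts. *)
Definition observable (X : T -> R) :=
  exists2 phi, test_mx setT phi & X = fun w => cRe (f w phi).

Lemma observable_lin X Y s : observable X -> observable Y -> observable (fun w => X w + s * Y w).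
Proof.
move=> [phi tp ->] [psi tq ->]; exists (fun x => s%:C *: psi x + phi x); first exact: test_mx_lin.
by apply/funext => w; rewrite vpairingP// cReD cReM /= mul0r subr0 addrC.
Qed.

Lemma observable_component j psi p : test_fun setT psi ->
  observable (fun w => part p (component (f w) j psi)).
Proof.
move=> tp; case: p; last by exists (fun x => psi x *: delta_mx j 0); first exact: test_mx_delta.
(* Im z is the real part of -i z. *)
exists (fun x => ((0 +i* (-1)) * psi x) *: delta_mx j 0).
  by apply: test_mx_delta; exact: test_funZ.
apply/funext => w; rewrite -[f w _]/(component (f w) j (fun x => (0 +i* (-1)) * psi x)).
by rewrite componentZ// cReM /= mul0r sub0r mulN1r opprK.
Qed.

Lemma observable_moments X : observable X -> fourth_moment P X /\
  \int[P]_w X w ^+ 4 = 3 * (\int[P]_w X w ^+ 2) ^+ 2.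
Proof.
move=> [phi tp ->].
have gX : gaussian P (fun w => cRe (f w phi)).
  by have := gf tp 1 0; under eq_fun do rewrite mul1r mul0r addr0.
have [i4 e4] := gaussian_moments gX (congr1 cRe (cf tp)).
by split => //; split => //; case: gX.
Qed.

Lemma observable_wick a b c e : observable a -> observable b -> observable c -> observable e ->
  \int[P]_w (a w * b w * c w * e w) =
  pairing P a b * pairing P c e + pairing P a c * pairing P b e + pairing P a e * pairing P b c.
Proof.
move=> ha hb hc he.
apply: wick; [exact: (observable_moments ha).1|exact: (observable_moments hb).1|
  exact: (observable_moments hc).1|exact: (observable_moments he).1|].
move=> s t u x; have hx := observable_lin u (observable_lin t (observable_lin s ha hb) hc) he.
exact: (observable_moments hx).2.
Qed.

Lemma cexpectationE (Z : T -> C) : cexpectation P Z = cintegral P setT Z.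
Proof. by rewrite /cexpectation unlock. Qed.

End FieldMoments.

(** * Localised Fourier modes along a ray *)

Section Rays.
Context d (T : measurableType d) (R : realType) (P : probability T R).
Local Notation pt := 'rV[R]_3.
Local Notation C := R[i].
Variable f : T -> vdistribution R.
Variable chi : pt -> C.
Hypotheses (tchi : test_fun setT chi) (chiJ : forall x, (chi x)^* = chi x).

Definition mode j (xi : pt) w : C := component (f w) j (fun x => chi x * expi (- dot x xi)).

Lemma test_mode (xi : pt) : test_fun setT (fun x => chi x * expi (- dot x xi)).
Proof.
by apply: test_funM => //; under eq_fun do rewrite -dotNr; exact: smooth_expi.
Qed.

(** [covariance_kernel] conjugates its last test function; as [chi] is real, chi exp(i x.zeta)
    becomes chi exp(-i x.zeta), the test function of the mode. *)
Lemma mode_covariance j l xi zeta :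
  cintegral P setT (fun w => mode j xi w * (mode l zeta w)^*) =
  covariance_kernel P f j l (fun x => chi x * expi (- dot x xi)) (fun x => chi x * expi (dot x zeta)).
Proof.
rewrite /covariance_kernel cexpectationE; apply: eq_cintegral => w _; rewrite /mode.
congr (_ * (component _ _ _)^*); apply/funext => x.
by rewrite rmorphM /= chiJ expiN.
Qed.

Lemma mode_relation j l xi zeta :
  cintegral P setT (fun w => mode j xi w * mode l zeta w) =
  relation_kernel P f j l (fun x => chi x * expi (- dot x xi)) (fun x => chi x * expi (dot x (- zeta))).
Proof.
rewrite /relation_kernel cexpectationE; apply: eq_cintegral => w _; rewrite /mode.
by congr (_ * component _ _ _); apply/funext => x; rewrite dotNr.
Qed.

(** Plane waves depend continuously on their frequency, with all derivatives, uniformly on the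
    support of [chi]. Continuity of the paths is what makes them jointly measurable and locally
    bounded. *)
Lemma ccont_mode (u : vdistribution R) j (v : pt) (b : R -> R) : continuous b ->
  ccont (fun t => component u j (fun x => chi x * expi (- dot x (b t *: v)))).
Proof.
move=> cb.
pose c t := - b t; have cc t : c x @[x --> t] --> c t by apply: cvgN; exact: cb.
pose E t (x : pt) := expi (dot x (c t *: v)) : C.
have -> : (fun t => component u j (fun x => chi x * expi (- dot x (b t *: v)))) =
    fun t => component u j (fun x => chi x * E t x).
  by apply/funext => t; congr (component u j _); apply/funext => x; rewrite /E scaleNr dotNr.
have sE t : smooth (E t) by exact: smooth_expi.
have tE t : test_fun setT (fun x => chi x * E t x) by apply: test_funM.
suff H t0 : ccvg (nbhs t0) (fun t => component u j (fun x => chi x * E t x)) (component u j (fun x => chi x * E t0 x)).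
  by split => t0; [exact: (H t0).1|exact: (H t0).2].
pose g t x := E t x + (-1) * E t0 x.
have sg t : smooth (g t) by apply: smoothD => //; exact: smoothZ.
have e1 t : component u j (fun x => chi x * E t x) =
    component u j (fun x => chi x * g t x) + component u j (fun x => chi x * E t0 x).
  rewrite -componentD//; last by apply: test_funM.
  by congr (component u j _); apply/funext => x; rewrite /g; ring.
have -> : (fun t => component u j (fun x => chi x * E t x)) =
    fun t => component u j (fun x => chi x * g t x) + component u j (fun x => chi x * E t0 x).
  by apply/funext => t; exact: e1.
rewrite -[X in ccvg _ _ X]add0r; apply: ccvgD; last exact: ccvg_cst.
apply: component_cvg0 => // s e e0.
have [_ cK _] := tchi; have [r [r0 hr]] := compact_coord_bound cK.
pose rho := r * \sum_k `|v 0 k|.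
pose Pr t : C := \prod_(k <- s) ('i * ((c t *: v) 0 k)%:C).
have cP : ccvg (nbhs t0) Pr (Pr t0).
  rewrite {}/Pr; elim: s => [|k s IH].
    by under eq_fun do rewrite big_nil; rewrite big_nil; exact: ccvg_cst.
  under eq_fun do rewrite big_cons; rewrite big_cons.
  apply: ccvgM => //; apply: ccvgM; first exact: ccvg_cst.
  apply: ccvgR; rewrite mxE; under eq_fun do rewrite mxE.
  by apply: cvgM; [exact: cc|exact: cvg_cst].
pose h t := nc (Pr t - Pr t0) + nc (Pr t0) * (2 * (rho * `|c t - c t0|)).
have h0 : h t @[t --> t0] --> 0.
  have -> : (0 : R) = 0 + nc (Pr t0) * (2 * (rho * `|c t0 - c t0|)) by rewrite subrr normr0 !mulr0 addr0.
  apply: cvgD; first exact: ccvg_nc.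
  apply: cvgM; first exact: cvg_cst.
  apply: cvgM; first exact: cvg_cst.
  apply: cvgM; first exact: cvg_cst.
  by apply: cvg_norm; apply: cvgB; [exact: cc|exact: cvg_cst].
move/cvgrPdist_le : h0 => /(_ e e0); apply: filterS => t; rewrite sub0r normrN => ht x xK.
have -> : cpartials s (g t) x = (Pr t - Pr t0) * E t x + Pr t0 * (E t x - E t0 x).
  rewrite /g cpartialsD//; last exact: smoothZ.
  rewrite cpartialsZ// !cpartials_expi -/(Pr t) -/(Pr t0) -/(E t x) -/(E t0 x); ring.
apply: le_trans (ncD _ _) _; apply: le_trans (le_trans (ler_norm _) ht).
rewrite !ncM nc_expi mulr1; apply: lerD => //; apply: ler_wpM2l; first exact: nc_ge0.
apply: le_trans (expi_lipschitz _ _) _; apply: ler_wpM2l => //.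
rewrite !dotZr -mulrBl normrM mulrC; apply: ler_wpM2r => //.
exact: norm_dot_le (hr x xK).
Qed.

Lemma covariance_kernel0 j l psi : covariance_kernel P f j l psi (fun=> 0) = 0.
Proof.
rewrite /covariance_kernel cexpectationE.
rewrite (eq_cintegral _ (h := fun=> 0)); last first.
  move=> w _; rewrite (_ : (fun _ => _) = fun=> 0); last first.
    by apply/funext => y; apply: complex_eqP; rewrite ?cReJ ?cImJ /= ?oppr0.
  by rewrite component0; apply: complex_eqP; rewrite !cE /= ?oppr0; ring.
by apply: complex_eqP; rewrite /= /Rintegral integral0.
Qed.

Lemma relation_kernel0 j l psi : relation_kernel P f j l psi (fun=> 0) = 0.
Proof.
rewrite /relation_kernel cexpectationE.
rewrite (eq_cintegral _ (h := fun=> 0)); last by move=> w _; rewrite component0 mulr0.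
by apply: complex_eqP; rewrite /= /Rintegral integral0.
Qed.

Variables (Sc Sr : pt -> pt -> 'M[C]_3) (m : R).
Hypotheses (pc : is_psido (covariance_kernel P f) Sc) (pr : is_psido (relation_kernel P f) Sr).
Hypotheses (sc : symbol_class (- m) Sc) (sr : symbol_class (- m) Sr) (m3 : `|m| <= 3).
Hypotheses (gf : gaussian_field P f) (cf : centered P f).
Variable v : pt.
Hypothesis v1 : enorm v = 1.

Definition ray j s a (x : R) := mode j ((s * (x + a)) *: v).

Lemma observable_ray j s a x p : observable f (fun w => part p (ray j s a x w)).
Proof. by apply: observable_component; exact: test_mode. Qed.

Lemma kernel_bound (K : 'I_3 -> 'I_3 -> (pt -> C) -> (pt -> C) -> C) S j l : is_psido K S -> symbol_class (- m) S ->
  (forall j l psi, K j l psi (fun=> 0) = 0) ->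
  exists B, 0 <= B /\ forall xi zeta k,
    nc (K j l (fun x => chi x * expi (- dot x xi)) (fun x => chi x * expi (dot x zeta))) *
      (1 + `|(xi - zeta) 0 k|) <= B * (1 + enorm zeta) `^ (- m).
Proof.
move=> pK sS K0; have o3 : `|- m| <= 3 by rewrite normrN.
have [c [c0 hs]] := symbol_slice j l sS.
have [_ [B [B0 hB]]] := amplitude_decay tchi c0 hs o3.
have c30 : 0 <= ((2 * pi) ^+ 3)^-1 :> R by rewrite invr_ge0 exprn_ge0// mulr_ge0// pi_ge0.
exists (((2 * pi) ^+ 3)^-1 * B); split; first by rewrite mulr_ge0.
move=> xi zeta k; rewrite (kernel_amplitude j l xi zeta pK sS o3 tchi K0) ncM ncR ger0_norm// -!mulrA.
by apply: ler_wpM2l.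
Qed.

(** Decay in the difference of two frequencies becomes decay in |x - y| because both lie on the line
    spanned by v. The covariance compares with the frequency of the second mode and the relation
    with its opposite, so either sign has to be handled. *)
Lemma ray_decay j l s s' a a' : `|s| = 1 -> `|s'| = 1 -> 0 <= a -> 0 <= a' ->
  exists B, forall p q x y, 1 <= x -> 1 <= y ->
  `|pairing P (fun w => part p (ray j s a x w)) (fun w => part q (ray l s' a' y w))| * (1 + `|x - y|) <=
  B * (1 + y) `^ (- m).
Proof.
move=> s1 s1' a0 a0'.
have [B1 [B10 h1]] := kernel_bound j l pc sc covariance_kernel0.
have [B2 [B20 h2]] := kernel_bound j l pr sr relation_kernel0.
(* The available decay is in one coordinate of the frequency, so a coordinate in which v is nonzero
   is selected. *)
have [k vk] : exists k, v 0 k != 0.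
  case: (boolP [exists k, v 0 k != 0]) => [/existsP//|]; rewrite negb_exists => /forallP v0.
  move: v1; rewrite /enorm /dot big1 ?sqrtr0 => [/esym/eqP|i _]; first by rewrite oner_eq0.
  by have := v0 i; rewrite negbK => /eqP ->; rewrite mul0r.
have r0 : 0 < `|v 0 k| by rewrite normr_gt0.
have r1 : `|v 0 k| <= 1 by rewrite -v1 enorm_coord.
set r := `|v 0 k| in r0 r1.
exists ((1 + a + a') / r * (1 + a') ^+ 3 * (B1 + B2)) => p q x y x1 y1.
(* The reverse triangle inequality bounds the difference of the lengths x + a and y + a' by the
   distance of the frequencies, whatever the signs s and e; the shifts a and a' are absorbed in the
   constant. *)
have geo (e : R) : `|e| = 1 -> 1 + `|x - y| <= (1 + a + a') / r * (1 + `|((s * (x + a)) *: v - (e * (y + a')) *: v) 0 k|).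
  move=> e1.
  rewrite !mxE -mulrBl normrM -/r.
  have := ler_dist_dist (s * (x + a)) (e * (y + a')).
  rewrite !normrM s1 e1 !mul1r (ger0_norm (_ : 0 <= x + a)) ?(ger0_norm (_ : 0 <= y + a')); [|lra|lra].
  move: `|s * _ - _| (normr_ge0 (s * (x + a) - e * (y + a'))) => t t0.
  rewrite ler_norml => /andP[h1' h2'].
  have h3 : `|x - y| <= t + a + a' by rewrite ler_norml; apply/andP; split; lra.
  rewrite mulrAC ler_pdivlMr//; apply: le_trans (ler_wpM2r (ltW r0) (lerD (lexx 1) h3)) _.
  have := mulr_ge0 (addr_ge0 (addr_ge0 ler01 a0) a0') (_ : 0 <= 1 - r); rewrite subr_ge0 => /(_ r1).
  have := mulr_ge0 (addr_ge0 a0 a0') (mulr_ge0 t0 (ltW r0)); lra.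
have wt : (1 + enorm ((s' * (y + a')) *: v)) `^ (- m) <= (1 + y) `^ (- m) * (1 + a') ^+ 3.
  rewrite enormZ v1 mulr1 normrM s1' mul1r ger0_norm; last lra.
  apply: powR_peetre; [lra|lra|lra|..].
  - by have := mulr_ge0 (le_trans ler01 y1) a0'; lra.
  - have := mulr_ge0 (addr_ge0 (le_trans ler01 y1) a0') a0'; lra.
  - by rewrite normrN.
have hb : forall z B, 0 <= B -> forall e, `|e| = 1 ->
   nc z * (1 + `|((s * (x + a)) *: v - (e * (y + a')) *: v) 0 k|) <= B * (1 + enorm ((s' * (y + a')) *: v)) `^ (- m) ->
   nc z * (1 + `|x - y|) <= (1 + a + a') / r * (1 + a') ^+ 3 * B * (1 + y) `^ (- m).
  move=> z B B0 e e1 hz.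
  apply: le_trans (ler_wpM2l (nc_ge0 z) (geo e e1)) _.
  rewrite mulrCA -!mulrA; apply: ler_wpM2l.
    by rewrite addr_ge0// addr_ge0.
  apply: ler_wpM2l; first by rewrite invr_ge0 ltW.
  apply: le_trans hz _; rewrite [leRHS](_ : _ = B * ((1 + y) `^ (- m) * (1 + a') ^+ 3)); last by ring.
  exact: ler_wpM2l.
have ob z := observable_moments gf cf z.
have := pairing_part_le p q (fun p => (ob _ (observable_ray j s a x p)).1) (fun p => (ob _ (observable_ray l s' a' y p)).1).
have t0 : 0 <= 1 + `|x - y| by rewrite addr_ge0.
move=> /(ler_wpM2r t0)/le_trans; apply.
rewrite mulrDl [leRHS](_ : _ = (1 + a + a') / r * (1 + a') ^+ 3 * B2 * (1 + y) `^ (- m) +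
  (1 + a + a') / r * (1 + a') ^+ 3 * B1 * (1 + y) `^ (- m)); last by ring.
apply: lerD.
  apply: (hb _ _ B20 (- s')); first by rewrite normrN.
  rewrite mode_relation; have := h2 ((s * (x + a)) *: v) (- ((s' * (y + a')) *: v)) k.
  by rewrite enormN mulNr scaleNr.
apply: (hb _ _ B10 s') => //.
by rewrite mode_covariance; exact: h1.
Qed.

Section Weight.
Variables (tau : R) (tau0 : 0 <= tau).

                                                                           
                                 
(** This is x^(m-2) x (x + tau) expanded: the weight once the factors kappa and kappa + tau of the
    two far fields are absorbed. It is set to 0 below 1 to keep it locally bounded, which is
    invisible to averages over [Q, 2Q] with Q >= 1. *)
Definition weight (x : R) : R := if 1 <= x then x `^ m + tau * x `^ (m - 1) else 0.

Lemma weightE x : 1 <= x -> weight x = x `^ m * (1 + tau / x).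
Proof.
move=> x1; rewrite /weight x1; have x0 : x != 0 by rewrite gt_eqF//; lra.
rewrite powRD; last by apply/implyP.
rewrite powRN powRr1; last lra.
ring.
Qed.

Lemma weight0 x : x < 1 -> weight x = 0.
Proof. by rewrite /weight leNgt => ->. Qed.

Lemma measurable_weight : measurable_fun setT weight.
Proof.
apply: measurable_fun_ifT.
- exact: measurable_fun_ler.
- apply: measurable_funD; first exact: measurable_powR.
  by apply: measurable_funM; [exact: measurable_cst|exact: measurable_powR].
- exact: measurable_cst.
Qed.

Lemma weight_le x : 1 <= x -> 0 <= weight x <= x `^ m * (1 + tau).
Proof.
move=> x1; rewrite weightE//; have x0 : 0 < x by lra.
have h1 : 0 <= tau / x by rewrite divr_ge0// ltW.
have h2 : tau / x <= tau by rewrite ler_pdivrMr// ler_peMr.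
by rewrite mulr_ge0 ?powR_ge0 ?addr_ge0//= ler_wpM2l ?powR_ge0// lerD2l.
Qed.

Lemma weight_decay x : 1 <= x -> `|weight x| * (1 + x) `^ (- m) <= 8 * (1 + tau).
Proof.
move=> x1; have /andP[w0 w1] := weight_le x1; rewrite ger0_norm//.
apply: le_trans (ler_wpM2r (powR_ge0 _ _) w1) _.
rewrite mulrAC; apply: ler_wpM2r; first exact: addr_ge0.
exact: powR_shift1.
Qed.

Lemma weight_bounded b : exists M, forall x, x <= b -> `|weight x| <= M.
Proof.
exists (`|b| ^+ 3 * (1 + tau)) => x xb.
have t1 : 0 <= 1 + tau by exact: addr_ge0.
have [x1|x1] := ltP x 1; first by rewrite weight0// normr0 mulr_ge0// exprn_ge0.
have /andP[w0 w1] := weight_le x1; rewrite ger0_norm//; apply: le_trans w1 _.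
apply: ler_wpM2r => //; apply: (@le_trans _ _ (x `^ 3%:R)).
  by apply: ler_powR => //; apply: le_trans (ler_norm _) m3.
have x0 : 0 <= x by lra.
rewrite powR_mulrn//; apply: lerXn2r; rewrite ?nnegrE//.
exact: le_trans xb (ler_norm _).
Qed.

(** The two frequencies differ by tau v whatever x is, so [kernel_amplitude] evaluates a transform
    at this fixed point, and [hat_amplitude_limit] gives its limit; the extra factor 1 + tau / x
    tends to 1. *)
Lemma kernel_limit (K : 'I_3 -> 'I_3 -> (pt -> C) -> (pt -> C) -> C) S B (a : pt -> 'M[C]_3) j l :
  is_psido K S -> symbol_class (- m) S -> (forall j l psi, K j l psi (fun=> 0) = 0) ->
  symbol_class (- m - 1) B ->
  (forall x xi, 1 <= enorm xi -> S x xi = (enorm xi `^ (- m))%:C *: a x + B x xi) ->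
  (forall x, integral3 (fun xi => expi (dot x xi) * hat chi xi) = ((2 * pi) ^+ 3)%:C * chi x) ->
  ccont (fun x => a x j l) -> (forall x, a x j l != 0 -> chi x = 1) ->
  ccvg (pinfty_nbhs R) (fun x => (weight x)%:C *
    K j l (fun y => chi y * expi (- dot y ((x + tau) *: v))) (fun y => chi y * expi (dot y (x *: v))))
    (hat (fun x => a x j l) (tau *: v)).
Proof.
move=> pK sS K0 sB SE inv ca achi; have o3 : `|- m| <= 3 by rewrite normrN.
have [c [c0 hs]] := symbol_slice j l sS.
have [c' hB] : exists c', forall x xi, nc (B x xi j l) <= c' * (1 + enorm xi) `^ (- m - 1).
  have [_ /(_ [::] [::]) [c' h]] := sB j l; exists c' => x xi.
  by have := h x xi; rewrite /= row_mxKl row_mxKr subr0.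
have sE x xi : 1 <= enorm xi -> S x xi j l = (enorm xi `^ (- m))%:C * a x j l + B x xi j l.
  by move=> h; rewrite SE// !mxE.
(* Limits at infinity are tested along sequences, for which dominated convergence was stated. *)
suff H (kap : nat -> R) : kap n @[n --> \oo] --> pinfty_nbhs R -> ccvg \oo (fun n => (weight (kap n))%:C *
    K j l (fun y => chi y * expi (- dot y ((kap n + tau) *: v))) (fun y => chi y * expi (dot y (kap n *: v))))
    (hat (fun x => a x j l) (tau *: v)).
  by split; apply/cvg_pinftyP => u uy; [exact: (H u uy).1|exact: (H u uy).2].
(* The limit lemmas require every term to be at least 1; the truncation is eventually inactive. *)
move=> kapy; pose kp n := Num.max 1 (kap n).
have kp1 n : 1 <= kp n by rewrite le_max lexx.
have near_kp : {near \oo, kp =1 kap}.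
  have [N _ hN] : \forall n \near \oo, 1 <= kap n.
    by apply: (kapy [set x | 1 <= x]); apply: nbhs_pinfty_ge; exact: num_real.
  by exists N => // n /hN h; rewrite /kp max_r.
have kpy : kp n @[n --> \oo] --> pinfty_nbhs R.
  by apply: cvg_trans kapy; apply: near_eq_cvg; apply: filterS near_kp => n ->.
have lim := hat_amplitude_limit tchi inv c0 hs m3 hB sE v1 kp1 kpy (tau *: v) ca achi.
have p30 : ((2 * pi) ^+ 3 : R) != 0 by rewrite expf_neq0// mulf_neq0 ?pnatr_eq0// gt_eqF ?pi_gt0.
have lim2 : ccvg \oo (fun n => (1 + tau / kp n)%:C * ((((2 * pi) ^+ 3)^-1)%:C *
    ((kp n `^ m)%:C * hat (fun x => chi x * amplitude chi (fun x xi => S x xi j l) x (kp n *: v)) (tau *: v))))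
    (1 * ((((2 * pi) ^+ 3)^-1)%:C * (((2 * pi) ^+ 3)%:C * hat (fun x => a x j l) (tau *: v)))).
  apply: ccvgM; last by apply: ccvgM => //; exact: ccvg_cst.
  apply: ccvgR; rewrite -[X in _ --> X]addr0; apply: cvgD; first exact: cvg_cst.
  by rewrite -[X in _ --> X](mulr0 tau); apply: cvgM; [exact: cvg_cst|exact: cvg_inv_pinfty].
have e1 : 1 * ((((2 * pi) ^+ 3)^-1)%:C * (((2 * pi) ^+ 3)%:C * hat (fun x => a x j l) (tau *: v))) =
    hat (fun x => a x j l) (tau *: v).
  by rewrite mul1r mulrA -rmorphM mulVf// mul1r.
rewrite e1 in lim2; apply: near_ccvg lim2; apply: filterS near_kp => n <-.
rewrite (kernel_amplitude j l _ _ pK sS o3 tchi K0) weightE// -scalerBl (_ : kp n + tau - kp n = tau); last by ring.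
rewrite rmorphM; ring.
Qed.

                                                                                
(** One flag treats the covariance case (conjugate) and the relation case together. *)
Definition cj (c : bool) (z : C) : C := if c then z^* else z.

Lemma part_cj c p z : part p (cj c z) = (if c && p then -1 else 1) * part p z.
Proof. by case: c; case: p; rewrite /= ?cReJ ?cImJ ?mulN1r ?mul1r. Qed.

(** Conjugation changes only signs of real and imaginary parts, so the decay of correlations between
    rays carries over, and [complex_average] applies. *)
Lemma ray_average j l s c (L : C) : `|s| = 1 ->
  ccvg (pinfty_nbhs R) (fun x => (weight x)%:C *
    cintegral P setT (fun w => ray j 1 tau x w * cj c (ray l s 0 x w))) L ->
  {ae P, forall w, ccvg (pinfty_nbhs R) (fun Q => (Q^-1)%:C *
    cintegral lebesgue_measure `[Q, 2 * Q] (fun x => (weight x)%:C * (ray j 1 tau x w * cj c (ray l s 0 x w)))) L}.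
Proof.
move=> s1 hL.
have n1 : `|1 : R| = 1 by rewrite normr1.
have [B1 h1] := ray_decay j j n1 n1 tau0 tau0.
have [B2 h2] := ray_decay l l s1 s1 (lexx 0) (lexx 0).
have [B3 h3] := ray_decay j l n1 s1 tau0 (lexx 0).
have cline (e a : R) : continuous (fun x : R => e * (x + a)).
  by move=> x; apply: cvgM; [exact: cvg_cst|apply: cvgD; [exact: cvg_id|exact: cvg_cst]].
pose B := `|B1| + `|B2| + `|B3|.
have oX p x : observable f (fun w => part p (ray j 1 tau x w)) := observable_ray j 1 tau x p.
have oY p x : observable f (fun w => part p (cj c (ray l s 0 x w))).
  have o1 := observable_ray l s 0 x p.
  (* The sign sigma is produced as X + (sigma - 1) X, the form in which [observable_lin] is
     stated. *)
  have := observable_lin ((if c && p then -1 else 1) - 1) o1 o1.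
  by congr (observable f _); apply/funext => w; rewrite part_cj; ring.
have fX p x := (observable_moments gf cf (oX p x)).1.
have fY p x := (observable_moments gf cf (oY p x)).1.
have BB y (z b : R) : `|b| <= B -> z <= b * (1 + y) `^ (- m) -> z <= B * (1 + y) `^ (- m).
  move=> bB hz; apply: le_trans hz _; apply: ler_wpM2r; first exact: powR_ge0.
  exact: le_trans (ler_norm _) bB.
have BE : [/\ `|B1| <= B, `|B2| <= B & `|B3| <= B].
  by have := normr_ge0 B1; have := normr_ge0 B2; have := normr_ge0 B3; rewrite /B; split; lra.
have [b1 b2 b3] := BE.
pose sg p : R := if c && p then -1 else 1.
have nsg p : `|sg p| = 1 by rewrite /sg; case: ifP; rewrite ?normrN normr1.
have psg (a e : R) (U V : T -> R) : `|a| = 1 -> `|e| = 1 -> fourth_moment P U -> fourth_moment P V ->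
    `|pairing P (fun w => a * U w) (fun w => e * V w)| = `|pairing P U V|.
  move=> a1 e1 fU fV; rewrite /pairing.
  under eq_Rintegral do rewrite mulrACA.
  by rewrite (RintegralZl _ measurableT (integrable_prod2 fU fV)) !normrM a1 e1 !mul1r.
have oR x p := (observable_moments gf cf (observable_ray l s 0 x p)).1.
have EY p x : (fun w => part p (cj c (ray l s 0 x w))) = fun w => sg p * part p (ray l s 0 x w).
  by apply/funext => w; rewrite part_cj.
apply: (complex_average (X := ray j 1 tau) (Y := fun x w => cj c (ray l s 0 x w)) (m := m) (B := B) (K := 8 * (1 + tau))).
- exact: fX.
- exact: fY.
- by move=> w; exact: (ccont_mode (f w) j v (cline 1 tau)).
- move=> w; have h : ccont (fun x => ray l s 0 x w) := ccont_mode (f w) l v (cline s 0).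
  by rewrite /cj; case: (c) => //; exact: ccontJ.
- by move=> p q x y x1 y1; apply: BB b1 _; exact: h1.
- move=> p q x y x1 y1; rewrite !EY psg//; apply: BB b2 _; exact: h2.
- move=> p q x y x1 y1; rewrite EY.
  have := psg 1 (sg q) (fun w => part p (ray j 1 tau x w)) (fun w => part q (ray l s 0 y w)) n1 (nsg q) (fX p x) (oR y q).
  rewrite (_ : (fun w => 1 * part p (ray j 1 tau x w)) = fun w => part p (ray j 1 tau x w)); last first.
    by apply/funext => w; rewrite mul1r.
  by move=> ->; apply: BB b3 _; exact: h3.
- by move=> p q x y; exact: (observable_wick gf cf).
- exact: measurable_weight.
- exact: weight0.
- exact: weight_decay.
- exact: weight_bounded.
- exact: hL.
Qed.

End Weight.

End Rays.

Lemma far_field_factor (K : realFieldType) (x t u p : K) : x != 0 -> x + t != 0 -> p != 0 ->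
  (16 * p ^+ 2)^-1 * u = u / (x * (x + t)) * ((x + t) / (4 * p) * (x / (4 * p))).
Proof. by move=> x0 xt p0; field; rewrite p0 xt. Qed.

(** * Entrywise limits of complex matrices *)

Section MatrixLimits.
Variable R : realType.
Local Notation C := R[i].

Lemma complex_matrix_cvg (F : R -> 'M[C]_3) (L : 'M[C]_3) :
  (forall j l, ccvg (pinfty_nbhs R) (fun Q => F Q j l) (L j l)) ->
  (F Q : 'M[C^o]_3) @[Q --> +oo] --> (L : 'M[C^o]_3).
Proof.
move=> h; apply/cvg_ballP => e e0; rewrite /ball /=.
(* The radius of a ball is itself a complex number; being positive forces it to be real. *)
have [e1 e2] : cIm e = 0 /\ 0 < cRe e by move: e0; rewrite ltcE => /andP[/eqP -> ->].
have H j l : \forall Q \near pinfty_nbhs R, nc (F Q j l - L j l) < cRe e.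
  have : nc (F Q j l - L j l) @[Q --> +oo] --> 0 by apply: ccvg_nc; exact: h.
  move/cvgrPdist_lt => /(_ _ e2); apply: filterS => Q.
  by rewrite sub0r normrN; apply: le_lt_trans; exact: ler_norm.
have : \forall Q \near pinfty_nbhs R, forall j l, nc (F Q j l - L j l) < cRe e.
  by apply: fin_near_ord => j; apply: fin_near_ord => l; exact: H.
apply: filterS => Q hQ; split=> // j l.
rewrite -ball_normE /= normc_def -nc_def ltcE /= e1 eqxx /=.
by have := hQ j l; rewrite nc_subC.
Qed.

Lemma complex_matrix_cvg_unique (F : R -> 'M[C]_3) (L L' : 'M[C]_3) :
  (F Q : 'M[C^o]_3) @[Q --> +oo] --> (L : 'M[C^o]_3) ->
  (F Q : 'M[C^o]_3) @[Q --> +oo] --> (L' : 'M[C^o]_3) -> L = L'.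
Proof. by apply: cvg_unique; exact: norm_hausdorff. Qed.

End MatrixLimits.

(** * Almost sure support of the field *)

Section RandomSupport.
Context d (T : measurableType d) (R : realType) (P : probability T R).
Local Notation pt := 'rV[R]_3.
Local Notation C := R[i].

Lemma ae_countable (I : countType) (Q : I -> T -> Prop) :
  (forall i, {ae P, forall w, Q i w}) -> {ae P, forall w, forall i, Q i w}.
Proof.
move=> h; pose Q' n w := if unpickle n is Some i then Q i w else True.
have h' n : {ae P, forall w, Q' n w}.
  by rewrite /Q'; case: unpickle => [i|]; [exact: h|exact: aeW].
have := ae_foralln h'; apply: filterS => w hw i.
by have := hw (pickle i); rewrite /Q' pickleK.
Qed.

Variable f : T -> vdistribution R.
Hypotheses (gf : gaussian_field P f) (cf : centered P f).
Variables (D : set pt) (S : pt -> pt -> 'M[C]_3).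
Hypotheses (pS : is_psido (covariance_kernel P f) S) (SD : forall xi, test_mx D (S^~ xi)).

(** The second moment is the covariance operator tested against psi. The symbol vanishes for x
    outside D and psi vanishes on D, so the integrand is identically 0, and a variable with zero
    second moment is almost surely 0. *)
Lemma component_ae0 j psi : test_fun setT psi -> test_fun setT (fun x => (psi x)^*) ->
  (forall x, D x -> psi x = 0) -> {ae P, forall w, component (f w) j psi = 0}.
Proof.
move=> tpsi tpsi' psiD.
have var0 : cintegral P setT (fun w => component (f w) j psi * (component (f w) j psi)^*) = 0.
  pose psi' x := (psi x)^*.
  have e1 : cintegral P setT (fun w => component (f w) j psi * (component (f w) j psi)^*) =
      covariance_kernel P f j j psi psi'.
    rewrite /covariance_kernel cexpectationE; apply: eq_cintegral => w _.
    by congr (_ * (component _ _ _)^*); apply/funext => x; rewrite /psi' conjcK.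
  have e2 : kernel_operator (covariance_kernel P f) (fun y => psi' y *: delta_mx j 0) j psi =
      covariance_kernel P f j j psi psi'.
    rewrite /kernel_operator (bigD1 j)//= big1 ?addr0 => [|l lj].
      by congr covariance_kernel; rewrite entry_delta eqxx; apply/funext => x; rewrite mul1r.
    rewrite entry_delta (negbTE lj); under eq_fun do rewrite mul0r.
    exact: covariance_kernel0.
  rewrite e1 -e2 pS//; last exact: test_mx_delta.
  rewrite (_ : (fun x => _) = fun=> 0); first by apply: complex_eqP; rewrite /= /Rintegral integral0.
  apply/funext => x; have [Dx|Dx] := pselect (D x); first by rewrite psiD// mul0r.
  rewrite /psido mxE mxE (_ : (fun xi => _) = fun=> 0).
    by rewrite (_ : integral3 _ = 0) ?mulr0//; apply: complex_eqP; rewrite /= /Rintegral integral0.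
  apply/funext => xi; rewrite (_ : S x xi = 0) ?mul0mx ?mxE ?mulr0//.
  apply/matrixP => i l; rewrite mxE; apply: (csupport0 (g := fun x => S x xi i l)).
  by have [_ _ h] := SD xi i l; move=> /h.
have ob p := observable_moments gf cf (observable_component f j p tpsi).
have pe0 p : pairing P (fun w => part p (component (f w) j psi)) (fun w => part p (component (f w) j psi)) = 0.
  have := (pairing_part (fun p => (ob p).1) (fun p => (ob p).1)).2; rewrite var0 => /(congr1 cRe) /=.
  have ge0 q : 0 <= pairing P (fun w => part q (component (f w) j psi)) (fun w => part q (component (f w) j psi)).
    by apply: Rintegral_ge0 => w _; rewrite -expr2 sqr_ge0.
  by have := ge0 true; have := ge0 false; case: p; rewrite /=; lra.
have a0 p : {ae P, forall w, part p (component (f w) j psi) = 0}.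
  set X := fun w => part p (component (f w) j psi).
  have fX : fourth_moment P X := (ob p).1.
  have i2 := integrable_prod2 fX fX.
  have : (\int[P]_w `|(X w * X w)%:E| = 0)%E.
    under eq_integral do rewrite gee0_abs ?lee_fin -?expr2 ?sqr_ge0//.
    have := pe0 p; rewrite /pairing /Rintegral => h.
    rewrite -[LHS]fineK; last by under eq_integral do rewrite expr2; exact: integrable_fin_num.
    by congr (_%:E); rewrite -[RHS]h; congr fine; apply: eq_integral => w _; rewrite expr2.
  move/(ae_eq_integral_abs P measurableT (measurable_int _ i2)).
  apply: filterS => w /(_ Logic.I) /= [] /eqP.
  by rewrite mulf_eq0 orbb => /eqP.
apply: filterS2 (a0 false) (a0 true) => w h1 h2.
exact: complex_eqP.
Qed.

(** A countable union of null sets, one for each rational centre, radius and lattice frequency, is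
    discarded; off it [dsupport_closure] applies. *)
Lemma ae_dsupport : {ae P, forall w j, dsupport (component (f w) j) `<=` closure D}.
Proof.
pose Q (i : 'I_3 * 'rV[rat]_3 * nat * 'rV[int]_3) w :=
  (forall x, box (qbox_center R i.1.1.2) (2 * i.1.2.+1%:R^-1) x -> ~ D x) ->
  component (f w) i.1.1.1 (fun x => cutoff (qbox_center R i.1.1.2) i.1.2.+1%:R^-1 x *
       expi (dot x (lattice (3 * i.1.2.+1%:R^-1) i.2))) = 0.
have h i : {ae P, forall w, Q i w}.
  rewrite /Q; have [H|H] := pselect (forall x, box (qbox_center R i.1.1.2) (2 * i.1.2.+1%:R^-1) x -> ~ D x); last first.
    exact: aeW.
  have r0 : 0 < i.1.2.+1%:R^-1 :> R by [].
  set q := qbox_center R _ in H *; set r := i.1.2.+1%:R^-1 in r0 H *.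
  have tt z : test_fun setT (fun x => cutoff q r x * expi (dot x z)).
    by apply: test_funM; [exact: test_cutoff|exact: smooth_expi].
  have /= := @component_ae0 i.1.1.1 (fun x => cutoff q r x * expi (dot x (lattice (3 * r) i.2))) (tt _).
  have -> : (fun x => (cutoff q r x * expi (dot x (lattice (3 * r) i.2)))^*) =
      fun x => cutoff q r x * expi (dot x (- lattice (3 * r) i.2)).
    by apply/funext => x; rewrite rmorphM /= cutoffJ dotNr expiN.
  move=> h; have {}h := h (tt _); apply: filterS (h _) => [w hw _ //|x Dx].
  by rewrite cutoff0 ?mul0r// => bx; exact: H bx Dx.
apply: filterS (ae_countable h) => w hw j; apply: dsupport_closure => q N k H.
exact: (hw (j, q, N, k) H).
Qed.

End RandomSupport.

(** * The far-field pattern and its frequency averages *)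

Section FarField.
Context d (T : measurableType d) (R : realType) (P : probability T R).
Local Notation pt := 'rV[R]_3.
Local Notation C := R[i].
Local Notation mu := (@lebesgue_measure R).
Variables (f : T -> vdistribution R) (D : set pt) (m : R) (Ac Ar : pt -> 'M[C]_3).
Hypotheses (hD : bounded_domain D) (m3 : `|m| <= 3) (gmig : centered_GMIG P f D m Ac Ar).

Lemma bounded_cutoff (E : set pt) : bounded_set E -> exists r (V : set pt),
  [/\ 0 < r, open V, closure E `<=` V & forall x, V x -> cutoff 0 r x = 1].
Proof.
move=> [M [_ hM]]; pose b := `|M| + 1.
have b0 : 0 <= b by rewrite addr_ge0.
have Eb : E `<=` box 0 b.
  move=> x Ex k; rewrite mxE subr0; apply: le_trans (le_coord_norm x k) _.
  by apply: (hM b) => //; rewrite /b ltr_pwDr// ler_norm.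
have r0 : 0 < b + 1 by rewrite ltr_wpDl.
exists (b + 1), (interior (box 0 (b + 1))); split => //.
- exact: open_interior.
- move=> x /(closure_subset Eb); rewrite -((closure_id _).1 (@closed_box R 3 0 b)) => bx.
  have := @box_nbhs R 3 x 1 ltr01; apply: filterS => y hy k.
  have := hy k; have := bx k; rewrite !mxE !subr0 => h1 h2.
  by rewrite -[y 0 k](subrK (x 0 k)) addrC; apply: le_trans (ler_normD _ _) (lerD h1 h2).
- by move=> x /interior_subset; exact: cutoff1.
Qed.

Lemma far_field_mode w chi V (v : pt) (kappa : R) j : test_fun setT chi -> open V ->
  dsupport (component (f w) j) `<=` V -> (forall x, V x -> chi x = 1) ->
  far_field f w v kappa j 0 = (0 +i* (kappa / (4 * pi))) * mode f chi j (kappa *: v) w.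
Proof.
move=> tchi oV sV chi1; rewrite /far_field mxE; congr (_ * _).
have -> : (fun y : pt => expi (- (kappa * dot v y))) = fun y => expi (dot y (- (kappa *: v))).
  by apply/funext => y; rewrite dotNr dotZr dotC.
rewrite (smooth_pairingE tchi oV sV chi1); last exact: smooth_expi.
by congr component; apply/funext => x; rewrite dotNr.
Qed.

Lemma weighted_cintegrable (om : R -> R) (Z : R -> C) a b : a <= b -> measurable_fun setT om ->
  (forall b, exists M, forall x, x <= b -> `|om x| <= M) -> ccont Z ->
  cintegrable mu `[a, b] (fun x => (om x)%:C * Z x).
Proof.
move=> ab mom /(_ b) [M hM] [cr ci].
have H (g : R -> R) : continuous g -> mu.-integrable `[a, b] (fun x => (om x * g x)%:E).
  move=> cg; have cn : continuous (fun x => `|g x|) by move=> x; apply: cvg_norm; exact: cg.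
  have [c _ hc] := EVT_max ab (continuous_subspaceT cn).
  apply: (bounded_integrable_itv (M := M * `|g c|)).
    by apply: measurable_funM => //; exact: continuous_measurable_fun.
  move=> x xI; rewrite normrM; apply: ler_pM => //; last exact: hc.
  by apply: hM; move: xI; rewrite /= in_itv/= => /andP[].
have E1 : (fun x => (cRe ((om x)%:C * Z x))%:E) = fun x => (om x * cRe (Z x))%:E.
  by apply/funext => x; rewrite cReM /= mul0r subr0.
have E2 : (fun x => (cIm ((om x)%:C * Z x))%:E) = fun x => (om x * cIm (Z x))%:E.
  by apply/funext => x; rewrite cImM /= mul0r addr0.
by rewrite /cintegrable E1 E2; split; exact: H.
Qed.

Section Limits.
Variables (v : pt) (tau : R).
Hypotheses (v1 : enorm v = 1) (tau0 : 0 <= tau).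

(** The factors i kappa / (4 pi) are pulled out of the product: i times its conjugate is 1 and i
    times i is -1, which is the sign distinguishing the two limits. *)
Lemma frequency_mean_mode w chi V (v' : pt) j l Q (c : bool) : 1 <= Q -> test_fun setT chi -> open V ->
  (forall j, dsupport (component (f w) j) `<=` V) -> (forall x, V x -> chi x = 1) ->
  (Q^-1)%:C * cintegral mu `[Q, 2 * Q] (fun x => (x `^ (m - 2))%:C *
    (far_field f w v (x + tau) j 0 * cj c (far_field f w v' x l 0))) =
  (if c then 1 else -1) * ((16 * pi ^+ 2)^-1)%:C * ((Q^-1)%:C * cintegral mu `[Q, 2 * Q] (fun x =>
    (weight m tau x)%:C * (mode f chi j ((x + tau) *: v) w * cj c (mode f chi l (x *: v') w)))).
Proof.
move=> Q1 tchi oV sV chi1.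
rewrite mulrCA; congr (_ * _); rewrite -cintegralZ.
- apply: eq_cintegral => x; rewrite /= in_itv/= => /andP[Qx _].
  rewrite !(far_field_mode _ _ tchi oV (sV _) chi1).
  have x1 : 1 <= x := le_trans Q1 Qx.
  have x0 : x != 0 by rewrite gt_eqF//; lra.
  have pi0 : pi != 0 :> R by rewrite gt_eqF// pi_gt0.
  have wE : x `^ (m - 2) = weight m tau x / (x * (x + tau)).
    have xt : x + tau != 0 by rewrite gt_eqF// ltr_pwDl//; lra.
    rewrite weightE// powRD; last by apply/implyP.
    rewrite powRN (powR_mulrn 2); last lra.
    by field; rewrite xt.
  have cjM (a b : C) : cj c (a * b) = cj c a * cj c b by rewrite /cj; case: (c); rewrite ?rmorphM.
  set M1 := mode f chi j _ w; set M2 := mode f chi l _ w.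
  have CM (a b : R) : (a * b)%:C = a%:C * b%:C by apply: complex_eqP; rewrite !cE /=; ring.
  have e1 (s t : R) : (0 +i* s) * cj c (0 +i* t) = (if c then 1 else -1) * (s * t)%:C :> C.
    by rewrite /cj; case: (c); apply: complex_eqP; rewrite !cE /=; ring.
  rewrite cjM; set A1 := (0 +i* ((x + tau) / _)); set A2 := (0 +i* (x / _)).
  rewrite (_ : _ * _ = (x `^ (m - 2))%:C * (A1 * cj c A2) * (M1 * cj c M2)); last by ring.
  rewrite e1 [RHS](_ : _ = (if c then 1 else -1) * (((16 * pi ^+ 2)^-1) * weight m tau x)%:C * (M1 * cj c M2)); last first.
    by rewrite CM !mulrA.
  rewrite (_ : (16 * pi ^+ 2)^-1 * weight m tau x = x `^ (m - 2) * ((x + tau) / (4 * pi) * (x / (4 * pi)))).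
    by move: (_ / _ * (_ / _)) (x `^ (m - 2)) => q p; rewrite CM -!mulrA mulrCA.
  have xt : x + tau != 0 by rewrite gt_eqF// ltr_pwDl//; lra.
  by rewrite wE; exact: far_field_factor.
- exact: measurable_itv.
- apply: weighted_cintegrable; [lra|exact: measurable_weight|exact: weight_bounded|].
  have c1 : continuous (fun x : R => x + tau) by move=> x; apply: cvgD; [exact: cvg_id|exact: cvg_cst].
  have c2 : continuous (fun x : R => x) by move=> x; exact: cvg_id.
  have h1 : ccont (fun x : R => mode f chi j ((x + tau) *: v) w) := ccont_mode tchi (f w) j v c1.
  have h : ccont (fun x : R => mode f chi l (x *: v') w) := ccont_mode tchi (f w) l v' c2.
  by apply: (ccontM h1); rewrite /cj; case: (c) => //; exact: ccontJ.
Qed.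

(** Both limits at once: K is the kernel at hand, v' the second direction and c the conjugation
    flag. The hypothesis on K says that expected products of modes are values of K with second
    frequency x v, which covers v' = v with conjugation and v' = -v without. *)
Lemma ae_average (K : 'I_3 -> 'I_3 -> (pt -> C) -> (pt -> C) -> C) (A : pt -> 'M[C]_3) (v' : pt) (c : bool) :
  has_isotropic_symbol D m K A -> (forall j l psi, K j l psi (fun=> 0) = 0) ->
  (forall chi j l x, test_fun setT chi -> (forall x, (chi x)^* = chi x) ->
     cintegral P setT (fun w => mode f chi j ((x + tau) *: v) w * cj c (mode f chi l (x *: v') w)) =
     K j l (fun y => chi y * expi (- dot y ((x + tau) *: v))) (fun y => chi y * expi (dot y (x *: v)))) ->
  (v' = v \/ v' = - v) ->
  {ae P, forall w, forall i : 'I_3 * 'I_3,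
    ccvg (pinfty_nbhs R) (fun Q => (Q^-1)%:C * cintegral mu `[Q, 2 * Q] (fun x => (x `^ (m - 2))%:C *
      (far_field f w v (x + tau) i.1 0 * cj c (far_field f w v' x i.2 0))))
    ((if c then 1 else -1) * ((16 * pi ^+ 2)^-1)%:C * fourier A (tau *: v) i.1 i.2)}.
Proof.
move=> [tA [S [B [pS sS _ [sB _] SE]]]] K0 KE hv.
(* Both symbols enter whichever kernel K is: the decay of real correlations uses covariance and
   relation together, and the support uses the covariance. *)
have [gf cf [_ [Sc [_ [pc sc Dc _ _]]]] [_ [Sr [_ [pr sr _ _ _]]]]] := gmig.
have [_ _ _ bD] := hD.
have [r [V [r0 oV DV chi1]]] := bounded_cutoff bD.
have tchi : test_fun setT (cutoff (0 : pt) r) by apply: test_cutoff.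
have chiJ (x : pt) : (cutoff 0 r x)^* = cutoff 0 r x := cutoffJ _ _ _.
have [s [s1 sv]] : exists s : R, `|s| = 1 /\ v' = s *: v.
  case: hv => ->; [exists 1|exists (-1)]; rewrite ?normrN ?normr1 ?scale1r ?scaleN1r//.
have av (i : 'I_3 * 'I_3) := ray_average tchi chiJ pc pr sc sr m3 gf cf v1 tau0 (j := i.1) (l := i.2) (c := c) s1.
have rE j x w : ray f (cutoff (0 : pt) r) v j 1 tau x w = mode f (cutoff 0 r) j ((x + tau) *: v) w.
  by rewrite /ray mul1r.
have rE' l x w : ray f (cutoff (0 : pt) r) v l s 0 x w = mode f (cutoff 0 r) l (x *: v') w.
  by rewrite /ray addr0 sv scalerA mulrC.
have {av} av (i : 'I_3 * 'I_3) : {ae P, forall w, ccvg (pinfty_nbhs R)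
    (fun Q => (Q^-1)%:C * cintegral mu `[Q, 2 * Q] (fun x => (weight m tau x)%:C *
      (mode f (cutoff 0 r) i.1 ((x + tau) *: v) w * cj c (mode f (cutoff 0 r) i.2 (x *: v') w))))
    (hat (fun x => A x i.1 i.2) (tau *: v))}.
  have := av (hat (fun x => A x i.1 i.2) (tau *: v)) i.
  have -> : (fun x => (weight m tau x)%:C * cintegral P setT (fun w => ray f (cutoff 0 r) v i.1 1 tau x w *
       cj c (ray f (cutoff 0 r) v i.2 s 0 x w))) = fun x => (weight m tau x)%:C *
     K i.1 i.2 (fun y => cutoff 0 r y * expi (- dot y ((x + tau) *: v))) (fun y => cutoff 0 r y * expi (dot y (x *: v))).
    apply/funext => x; congr (_ * _); rewrite -(KE _ _ _ _ tchi chiJ); apply: eq_cintegral => w _.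
    by rewrite rE rE'.
  have AD x : A x i.1 i.2 != 0 -> cutoff 0 r x = 1.
    move=> Ax; apply: chi1; apply: DV; apply: subset_closure.
    by have [_ _ h] := tA i.1 i.2; apply: h; exact: subset_closure.
  have cA : ccont (fun x => A x i.1 i.2) by have [h _ _] := tA i.1 i.2; exact: smooth0.
  have kl := kernel_limit tchi m3 v1 tau pS sS K0 sB SE (fun x => cutoff_inversion 0 x r0) cA AD.
  have EF w : (fun x => (weight m tau x)%:C * (ray f (cutoff 0 r) v i.1 1 tau x w * cj c (ray f (cutoff 0 r) v i.2 s 0 x w))) =
      fun x => (weight m tau x)%:C * (mode f (cutoff 0 r) i.1 ((x + tau) *: v) w * cj c (mode f (cutoff 0 r) i.2 (x *: v') w)).
    by apply/funext => x; rewrite rE rE'.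
  by move=> /(_ kl); apply: filterS => w; rewrite EF.
apply: filterS2 (ae_dsupport gf cf pc Dc) (ae_countable av) => w hw lim i.
have sV j : dsupport (component (f w) j) `<=` V by apply: subset_trans DV.
rewrite fourierE; have lim2 : ccvg (pinfty_nbhs R) (fun Q => (if c then 1 else -1) * ((16 * pi ^+ 2)^-1)%:C *
    ((Q^-1)%:C * cintegral mu `[Q, 2 * Q] (fun x => (weight m tau x)%:C *
      (mode f (cutoff 0 r) i.1 ((x + tau) *: v) w * cj c (mode f (cutoff 0 r) i.2 (x *: v') w)))))
    ((if c then 1 else -1) * ((16 * pi ^+ 2)^-1)%:C * hat (fun x => A x i.1 i.2) (tau *: v)).
  by apply: ccvgM; [exact: ccvg_cst|exact: lim].
apply: near_ccvg lim2; near=> Q.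
by rewrite (frequency_mean_mode (V := V) (chi := cutoff 0 r))//; near: Q; apply: nbhs_pinfty_ge; exact: num_real.
Unshelve. all: by end_near. Qed.

Lemma outer_conjE (a b : 'cV[C]_3) j l : (a *m (map_mx conjc b)^T) j l = a j 0 * (b l 0)^*.
Proof. by rewrite !mxE big_ord1 !mxE. Qed.

Lemma outerE (a b : 'cV[C]_3) j l : (a *m b^T) j l = a j 0 * b l 0.
Proof. by rewrite !mxE big_ord1 !mxE. Qed.

Lemma covariance_limitE : covariance_limit P f m v tau
  (((16 * pi ^+ 2)^-1)%:C *: fourier Ac (tau *: v)).
Proof.
have [_ _ hc _] := gmig.
have := ae_average (v' := v) (c := true) hc (@covariance_kernel0 _ _ _ P f).
move=> /(_ _ (or_introl erefl)) h; apply: filterS (h _) => [w lim|chi j l x tchi chiJ].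
  apply: complex_matrix_cvg => j l; rewrite mxE -[X in X * _]mul1r.
  apply: near_ccvg (lim (j, l)); apply: nearW => Q; rewrite /frequency_mean mxE [in RHS]mxE; congr (_ * _).
  by apply: eq_cintegral => x _; rewrite outer_conjE.
exact: mode_covariance.
Qed.

Lemma relation_limitE : relation_limit P f m v tau
  (- (((16 * pi ^+ 2)^-1)%:C *: fourier Ar (tau *: v))).
Proof.
have [_ _ _ hr] := gmig.
have := ae_average (v' := - v) (c := false) hr (@relation_kernel0 _ _ _ P f).
move=> /(_ _ (or_intror erefl)) h; apply: filterS (h _) => [w lim|chi j l x tchi chiJ].
  apply: complex_matrix_cvg => j l; rewrite mxE [X in ccvg _ _ (- X)]mxE -mulN1r mulrA.
  apply: near_ccvg (lim (j, l)); apply: nearW => Q; rewrite /frequency_mean mxE [in RHS]mxE; congr (_ * _).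
  by apply: eq_cintegral => x _; rewrite outerE.
by rewrite mode_relation// scalerN opprK.
Qed.

End Limits.

End FarField.

(** * Continuation and injectivity of the Fourier transform *)

Section FourierUniqueness.
Variable R : realType.
Local Notation pt := 'rV[R]_3.
Local Notation C := R[i].

Lemma integral3_sum (I : Type) (r : seq I) (F : I -> pt -> C) : (forall i, tame (F i)) ->
  tame (fun x => \sum_(i <- r) F i x) /\
  integral3 (fun x => \sum_(i <- r) F i x) = \sum_(i <- r) integral3 (F i).
Proof.
move=> tF; elim: r => [|i r [t e]].
  have E : (fun x => \sum_(i <- [::]) F i x) = fun=> 0 by apply/funext => x; rewrite big_nil.
  rewrite E big_nil; split; first exact: test_tame (test_fun0 setT).
  by apply: complex_eqP; rewrite /= /Rintegral integral0.
have E : (fun x => \sum_(j <- i :: r) F j x) = fun x => F i x + \sum_(j <- r) F j x.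
  by apply/funext => x; rewrite big_cons.
rewrite E big_cons; split; first exact: tameD.
by rewrite integral3D// e.
Qed.

Lemma nc_nat (n : nat) : nc (n%:R : C) = n%:R.
Proof.
have -> : n%:R = (n%:R : R)%:C :> C by rewrite rmorph_nat.
by rewrite ncR normr_nat.
Qed.

Lemma ffact_le_exp (n k : nat) : (n ^_ k <= n ^ k)%N.
Proof. by elim: k => // k IH; rewrite ffactnSr expnSr leq_mul// leq_subr. Qed.

Section Continuation.
Variables (G : pt -> C) (eta : pt) (b : R).
Hypotheses (tG : tame G) (b0 : 0 <= b) (sG : forall x, G x != 0 -> `|dot x eta| <= b).
Let F t := integral3 (fun x => expi (- (t * dot x eta)) * G x).

Let z (s : R) (x : pt) : C := expi (- (s * dot x eta)).

Let zX s x j : z s x ^+ j = expi (- (j%:R * s * dot x eta)).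
Proof.
elim: j => [|j IH]; first by rewrite expr0 !mul0r oppr0 expi0.
by rewrite exprS IH /z -expiD; congr expi; rewrite -(natr1 j); ring.
Qed.

Let cz s : ccont (z s).
Proof.
have -> : z s = fun x => expi (dot x ((- s) *: eta)) by apply/funext => x; rewrite dotZr mulNr.
exact: smooth0 (smooth_expi _).
Qed.

Let nz s x : nc (z s x - 1) <= 2 * (`|s| * `|dot x eta|).
Proof. by apply: le_trans (expi_norm _) _; rewrite normrN normrM. Qed.

Let nz2 s x : nc (z s x - 1) <= 2.
Proof. by apply: le_trans (ncB _ _) _; rewrite nc_expi nc1. Qed.

Let tzz s j k : tame (fun x => z s x ^+ j * (z s x - 1) ^+ k * G x).
Proof.
have cX (h : pt -> C) n : ccont h -> ccont (fun x => h x ^+ n).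
  move=> ch; elim: n => [|n IH]; first by under eq_fun do rewrite expr0; exact: ccont_cst.
  by under eq_fun do rewrite exprS; exact: ccontM.
apply: (tameM (M := 2 ^+ k)) => //.
  by apply: ccontM; apply: cX; [exact: cz|apply: ccontB; [exact: cz|exact: ccont_cst]].
move=> x; rewrite ncM !ncX nc_expi expr1n mul1r; apply: lerXn2r; rewrite ?nnegrE//; exact: nc_ge0.
Qed.

(** The integral is a k-th finite difference of F starting at node j, a combination of the values of
    F at the nodes j s, ..., (j + k) s. *)
Let vanish s K : (forall j, (j <= K)%N -> F (j%:R * s) = 0) ->
  forall k j, (j + k <= K)%N -> integral3 (fun x => z s x ^+ j * (z s x - 1) ^+ k * G x) = 0.
Proof.
move=> F0; elim=> [|k IH] j jk.
  rewrite -(F0 j); last by rewrite -[j]addn0.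
  by apply: eq_integral3 => x; rewrite expr0 mulr1 zX.
have E : (fun x => z s x ^+ j * (z s x - 1) ^+ k.+1 * G x) = fun x =>
    z s x ^+ j.+1 * (z s x - 1) ^+ k * G x - z s x ^+ j * (z s x - 1) ^+ k * G x.
  by apply/funext => x; rewrite !exprS; ring.
rewrite E integral3B// IH ?addSnnS// IH ?subrr//.
by apply: leq_trans jk; rewrite leq_add2l.
Qed.

                                                                             
                                                                               
                                                                         
             
(** F extends to an entire function of exponential type, but the argument is kept real: with step s
    = 1/n, write the phase at time 1 as (1 + (z - 1))^n and expand. The low-order terms are finite
    differences of F at nodes where F vanishes, and the others are bounded by a tail of the
    exponential series of 2b, since |z - 1| <= 2 b s on the support of G. *)
Lemma continuation (del : R) : 0 < del -> (forall t, 0 <= t <= del -> F t = 0) -> F 1 = 0.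
Proof.
move=> d0 F0; have [B [B0 GB]] : exists B, 0 <= B /\ forall x, nc (G x) <= B * bump3 x.
  have [_ [B hB]] := tG; exists `|B|; split => // x; apply: le_trans (hB x) _.
  by apply: ler_wpM2r; [exact: ltW (bump3_gt0 x)|exact: ler_norm].
have [M M1] : exists M : nat, M.+1%:R^-1 <= del.
  have := @cvg_invS R; move/cvgrPdist_le => /(_ _ d0) [M _ hM]; exists M.
  by have := hM M (leqnn M); rewrite /= sub0r normrN ger0_norm.
pose a := 2 * b; pose S n := series (exp_coeff a) n.
have bound K : nc (F 1) <= (S (M.+1 * K.+1).+1 - S K.+2) * B * mass3 R.
  (* With this n the first K + 1 nodes j / n stay below 1 / (M + 1), hence in the interval where F
     is known to vanish. *)
  pose n := (M.+1 * K.+1)%N; pose s : R := n%:R^-1.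
  have n0 : n%:R != 0 :> R by rewrite pnatr_eq0.
  have s0 : 0 <= s by rewrite invr_ge0.
  have Fs j : (j <= K.+1)%N -> F (j%:R * s) = 0.
    move=> jK; apply: F0; rewrite mulr_ge0//=; apply: le_trans M1.
    rewrite ler_pdivrMr ?lt0r ?n0//= ler_pdivlMl ?ltr0n// -natrM ler_nat.
    by rewrite leq_mul2l jK orbT.
  have KN : (K.+2 <= n.+1)%N by rewrite ltnS /n leq_pmull.
  have ES : S n.+1 - S K.+2 = \sum_(K.+2 <= k < n.+1) exp_coeff a k.
    have e : S n.+1 = S K.+2 + \sum_(K.+2 <= k < n.+1) exp_coeff a k by rewrite /S /series /= (@big_cat_nat _ _ _ K.+2).
    by rewrite e addrAC subrr add0r.
  have a0 : 0 <= a by rewrite mulr_ge0.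
  pose r x := \sum_(K.+2 <= k < n.+1) ((z s x - 1) ^+ k *+ 'C(n, k)).
  have E x : expi (- (1 * dot x eta)) * G x =
     \sum_(0 <= k < K.+2) ('C(n, k)%:R * (z s x ^+ 0 * (z s x - 1) ^+ k * G x)) + r x * G x.
    have -> : expi (- (1 * dot x eta)) = z s x ^+ n by rewrite zX mulfV.
    have -> : z s x ^+ n = \sum_(0 <= k < n.+1) ((z s x - 1) ^+ k *+ 'C(n, k)).
      rewrite -{1}[z s x](subrK 1) addrC exprDn big_mkord; apply: eq_bigr => i _.
      by rewrite expr1n mul1r.
    rewrite (@big_cat_nat _ _ _ K.+2)//= mulrDl; congr (_ + _).
    by rewrite big_distrl; apply: eq_bigr => i _; rewrite expr0 mul1r mulrA mulr_natl.
  have t1 (k : nat) : tame (fun x => 'C(n, k)%:R * (z s x ^+ 0 * (z s x - 1) ^+ k * G x)).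
    by apply: tameZ; exact: tzz.
  have [tS eS] := integral3_sum (index_iota 0 K.+2) t1.
  have trk (k : nat) : tame (fun x => (z s x - 1) ^+ k *+ 'C(n, k) * G x).
    have := tameZ 'C(n, k)%:R (tzz s 0 k); congr tame; apply/funext => x.
    by rewrite expr0 mul1r mulrA mulr_natl.
  have tr : tame (fun x => r x * G x).
    have [t _] := integral3_sum (index_iota K.+2 n.+1) trk.
    by move: t; congr tame; apply/funext => x; rewrite /r big_distrl.
  have -> : F 1 = integral3 (fun x => r x * G x).
    rewrite /F (eq_integral3 E) integral3D// eS big_nat big1 ?add0r// => k /andP[_ kK].
    by rewrite integral3Z// (vanish Fs) ?mulr0.
  apply: nc_integral3; first by case: tr.
  move=> x; rewrite ncM; have [->|Gx] := eqVneq (G x) 0.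
    rewrite nc0 mulr0; apply: mulr_ge0; last exact: ltW (bump3_gt0 x).
    by apply: mulr_ge0 => //; rewrite ES sumr_ge0// => k _; exact: exp_coeff_ge0.
  rewrite -mulrA; apply: ler_pM; [exact: nc_ge0|exact: nc_ge0| |exact: GB].
  apply: le_trans (nc_sum _ _ _) _.
  rewrite ES; apply: ler_sum => k _.
  rewrite -mulr_natl ncM nc_nat ncX /exp_coeff /= exprMn.
  have zs : nc (z s x - 1) ^+ k <= (a * s) ^+ k.
    apply: lerXn2r; rewrite ?nnegrE ?nc_ge0 ?mulr_ge0//.
    apply: le_trans (nz s x) _; rewrite (ger0_norm s0) /a -mulrA; apply: ler_wpM2l => //.
    by rewrite mulrC; apply: ler_wpM2r => //; exact: sG.
  have Cs : 'C(n, k)%:R * s ^+ k <= k`!%:R^-1.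
    rewrite -[leRHS]mul1r ler_pdivlMr ?ltr0n ?fact_gt0// /s exprVn mulrAC.
    rewrite ler_pdivrMr ?exprn_gt0 ?lt0r ?n0//= mul1r -natrM -natrX ler_nat bin_ffact.
    exact: ffact_le_exp.
  apply: le_trans (ler_wpM2l (ler0n _ _) zs) _; rewrite exprMn mulrCA.
  by rewrite -exprMn; apply: ler_wpM2l => //; rewrite exprn_ge0// mulr_ge0.
have Slim : (S (M.+1 * K.+1).+1 - S K.+2) * B * mass3 R @[K --> \oo] --> (0 : R).
  have cS := is_cvg_series_exp_coeff a.
  have up (h : nat -> nat) : (forall K, (K <= h K)%N) -> S (h K) @[K --> \oo] --> limn (series (exp_coeff a)).
    move=> hK; apply: (cvg_comp _ _ _ cS); apply/cvgnyPge => A; exists A => // K /= AK.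
    exact: leq_trans AK (hK K).
  have -> : (0 : R) = (limn (series (exp_coeff a)) - limn (series (exp_coeff a))) * B * mass3 R.
    by rewrite subrr !mul0r.
  apply: cvgM; last exact: cvg_cst.
  apply: cvgM; last exact: cvg_cst.
  apply: cvgB; apply: up => K; first by apply: leqW; apply: ltnW; exact: leq_pmull.
  by rewrite -addn2 leq_addr.
apply: nc_eq0; apply/eqP; rewrite eq_le nc_ge0 andbT.
apply: (cvgr_to_ge Slim); exact: nearW.
Qed.

End Continuation.

(** A synthesis of g is built from values of its transform, hence is 0, yet it approximates g(x)
    arbitrarily well. *)
Lemma hat_eq0 (g : pt -> C) : test_fun setT g -> (forall xi, hat g xi = 0) -> forall x, g x = 0.
Proof.
move=> tg hg x.
have [M [M0 _ hM]] := test_lipschitz tg.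
have lip := row3_dist1 hM.
have [r [r0 hr]] := test_support tg.
pose T := r + \sum_k `|x 0 k| + 1.
have T0 : 0 < T by rewrite ltr_wpDl// addr_ge0// sumr_ge0.
have close y : g y != 0 -> forall k, `|y 0 k - x 0 k| <= T.
  move=> gy k; apply: le_trans (ler_normB _ _) _; rewrite /T -addrA; apply: lerD; first exact: hr.
  by rewrite (bigD1 k)//= -addrA lerDl addr_ge0// sumr_ge0.
apply: nc_eq0; apply/eqP; rewrite eq_le nc_ge0 andbT.
apply/ler_addgt0Pr => e e0; rewrite add0r.
have e1 : 0 < e / (2 * M + 1) by rewrite divr_gt0// ltr_wpDl// mulr_ge0.
have [s hs] := trig_kernel T0 e1.
have := hs g (2 * M) x (test_tame tg) lip close.
have -> : synthesis T s g x = 0.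
  by rewrite /synthesis big1// => i _; rewrite hg mulr0 mul0r.
rewrite sub0r ncN => /le_trans; apply.
rewrite mulrA ler_pdivrMr ?ltr_wpDl ?mulr_ge0// mulrC; apply: ler_wpM2l; first exact: ltW.
by rewrite lerDl.
Qed.

(** On the line from eta0 to xi the transform is the function F of [continuation]: it vanishes for
    small t, and F(1) is the value at xi. *)
Lemma hat_vanish (g : pt -> C) (eta0 : pt) (rho : R) : test_fun setT g -> 0 < rho ->
  (forall xi, box eta0 rho xi -> hat g xi = 0) -> forall x, g x = 0.
Proof.
move=> tg r0 h0; apply: hat_eq0 => // xi; pose eta := xi - eta0.
pose G x := expi (- dot x eta0) * g x.
have tG : tame G by apply: tame_hat; exact: test_tame tg.
have [r [r1 hr]] := test_support tg.
have EF t : integral3 (fun x => expi (- (t * dot x eta)) * G x) = hat g (eta0 + t *: eta).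
  apply: eq_integral3 => x; rewrite /G mulrA -expiD; congr (expi _ * _).
  by rewrite dotDr dotZr; ring.
have := @continuation G eta (r * \sum_k `|eta 0 k|) tG _ _ (rho / (1 + \sum_k `|eta 0 k|)).
have s0 : 0 <= \sum_k `|eta 0 k| by rewrite sumr_ge0.
rewrite EF scale1r /eta [eta0 + _]addrC subrK; apply.
- by rewrite mulr_ge0.
- move=> x; have [g0|gx] := eqVneq (g x) 0; first by rewrite /G g0 mulr0 eqxx.
  by move=> _; apply: norm_dot_le; exact: hr.
- by rewrite divr_gt0// ltr_pwDl.
- move=> t /andP[t0 td]; rewrite EF; apply: h0 => k.
  rewrite mxE addrAC subrr add0r mxE normrM (ger0_norm t0).
  have s1 : 0 < 1 + \sum_k `|eta 0 k| by rewrite ltr_pwDl.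
  have hk : `|eta 0 k| <= 1 + \sum_k `|eta 0 k|.
    by rewrite [X in _ + X](bigD1 k)//= addrCA lerDl addr_ge0// sumr_ge0.
  apply: le_trans (ler_pM t0 (normr_ge0 _) td hk) _.
  by rewrite divfK// gt_eqF.
Qed.

End FourierUniqueness.

(** * Uniqueness of the principal symbols *)

Section Uniqueness.
Variable R : realType.
Local Notation pt := 'rV[R]_3.
Local Notation C := R[i].

Lemma continuous_enorm : continuous (@enorm R 3).
Proof.
have c : continuous (fun x : pt => dot x x).
  by apply: continuous_sum => i x; apply: continuousM; exact: coord_continuous.
by move=> x; apply: (continuous_comp (c x)); exact: sqrt_continuous.
Qed.

(** Polar coordinates xi -> (|xi|, xi / |xi|) are continuous off the origin, so the products t u
    with (t, u) in Theta fill a neighbourhood of tau v. *)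
Lemma polar_nbhs (Theta : set (R * pt)) tau v : open_in_freq_sphere Theta -> Theta (tau, v) ->
  exists rho, 0 < rho /\ forall xi, box (tau *: v) rho xi -> exists t u, Theta (t, u) /\ xi = t *: u.
Proof.
move=> [U [oU ->]] [Utv [/= tau0 v1]]; set x0 := tau *: v.
have e0 : enorm x0 = tau by rewrite enormZ (v1 : enorm v = 1) mulr1 gtr0_norm.
have ce := continuous_enorm (x := x0).
have pos : \near x0, 0 < enorm x0 by apply: (cvgr_gt _ ce); rewrite e0.
have cU : (enorm xi, (enorm xi)^-1 *: xi) @[xi --> x0] --> (tau, v).
  have -> : (tau, v) = (enorm x0, (enorm x0)^-1 *: x0).
    by rewrite e0 /x0 scalerA mulVf ?scale1r// gt_eqF.
  have h : (enorm xi)^-1 *: xi @[xi --> x0] --> (enorm x0)^-1 *: x0.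
    have n0 : enorm x0 != 0 by rewrite e0 gt_eqF.
    have h1 : (enorm xi)^-1 @[xi --> x0] --> (enorm x0)^-1 by apply: cvgV; (exact: n0 || exact: ce || exact: nbhs_filter).
    by apply: cvgZ; (exact: h1 || exact: cvg_id || exact: nbhs_filter).
  by have := cvg_pair ce h; apply; exact: nbhs_filter.
have nU : nbhs (tau, v) U by exact: open_nbhs_nbhs.
have := nbhs_box (filterI pos (cU _ nU)).
move=> [rho [rho0 hrho]]; exists rho; split => // xi /hrho [p0 Uxi].
exists (enorm xi), ((enorm xi)^-1 *: xi); split; last by rewrite scalerA mulfV ?scale1r// gt_eqF.
split => //; split => //=; rewrite /sphere2 /= enormZ ger0_norm ?invr_ge0 ?ltW//.
by rewrite mulVf// gt_eqF.
Qed.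

Lemma fourier_unique (A A' : pt -> 'M[C]_3) (Theta : set (R * pt)) : test_mx setT A -> test_mx setT A' ->
  Theta !=set0 -> open_in_freq_sphere Theta ->
  (forall t v, Theta (t, v) -> fourier A (t *: v) = fourier A' (t *: v)) -> A = A'.
Proof.
move=> tA tA' [[tau v] T0] oT H.
have [rho [rho0 hrho]] := polar_nbhs oT T0.
apply/funext => x; apply/matrixP => j l.
pose g x := A x j l + (-1) * A' x j l.
have tg : test_fun setT g by apply: test_funD; [exact: tA|apply: test_funZ; exact: tA'].
have h0 xi : box (tau *: v) rho xi -> hat g xi = 0.
  move=> /hrho [t [u [Ttu ->]]]; rewrite /g hatD; [|exact: test_tame (tA j l)|exact: tameZ (test_tame (tA' j l))].
  rewrite hatZ; last exact: test_tame (tA' j l).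
  by rewrite -!fourierE (H _ _ Ttu) mulN1r subrr.
have := hat_vanish tg rho0 h0 x; rewrite /g mulN1r => /eqP.
by rewrite subr_eq0 => /eqP.
Qed.

(** A null set cannot be the whole space, which has probability 1; so an almost sure property holds
    at some outcome. *)
Lemma ae_exists d (T : measurableType d) (P : probability T R) (Q : T -> Prop) :
  {ae P, forall w, Q w} -> exists w, Q w.
Proof.
move=> [N [mN PN QN]]; apply: contrapT => /forallNP nQ.
have NT : N = setT by apply/seteqP; split => // w _; apply: QN; exact: nQ.
by have := probability_setT P; rewrite -NT PN => /esym/eqP; rewrite onee_eq0.
Qed.

Lemma limit_values d (T : measurableType d) (P : probability T R) (F : T -> R -> 'M[C]_3) (L L' : 'M[C]_3) :
  {ae P, forall w, (F w Q : 'M[C^o]_3) @[Q --> +oo] --> (L : 'M[C^o]_3)} ->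
  {ae P, forall w, (F w Q : 'M[C^o]_3) @[Q --> +oo] --> (L' : 'M[C^o]_3)} -> L = L'.
Proof.
move=> h h'; have [w [hw hw']] := ae_exists (filterI h h').
exact: complex_matrix_cvg_unique hw hw'.
Qed.

End Uniqueness.

Theorem theorem5p2 (R : realType) (d : measure_display)
    (T : measurableType d) (P : probability T R)
    (D : set 'rV[R]_3) (m : R) (Ac Ar : 'rV[R]_3 -> 'M[R[i]]_3)
    (f : T -> vdistribution R)
    (P_complete : measure_is_complete P)
    (D_domain : bounded_domain D)
    (m_range : -1 < m <= 3)
    (f_GMIG : centered_GMIG P f D m Ac Ar)
    (f_X : {ae P, forall w, spaceX (f w)}) :
  (forall (xhat : 'rV[R]_3) (tau : R), sphere2 xhat -> 0 <= tau ->
     covariance_limit P f m xhat tau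
       (((16 * pi ^+ 2)^-1)%:C *: fourier Ac (tau *: xhat)) /\
     relation_limit P f m xhat tau
       (- (((16 * pi ^+ 2)^-1)%:C *: fourier Ar (tau *: xhat)))) /\
  (forall Theta : set (R * 'rV[R]_3),
     Theta !=set0 -> open_in_freq_sphere Theta ->
     forall (d' : measure_display) (T' : measurableType d')
       (P' : probability T' R) (D' : set 'rV[R]_3)
       (Ac' Ar' : 'rV[R]_3 -> 'M[R[i]]_3) (f' : T' -> vdistribution R),
     measure_is_complete P' -> bounded_domain D' ->
     centered_GMIG P' f' D' m Ac' Ar' ->
     {ae P', forall w, spaceX (f' w)} ->
     ((forall (tau : R) (xhat : 'rV[R]_3), Theta (tau, xhat) ->
         exists L : 'M[R[i]]_3, covariance_limit P f m xhat tau L /\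
                                covariance_limit P' f' m xhat tau L) ->
      Ac = Ac') /\
     ((forall (tau : R) (xhat : 'rV[R]_3), Theta (tau, xhat) ->
         exists L : 'M[R[i]]_3, relation_limit P f m xhat tau L /\
                                relation_limit P' f' m xhat tau L) ->
      Ar = Ar')).
Proof.
have m3 : `|m| <= 3 by rewrite ler_norml; move: m_range => /andP[? ->]; rewrite andbT; lra.
split=> [v tau v1 tau0|Theta T0 oT d' T' P' D' Ac' Ar' f' _ D'_domain f'_GMIG _].
  by split; [exact: (covariance_limitE D_domain m3 f_GMIG v1 tau0)|exact: (relation_limitE D_domain m3 f_GMIG v1 tau0)].
have k0 : ((16 * pi ^+ 2)^-1)%:C != 0 :> R[i].
  have pi0 : (16 * pi ^+ 2)^-1 != 0 :> R by rewrite invr_neq0// mulf_neq0 ?expf_neq0// gt_eqF ?pi_gt0.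
  by apply: contra_neq pi0 => /(congr1 cRe).
have TS t v : Theta (t, v) -> enorm v = 1 /\ 0 <= t.
  by move: oT => [U [_ ->]] [_ [/= /ltW t0 v1]].
have tS (E : set 'rV[R]_3) (A : 'rV[R]_3 -> 'M[R[i]]_3) : test_mx E A -> test_mx setT A.
  by move=> tA j l; apply: test_funS (tA j l).
have [_ _ [/tS tAc _] [/tS tAr _]] := f_GMIG; have [_ _ [/tS tAc' _] [/tS tAr' _]] := f'_GMIG.
split=> H.
- apply: (fourier_unique tAc tAc' T0 oT) => t v Ttv; have [v1 t0] := TS _ _ Ttv.
  have [L [h h']] := H _ _ Ttv.
  (* The first part gives an explicit almost sure limit for each field; uniqueness of limits at a
     common outcome identifies both with L. *)
  have e1 := limit_values h (covariance_limitE D_domain m3 f_GMIG v1 t0).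
  have e2 := limit_values h' (covariance_limitE D'_domain m3 f'_GMIG v1 t0).
  by apply: (scalerI k0); rewrite -e1 -e2.
- apply: (fourier_unique tAr tAr' T0 oT) => t v Ttv; have [v1 t0] := TS _ _ Ttv.
  have [L [h h']] := H _ _ Ttv.
  have e1 := limit_values h (relation_limitE D_domain m3 f_GMIG v1 t0).
  have e2 := limit_values h' (relation_limitE D'_domain m3 f'_GMIG v1 t0).
  by apply: (scalerI k0); apply: oppr_inj; rewrite -e1 -e2.
Qed.
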